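(* Let $\mathcal L$ be a lamination by complex manifolds of a compact space $X$, having no vanishing cycle. If $\mathcal L$ admits a holomorphic line bundle with a smooth hermitian metric whose curvature is strictly positive along the leaves, then $\mathcal L$ is projective.
   Context: Compact spaces are Hausdorff. A lamination by complex manifolds $\mathcal L$ of a space $X$ is a maximal atlas of homeomorphisms $\varphi:U\to B\times T$ from open sets $U$ covering $X$ onto the product of the unit ball $B\subset\mathbb{C}^n$ with a topological space $T$, such that the changes of charts have the form $(z,t)\mapsto(z'(z,t),t'(t))$ with $z'$ holomorphic in $z$. The leaves are the complex manifolds obtained by gluing the plaques $B\times\{t\}$. Holomorphic functions on open sets of $X$ are the continuous functions holomorphic along the leaves (sheaf $\mathcal O$); a holomorphic line bundle on $\mathcal L$ is an element of $H^1(X,\mathcal O^* )$. A function is smooth (of class $C^\infty(\mathcal L)$) if it is smooth along leaves and all its derivatives in the leaf coordinate $z$ are continuous in $(z,t)$; a hermitian metric is smooth if norms of local nowhere zero holomorphic sections are smooth. The curvature along leaves is $\Omega=\sqrt{-1}\,\overline\partial\partial\log|s|^2$ ($s$ a local nowhere zero holomorphic section); it is strictly positive if $\Omega(u,\sqrt{-1}u)>0$ for each nonzero vector $u$ tangent to a leaf. Vanishing cycle: a loop contained in a leaf, not homotopic to a point in its leaf, which is a uniform limit of loops contained in nearby leaves that are homotopic to a point in their leaf. Projective: a lamination by complex manifolds of a compact space $X$ is projective if the continuous maps $\pi:X\to\mathbb{C}P^N$ ($N$ arbitrary) whose restriction to every leaf is a holomorphic immersion separate the points of $X$, i.e. for all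 $x\ne y$ in $X$ there is such a $\pi$ with $\pi(x)\neq\pi(y)$. *)

(* Defs.v *)
From HB Require Import structures.
From mathcomp Require Import all_boot all_order all_algebra.
From mathcomp Require Import generic_quotient complex.
From mathcomp Require Import all_classical all_reals all_analysis.

Set Implicit Arguments.
Unset Strict Implicit.
Unset Printing Implicit Defensive.

Import Order.TTheory GRing.Theory Num.Theory.
Import numFieldNormedType.Exports.

Local Open Scope classical_set_scope.
Local Open Scope ring_scope.
Local Open Scope quotient_scope.
Local Open Scope complex_scope.

(* With this instance, [differentiable] for maps between spaces [R[i]^n] means
   complex differentiable. *)
HB.instance Definition _ (R : realType) := NormedModule.copy R[i] R[i]^o.

(* The Euclidean ball; the norm of ['rV[R[i]]_n] is the sup norm. *)
Definition unit_ball (R : realType) (n : nat) : set 'rV[R[i]]_n :=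
  [set z | \sum_(i < n) `|z 0 i| ^+ 2 < 1].

Definition box (R : realType) (n : nat) (T : Type) : set ('rV[R[i]]_n * T) :=
  [set p | unit_ball p.1].

(* A homeomorphism from the open set [chart_dom] onto [B * T].  Both it and its
   inverse are total functions, whose values outside [chart_dom] and [B * T]
   are irrelevant. *)
Record chart (R : realType) (X : topologicalType) (n : nat) := Chart {
  chart_trans : topologicalType;
  chart_dom : set X;
  chart_map : X -> 'rV[R[i]]_n * chart_trans;
  chart_inv : 'rV[R[i]]_n * chart_trans -> X;
  chart_dom_open : open chart_dom;
  chart_map_box : forall x, chart_dom x -> box (chart_map x);
  chart_inv_dom : forall p, box p -> chart_dom (chart_inv p);
  chart_mapK : {in chart_dom, cancel chart_map chart_inv};
  chart_invK : {in @box R n chart_trans, cancel chart_inv chart_map};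
  chart_map_continuous : {within chart_dom, continuous chart_map};
  chart_inv_continuous : {within @box R n chart_trans, continuous chart_inv}
}.

Arguments chart_map {R X n} c x.
Arguments chart_inv {R X n} c p.

Section Transitions.
Context {R : realType} {X : topologicalType} {n : nat}.
Implicit Types c d : chart R X n.

Definition overlap c d : set ('rV[R[i]]_n * chart_trans c) :=
  [set p | box p /\ chart_dom d (chart_inv c p)].
Arguments overlap : clear implicits.

Definition transition c d (p : 'rV[R[i]]_n * chart_trans c) :
    'rV[R[i]]_n * chart_trans d :=
  chart_map d (chart_inv c p).
Arguments transition : clear implicits.

(* The change of charts is [(z, t) |-> (z'(z, t), t'(t))] with [z'] holomorphic
   in [z].  The form is required locally on the overlap: a plaque of [c] may
   meet [d] in several components, lying in distinct plaques of [d]. *)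
Definition laminated_transition c d : Prop :=
  (forall p, overlap c d p ->
     exists t' : chart_trans c -> chart_trans d,
       \forall q \near p, (transition c d q).2 = t' q.2) /\
  (forall z t, overlap c d (z, t) ->
     differentiable (fun w => (transition c d (w, t)).1) z).

Definition compatible c d : Prop :=
  laminated_transition c d /\ laminated_transition d c.

End Transitions.

Record lamination (R : realType) (X : topologicalType) (n : nat) :=
  Lamination {
  atlas : chart R X n -> Prop;
  atlas_cover : forall x, exists2 c, atlas c & chart_dom c x;
  atlas_compatible : forall c d, atlas c -> atlas d -> compatible c d;
  atlas_maximal : forall c, (forall d, atlas d -> compatible c d) -> atlas c
}.

(* [X] with the leaf topology, obtained by gluing the plaques [B * {t}]: a set
   is open when its trace on every plaque is. *)
Definition leaf_space (R : realType) (X : topologicalType) (n : nat)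
  (L : lamination R X n) : Type := X.

Section LeafTopology.
Context (R : realType) (X : topologicalType) (n : nat) (L : lamination R X n).

HB.instance Definition _ := Choice.copy (leaf_space L) X.

Definition leaf_open (W : set (leaf_space L)) : Prop :=
  forall c, atlas L c -> forall t : chart_trans c,
    open ([set z | W (chart_inv c (z, t))] : set (subspace (@unit_ball R n))).

Fact leaf_openT : leaf_open setT.
Proof. by move=> c _ t; exact: openT. Qed.

Fact leaf_openI : setI_closed leaf_open.
Proof. by move=> V W oV oW c Lc t; exact: openI (oV c Lc t) (oW c Lc t). Qed.

Fact leaf_open_bigU (I : Type) (W : I -> set (leaf_space L)) :
  (forall i, leaf_open (W i)) -> leaf_open (\bigcup_i W i).
Proof.
by move=> oW c Lc t; apply: (@bigcup_open (subspace (@unit_ball R n)) I setT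
  (fun i => [set z | W i (chart_inv c (z, t))])) => i _; exact: oW.
Qed.

HB.instance Definition _ := isOpenTopological.Build (leaf_space L)
  leaf_openT leaf_openI leaf_open_bigU.

Definition is_leaf (F : set (leaf_space L)) : Prop :=
  exists x, F = connected_component [set: leaf_space L] x.

End LeafTopology.

Section VanishingCycles.
Context {R : realType} {X : topologicalType} {n : nat} (L : lamination R X n).
Implicit Types (F : set (leaf_space L)) (gamma : R -> leaf_space L).

Definition loop_in F gamma : Prop :=
  [/\ {within `[0, 1], continuous gamma},
      gamma 0 = gamma 1
    & forall s : R, s \in `[0, 1] -> F (gamma s)].

Definition null_homotopic_in F gamma : Prop :=
  exists H : R * R -> leaf_space L,
    [/\ {within `[0, 1] `*` `[0, 1], continuous H},
        forall r s : R, r \in `[0, 1] -> s \in `[0, 1] -> F (H (r, s)),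
        forall r : R, r \in `[0, 1] -> H (r, 0) = H (r, 1),
        forall s : R, s \in `[0, 1] -> H (0, s) = gamma s
      & exists x, forall s : R, s \in `[0, 1] -> H (1, s) = x].

(* The entourages of the unique uniformity of a compact Hausdorff space [X] are
   the neighbourhoods, for the topology of [X], of the diagonal of [X * X]. *)
Definition vanishing_cycle gamma : Prop :=
  (exists F, [/\ is_leaf F, loop_in F gamma & ~ null_homotopic_in F gamma]) /\
  (forall E : set (X * X), open E -> diagonal `<=` E ->
     exists F' gamma',
       [/\ is_leaf F', loop_in F' gamma', null_homotopic_in F' gamma'
         & forall s : R, s \in `[0, 1] -> E (gamma s : X, gamma' s : X)]).

End VanishingCycles.

Arguments vanishing_cycle {R X n} L gamma.

Section LineBundles.
Context {R : realType} {X : topologicalType} {n : nat} (L : lamination R X n).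

Definition holomorphic_on (V : set X) (f : X -> R[i]) : Prop :=
  {within V, continuous f} /\
  (forall c, atlas L c -> forall z (t : chart_trans c),
     unit_ball z -> V (chart_inv c (z, t)) ->
     differentiable (fun w => f (chart_inv c (w, t))) z).

Definition holomorphic_unit_on (V : set X) (f : X -> R[i]) : Prop :=
  holomorphic_on V f /\ (forall x, V x -> f x != 0).

Record cocycle := Cocycle {
  cov_idx : Type;
  cov : cov_idx -> set X;
  cocycle_fun : cov_idx -> cov_idx -> X -> R[i];
  cov_open : forall i, open (cov i);
  cov_cover : forall x, exists i, cov i x;
  cocycle_unit : forall i j,
    holomorphic_unit_on (cov i `&` cov j) (cocycle_fun i j);
  cocycleP : forall i j k x, cov i x -> cov j x -> cov k x ->
    cocycle_fun i j x * cocycle_fun j k x = cocycle_fun i k x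
}.

(* Equality of the classes in the first cohomology group of the sheaf O^* of
   nowhere zero holomorphic functions: the two cocycles differ by a coboundary
   on a common refinement of their covers. *)
Definition cohomologous (g h : cocycle) : Prop :=
  exists (K : Type) (W : K -> set X) (a : K -> cov_idx g) (b : K -> cov_idx h)
         (f : K -> X -> R[i]),
    [/\ forall k, open (W k),
        forall x, exists k, W k x,
        forall k, W k `<=` cov (a k) `&` cov (b k),
        forall k, holomorphic_unit_on (W k) (f k)
      & forall k l x, W k x -> W l x ->
          cocycle_fun (b k) (b l) x * f l x =
          f k x * cocycle_fun (a k) (a l) x].

Record line_bundle := LineBundle {
  bundle_class : set cocycle;
  bundle_classP : exists g, bundle_class = [set h | cohomologous g h]
}.

End LineBundles.

Section Smoothness.
Context {R : realType} {n : nat}.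

Definition real_derive (v : 'rV[R[i]]_n) (f : 'rV[R[i]]_n -> R)
    (z : 'rV[R[i]]_n) : R :=
  derive1 (fun s : R => f (z + s%:C *: v)) 0.

Definition real_derivable (v : 'rV[R[i]]_n) (f : 'rV[R[i]]_n -> R)
    (z : 'rV[R[i]]_n) : Prop :=
  derivable (fun s : R => f (z + s%:C *: v)) 0 1.

Definition leaf_derive (T : Type) (vs : seq 'rV[R[i]]_n)
    (f : 'rV[R[i]]_n * T -> R) : 'rV[R[i]]_n * T -> R :=
  foldr (fun v g p => real_derive v (fun z => g (z, p.2)) p.1) f vs.

Definition leaf_smooth_on (T : topologicalType) (W : set ('rV[R[i]]_n * T))
    (f : 'rV[R[i]]_n * T -> R) : Prop :=
  forall (vs : seq 'rV[R[i]]_n) (p : 'rV[R[i]]_n * T), W p ->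
    {for p, continuous (leaf_derive vs f)} /\
    (forall v, real_derivable v (fun z => leaf_derive vs f (z, p.2)) p.1).

Definition complex_derive (v : 'rV[R[i]]_n) (f : 'rV[R[i]]_n -> R[i])
    (z : 'rV[R[i]]_n) : R[i] :=
  real_derive v (fun w => complex.Re (f w)) z +i*
  real_derive v (fun w => complex.Im (f w)) z.

(* The derivations d/dz_j = (d/dx_j - i d/dy_j) / 2 and
   d/dzbar_j = (d/dx_j + i d/dy_j) / 2. *)
Definition d_dz (j : 'I_n) (f : 'rV[R[i]]_n -> R[i]) (z : 'rV[R[i]]_n) : R[i] :=
  (complex_derive (delta_mx 0 j) f z -
   'i * complex_derive ('i *: delta_mx 0 j) f z) / 2%:R.

Definition d_dzbar (j : 'I_n) (f : 'rV[R[i]]_n -> R[i])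
    (z : 'rV[R[i]]_n) : R[i] :=
  (complex_derive (delta_mx 0 j) f z +
   'i * complex_derive ('i *: delta_mx 0 j) f z) / 2%:R.

(* dbar d f = sum_(j, k) (d^2 f / dzbar_k dz_j) dzbar_k /\ dz_j, as an
   alternating form: (dzbar_k /\ dz_j)(u, v) = ubar_k v_j - vbar_k u_j. *)
Definition dbar_d (f : 'rV[R[i]]_n -> R[i]) (z u v : 'rV[R[i]]_n) : R[i] :=
  \sum_(j < n) \sum_(k < n)
     d_dzbar k (d_dz j f) z * ((u 0 k)^* * v 0 j - (v 0 k)^* * u 0 j).

End Smoothness.

Section HermitianMetrics.
Context {R : realType} {X : topologicalType} {n : nat} (L : lamination R X n).

Definition smooth_on (V : set X) (f : X -> R) : Prop :=
  forall c, atlas L c ->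
    leaf_smooth_on [set p : 'rV[R[i]]_n * chart_trans c |
                      box p /\ V (chart_inv c p)] (f \o chart_inv c).

Variable g : cocycle L.

(* A holomorphic section over [V] of the line bundle with transition functions
   [cocycle_fun g], in the trivializations over the [cov i]. *)
Record holomorphic_section (V : set X) := HolomorphicSection {
  section_fun : cov_idx g -> X -> R[i];
  section_holomorphic : forall i,
    holomorphic_on L (V `&` cov i) (section_fun i);
  sectionP : forall i j x, V x -> cov i x -> cov j x ->
    section_fun i x = cocycle_fun i j x * section_fun j x
}.

Definition nowhere_zero V (s : holomorphic_section V) : Prop :=
  forall i x, V x -> cov i x -> section_fun s i x != 0.

(* [metric_weight i] is the norm of the section equal to [1] in the [i]-th
   trivialization. *)
Record hermitian_metric := HermitianMetric {
  metric_weight : cov_idx g -> X -> R;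
  metric_weight_gt0 : forall i x, cov i x -> 0 < metric_weight i x;
  metric_weightP : forall i j x, cov i x -> cov j x ->
    Normc.normc (cocycle_fun i j x) * metric_weight i x = metric_weight j x
}.

(* The norm of [s] at [x], computed in any trivialization around [x]. *)
Definition section_norm (m : hermitian_metric) V (s : holomorphic_section V)
    (x : X) : R :=
  let i := sval (cid (cov_cover g x)) in
  Normc.normc (section_fun s i x) * metric_weight m i x.

Definition smooth_metric (m : hermitian_metric) : Prop :=
  forall (V : set X) (s : holomorphic_section V), open V -> nowhere_zero s ->
    smooth_on V (section_norm m s).

(* i dbar d log |s|^2 at the point [chart_inv c (z, t)], in the leaf
   coordinate [z]. *)
Definition curvature (m : hermitian_metric) V (s : holomorphic_section V)
    (c : chart R X n) (t : chart_trans c) (z u v : 'rV[R[i]]_n) : R[i] :=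
  'i * dbar_d (fun w => (ln (section_norm m s (chart_inv c (w, t)) ^+ 2))%:C)
         z u v.

Definition positive_curvature (m : hermitian_metric) : Prop :=
  forall (V : set X) (s : holomorphic_section V), open V -> nowhere_zero s ->
  forall c, atlas L c -> forall (t : chart_trans c) (z : 'rV[R[i]]_n),
    unit_ball z -> V (chart_inv c (z, t)) ->
    forall u : 'rV[R[i]]_n, u != 0 -> 0 < curvature m s t z u ('i *: u).

End HermitianMetrics.

Section ProjectiveSpace.
Context (R : realType) (N : nat).

Definition nonzero_vector := [set v : 'rV[R[i]]_N.+1 | v != 0].

Definition collinear (v w : nonzero_vector) : bool :=
  `[< exists a : R[i], \val w = a *: \val v >].

Fact collinear_equiv : equiv_class_of collinear.
Proof.
have sym v w : collinear v w -> collinear w v.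
  move=> /asboolP[a e]; apply/asboolP; exists a^-1.
  rewrite e scalerA mulVf ?scale1r//; apply/eqP => a0.
  by have := set_valP w; rewrite /nonzero_vector /= e a0 scale0r eqxx.
split=> [v|v w|w v x].
- by apply/asboolP; exists 1; rewrite scale1r.
- by apply/idP/idP; exact: sym.
- move=> /asboolP[a e] /asboolP[b f]; apply/asboolP.
  by exists (b * a); rewrite f e scalerA.
Qed.

Definition collinear_rel : equiv_rel nonzero_vector :=
  EquivRelPack collinear_equiv.

Definition CP : Type := quotient_topology {eq_quot collinear_rel}.

HB.instance Definition _ :=
  Topological.copy CP (quotient_topology {eq_quot collinear_rel}).

Definition homogeneous (x : CP) : 'rV[R[i]]_N.+1 :=
  \val (repr (x : {eq_quot collinear_rel})).

Definition affine_dom (j : 'I_N.+1) : set CP :=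
  [set x | homogeneous x 0 j != 0].

Definition affine_chart (j : 'I_N.+1) (x : CP) : 'rV[R[i]]_N :=
  \row_(k < N) (homogeneous x 0 (lift j k) / homogeneous x 0 j).

End ProjectiveSpace.

Section Projective.
Context {R : realType} {X : topologicalType} {n : nat} (L : lamination R X n).

Definition leafwise_holomorphic_immersion (N : nat) (f : X -> CP R N) : Prop :=
  forall c, atlas L c -> forall (t : chart_trans c) (z : 'rV[R[i]]_n),
    unit_ball z -> forall j, affine_dom j (f (chart_inv c (z, t))) ->
    let F := fun w : 'rV[R[i]]_n => affine_chart j (f (chart_inv c (w, t))) in
    differentiable F z /\ injective ('d F z).

Definition projective_lamination : Prop :=
  forall x y : X, x != y ->
    exists (N : nat) (f : X -> CP R N),
      [/\ continuous f, leafwise_holomorphic_immersion f & f x != f y].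

End Projective.

(* Main.v *)
(* Holomorphic sections of high powers [k] of the positive bundle are constructed by gluing, without
   any d-bar equation.  In leaf coordinates rescaled by [sqrt k], the metric of the k-th power is, after
   multiplication by a nowhere zero holomorphic function (the gauge), close to the Gaussian weight
   [exp (- |w|^2 / 2)].  On large polydiscs with this weight, Cauchy kernels twisted cell by cell define
   an operator [Q] with values in the holomorphic functions, such that [|Q u - u| <= K eta] when [u] is
   within [eta] of holomorphic functions on discs of fixed radius; [K] does not depend on the size of the
   polydisc.  Hence, if the weights of a partition of unity vary little on such discs, gluing the [Q u]
   in finitely many patches gives a section within [K eta] of [u] and within [eta / 2] of holomorphic
   ones, and the iteration converges to a holomorphic section at distance at most [2 K eta] of [u].
   It is continuous on [X] since everything depends continuously on the transverse parameter.
   The starting sections are gauges multiplied by [1] or by a coordinate, and cut off by continuous functions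
   that are almost constant on the discs of radius of order [1 / sqrt k].  Cutting off transversally in this
   way needs no holonomy, and the sections obtained separate points and tangent vectors. *)

(* That the bound for [Q] does not depend on the size of the polydisc breaks a circle between the
   constants. In rescaled coordinates a disc moves points by at most [d0], whatever [k]; tents on a
   lattice of mesh [Rr] therefore oscillate on it by a multiple of [d0 / Rr], and the gluing
   contracts errors only if [Rr] is large compared with the norm of [Q]. But [Q] must act on
   polydiscs whose half-side [N] exceeds [Rr]: if the norm of [Q] grew with [N], no choice need be
   consistent. The flow boxes come next, with the Hessian of the weight frozen up to a relative
   error of order [1 / N^2], so that the gauge is Gaussian up to a factor [2] on these polydiscs.
   Finally [k] is taken so large that the polydiscs, of true size [N / sqrt k], are small inside the
   boxes. The plain Cauchy integral is not uniform in [N]: an admissible error at a distant point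
   [w] has size [exp (|w|^2 / 2)], and [1 / (w - z)] does not compensate for it. Multiplying the
   kernel on the cell of centre [c] by the exponential of [(z - w)] times the conjugate of [c] turns
   this growth into a Gaussian decay in the distance from [z] to [c]. *)
Require Import Defs.
From HB Require Import structures.
From mathcomp Require Import all_boot all_order all_algebra generic_quotient complex.
From mathcomp Require Import all_classical all_reals all_analysis.
From mathcomp Require Import ring lra.
Set Implicit Arguments.
Unset Strict Implicit.
Unset Printing Implicit Defensive.
Import Order.TTheory GRing.Theory Num.Theory.
Import numFieldNormedType.Exports.
Local Open Scope classical_set_scope.
Local Open Scope ring_scope.
Local Open Scope complex_scope.

(** * Moduli, norms and continuity *)

Section Modulus.
Context {R : realType}.
Local Notation C := R[i].
Implicit Types (x y z : C) (r s : R).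

(* The norms of the library take values in [R[i]]; [nc] and, below, [vn] are real. *)
Definition nc (z : C) : R := Normc.normc z.

Lemma ncE z : `|z| = (nc z)%:C.
Proof. by rewrite /nc; case: z. Qed.

Lemma nc_ge0 z : 0 <= nc z.
Proof. by have := normr_ge0 z; rewrite ncE -lecR. Qed.

Lemma nc0 : nc 0 = 0.
Proof. by apply: complexI; rewrite -ncE normr0. Qed.

Lemma nc1 : nc 1 = 1.
Proof. by apply: complexI; rewrite -ncE normr1. Qed.

Lemma nc_eq0 z : (nc z == 0) = (z == 0).
Proof. by rewrite -(normr_eq0 z) ncE -(inj_eq (@complexI R)). Qed.

Lemma nc_gt0 z : (0 < nc z) = (z != 0).
Proof. by rewrite lt_def nc_ge0 andbT nc_eq0. Qed.

Lemma ncM x y : nc (x * y) = nc x * nc y.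
Proof. by apply: complexI; rewrite rmorphM /= -!ncE normrM. Qed.

Lemma ncX z k : nc (z ^+ k) = nc z ^+ k.
Proof. by elim: k => [|k ih]; rewrite ?expr0 ?nc1// !exprS ncM ih. Qed.

Lemma ncV z : nc z^-1 = (nc z)^-1.
Proof.
have [->|z0] := eqVneq z 0; first by rewrite invr0 nc0 invr0.
apply: (mulfI (x := nc z)); first by rewrite nc_eq0.
by rewrite -ncM !divff ?nc1 ?nc_eq0.
Qed.

Lemma ncN z : nc (- z) = nc z.
Proof. by apply: complexI; rewrite -!ncE normrN. Qed.

Lemma ncD x y : nc (x + y) <= nc x + nc y.
Proof. by have := ler_normD x y; rewrite !ncE -rmorphD/= lecR. Qed.

Lemma ncB x y : nc (x - y) <= nc x + nc y.
Proof. by rewrite -(ncN y) ncD. Qed.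

Lemma nc_dist x y : nc (x - y) = nc (y - x).
Proof. by rewrite -ncN opprB. Qed.

Lemma nc_dist_le x y : `|nc x - nc y| <= nc (x - y).
Proof.
rewrite ler_norml; apply/andP; split.
  by rewrite lerNl opprB lerBlDr nc_dist (le_trans _ (ncD _ _))// subrK.
by rewrite lerBlDr (le_trans _ (ncD _ _))// subrK.
Qed.

Lemma nc_sum (I : Type) (s : seq I) (P : pred I) (F : I -> C) :
  nc (\sum_(i <- s | P i) F i) <= \sum_(i <- s | P i) nc (F i).
Proof.
elim/big_ind2: _ => [|x a y b h1 h2|//]; first by rewrite nc0.
exact: le_trans (ncD _ _) (lerD h1 h2).
Qed.

Lemma ncR r : nc r%:C = `|r|.
Proof. by rewrite /nc /= expr0n addr0 sqrtr_sqr. Qed.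

Lemma nci : nc 'i = 1.
Proof. by rewrite /nc /= expr0n add0r expr1n sqrtr1. Qed.

Lemma nc_sqr z : nc z ^+ 2 = complex.Re z ^+ 2 + complex.Im z ^+ 2.
Proof. by case: z => a b; rewrite /nc /= sqr_sqrtr// addr_ge0 ?sqr_ge0. Qed.

Lemma Re_le_nc z : `|complex.Re z| <= nc z.
Proof. by rewrite -ler_sqr ?nnegrE ?nc_ge0// nc_sqr real_normK ?num_real// lerDl sqr_ge0. Qed.

Lemma Im_le_nc z : `|complex.Im z| <= nc z.
Proof. by rewrite -ler_sqr ?nnegrE ?nc_ge0// nc_sqr real_normK ?num_real// lerDr sqr_ge0. Qed.

Lemma nc_conj z : nc z^* = nc z.
Proof. by case: z => a b; rewrite /nc /= sqrrN. Qed.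

Lemma complexE' z : z = (complex.Re z)%:C + 'i * (complex.Im z)%:C.
Proof.
by case: z => a b; apply/eqP; rewrite eq_complex /= !(mul0r,mulr0,mul1r,add0r,addr0,subr0,oppr0) !eqxx.
Qed.

Lemma nc_le_ReIm z : nc z <= `|complex.Re z| + `|complex.Im z|.
Proof.
rewrite {1}(complexE' z) (le_trans (ncD _ _))// ncM nci mul1r !ncR//.
Qed.

Lemma nc_mulconj z : z * z^* = (nc z ^+ 2)%:C.
Proof.
rewrite nc_sqr; case: z => a b; apply/eqP; rewrite eq_complex /=; apply/andP; split; apply/eqP; ring.
Qed.

Lemma cReD x y : complex.Re (x + y) = complex.Re x + complex.Re y.
Proof. by case: x => a b; case: y. Qed.
Lemma cImD x y : complex.Im (x + y) = complex.Im x + complex.Im y.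
Proof. by case: x => a b; case: y. Qed.
Lemma cReN x : complex.Re (- x) = - complex.Re x.
Proof. by case: x. Qed.
Lemma cImN x : complex.Im (- x) = - complex.Im x.
Proof. by case: x. Qed.
Lemma cReM x y : complex.Re (x * y) = complex.Re x * complex.Re y - complex.Im x * complex.Im y.
Proof. by case: x => a b; case: y. Qed.
Lemma cImM x y : complex.Im (x * y) = complex.Re x * complex.Im y + complex.Im x * complex.Re y.
Proof. by case: x => a b; case: y. Qed.

Lemma Re_sum (I : Type) (s : seq I) (P : pred I) (F : I -> C) :
  complex.Re (\sum_(i <- s | P i) F i) = \sum_(i <- s | P i) complex.Re (F i).
Proof. by elim/big_rec2: _ => //= i y z _ <-; rewrite cReD. Qed.

Lemma complex_ext x y : complex.Re x = complex.Re y -> complex.Im x = complex.Im y -> x = y.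
Proof. by case: x => a b; case: y => c d /= -> ->. Qed.

Lemma gt0_complexE z : 0 < z -> z = (complex.Re z)%:C /\ 0 < complex.Re z.
Proof.
by case: z => a b; rewrite ltcE /= => /andP[/eqP -> ->].
Qed.

Lemma cvg_ncP (T : Type) (F : set_system T) {FF : Filter F} (f : T -> C) (l : C) :
  (f x @[x --> F] --> l) <-> (forall e : R, 0 < e -> \forall x \near F, nc (f x - l) <= e).
Proof.
split.
  move=> /cvgr_distC_le h e e0; have e0' : 0 < e%:C :> C by rewrite ltcR.
  by near=> x; rewrite -lecR -ncE; near: x; exact: h.
move=> h; apply/cvgrPdistC_le => e e0.
have [eE e0'] := gt0_complexE e0.
by near=> x; rewrite eE ncE lecR; near: x; exact: h.
Unshelve. all: by end_near. Qed.

Lemma cvgr_RP (T : Type) (F : set_system T) {FF : Filter F} (f : T -> R) (l : R) :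
  (f x @[x --> F] --> l) <-> (forall e : R, 0 < e -> \forall x \near F, `|f x - l| <= e).
Proof. by split => [/cvgrPdistC_le|h]; [|apply/cvgrPdistC_le]. Qed.

Lemma cvg_Re (T : Type) (F : set_system T) {FF : Filter F} (f : T -> C) (l : C) :
  f x @[x --> F] --> l -> complex.Re (f x) @[x --> F] --> complex.Re l.
Proof.
move=> /cvg_ncP h; apply/cvgr_RP => e e0; near=> x.
by rewrite -cReN -cReD (le_trans (Re_le_nc _))//; near: x; exact: h.
Unshelve. all: by end_near. Qed.

Lemma cvg_Im (T : Type) (F : set_system T) {FF : Filter F} (f : T -> C) (l : C) :
  f x @[x --> F] --> l -> complex.Im (f x) @[x --> F] --> complex.Im l.
Proof.
move=> /cvg_ncP h; apply/cvgr_RP => e e0; near=> x.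
by rewrite -cImN -cImD (le_trans (Im_le_nc _))//; near: x; exact: h.
Unshelve. all: by end_near. Qed.

Lemma cvg_nc (T : Type) (F : set_system T) {FF : Filter F} (f : T -> C) (l : C) :
  f x @[x --> F] --> l -> nc (f x) @[x --> F] --> nc l.
Proof.
move=> /cvg_ncP h; apply/cvgr_RP => e e0; near=> x.
by rewrite (le_trans (nc_dist_le _ _))//; near: x; exact: h.
Unshelve. all: by end_near. Qed.

Lemma cvg_RC (T : Type) (F : set_system T) {FF : Filter F} (f : T -> R) (l : R) :
  f x @[x --> F] --> l -> (f x)%:C @[x --> F] --> l%:C.
Proof.
move=> /cvgr_RP h; apply/cvg_ncP => e e0; near=> x.
by rewrite -rmorphB ncR; near: x; exact: h.
Unshelve. all: by end_near. Qed.

Lemma cvg_conj (T : Type) (F : set_system T) {FF : Filter F} (f : T -> C) (l : C) :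
  f x @[x --> F] --> l -> (f x)^* @[x --> F] --> l^*.
Proof.
move=> /cvg_ncP h; apply/cvg_ncP => e e0; near=> x.
by rewrite -rmorphB nc_conj; near: x; exact: h.
Unshelve. all: by end_near. Qed.

Lemma cvg_cM (T : Type) (F : set_system T) {FF : Filter F} (f g : T -> C) (l m : C) :
  f x @[x --> F] --> l -> g x @[x --> F] --> m -> f x * g x @[x --> F] --> l * m.
Proof.
move=> hf hg; have hgn := (cvgr_RP _ _).1 (cvg_nc hg).
move/cvg_ncP : hf => hf; move/cvg_ncP : hg => hg.
have mp : 0 < nc m + 1 by rewrite ltr_wpDl ?nc_ge0.
have lp : 0 < nc l + 1 by rewrite ltr_wpDl ?nc_ge0.
apply/cvg_ncP => e e0.
have e1 : 0 < e / 2 / (nc m + 1) by rewrite !divr_gt0 ?ltr0n.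
have e2 : 0 < e / 2 / (nc l + 1) by rewrite !divr_gt0 ?ltr0n.
near=> x.
have g1 : nc (g x) <= nc m + 1.
  have h : `|nc (g x) - nc m| <= 1 by near: x; apply: hgn.
  by rewrite -lerBlDl (le_trans (ler_norm _)).
have h1 : nc (f x - l) <= e / 2 / (nc m + 1) by near: x; exact: hf.
have h2 : nc (g x - m) <= e / 2 / (nc l + 1) by near: x; exact: hg.
have -> : f x * g x - l * m = (f x - l) * g x + l * (g x - m) by ring.
rewrite (le_trans (ncD _ _))// !ncM (splitr e) lerD//.
  by rewrite (le_trans (ler_pM (nc_ge0 _) (nc_ge0 _) h1 g1))// divfK ?gt_eqF.
have lle : nc l <= nc l + 1 by rewrite lerDl.
by rewrite (le_trans (ler_pM (nc_ge0 _) (nc_ge0 _) lle h2))// mulrC divfK ?gt_eqF.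
Unshelve. all: by end_near. Qed.

Lemma cvg_cD (T : Type) (F : set_system T) {FF : Filter F} (f g : T -> C) (l m : C) :
  f x @[x --> F] --> l -> g x @[x --> F] --> m -> f x + g x @[x --> F] --> l + m.
Proof.
move=> /cvg_ncP hf /cvg_ncP hg; apply/cvg_ncP => e e0; near=> x.
rewrite opprD addrACA (le_trans (ncD _ _))// (splitr e) lerD//; near: x.
  by apply: hf; rewrite divr_gt0.
by apply: hg; rewrite divr_gt0.
Unshelve. all: by end_near. Qed.

Lemma cvg_cN (T : Type) (F : set_system T) {FF : Filter F} (f : T -> C) (l : C) :
  f x @[x --> F] --> l -> - f x @[x --> F] --> - l.
Proof.
move=> /cvg_ncP hf; apply/cvg_ncP => e e0; near=> x.
by rewrite -opprD ncN; near: x; exact: hf.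
Unshelve. all: by end_near. Qed.

Lemma cvg_cB (T : Type) (F : set_system T) {FF : Filter F} (f g : T -> C) (l m : C) :
  f x @[x --> F] --> l -> g x @[x --> F] --> m -> f x - g x @[x --> F] --> l - m.
Proof. by move=> h1 h2; exact: (cvg_cD h1 (cvg_cN h2)). Qed.

Lemma cvg_cV (T : Type) (F : set_system T) {FF : Filter F} (f : T -> C) (l : C) :
  l != 0 -> f x @[x --> F] --> l -> (f x)^-1 @[x --> F] --> l^-1.
Proof.
move=> l0 hf; have hfn := (cvgr_RP _ _).1 (cvg_nc hf).
have lp : 0 < nc l by rewrite nc_gt0.
move/cvg_ncP : hf => hf.
apply/cvg_ncP => e e0; near=> x.
have f1 : nc l / 2 <= nc (f x).
  have : `|nc (f x) - nc l| <= nc l / 2 by near: x; apply: hfn; rewrite divr_gt0.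
  by rewrite ler_norml => /andP[+ _]; lra.
have h1 : nc (f x - l) <= e * (nc l / 2 * nc l) by near: x; apply: hf; rewrite !mulr_gt0// invr_gt0.
have fp : 0 < nc (f x) by rewrite (lt_le_trans _ f1)// divr_gt0.
have fx0 : f x != 0 by rewrite -nc_gt0.
have -> : (f x)^-1 - l^-1 = - (f x - l) / (f x * l) by field; rewrite fx0 l0.
rewrite ncM ncN ncV ncM ler_pdivrMr ?mulr_gt0//.
by rewrite (le_trans h1)// ler_pM2l// ler_pM2r.
Unshelve. all: by end_near. Qed.

Lemma nearC (z : C) (P : set C) :
  (\forall w \near z, P w) <-> exists2 d : R, 0 < d & forall h : C, nc h <= d -> P (z + h).
Proof.
split.
  move=> /nbhs_ballP[e /= e0] h.
  have [eE e0'] := gt0_complexE e0.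
  exists (complex.Re e / 2) => [|w hw]; first by rewrite divr_gt0.
  apply: h; rewrite -ball_normE /= opprD addNKr normrN ncE eE ltcR (le_lt_trans hw)//.
  by rewrite ltr_pdivrMr// ltr_pMr// ltr1n.
move=> [d d0 h]; apply/nbhs_ballP; exists d%:C => /=; first by rewrite ltcR.
move=> w; rewrite -ball_normE /= ncE ltcR nc_dist => hw.
by rewrite -(subrK z w) addrC; apply: h; exact: ltW.
Qed.

End Modulus.

Section Differentiability.
Context {R : realType} {V : normedModType R[i]}.
Local Notation C := R[i].

Definition vn (v : V) : R := complex.Re `|v|.

Lemma vnE (v : V) : `|v| = (vn v)%:C.
Proof.
by rewrite /vn; have := normr_ge0 v; case: `|v| => a b; rewrite lecE /= => /andP[/eqP -> _].
Qed.

Lemma vn_ge0 v : 0 <= vn v.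
Proof. by rewrite -(lecR 0) -vnE; exact: normr_ge0. Qed.

Lemma vn0 : vn 0 = 0.
Proof. by rewrite /vn normr0. Qed.

Lemma vnZ a v : vn (a *: v) = nc a * vn v.
Proof. by rewrite /vn normrZ ncE vnE -rmorphM. Qed.

Lemma vnD u v : vn (u + v) <= vn u + vn v.
Proof. by have := ler_normD u v; rewrite !vnE -rmorphD lecR. Qed.

Lemma vnN v : vn (- v) = vn v.
Proof. by rewrite /vn normrN. Qed.

Lemma vn_eq0 v : (vn v == 0) = (v == 0).
Proof. by rewrite -(normr_eq0 v) vnE -(inj_eq (@complexI R)). Qed.

Lemma nearV (z : V) (P : set V) :
  (\forall w \near z, P w) <-> exists2 d : R, 0 < d & forall h : V, vn h <= d -> P (z + h).
Proof.
split.
  move=> /nbhs_ballP[e /= e0] h.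
  have [eE e0'] := gt0_complexE e0.
  exists (complex.Re e / 2) => [|w hw]; first by rewrite divr_gt0.
  apply: h; rewrite -ball_normE /= opprD addNKr normrN vnE eE ltcR (le_lt_trans hw)//.
  by rewrite ltr_pdivrMr// ltr_pMr// ltr1n.
move=> [d d0 h]; apply/nbhs_ballP; exists d%:C => /=; first by rewrite ltcR.
move=> w; rewrite -ball_normE /= vnE ltcR -vnN opprB => hw.
by rewrite -(subrK z w) addrC; apply: h; exact: ltW.
Qed.

Lemma diff_eps (f : V -> C) z : differentiable f z -> forall e : R, 0 < e ->
  exists2 d : R, 0 < d & forall v, vn v <= d -> nc (f (z + v) - f z - 'd f z v) <= e * vn v.
Proof.
move=> /diff_locallyP[_ /eqaddoP h] e e0.
have e0' : 0 < e%:C :> C by rewrite ltcR.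
have /nearV[d d0 hd] := h _ e0'; exists d => // v /hd.
rewrite add0r !fctE ncE vnE -rmorphM lecR /= [v + z]addrC.
by rewrite opprD addrA.
Qed.

(** The bound [M] makes the candidate [l] continuous, as a differential must be; on a general normed
    module linearity alone does not give this. *)
Lemma eps_diff (f : V -> C) z (l : V -> C) (M : R) :
  (forall a u v, l (a *: u + v) = a * l u + l v) ->
  (forall v, nc (l v) <= M * vn v) ->
  (forall e : R, 0 < e ->
    exists2 d : R, 0 < d & forall v, vn v <= d -> nc (f (z + v) - f z - l v) <= e * vn v) ->
  differentiable f z /\ 'd f z = l :> (V -> C).
Proof.
move=> llin lM h.
pose L := GRing.isLinear.Build C V C *%R l llin.
pose l' : {linear V -> C} := HB.pack l L.
have lc : continuous l'.
  move=> x; apply/cvg_ncP => e e0; apply/nearV.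
  have M0 : 0 < `|M| + 1 by rewrite ltr_wpDl.
  exists (e / (`|M| + 1)) => [|v hv]; first by rewrite divr_gt0.
  rewrite -(linearB l') /= addrC addKr (le_trans (lM v))//.
  rewrite ler_pdivlMr// in hv; rewrite (le_trans _ hv)// mulrC ler_wpM2l ?vn_ge0//.
  by rewrite (le_trans (ler_norm _))// lerDl.
have ho : f \o shift z = cst (f z) + l' +o_ (0 : V) id.
  apply/eqaddoP => _ /posnumP[e].
  have [eE e0'] := gt0_complexE (gt0 e).
  apply/nearV; have [d d0 hd] := h _ e0'; exists d => // v /hd.
  by rewrite eE add0r !fctE ncE vnE -rmorphM lecR /= [v + z]addrC opprD addrA.
have dE := diff_unique lc ho.
split; last exact: dE.
apply/diff_locallyP; rewrite dE; split; [exact: lc|exact: ho].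
Qed.

Lemma diff_cont (f : V -> C) z : differentiable f z -> {for z, continuous f}.
Proof. by move=> h; apply: differentiable_continuous. Qed.

Lemma diffD (f g : V -> C) z : differentiable f z -> differentiable g z ->
  differentiable (fun x => f x + g x) z.
Proof. by move=> h1 h2; exact: differentiableD. Qed.

Lemma diffB (f g : V -> C) z : differentiable f z -> differentiable g z ->
  differentiable (fun x => f x - g x) z.
Proof. by move=> h1 h2; exact: differentiableB. Qed.

Lemma diffM' (f g : V -> C) z : differentiable f z -> differentiable g z ->
  differentiable (fun x => f x * g x) z.
Proof. by move=> h1 h2; exact: differentiableM. Qed.

Lemma diffV' (f : V -> C) z : differentiable f z -> f z != 0 ->
  differentiable (fun x => (f x)^-1) z.
Proof. by move=> h1 h2; exact: differentiableV. Qed.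

Lemma diff_cst' (a : C) z : differentiable (fun _ : V => a) z.
Proof. exact: differentiable_cst. Qed.

Lemma diffX (f : V -> C) k z : differentiable f z -> differentiable (fun x => f x ^+ k) z.
Proof.
move=> h; elim: k => [|k ih]; first by under eq_fun do rewrite expr0; exact: diff_cst'.
by under eq_fun do rewrite exprS; exact: diffM'.
Qed.

Lemma diff_sum (I : finType) (f : I -> V -> C) z : (forall i, differentiable (f i) z) ->
  differentiable (fun x => \sum_i f i x) z.
Proof.
move=> h; elim: (index_enum I) => [|i s ih].
  by under eq_fun do rewrite big_nil; exact: diff_cst'.
by under eq_fun do rewrite big_cons; exact: diffD.
Qed.

Lemma diff_near (f g : V -> C) z : (\forall x \near z, f x = g x) ->
  differentiable f z -> differentiable g z /\ 'd g z = 'd f z :> (V -> C).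
Proof.
move=> /nearV[d d0 fg] df.
have [M M0 hM] : exists2 M : R, 0 < M & forall v, nc ('d f z v) <= M * vn v.
  have /linear_lipschitz[k k0 hk] := diff_continuous df.
  have [kE k0'] := gt0_complexE k0.
  exists (complex.Re k) => // v.
  by rewrite -lecR rmorphM /= -kE -ncE -vnE.
apply: (@eps_diff g z _ M) => [a u v||e e0]; [by rewrite linearP|exact: hM|].
have [d' d'0 h] := diff_eps df e0.
exists (Num.min d d') => [|v]; first by rewrite lt_min d0.
rewrite le_min => /andP[h1 h2]; have := fg 0; rewrite vn0 addr0 => /(_ (ltW d0)) <-.
by rewrite -(fg v h1); exact: h.
Qed.

End Differentiability.

Lemma vn_nc (R : realType) (z : R[i]) : @vn R R[i] z = nc z.
Proof. by rewrite /vn ncE. Qed.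

Lemma cont_cst (R : realType) (V : topologicalType) (k : R[i]) (z : V) : {for z, continuous (fun=> k)}.
Proof. exact: cvg_cst. Qed.

Lemma cont_pair (V W Z : topologicalType) (f : V -> W) (g : V -> Z) (z : V) :
  {for z, continuous f} -> {for z, continuous g} -> {for z, continuous (fun x => (f x, g x))}.
Proof. by move=> hf hg; exact: (cvg_pair hf hg). Qed.

Lemma cont_comp (V W Z : topologicalType) (f : V -> W) (g : W -> Z) (z : V) :
  {for z, continuous f} -> {for f z, continuous g} -> {for z, continuous (fun x => g (f x))}.
Proof. by move=> hf hg; exact: (continuous_comp hf hg). Qed.

Lemma cont_id (V : topologicalType) (z : V) : {for z, continuous (fun x => x)}.
Proof. exact: cvg_id. Qed.

Lemma cont_cstW (V W : topologicalType) (k : W) (z : V) : {for z, continuous (fun=> k)}.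
Proof. exact: cvg_cst. Qed.

Lemma cont_fst (V W : topologicalType) (p : V * W) : {for p, continuous (fun q => q.1)}.
Proof. exact: cvg_fst. Qed.

Lemma cont_snd (V W : topologicalType) (p : V * W) : {for p, continuous (fun q => q.2)}.
Proof. exact: cvg_snd. Qed.

Lemma cont_ext (V W : topologicalType) (f g : V -> W) (z : V) : f =1 g ->
  {for z, continuous f} -> {for z, continuous g}.
Proof. by move=> /funext ->. Qed.

Arguments cont_cst {R V} k z.
Arguments cont_id {V} z.
Arguments cont_cstW {V W} k z.
Arguments cont_fst {V W} p.
Arguments cont_snd {V W} p.

(* [{for z, continuous f}] with [f] complex valued, in a form in which no filter
   instance has to be inferred. *)
Lemma contP (R : realType) (V : topologicalType) (f : V -> R[i]) z :
  {for z, continuous f} <-> forall e : R, 0 < e -> \forall x \near z, nc (f x - f z) <= e.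
Proof. exact: cvg_ncP. Qed.

Section Continuity.
Context {R : realType} {V : topologicalType}.
Implicit Types (f g : V -> R[i]) (z : V).

Lemma contM f g z : {for z, continuous f} -> {for z, continuous g} ->
  {for z, continuous (fun x => f x * g x)}.
Proof. by move=> hf hg; exact: cvg_cM hf hg. Qed.

Lemma contD f g z : {for z, continuous f} -> {for z, continuous g} ->
  {for z, continuous (fun x => f x + g x)}.
Proof. by move=> hf hg; exact: cvg_cD hf hg. Qed.

Lemma contB f g z : {for z, continuous f} -> {for z, continuous g} ->
  {for z, continuous (fun x => f x - g x)}.
Proof. by move=> hf hg; exact: cvg_cB hf hg. Qed.

Lemma contV f z : {for z, continuous f} -> f z != 0 -> {for z, continuous (fun x => (f x)^-1)}.
Proof. by move=> hf hz; exact: cvg_cV hz hf. Qed.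

Lemma cont_conj f z : {for z, continuous f} -> {for z, continuous (fun x => (f x)^*)}.
Proof. by move=> hf; exact: cvg_conj hf. Qed.

Lemma cont_RC (f : V -> R) z : {for z, continuous f} -> {for z, continuous (fun x => (f x)%:C)}.
Proof. by move=> hf; exact: cvg_RC hf. Qed.

Lemma cont_nc f z : {for z, continuous f} -> {for z, continuous (fun x => nc (f x))}.
Proof. by move=> hf; exact: cvg_nc hf. Qed.

Lemma cont_Re f z : {for z, continuous f} -> {for z, continuous (fun x => complex.Re (f x))}.
Proof. by move=> hf; exact: cvg_Re hf. Qed.

Lemma cont_Im f z : {for z, continuous f} -> {for z, continuous (fun x => complex.Im (f x))}.
Proof. by move=> hf; exact: cvg_Im hf. Qed.

Lemma contX f k z : {for z, continuous f} -> {for z, continuous (fun x => f x ^+ k)}.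
Proof.
move=> h; elim: k => [|k ih]; first exact: cont_cst.
by apply: (cont_ext _ (contM h ih)) => x; rewrite exprS.
Qed.

Lemma cont_sum (T : finType) (f : T -> V -> R[i]) z : (forall i, {for z, continuous (f i)}) ->
  {for z, continuous (fun x => \sum_i f i x)}.
Proof.
move=> h; elim: (index_enum T) => [|i s ih].
  have -> : (fun x => \sum_(i <- [::]) f i x) = (fun=> 0) by apply/funext => x; rewrite big_nil.
  exact: cont_cst.
by apply: (cont_ext _ (contD (h i) ih)) => x; rewrite big_cons.
Qed.

Lemma cont_near f g z : (\forall x \near z, f x = g x) -> {for z, continuous f} ->
  {for z, continuous g}.
Proof.
move=> fg hf; have fgz := nbhs_singleton fg.
apply/contP => e e0; have := (contP f z).1 hf e e0.
by apply: filterS2 fg => x -> ; rewrite fgz.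
Qed.

End Continuity.

Lemma contRP (R : realType) (V : topologicalType) (f : V -> R) z :
  {for z, continuous f} <-> forall e : R, 0 < e -> \forall x \near z, `|f x - f z| <= e.
Proof. exact: cvgr_RP. Qed.

(** * Contour integrals and Cauchy's theorem *)

Section Integral.
Context {R : realType}.
Local Notation C := R[i].
Local Notation mu := (@lebesgue_measure R).
Implicit Types (a b c : R) (f g : R -> C).

(** Continuity is two-sided at every point, end points included, which keeps subspace topologies out
    of the contour integrals. *)
Definition ci a b f := forall s, a <= s <= b -> {for s, continuous f}.

Definition I a b f : C :=
  (\int[mu]_(s in `[a, b]) complex.Re (f s)) +i* (\int[mu]_(s in `[a, b]) complex.Im (f s)).

Lemma cont_itv_integrable a b (f : R -> R) :
  (forall s, a <= s <= b -> {for s, continuous f}) -> mu.-integrable `[a, b] (EFin \o f).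
Proof.
move=> h; apply: continuous_compact_integrable; first exact: segment_compact.
apply: continuous_in_subspaceT => s; rewrite inE /= in_itv /=; exact: h.
Qed.

Lemma ci_Re a b f : ci a b f -> mu.-integrable `[a, b] (EFin \o (fun s => complex.Re (f s))).
Proof. by move=> h; apply: cont_itv_integrable => s hs; exact: cvg_Re (h s hs). Qed.

Lemma ci_Im a b f : ci a b f -> mu.-integrable `[a, b] (EFin \o (fun s => complex.Im (f s))).
Proof. by move=> h; apply: cont_itv_integrable => s hs; exact: cvg_Im (h s hs). Qed.

Lemma ciB a b f g : ci a b f -> ci a b g -> ci a b (fun s => f s - g s).
Proof. by move=> hf hg s hs; exact: cvg_cB (hf s hs) (hg s hs). Qed.

Lemma ciM a b f g : ci a b f -> ci a b g -> ci a b (fun s => f s * g s).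
Proof. by move=> hf hg s hs; exact: cvg_cM (hf s hs) (hg s hs). Qed.

Lemma ci_cst a b (k : C) : ci a b (fun=> k).
Proof. by move=> s _; exact: cvg_cst. Qed.

Lemma ID a b f g : ci a b f -> ci a b g -> I a b (fun s => f s + g s) = I a b f + I a b g.
Proof.
move=> hf hg; apply: complex_ext; rewrite /= ?cReD ?cImD /=.
  under eq_Rintegral do rewrite cReD.
  by rewrite RintegralD//; [exact: ci_Re|exact: ci_Re].
under eq_Rintegral do rewrite cImD.
by rewrite RintegralD//; [exact: ci_Im|exact: ci_Im].
Qed.

Lemma IZ a b (k : C) f : ci a b f -> I a b (fun s => k * f s) = k * I a b f.
Proof.
move=> hf; have hR := ci_Re hf; have hI := ci_Im hf.
apply: complex_ext; rewrite /= ?cReM ?cImM /=.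
  transitivity (\int[mu]_(s in `[a, b]) (complex.Re k * complex.Re (f s) - complex.Im k * complex.Im (f s))).
    by apply: eq_Rintegral => s _; rewrite -cReM.
  rewrite RintegralB ?RintegralZl//.
    by apply: cont_itv_integrable => s hs; apply: cvgZr; exact: cvg_Re (hf s hs).
  by apply: cont_itv_integrable => s hs; apply: cvgZr; exact: cvg_Im (hf s hs).
transitivity (\int[mu]_(s in `[a, b]) (complex.Re k * complex.Im (f s) + complex.Im k * complex.Re (f s))).
  by apply: eq_Rintegral => s _; rewrite -cImM.
rewrite RintegralD ?RintegralZl//.
  by apply: cont_itv_integrable => s hs; apply: cvgZr; exact: cvg_Im (hf s hs).
by apply: cont_itv_integrable => s hs; apply: cvgZr; exact: cvg_Re (hf s hs).
Qed.

Lemma IN a b f : ci a b f -> I a b (fun s => - f s) = - I a b f.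
Proof. by move=> hf; rewrite -mulN1r -IZ//; congr I; apply/funext => s; rewrite mulN1r. Qed.

Lemma IB a b f g : ci a b f -> ci a b g -> I a b (fun s => f s - g s) = I a b f - I a b g.
Proof.
move=> hf hg; rewrite -IN//; apply: ID hf _ => s hs; exact: cvg_cN (hg s hs).
Qed.

Lemma I_ext a b f g : (forall s, a <= s <= b -> f s = g s) -> I a b f = I a b g.
Proof.
by move=> h; congr (_ +i* _); apply: eq_Rintegral => s; rewrite inE /= in_itv /= => /h ->.
Qed.

Lemma Rint_cst a b (r : R) : a <= b -> \int[mu]_(s in `[a, b]) r = r * (b - a).
Proof.
move=> ab; rewrite Rintegral_cst//= lebesgue_measure_itv /= lte_fin.
have [ltab|ba] := ltP a b; first by rewrite -EFinB.
by (have -> : b = a by apply/eqP; rewrite eq_le ab ba); rewrite subrr.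
Qed.

Lemma Rint_bound a b (f : R -> R) M : a <= b ->
  (forall s, a <= s <= b -> {for s, continuous f}) ->
  (forall s, a <= s <= b -> `|f s| <= M) ->
  `|\int[mu]_(s in `[a, b]) f s| <= M * (b - a).
Proof.
move=> ab cf fM; have ci' := cont_itv_integrable cf.
rewrite (le_trans (le_normr_Rintegral _ ci'))//.
rewrite -(Rint_cst M ab).
apply: le_Rintegral => //.
  by apply: cont_itv_integrable => s hs; apply: cvg_norm; exact: cf.
by apply: cont_itv_integrable => s hs; exact: cvg_cst.
Qed.

(** The factor [2] comes from bounding the real and imaginary parts separately; it is carried along
    in the later constants. *)
Lemma I_bound a b f M : a <= b -> ci a b f -> (forall s, a <= s <= b -> nc (f s) <= M) ->
  nc (I a b f) <= 2 * M * (b - a).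
Proof.
move=> ab cf fM; rewrite (le_trans (nc_le_ReIm _))//= -mulrA mulr_natl mulr2n lerD//.
  apply: Rint_bound => // s hs; first exact: cvg_Re (cf s hs).
  exact: le_trans (Re_le_nc _) (fM s hs).
apply: Rint_bound => // s hs; first exact: cvg_Im (cf s hs).
exact: le_trans (Im_le_nc _) (fM s hs).
Qed.

Lemma Rint_split a c b (f : R -> R) : a <= c -> c <= b ->
  (forall s, a <= s <= b -> {for s, continuous f}) ->
  \int[mu]_(s in `[a, b]) f s = \int[mu]_(s in `[a, c]) f s + \int[mu]_(s in `[c, b]) f s.
Proof.
move=> ac cb cf; have ig := cont_itv_integrable cf.
rewrite -(@Rintegral_itv_obnd_cbnd _ c).
  by rewrite -(Rintegral_itvB ig) ?bnd_simp// addrC subrK.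
apply: integrableS ig => //; apply: subset_itv; rewrite bnd_simp//.
Qed.

Lemma I_split a c b f : a <= c -> c <= b -> ci a b f -> I a b f = I a c f + I c b f.
Proof.
move=> ac cb cf; apply: complex_ext; rewrite /= ?cReD ?cImD /=; apply: Rint_split => // s hs.
  exact: cvg_Re (cf s hs).
exact: cvg_Im (cf s hs).
Qed.

Lemma I_cst a b (k : C) : a <= b -> I a b (fun=> k) = k * (b - a)%:C.
Proof.
move=> ab.
by apply: complex_ext; rewrite ?cReM ?cImM /= !Rint_cst// !(mulr0,subr0,addr0,add0r).
Qed.

Lemma I_ge a b f (r : R) : a <= b -> ci a b f -> (forall s, a <= s <= b -> r <= complex.Im (f s)) ->
  r * (b - a) <= complex.Im (I a b f).
Proof.
move=> ab cf h; rewrite -(Rint_cst r ab).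
apply: le_Rintegral => //.
- by apply: cont_itv_integrable => s hs; exact: cvg_cst.
- exact: ci_Im.
Qed.

Lemma I_id a b : a <= b -> I a b (fun s => s%:C) = ((b ^+ 2 - a ^+ 2) / 2)%:C.
Proof.
rewrite le_eqVlt => /orP[/eqP ->|ab].
  (* On a degenerate segment additivity says that the integral equals twice itself; the fundamental
     theorem of calculus is kept for [a < b]. *)
  rewrite subrr mul0r; have := I_split (lexx b) (lexx b) (f := fun s => s%:C).
  move=> h; have /h : ci b b (fun s => s%:C) by move=> s _; apply: cvg_RC; exact: cvg_id.
  by move/eqP; rewrite -subr_eq0 opprD addNKr oppr_eq0 => /eqP.
apply: complex_ext => /=; last first.
  rewrite (_ : (fun=> _) = cst 0)//; rewrite Rintegral_cst//= mul0r//.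
rewrite /Rintegral (@continuous_FTC2 R id (fun s => s ^+ 2 / 2) a b ab)//=.
- by rewrite mulrBl.
- by apply: continuous_in_subspaceT => s _; exact: cvg_id.
- split.
  + by move=> s _; apply: derivableM => //; exact: exprn_derivable.
  + apply: cvg_at_right_filter; apply: cvgMl; exact: (cvgM cvg_id cvg_id).
  + apply: cvg_at_left_filter; apply: cvgMl; exact: (cvgM cvg_id cvg_id).
move=> s _; rewrite derive1E deriveM//.
rewrite derive_cst scaler0 add0r exp_derive /= expr1 /GRing.scale /=; lra.
Qed.

End Integral.

(** * Contour integrals over rectangles and Goursat's theorem *)

Section Rectangles.
Context {R : realType}.
Local Notation C := R[i].
Implicit Types (x y : R) (f g : C -> C).

Definition rect (x0 x1 y0 y1 : R) (z : C) :=
  (x0 <= complex.Re z <= x1) && (y0 <= complex.Im z <= y1).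

Definition rc x0 x1 y0 y1 f := forall z, rect x0 x1 y0 y1 z -> {for z, continuous f}.

(* Only the values on the boundary matter for the contour integral, and its
   integrands below are often singular inside. *)
Definition bd x0 x1 y0 y1 (z : C) :=
  rect x0 x1 y0 y1 z &&
  [|| complex.Re z == x0, complex.Re z == x1, complex.Im z == y0 | complex.Im z == y1].

Definition re x0 x1 y0 y1 f := forall z, bd x0 x1 y0 y1 z -> {for z, continuous f}.

Definition J x0 x1 y0 y1 f : C :=
  I x0 x1 (fun s => f (s +i* y0)) + 'i * I y0 y1 (fun s => f (x1 +i* s))
  - I x0 x1 (fun s => f (s +i* y1)) - 'i * I y0 y1 (fun s => f (x0 +i* s)).

Lemma cvg_hline y s : (t +i* y) @[t --> s] --> s +i* y.
Proof.
apply/cvg_ncP => e e0; near=> t.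
have -> : (t +i* y) - (s +i* y) = (t - s)%:C by apply: complex_ext => /=; rewrite ?subrr.
by rewrite ncR; near: t; apply: (cvgr_RP _ _).1 => //; exact: cvg_id.
Unshelve. all: by end_near. Qed.

Lemma cvg_vline x s : (x +i* t) @[t --> s] --> x +i* s.
Proof.
apply/cvg_ncP => e e0; near=> t.
have -> : (x +i* t) - (x +i* s) = 'i * (t - s)%:C.
  by apply: complex_ext => /=; rewrite ?subrr ?mul0r ?mul1r ?mulr0 ?subr0 ?add0r// addr0.
by rewrite ncM nci mul1r ncR; near: t; apply: (cvgr_RP _ _).1 => //; exact: cvg_id.
Unshelve. all: by end_near. Qed.

Lemma rc_h x0 x1 y0 y1 f y : rc x0 x1 y0 y1 f -> y0 <= y <= y1 ->
  ci x0 x1 (fun s => f (s +i* y)).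
Proof.
move=> h hy s hs; apply: (@continuous_comp _ _ _ (fun t => t +i* y) f s).
  exact: cvg_hline.
by apply: h; rewrite /rect /= hs.
Qed.

Lemma rc_v x0 x1 y0 y1 f x : rc x0 x1 y0 y1 f -> x0 <= x <= x1 ->
  ci y0 y1 (fun s => f (x +i* s)).
Proof.
move=> h hx s hs; apply: (@continuous_comp _ _ _ (fun t => x +i* t) f s).
  exact: cvg_vline.
by apply: h; rewrite /rect /= hx.
Qed.

Lemma rc_re x0 x1 y0 y1 f : rc x0 x1 y0 y1 f -> re x0 x1 y0 y1 f.
Proof. by move=> h z /andP[hz _]; exact: h. Qed.

Lemma reM x0 x1 y0 y1 f g : re x0 x1 y0 y1 f -> re x0 x1 y0 y1 g ->
  re x0 x1 y0 y1 (fun z => f z * g z).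
Proof. by move=> hf hg z hz; exact: cvg_cM (hf z hz) (hg z hz). Qed.

Lemma reB x0 x1 y0 y1 f g : re x0 x1 y0 y1 f -> re x0 x1 y0 y1 g ->
  re x0 x1 y0 y1 (fun z => f z - g z).
Proof. by move=> hf hg z hz; exact: cvg_cB (hf z hz) (hg z hz). Qed.

Lemma re_cst x0 x1 y0 y1 (k : C) : re x0 x1 y0 y1 (fun=> k).
Proof. by move=> z _; exact: cont_cst. Qed.

Lemma rcS x0 x1 y0 y1 a b c d f : x0 <= a -> b <= x1 -> y0 <= c -> d <= y1 ->
  rc x0 x1 y0 y1 f -> rc a b c d f.
Proof.
move=> h1 h2 h3 h4 h z /andP[/andP[z1 z2] /andP[z3 z4]]; apply: h.
by rewrite /rect (le_trans h1 z1) (le_trans z2 h2) (le_trans h3 z3) (le_trans z4 h4).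
Qed.

Lemma rcM x0 x1 y0 y1 f g : rc x0 x1 y0 y1 f -> rc x0 x1 y0 y1 g ->
  rc x0 x1 y0 y1 (fun z => f z * g z).
Proof. by move=> hf hg z hz; exact: cvg_cM (hf z hz) (hg z hz). Qed.

Lemma rcB x0 x1 y0 y1 f g : rc x0 x1 y0 y1 f -> rc x0 x1 y0 y1 g ->
  rc x0 x1 y0 y1 (fun z => f z - g z).
Proof. by move=> hf hg z hz; exact: cvg_cB (hf z hz) (hg z hz). Qed.

Lemma rcD x0 x1 y0 y1 f g : rc x0 x1 y0 y1 f -> rc x0 x1 y0 y1 g ->
  rc x0 x1 y0 y1 (fun z => f z + g z).
Proof. by move=> hf hg z hz; exact: cvg_cD (hf z hz) (hg z hz). Qed.

Lemma rc_cst x0 x1 y0 y1 (k : C) : rc x0 x1 y0 y1 (fun=> k).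
Proof. by move=> z _; exact: cont_cst. Qed.

Lemma rc_id x0 x1 y0 y1 : rc x0 x1 y0 y1 (fun z => z).
Proof. by move=> z _; exact: cvg_id. Qed.

Section Fixed.
Variables (x0 x1 y0 y1 : R).
Hypotheses (x01 : x0 <= x1) (y01 : y0 <= y1).

Let X0 : x0 <= x0 <= x1. Proof. by rewrite lexx. Qed.
Let X1 : x0 <= x1 <= x1. Proof. by rewrite lexx x01. Qed.
Let Y0 : y0 <= y0 <= y1. Proof. by rewrite lexx. Qed.
Let Y1 : y0 <= y1 <= y1. Proof. by rewrite lexx y01. Qed.

Lemma re_h0 f : re x0 x1 y0 y1 f -> ci x0 x1 (fun s => f (s +i* y0)).
Proof.
move=> h s hs; apply: (@continuous_comp _ _ _ (fun t => t +i* y0) f s).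
  exact: cvg_hline.
by apply: h; rewrite /bd /rect /= hs Y0 eqxx ?orbT.
Qed.

Lemma re_h1 f : re x0 x1 y0 y1 f -> ci x0 x1 (fun s => f (s +i* y1)).
Proof.
move=> h s hs; apply: (@continuous_comp _ _ _ (fun t => t +i* y1) f s).
  exact: cvg_hline.
by apply: h; rewrite /bd /rect /= hs Y1 eqxx ?orbT.
Qed.

Lemma re_v0 f : re x0 x1 y0 y1 f -> ci y0 y1 (fun s => f (x0 +i* s)).
Proof.
move=> h s hs; apply: (@continuous_comp _ _ _ (fun t => x0 +i* t) f s).
  exact: cvg_vline.
by apply: h; rewrite /bd /rect /= hs X0 eqxx ?orbT.
Qed.

Lemma re_v1 f : re x0 x1 y0 y1 f -> ci y0 y1 (fun s => f (x1 +i* s)).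
Proof.
move=> h s hs; apply: (@continuous_comp _ _ _ (fun t => x1 +i* t) f s).
  exact: cvg_vline.
by apply: h; rewrite /bd /rect /= hs X1 eqxx ?orbT.
Qed.

Lemma JD f g : re x0 x1 y0 y1 f -> re x0 x1 y0 y1 g ->
  J x0 x1 y0 y1 (fun z => f z + g z) = J x0 x1 y0 y1 f + J x0 x1 y0 y1 g.
Proof.
move=> hf hg; rewrite /J.
rewrite (ID (re_h0 hf) (re_h0 hg)) (ID (re_h1 hf) (re_h1 hg)).
rewrite (ID (re_v0 hf) (re_v0 hg)) (ID (re_v1 hf) (re_v1 hg)); ring.
Qed.

Lemma JB f g : re x0 x1 y0 y1 f -> re x0 x1 y0 y1 g ->
  J x0 x1 y0 y1 (fun z => f z - g z) = J x0 x1 y0 y1 f - J x0 x1 y0 y1 g.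
Proof.
move=> hf hg; rewrite /J.
rewrite (IB (re_h0 hf) (re_h0 hg)) (IB (re_h1 hf) (re_h1 hg)).
rewrite (IB (re_v0 hf) (re_v0 hg)) (IB (re_v1 hf) (re_v1 hg)); ring.
Qed.

Lemma JZ k f : re x0 x1 y0 y1 f ->
  J x0 x1 y0 y1 (fun z => k * f z) = k * J x0 x1 y0 y1 f.
Proof.
move=> hf; rewrite /J (IZ _ (re_h0 hf)) (IZ _ (re_h1 hf)).
by rewrite (IZ _ (re_v0 hf)) (IZ _ (re_v1 hf)); ring.
Qed.

Lemma J_bound f M : re x0 x1 y0 y1 f -> (forall z, bd x0 x1 y0 y1 z -> nc (f z) <= M) ->
  nc (J x0 x1 y0 y1 f) <= 4 * M * ((x1 - x0) + (y1 - y0)).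
Proof.
move=> hf hM.
have h1 : nc (I x0 x1 (fun s => f (s +i* y0))) <= 2 * M * (x1 - x0).
  by apply: I_bound (re_h0 hf) _ => // s hs; apply: hM; rewrite /bd /rect /= hs Y0 eqxx ?orbT.
have h2 : nc (I x0 x1 (fun s => f (s +i* y1))) <= 2 * M * (x1 - x0).
  by apply: I_bound (re_h1 hf) _ => // s hs; apply: hM; rewrite /bd /rect /= hs Y1 eqxx ?orbT.
have h3 : nc ('i * I y0 y1 (fun s => f (x0 +i* s))) <= 2 * M * (y1 - y0).
  rewrite ncM nci mul1r.
  by apply: I_bound (re_v0 hf) _ => // s hs; apply: hM; rewrite /bd /rect /= hs X0 eqxx ?orbT.
have h4 : nc ('i * I y0 y1 (fun s => f (x1 +i* s))) <= 2 * M * (y1 - y0).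
  rewrite ncM nci mul1r.
  by apply: I_bound (re_v1 hf) _ => // s hs; apply: hM; rewrite /bd /rect /= hs X1 eqxx ?orbT.
rewrite /J; set a := I _ _ _ in h1 *; set b := _ * I _ _ _ in h4 *.
set c := I _ _ _ in h2 *; set d := _ * I _ _ _ in h3 *.
have := ncB (a + b - c) d; have := ncB (a + b) c; have := ncD a b.
by move: h1 h2 h3 h4; lra.
Qed.

Lemma J_ext f g : (forall z, bd x0 x1 y0 y1 z -> f z = g z) ->
  J x0 x1 y0 y1 f = J x0 x1 y0 y1 g.
Proof.
move=> h; congr (_ + _ * _ - _ - _ * _); apply: I_ext => s hs; apply: h;
  by rewrite /bd /rect /= ?hs ?X0 ?X1 ?Y0 ?Y1 ?eqxx ?orbT.
Qed.

Lemma J_splitx c f : x0 <= c <= x1 -> rc x0 x1 y0 y1 f ->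
  J x0 x1 y0 y1 f = J x0 c y0 y1 f + J c x1 y0 y1 f.
Proof.
move=> /andP[c1 c2] hf; rewrite /J (I_split c1 c2 (rc_h hf Y0)) (I_split c1 c2 (rc_h hf Y1)).
by ring.
Qed.

Lemma J_splity c f : y0 <= c <= y1 -> rc x0 x1 y0 y1 f ->
  J x0 x1 y0 y1 f = J x0 x1 y0 c f + J x0 x1 c y1 f.
Proof.
move=> /andP[c1 c2] hf; rewrite /J (I_split c1 c2 (rc_v hf X0)) (I_split c1 c2 (rc_v hf X1)).
by ring.
Qed.

Lemma J_affine a b : J x0 x1 y0 y1 (fun z => a + b * z) = 0.
Proof.
have H y : I x0 x1 (fun s => a + b * (s +i* y)) =
    (a + b * 'i * y%:C) * (x1 - x0)%:C + b * ((x1 ^+ 2 - x0 ^+ 2) / 2)%:C.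
  rewrite -(I_id x01) -(I_cst _ x01) -IZ -?ID.
  - by apply: I_ext => s _; rewrite [s +i* y]complexE' /=; ring.
  - exact: ci_cst.
  - by move=> s _; apply: cvg_cM; [exact: cvg_cst|apply: cvg_RC; exact: cvg_id].
  - by move=> s _; apply: cvg_RC; exact: cvg_id.
have V x : I y0 y1 (fun s => a + b * (x +i* s)) =
    (a + b * x%:C) * (y1 - y0)%:C + b * 'i * ((y1 ^+ 2 - y0 ^+ 2) / 2)%:C.
  rewrite -(I_id y01) -(I_cst _ y01) -IZ -?ID.
  - by apply: I_ext => s _; rewrite [x +i* s]complexE' /=; ring.
  - exact: ci_cst.
  - by move=> s _; apply: cvg_cM; [exact: cvg_cst|apply: cvg_RC; exact: cvg_id].
  - by move=> s _; apply: cvg_RC; exact: cvg_id.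
by rewrite /J !H !V !rmorphB /=; ring.
Qed.

End Fixed.

Lemma midpoint (a b : R) : a <= b ->
  [/\ a <= (a + b) / 2, (a + b) / 2 <= b, (a + b) / 2 - a = (b - a) / 2 & b - (a + b) / 2 = (b - a) / 2].
Proof. by move=> ab; split; lra. Qed.

(** Otherwise one quarter of every bad rectangle is bad, and the nested bad quarters shrink to a
    point at which the local hypothesis is contradicted. *)
Lemma rect_bisection (P : R -> R -> R -> R -> Prop) x0 x1 y0 y1 :
  x0 <= x1 -> y0 <= y1 ->
  (forall a b c d, x0 <= a -> a <= b -> b <= x1 -> y0 <= c -> c <= d -> d <= y1 ->
    let m := (a + b) / 2 in let n := (c + d) / 2 in
    P a m c n -> P m b c n -> P a m n d -> P m b n d -> P a b c d) ->
  (forall z, rect x0 x1 y0 y1 z -> exists2 e : R, 0 < e &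
    forall a b c d, x0 <= a -> a <= b -> b <= x1 -> y0 <= c -> c <= d -> d <= y1 ->
    rect a b c d z -> b - a <= e -> d - c <= e -> P a b c d) ->
  P x0 x1 y0 y1.
Proof.
move=> x01 y01 step loc; apply: contrapT => nP.
pose bad (q : (R * R) * (R * R)) := [/\ x0 <= q.1.1, q.1.1 <= q.1.2, q.1.2 <= x1 &
  [/\ y0 <= q.2.1, q.2.1 <= q.2.2, q.2.2 <= y1 & ~ P q.1.1 q.1.2 q.2.1 q.2.2]].
pose sub (q q' : (R * R) * (R * R)) := [/\ q.1.1 <= q'.1.1, q'.1.2 <= q.1.2,
  q.2.1 <= q'.2.1, q'.2.2 <= q.2.2 &
  (q'.1.2 - q'.1.1 = (q.1.2 - q.1.1) / 2 /\ q'.2.2 - q'.2.1 = (q.2.2 - q.2.1) / 2)].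
have /choice[nx hnx] : forall q, exists q', bad q -> bad q' /\ sub q q'.
  move=> [[a b] [c d]].
  have [[/= h1 h2 h3 [h4 h5 h6 h7]]|nb] := pselect (bad ((a, b), (c, d))); last by exists ((a, b), (c, d)).
  pose m := (a + b) / 2; pose n := (c + d) / 2.
  have [m1 m2 m3 m4] := midpoint h2; have [n1 n2 n3 n4] := midpoint h5; rewrite -/m in m1 m2 m3 m4; rewrite -/n in n1 n2 n3 n4.
  have m5 := le_trans h1 m1; have m6 := le_trans m2 h3; have n5 := le_trans h4 n1; have n6 := le_trans n2 h6.
  have [p1|p1] := pselect (P a m c n); last first.
    by exists ((a, m), (c, n)) => _; rewrite /bad /sub /=; repeat split => //.
  have [p2|p2] := pselect (P m b c n); last first.
    by exists ((m, b), (c, n)) => _; rewrite /bad /sub /=; repeat split => //.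
  have [p3|p3] := pselect (P a m n d); last first.
    by exists ((a, m), (n, d)) => _; rewrite /bad /sub /=; repeat split => //.
  have [p4|p4] := pselect (P m b n d); last first.
    by exists ((m, b), (n, d)) => _; rewrite /bad /sub /=; repeat split => //.
  by case: h7; exact: step.
pose q n := iter n nx ((x0, x1), (y0, y1)).
have bq n : bad (q n).
  elim: n => [|n ih]; first by rewrite /bad /=; repeat split.
  by rewrite /q iterS; case: (hnx _ ih).
have sq n : sub (q n) (q n.+1) by rewrite /q iterS; case: (hnx _ (bq n)).
have wx n : (q n).1.2 - (q n).1.1 = (x1 - x0) / 2 ^+ n.
  elim: n => [|n ih]; first by rewrite expr0 divr1.
  by case: (sq n) => _ _ _ _ [-> _]; rewrite ih exprSr invfM mulrA.
have wy n : (q n).2.2 - (q n).2.1 = (y1 - y0) / 2 ^+ n.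
  elim: n => [|n ih]; first by rewrite expr0 divr1.
  by case: (sq n) => _ _ _ _ [_ ->]; rewrite ih exprSr invfM mulrA.
have mon n m : [/\ (q n).1.1 <= (q (n + m)%N).1.1, (q (n + m)%N).1.2 <= (q n).1.2,
    (q n).2.1 <= (q (n + m)%N).2.1 & (q (n + m)%N).2.2 <= (q n).2.2].
  elim: m => [|m [i1 i2 i3 i4]]; first by rewrite addn0.
  rewrite addnS; case: (sq (n + m)%N) => j1 j2 j3 j4 _.
  by split; [exact: le_trans j1|exact: le_trans j2 _|exact: le_trans j3|exact: le_trans j4 _].
have cross n m : (q n).1.1 <= (q m).1.2 /\ (q n).2.1 <= (q m).2.2.
  case: (mon n m) => i1 _ i3 _; case: (mon m n) => _ i2 _ i4; rewrite addnC in i2 i4.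
  case: (bq (n + m)%N) => _ b1 _ [_ b2 _ _].
  by split; [exact: le_trans i1 (le_trans b1 i2)|exact: le_trans i3 (le_trans b2 i4)].
pose A := [set (q n).1.1 | n in [set: nat]]; pose B := [set (q n).2.1 | n in [set: nat]].
(* The lower corners increase and stay below all upper corners by [cross], so the two suprema form a
   point common to all the bad rectangles. *)
have hA n : (q n).1.1 <= sup A <= (q n).1.2.
  apply/andP; split.
    apply: ub_le_sup; last by exists n.
    by exists x1 => _ [m _ <-]; case: (bq m) => _ b1 b2 _; exact: le_trans b2.
  apply: ge_sup; first by exists x0; exists 0%N.
  by move=> _ [m _ <-]; case: (cross m n).
have hB n : (q n).2.1 <= sup B <= (q n).2.2.
  apply/andP; split.
    apply: ub_le_sup; last by exists n.
    by exists y1 => _ [m _ <-]; case: (bq m) => _ _ _ [_ b1 b2 _]; exact: le_trans b2.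
  apply: ge_sup; first by exists y0; exists 0%N.
  by move=> _ [m _ <-]; case: (cross m n).
have [e e0 he] : exists2 e : R, 0 < e &
    forall a b c d, x0 <= a -> a <= b -> b <= x1 -> y0 <= c -> c <= d -> d <= y1 ->
    rect a b c d (sup A +i* sup B) -> b - a <= e -> d - c <= e -> P a b c d.
  by apply: loc; rewrite /rect /=; have := hA 0%N; have := hB 0%N => /= -> ->.
have [n hn] : exists n, (x1 - x0) / 2 ^+ n <= e /\ (y1 - y0) / 2 ^+ n <= e.
  have [n hn] : exists n, ((x1 - x0) + (y1 - y0)) / e <= n%:R.
    exists (Num.truncn (((x1 - x0) + (y1 - y0)) / e)).+1; exact/ltW/truncnS_gt.
  exists n; have : n%:R <= 2 ^+ n :> R by rewrite -natrX ler_nat ltnW// ltn_expl.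
  move=> /(le_trans hn); rewrite ler_pdivrMr// !ler_pdivrMr ?exprn_gt0//.
  by rewrite mulrC; split; lra.
case: (bq n) => b1 b2 b3 [b4 b5 b6]; apply; apply: he => //.
- by rewrite /rect /= hA hB.
- by rewrite wx; case: hn.
- by rewrite wy; case: hn.
Qed.

(** The bound carried through the bisection, [e] times the square of the half-perimeter, is exactly
    additive under quartering. On a small rectangle the affine part of [f] integrates to zero, and
    the remainder is at most [e / 4] times the half-perimeter. *)
Lemma goursat x0 x1 y0 y1 f : x0 <= x1 -> y0 <= y1 ->
  (forall z, rect x0 x1 y0 y1 z -> differentiable f z) -> J x0 x1 y0 y1 f = 0.
Proof.
move=> x01 y01 df; apply/eqP; rewrite -nc_eq0 eq_le nc_ge0 andbT.
have fc : rc x0 x1 y0 y1 f by move=> z hz; exact: diff_cont (df z hz).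
apply/ler_addgt0Pl => eps eps0; rewrite addr0.
pose K := ((x1 - x0) + (y1 - y0)) ^+ 2 + 1.
have K0 : 0 < K by rewrite ltr_wpDl// sqr_ge0.
pose e := eps / K.
have e0 : 0 < e by rewrite divr_gt0.
have : nc (J x0 x1 y0 y1 f) <= e * ((x1 - x0) + (y1 - y0)) ^+ 2.
  apply: (@rect_bisection (fun a b c d => nc (J a b c d f) <= e * ((b - a) + (d - c)) ^+ 2)) => //.
    move=> a b c d xa ab bx yc cd dy m n p1 p2 p3 p4.
    have [am mb _ _] := midpoint ab; have [cn nd _ _] := midpoint cd; rewrite -/m in am mb; rewrite -/n in cn nd.
    have hr : rc a b c d f by exact: rcS fc.
    rewrite (@J_splitx a b c d cd m) ?am//.
    rewrite (@J_splity a m c d am n) ?cn//; last by apply: rcS hr.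
    rewrite (@J_splity m b c d mb n) ?cn//; last by apply: rcS hr.
    set u1 := J _ _ _ _ _ in p1 *; set u3 := J _ _ _ _ _ in p3 *.
    set u2 := J _ _ _ _ _ in p2 *; set u4 := J _ _ _ _ _ in p4 *.
    have E : e * (b - a + (d - c)) ^+ 2 = e * (m - a + (n - c)) ^+ 2 + e * (m - a + (d - n)) ^+ 2
       + (e * (b - m + (n - c)) ^+ 2 + e * (b - m + (d - n)) ^+ 2).
      by rewrite /m /n; field.
    by rewrite E (le_trans (ncD _ _))// lerD// (le_trans (ncD _ _))// lerD.
  move=> z hz.
  have e4 : 0 < e / 4 by rewrite divr_gt0.
  have [dl dl0 hd] := diff_eps (df z hz) e4.
  exists (dl / 2) => [|a b c d xa ab bx yc cd dy zr wa wc]; first by rewrite divr_gt0.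
  have hr : rc a b c d f by exact: rcS fc.
  pose l := 'd f z 1.
  have lE v : 'd f z v = l * v by rewrite /l -[v in LHS]mulr1 -[v * 1]/(v *: (1 : C)) linearZ /= mulrC.
  have al : rc a b c d (fun w => f z - l * z + l * w).
    by apply: rcD; [exact: rc_cst|apply: rcM; [exact: rc_cst|exact: rc_id]].
  have -> : J a b c d f = J a b c d (fun w => f w - ((f z - l * z) + l * w)).
    by rewrite (JB _ _ (rc_re hr) (rc_re al)) ?J_affine ?subr0.
  have rb w : rect a b c d w -> nc (w - z) <= (b - a) + (d - c).
    move: zr => /andP[/andP[r1 r2] /andP[r3 r4]] /andP[/andP[s1 s2] /andP[s3 s4]].
    rewrite (le_trans (nc_le_ReIm _))// cReD cImD cReN cImN lerD// ler_norml; apply/andP; split; lra.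
  have -> : e * (b - a + (d - c)) ^+ 2 = 4 * (e / 4 * (b - a + (d - c))) * ((b - a) + (d - c)).
    by field.
  apply: (J_bound ab cd (rc_re (rcB hr al))) => w /andP[hw _].
  have := hd (w - z); rewrite vn_nc [z + _]addrC subrK lE.
  have -> : f w - f z - l * (w - z) = f w - (f z - l * z + l * w) by ring.
  have h := rb w hw.
  move=> /(_ _)/le_trans; apply; first by move: h wa wc; lra.
  by rewrite ler_wpM2l// ltW.
move=> /le_trans; apply.
rewrite /e mulrAC ler_pdivrMr// ler_wpM2l ?(ltW eps0)// /K lerDl//.
Qed.

End Rectangles.

(** * Cauchy's integral formula *)

Section Cauchy.
Context {R : realType}.
Local Notation C := R[i].
Implicit Types (f g : C -> C) (z a : C).

Definition inner (x0 x1 y0 y1 : R) (z : C) :=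
  [/\ x0 < complex.Re z, complex.Re z < x1, y0 < complex.Im z & complex.Im z < y1].

(* The Cauchy kernel, regularised at distance [d] of its pole. *)
Definition kr (d : R) z (w : C) : C := (w - z)^* / ((Num.max (nc (w - z)) d) ^+ 2)%:C.

Lemma kr_eq d z w : 0 < d -> d <= nc (w - z) -> kr d z w = (w - z)^-1.
Proof.
move=> d0 dw; rewrite /kr max_l// -nc_mulconj.
have w0 : w - z != 0 by rewrite -nc_gt0 (lt_le_trans d0).
have w1 : (w - z)^* != 0 by rewrite -nc_gt0 nc_conj nc_gt0.
by rewrite invfM mulrCA divff// mulr1.
Qed.

Lemma diff_id' z : differentiable (fun w : C => w) z.
Proof. exact: (ex_diff (df := id)). Qed.

Lemma diff_subc z w : differentiable (fun u : C => u - z) w.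
Proof. exact: diffB (diff_id' _) (diff_cst' _ _). Qed.

Lemma kr_cont d z w : 0 < d -> {for w, continuous (kr d z)}.
Proof.
move=> d0; have h := diff_cont (diff_subc z w).
have M0 : 0 < Num.max (nc (w - z)) d by rewrite lt_max d0 orbT.
have hm : {for w, continuous (fun u => Num.max (nc (u - z)) d)}.
  apply/contRP => e e0; have := (contRP _ _).1 (cont_nc h) e e0.
  apply: filterS => u; rewrite ler_norml => /andP[h1 h2].
  rewrite ler_norml; apply/andP.
  case: (leP (nc (u - z)) d) => h3; case: (leP (nc (w - z)) d) => h4; split; lra.
have hm2 : {for w, continuous (fun u => (Num.max (nc (u - z)) d) ^+ 2)}.
  have h2 : {for w, continuous (fun u => Num.max (nc (u - z)) d * Num.max (nc (u - z)) d)} by exact: (cvgM hm hm).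
  by apply: cont_ext h2 => u; rewrite expr2.
apply: (contM (cont_conj h)); apply: contV (cont_RC hm2) _.
by rewrite -nc_gt0 ncR normr_gt0 expf_neq0// gt_eqF.
Qed.

Lemma J_hole (x0 x1 y0 y1 a b c d : R) f :
  x0 <= a -> a <= b -> b <= x1 -> y0 <= c -> c <= d -> d <= y1 ->
  rc x0 x1 y0 y1 f ->
  J x0 a y0 y1 f = 0 -> J b x1 y0 y1 f = 0 -> J a b y0 c f = 0 -> J a b d y1 f = 0 ->
  J x0 x1 y0 y1 f = J a b c d f.
Proof.
move=> xa ab bx yc cd dy hf e1 e2 e3 e4.
have yy : y0 <= y1 by rewrite (le_trans yc)// (le_trans cd).
rewrite (@J_splitx _ x0 x1 y0 y1 yy a); last exact: hf; last first.
  by rewrite xa (le_trans ab).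
have hf1 : rc a x1 y0 y1 f by apply: rcS hf.
rewrite (@J_splitx _ a x1 y0 y1 yy b); last exact: hf1; last by rewrite ab.
have hf2 : rc a b y0 y1 f by apply: rcS hf1.
rewrite (@J_splity _ a b y0 y1 ab c); last exact: hf2; last first.
  by rewrite yc (le_trans cd).
have hf3 : rc a b c y1 f by apply: rcS hf2.
rewrite (@J_splity _ a b c y1 ab d); last exact: hf3; last by rewrite cd.
by rewrite e1 e2 e3 e4 !add0r !addr0.
Qed.

Lemma nc_far z w (d : R) : (d <= `|complex.Re w - complex.Re z|) || (d <= `|complex.Im w - complex.Im z|) ->
  d <= nc (w - z).
Proof.
case/orP => h; apply: le_trans h _.
  by rewrite -cReN -cReD Re_le_nc.
by rewrite -cImN -cImD Im_le_nc.
Qed.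

Lemma inner_margin (x0 x1 y0 y1 : R) z : inner x0 x1 y0 y1 z -> exists2 d : R, 0 < d &
  forall w, (complex.Re w <= x0) || (x1 <= complex.Re w) ||
    ((complex.Im w <= y0) || (y1 <= complex.Im w)) -> d <= nc (w - z).
Proof.
move=> [h1 h2 h3 h4].
exists (Num.min (Num.min (complex.Re z - x0) (x1 - complex.Re z))
                (Num.min (complex.Im z - y0) (y1 - complex.Im z))).
  by rewrite !lt_min !subr_gt0 h1 h2 h3 h4.
move=> w hw; apply: nc_far; move: hw; rewrite !ge_min.
case: (ler0P (complex.Re w - complex.Re z)) => ?; case: (ler0P (complex.Im w - complex.Im z)) => ? /orP[/orP[]|/orP[]] ?; apply/orP; first [left; apply/orP; left; apply/orP; left; lra
 | left; apply/orP; left; apply/orP; right; lra | right; apply/orP; right; apply/orP; left; lra | right; apply/orP; right; apply/orP; right; lra | exfalso; lra].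
Qed.

Lemma bd_far x0 x1 y0 y1 z w d :
  (forall w, (complex.Re w <= x0) || (x1 <= complex.Re w) ||
    ((complex.Im w <= y0) || (y1 <= complex.Im w)) -> d <= nc (w - z)) ->
  bd x0 x1 y0 y1 w -> d <= nc (w - z).
Proof.
move=> h /andP[_ /or4P[] /eqP e]; apply: h; rewrite e lexx ?orbT//.
Qed.

Lemma diff_cauchy_kernel f z w : differentiable f w -> w != z ->
  differentiable (fun w => f w / (w - z)) w.
Proof.
move=> h wz; apply: (diffM' h); apply: diffV' (diff_subc z w) _.
by rewrite subr_eq0.
Qed.

Lemma re_cauchy_kernel x0 x1 y0 y1 f z : rc x0 x1 y0 y1 f -> inner x0 x1 y0 y1 z ->
  re x0 x1 y0 y1 (fun w => f w / (w - z)).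
Proof.
move=> hf hz w hw; have [d d0 hd] := inner_margin hz.
have h := bd_far hd hw.
have hfw : {for w, continuous f} by apply: hf; case/andP: hw.
apply: (contM hfw); apply: contV (diff_cont (diff_subc z w)) _.
by rewrite -nc_gt0 (lt_le_trans d0).
Qed.

(** Cutting a rectangle into pieces requires an integrand continuous inside. The regularised kernel
    is continuous, and it agrees with the Cauchy kernel on both contours and on the four rectangles
    around the hole, where Goursat's theorem applies. *)
Lemma cauchy_hole (x0 x1 y0 y1 a b c d : R) f z :
  x0 <= a -> b <= x1 -> y0 <= c -> d <= y1 -> inner a b c d z ->
  (forall w, rect x0 x1 y0 y1 w -> differentiable f w) ->
  J x0 x1 y0 y1 (fun w => f w / (w - z)) = J a b c d (fun w => f w / (w - z)).
Proof.
move=> xa bx yc dy hz df.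
have [e e0 he] := inner_margin hz; case: (hz) => z1 z2 z3 z4.
have [ab cd] : a <= b /\ c <= d by split; lra.
have fc : rc x0 x1 y0 y1 f by move=> w hw; exact: diff_cont (df w hw).
have kc : rc x0 x1 y0 y1 (fun w => f w * kr e z w).
  by apply: rcM fc _ => w _; exact: kr_cont.
have [xx yy] : x0 <= x1 /\ y0 <= y1 by split; lra.
have E (x0' x1' y0' y1' : R) : x0' <= x1' -> y0' <= y1' -> (forall w, bd x0' x1' y0' y1' w -> e <= nc (w - z)) ->
    J x0' x1' y0' y1' (fun w => f w / (w - z)) = J x0' x1' y0' y1' (fun w => f w * kr e z w).
  by move=> h1 h2 h; apply: J_ext => // w /h hw; rewrite kr_eq.
rewrite E//; last first.
  move=> w /andP[/andP[/andP[w1 w2] /andP[w3 w4]] /or4P[] /eqP ew]; apply: he; move: w1 w2 w3 w4; rewrite ?ew ?xa ?bx ?yc ?dy ?orbT//.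
rewrite (E a b c d ab cd (fun w => bd_far he)).
have G (x0' x1' y0' y1' : R) : x0 <= x0' -> x1' <= x1 -> y0 <= y0' -> y1' <= y1 ->
   x0' <= x1' -> y0' <= y1' -> (forall w, rect x0' x1' y0' y1' w -> e <= nc (w - z)) ->
    J x0' x1' y0' y1' (fun w => f w * kr e z w) = 0.
  move=> h1 h2 h3 h4 h5 h6 h; rewrite -E//; last by move=> w /andP[/h].
  apply: goursat h5 h6 _ => w hw; apply: diff_cauchy_kernel.
    apply: df; move: hw => /andP[/andP[w1 w2] /andP[w3 w4]].
    by rewrite /rect (le_trans h1 w1) (le_trans w2 h2) (le_trans h3 w3) (le_trans w4 h4).
  by rewrite -subr_eq0 -nc_gt0 (lt_le_trans e0)// h.
apply: J_hole => //; apply: G => //; try lra; move=> w /andP[/andP[w1 w2] /andP[w3 w4]]; apply: he.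
- by rewrite w2.
- by rewrite w1 orbT.
- by rewrite w4 !orbT.
- by rewrite w3 !orbT.
Qed.

Lemma margin (a b x d : R) : 0 < d -> d <= x - a -> d <= b - x ->
  [/\ a <= x - d, x + d <= b, x - d < x & x < x + d].
Proof. by move=> *; split; lra. Qed.

Lemma big_radius (a b c d p q : R) : 0 <= p -> 0 <= q -> exists r : R,
  [/\ 1 <= r, p <= r, q <= r, - r <= a /\ b <= r & - r <= c /\ d <= r].
Proof.
move=> p0 q0; exists (1 + `|a| + `|b| + `|c| + `|d| + p + q).
have := ler_norm (- a); have := ler_norm b; have := ler_norm (- c); have := ler_norm d; rewrite !normrN.
have := normr_ge0 a; have := normr_ge0 b; have := normr_ge0 c; have := normr_ge0 d.
by move=> *; split; [lra|lra|lra|split; lra|split; lra].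
Qed.

(** The contour of the integral of [(f w - f z) / (w - z)] is shrunk to a square of half-side [d]
    around [z]. There the kernel is at most [1 / d], the length is proportional to [d], and
    [f w - f z] is small by continuity. *)
Lemma cauchy_ratio (x0 x1 y0 y1 : R) f z : inner x0 x1 y0 y1 z ->
  (forall w, rect x0 x1 y0 y1 w -> differentiable f w) ->
  J x0 x1 y0 y1 (fun w => f w / (w - z)) = f z * J x0 x1 y0 y1 (fun w => 1 / (w - z)).
Proof.
move=> hz df; case: (hz) => z1 z2 z3 z4.
have [xx yy] : x0 <= x1 /\ y0 <= y1 by split; lra.
have fc : rc x0 x1 y0 y1 f by move=> w hw; exact: diff_cont (df w hw).
have c1 := re_cauchy_kernel fc hz.
have c2 := re_cauchy_kernel (@rc_cst R x0 x1 y0 y1 1) hz.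
rewrite -(JZ xx yy _ c2); apply/eqP; rewrite -subr_eq0.
rewrite -(JB xx yy c1 (reM (@re_cst _ _ _ _ _ _) c2)).
rewrite (@J_ext _ _ _ _ _ xx yy _ (fun w => (f w - f z) / (w - z))); last first.
  by move=> w _; ring.
rewrite -nc_eq0 eq_le nc_ge0 andbT; apply/ler_addgt0Pl => eps eps0; rewrite addr0.
have dphi w : rect x0 x1 y0 y1 w -> differentiable (fun w => f w - f z) w.
  by move=> hw; apply: diffB (df w hw) (diff_cst' _ _).
have e16 : 0 < eps / 16 by rewrite divr_gt0.
have zr : rect x0 x1 y0 y1 z by rewrite /rect !ltW.
have /contP/(_ _ e16)/nearC[r r0 hr] := fc z zr.
pose m := Num.min (Num.min (complex.Re z - x0) (x1 - complex.Re z))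
                (Num.min (complex.Im z - y0) (y1 - complex.Im z)).
pose d := Num.min (r / 2) m.
have d0 : 0 < d by rewrite /d /m !lt_min !subr_gt0 divr_gt0// z1 z2 z3 z4.
have [d1 d2 d3 d4 d5] : [/\ d <= r / 2, d <= complex.Re z - x0, d <= x1 - complex.Re z,
    d <= complex.Im z - y0 & d <= y1 - complex.Im z].
  by rewrite /d /m !ge_min !lexx !orbT.
pose x := complex.Re z; pose y := complex.Im z.
have [mx1 mx2 mx3 mx4] := margin d0 d2 d3; have [my1 my2 my3 my4] := margin d0 d4 d5.
rewrite -/x in mx1 mx2 mx3 mx4; rewrite -/y in my1 my2 my3 my4.
have iz : inner (x - d) (x + d) (y - d) (y + d) z by split.
rewrite (@cauchy_hole x0 x1 y0 y1 (x - d) (x + d) (y - d) (y + d) (fun w => f w - f z) z mx1 mx2 my1 my2 iz dphi).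
have dd1 := ltW (lt_trans mx3 mx4).
have dd2 := ltW (lt_trans my3 my4).
have sub : rc (x - d) (x + d) (y - d) (y + d) (fun w => f w - f z).
  by apply: (@rcS _ x0 x1 y0 y1 _ _ _ _ _ mx1 mx2 my1 my2); exact: rcB fc (@rc_cst _ _ _ _ _ _).
have ree := re_cauchy_kernel sub iz.
rewrite (le_trans (J_bound dd1 dd2 ree (M := eps / 16 / d) _))//.
  move=> w hw; rewrite ncM ncV ler_pM ?invr_ge0 ?nc_ge0//.
    have -> : w = z + (w - z) by rewrite addrC subrK.
    apply: hr; case/andP: hw => /andP[/andP[w1 w2] /andP[w3 w4]] _.
    rewrite (le_trans (nc_le_ReIm _))// cReD cImD cReN cImN.
    have : `|complex.Re w - complex.Re z| <= d by rewrite ler_distl -/x w1 w2.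
    have : `|complex.Im w - complex.Im z| <= d by rewrite ler_distl -/y w3 w4.
    by move: d1; lra.
  have dw : d <= nc (w - z).
    have E1 (u : R) : `|u - d - u| = d by rewrite addrAC subrr add0r normrN gtr0_norm.
    have E2 (u : R) : `|u + d - u| = d by rewrite addrAC subrr add0r gtr0_norm.
    by apply: nc_far; case/andP: hw => _ /or4P[] /eqP ->; rewrite /x /y ?E1 ?E2 lexx ?orbT.
  by rewrite lef_pV2// posrE// (lt_le_trans d0).
have -> : x + d - (x - d) + (y + d - (y - d)) = 4 * d by ring.
have -> : 4 * (eps / 16 / d) * (4 * d) = eps by field; rewrite gt_eqF.
by [].
Qed.

(* This is [2 * 'i * pi]; only [W0 != 0] matters. *)
Definition W0 : C := J (-1) 1 (-1) 1 (fun w : C => 1 / (w - 0)).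

Lemma square_inner z (r : R) : 0 < r -> inner (complex.Re z - r) (complex.Re z + r) (complex.Im z - r) (complex.Im z + r) z.
Proof. by move=> r0; rewrite /inner; split; lra. Qed.

(** Both contours are enlarged to one square of half-side [r]. The two kernels differ by
    [z / (w * (w - z))], of order [r ^- 2], on a contour of length of order [r]. *)
Lemma winding (x0 x1 y0 y1 : R) z : inner x0 x1 y0 y1 z ->
  J x0 x1 y0 y1 (fun w => 1 / (w - z)) = W0.
Proof.
move=> hz; apply/eqP; rewrite -subr_eq0 -nc_eq0 eq_le nc_ge0 andbT.
apply/ler_addgt0Pl => eps eps0; rewrite addr0; case: (hz) => z1 z2 z3 z4.
have n0 := nc_ge0 z.
have n2 : 0 <= 2 * nc z by rewrite mulr_ge0.
have q0 : 0 <= 64 * nc z / eps by rewrite divr_ge0 ?mulr_ge0// ltW.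
have [r [r1 zr er [rx0 rx1] [ry0 ry1]]] := big_radius x0 x1 y0 y1 n2 q0.
have d1 w : differentiable (fun _ : C => 1 : C) w by exact: diff_cst'.
have r0 : 0 < r := lt_le_trans ltr01 r1.
have rm : - r <= -1 by rewrite lerN2.
have i1 : inner (-1) 1 (-1) 1 (0 : C) by split; rewrite /= ?ltrN10.
rewrite /W0 -(@cauchy_hole (-r) r (-r) r x0 x1 y0 y1 (fun=> 1) z rx0 rx1 ry0 ry1 hz (fun w _ => d1 w)).
rewrite -(@cauchy_hole (-r) r (-r) r (-1) 1 (-1) 1 (fun=> 1) 0 rm r1 rm r1 i1 (fun w _ => d1 w)).
have iz : inner (-r) r (-r) r z.
  by split; [exact: le_lt_trans rx0 z1|exact: lt_le_trans z2 rx1|exact: le_lt_trans ry0 z3|exact: lt_le_trans z4 ry1].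
have i0 : inner (-r) r (-r) r (0 : C) by split; rewrite /= ?oppr_lt0.
have rr : - r <= r by exact: ltW (gtrN r0).
have c1 := re_cauchy_kernel (@rc_cst R (-r) r (-r) r 1) iz.
have c0 := re_cauchy_kernel (@rc_cst R (-r) r (-r) r 1) i0.
rewrite -(JB rr rr c1 c0).
rewrite (le_trans (J_bound rr rr (reB c1 c0) (M := nc z * (r * (r / 2))^-1) _))//.
  move=> w hw.
  have wr : r <= nc (w - 0).
    have E1 : `|- r - 0| = r by rewrite subr0 normrN gtr0_norm.
    have E2 : `|r - 0| = r by rewrite subr0 gtr0_norm.
    by apply: nc_far; case/andP: hw => _ /or4P[] /eqP ->; rewrite /= ?E1 ?E2 lexx ?orbT.
  rewrite subr0 in wr *.
  have wz : r / 2 <= nc (w - z) by have := ncD (w - z) z; rewrite subrK; lra.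
  have w0 : w != 0 by rewrite -nc_gt0; lra.
  have wz0 : w - z != 0 by rewrite -nc_gt0; lra.
  have -> : 1 / (w - z) - 1 / w = z / (w * (w - z)) by field; rewrite w0 wz0.
  rewrite ncM ncV ncM ler_wpM2l// lef_pV2 ?posrE ?mulr_gt0 ?nc_gt0 ?divr_gt0//.
  by rewrite ler_pM ?divr_ge0// ltW.
have -> : 4 * (nc z * (r * (r / 2))^-1) * (r - - r + (r - - r)) = 32 * nc z / r.
  by field; rewrite gt_eqF.
rewrite ler_pdivrMr//; rewrite ler_pdivrMr// in er.
by nra.
Qed.

(** On each side of the square, the integrand times the direction of the side has imaginary part
    [(s ^+ 2 + 1)^-1], which is at least [1 / 2]. *)
Lemma W0_neq0 : W0 != 0.
Proof.
have hz : inner (-1) 1 (-1) 1 (0 : C) by rewrite /inner /=; split; lra.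
have c := re_cauchy_kernel (@rc_cst R (-1) 1 (-1) 1 1) hz.
have m11 : (-1 : R) <= 1 by lra.
suff : 0 < complex.Im W0 by apply: contraTneq => ->; rewrite ltxx.
have h0 := re_h0 m11 c; have h1 := re_h1 m11 c; have v0 := re_v0 m11 c; have v1 := re_v1 m11 c.
have Q s : -1 <= s <= 1 -> 1 / 2 <= (s ^+ 2 + 1)^-1 :> R.
  by move=> hs; rewrite mul1r lef_pV2 ?posrE; nra.
rewrite /W0 /J -(IN h1) -(IZ _ v1) -(IZ _ v0).
have iv0 : ci (-1) 1 (fun s => 'i * (1 / ((-1 +i* s) - 0) : C)) by exact: ciM (@ci_cst _ _ _ _) v0.
have iv1 : ci (-1) 1 (fun s => 'i * (1 / ((1 +i* s) - 0) : C)) by exact: ciM (@ci_cst _ _ _ _) v1.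
rewrite -(IN iv0) !cImD.
have nci' (f : R -> C) : ci (-1) 1 f -> ci (-1) 1 (fun s => - f s) by move=> hf s hs; exact: cvg_cN (hf s hs).
have A1 : 1 / 2 * (1 - -1) <= complex.Im (I (-1) 1 (fun s => 1 / ((s +i* -1) - 0) : C)).
  apply: I_ge h0 _ => // s /Q; rewrite subr0 mul1r /= => h; rewrite (le_trans h)//.
  by rewrite le_eqVlt; apply/orP; left; apply/eqP; field; nra.
have A2 : 1 / 2 * (1 - -1) <= complex.Im (I (-1) 1 (fun s => - (1 / ((s +i* 1) - 0)) : C)).
  apply: I_ge (nci' _ h1) _ => // s /Q; rewrite subr0 mul1r /= => h; rewrite (le_trans h)//.
  by rewrite le_eqVlt; apply/orP; left; apply/eqP; field; nra.
have A3 : 1 / 2 * (1 - -1) <= complex.Im (I (-1) 1 (fun s => 'i * (1 / ((1 +i* s) - 0)) : C)).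
  apply: I_ge iv1 _ => // s /Q; rewrite subr0 mul1r /= => h; rewrite (le_trans h)//.
  by rewrite le_eqVlt; apply/orP; left; apply/eqP; field; nra.
have A4 : 1 / 2 * (1 - -1) <= complex.Im (I (-1) 1 (fun s => - ('i * (1 / ((-1 +i* s) - 0))) : C)).
  apply: I_ge (nci' _ iv0) _ => // s /Q; rewrite subr0 mul1r /= => h; rewrite (le_trans h)//.
  by rewrite le_eqVlt; apply/orP; left; apply/eqP; field; nra.
by move: A1 A2 A3 A4; lra.
Qed.

Lemma cauchy_formula (x0 x1 y0 y1 : R) f z : inner x0 x1 y0 y1 z ->
  (forall w, rect x0 x1 y0 y1 w -> differentiable f w) ->
  J x0 x1 y0 y1 (fun w => f w / (w - z)) = f z * W0.
Proof. by move=> hz hf; rewrite cauchy_ratio// winding. Qed.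

End Cauchy.

(** * Taylor estimates, limits and integrals of holomorphic functions *)

Section Taylor.
Context {R : realType}.
Local Notation C := R[i].
Implicit Types (f : C -> C) (z a : C).

Definition sq a (r : R) z :=
  rect (complex.Re a - r) (complex.Re a + r) (complex.Im a - r) (complex.Im a + r) z.

Lemma sq_nc a (r : R) h : nc h <= r -> sq a r (a + h).
Proof.
move=> hr; rewrite /sq /rect cReD cImD !lerD2l -!ler_norml.
by rewrite (le_trans (Re_le_nc _) hr) (le_trans (Im_le_nc _) hr).
Qed.

Lemma nc_sq a (r : R) z : sq a r z -> nc (z - a) <= 2 * r.
Proof.
move=> /andP[/andP[h1 h2] /andP[h3 h4]].
rewrite (le_trans (nc_le_ReIm _))// mulr_natl mulr2n cReD cImD cReN cImN lerD// ler_norml; apply/andP; split; lra.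
Qed.

Lemma sqS a b (r s : R) z : nc (b - a) + s <= r -> sq b s z -> sq a r z.
Proof.
move=> h /andP[/andP[h1 h2] /andP[h3 h4]].
have := Re_le_nc (b - a); have := Im_le_nc (b - a).
rewrite cReD cImD cReN cImN !ler_norml => /andP[a1 a2] /andP[a3 a4].
by rewrite /sq /rect; apply/andP; split; apply/andP; split; lra.
Qed.

Lemma sq_center a (r : R) : 0 <= r -> sq a r a.
Proof. by move=> r0; have := @sq_nc a r 0; rewrite nc0 addr0; exact. Qed.

Lemma bd_sq_far a (r : R) w : 0 < r ->
  bd (complex.Re a - r) (complex.Re a + r) (complex.Im a - r) (complex.Im a + r) w -> r <= nc (w - a).
Proof.
move=> r0.
have E1 (u : R) : `|u - r - u| = r by rewrite addrAC subrr add0r normrN gtr0_norm.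
have E2 (u : R) : `|u + r - u| = r by rewrite addrAC subrr add0r gtr0_norm.
by move=> /andP[_ /or4P[] /eqP E]; apply: nc_far; rewrite E ?E1 ?E2 lexx ?orbT.
Qed.

(** The [32] is the product of the [4] of [J_bound], the half-perimeter [4 * r] and the factor
    [2 / r] bounding [1 / (w - (a + h))] on the contour in [taylor1]. *)
Definition KT : R := 32 / nc (@W0 R).

Lemma KT_gt0 : 0 < KT.
Proof. by rewrite divr_gt0// nc_gt0 W0_neq0. Qed.

(** All terms are Cauchy integrals over one square, with kernels that combine into
    [h ^+ 2 / ((w - a) ^+ 2 * (w - (a + h)))]. *)
Lemma taylor1 f a (r M : R) : 0 < r ->
  (forall z, sq a r z -> differentiable f z) -> (forall z, sq a r z -> nc (f z) <= M) ->
  exists l : C, nc l <= KT * M / r /\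
    forall h, nc h <= r / 2 -> nc (f (a + h) - f a - l * h) <= KT * M * nc h ^+ 2 / r ^+ 2.
Proof.
move=> r0 df fM.
pose x := complex.Re a; pose y := complex.Im a.
have xx : x - r <= x + r by lra.
have yy : y - r <= y + r by lra.
have Wp : 0 < nc (@W0 R) by rewrite nc_gt0 W0_neq0.
have M0 : 0 <= M by rewrite (le_trans (nc_ge0 (f a)))// fM// sq_center// ltW.
have fc w : sq a r w -> {for w, continuous f} by move=> /df; exact: diff_cont.
have far w : bd (x - r) (x + r) (y - r) (y + r) w -> r <= nc (w - a) by exact: bd_sq_far.
have bs w : bd (x - r) (x + r) (y - r) (y + r) w -> sq a r w by case/andP.
pose g w := f w / (w - a) ^+ 2.
have gc : re (x - r) (x + r) (y - r) (y + r) g.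
  move=> w hw; apply: (contM (fc w (bs w hw))).
  have cx : {for w, continuous (fun u : C => (u - a) ^+ 2)} by exact: contX (diff_cont (diff_subc a w)).
  apply: (contV cx).
  by rewrite expf_neq0// -nc_gt0 (lt_le_trans r0)// far.
exists (J (x - r) (x + r) (y - r) (y + r) g / W0); split.
  rewrite ncM ncV /KT.
  have -> : 32 / nc (@W0 R) * M / r = (32 * M / r) / nc (@W0 R) by ring.
  rewrite ler_pM2r ?invr_gt0//.
  rewrite (le_trans (J_bound xx yy gc (M := M / r ^+ 2) _))//.
    move=> w hw; rewrite ncM ncV ncX ler_pM ?invr_ge0 ?exprn_ge0 ?nc_ge0 ?fM ?bs//.
    by rewrite lef_pV2 ?posrE ?exprn_gt0 ?(lt_le_trans r0)// ?far// lerXn2r ?nnegrE ?nc_ge0 ?(ltW r0)// far.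
  have -> : 4 * (M / r ^+ 2) * (x + r - (x - r) + (y + r - (y - r))) = 16 * M / r.
    by field; rewrite gt_eqF.
  by rewrite ler_pM2r ?invr_gt0// ler_wpM2r//; lra.
move=> h hr.
have ha : inner (x - r) (x + r) (y - r) (y + r) a by exact: square_inner.
have hh : inner (x - r) (x + r) (y - r) (y + r) (a + h).
  have := Re_le_nc h; have := Im_le_nc h; rewrite !ler_norml => /andP[a1 a2] /andP[a3 a4].
  by rewrite /inner cReD cImD -/x -/y; split; lra.
have fr : rc (x - r) (x + r) (y - r) (y + r) f by move=> w; exact: fc.
have c1 := re_cauchy_kernel fr hh; have c2 := re_cauchy_kernel fr ha.
have c3 : re (x - r) (x + r) (y - r) (y + r) (fun w => h * g w) by exact: reM (@re_cst _ _ _ _ _ _) gc.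
have E : f (a + h) - f a - J (x - r) (x + r) (y - r) (y + r) g / W0 * h =
   J (x - r) (x + r) (y - r) (y + r) (fun w => f w / (w - (a + h)) - f w / (w - a) - h * g w) / W0.
  rewrite (JB xx yy (reB c1 c2) c3) (JB xx yy c1 c2) (JZ xx yy _ gc).
  rewrite (cauchy_formula hh df) (cauchy_formula ha df).
  by field; exact: W0_neq0.
rewrite E ncM ncV /KT.
have -> : 32 / nc (@W0 R) * M * nc h ^+ 2 / r ^+ 2 = (32 * M * nc h ^+ 2 / r ^+ 2) / nc (@W0 R) by ring.
rewrite ler_pM2r ?invr_gt0//.
rewrite (le_trans (J_bound xx yy (reB (reB c1 c2) c3) (M := M * (nc h ^+ 2 / (r ^+ 2 * (r / 2)))) _))//.
  move=> w hw.
  have w1 := far w hw.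
  have w2 : r / 2 <= nc (w - (a + h)).
    have := ncD (w - (a + h)) h; rewrite opprD addrA subrK; lra.
  have n1 : w - a != 0 by rewrite -nc_gt0; lra.
  have n2 : w - (a + h) != 0 by rewrite -nc_gt0; lra.
  have -> : f w / (w - (a + h)) - f w / (w - a) - h * g w =
     f w * (h ^+ 2 / ((w - a) ^+ 2 * (w - (a + h)))) by rewrite /g; field; rewrite n1 n2.
  rewrite ncM ler_pM ?nc_ge0 ?fM ?bs// ncM ncV ncM !ncX ler_wpM2l ?exprn_ge0 ?nc_ge0//.
  rewrite lef_pV2 ?posrE ?mulr_gt0 ?exprn_gt0 ?nc_gt0 ?divr_gt0//.
  rewrite ler_pM ?exprn_ge0 ?divr_ge0 ?(ltW r0)//.
  by rewrite lerXn2r ?nnegrE ?nc_ge0 ?(ltW r0).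
rewrite le_eqVlt; apply/orP; left; apply/eqP.
by field; rewrite gt_eqF.
Qed.

(* Differences in this form pass to limits and integrals, so that both inherit
   complex differentiability. *)
Definition divided_diff (G : C -> C) z (r B : R) := forall l m, nc l <= r -> nc m <= r ->
  nc (m * (G (z + l) - G z) - l * (G (z + m) - G z)) <= B * (nc l * nc m * (nc l + nc m)).

Lemma divided_diffP f a (r M : R) : 0 < r ->
  (forall z, sq a r z -> differentiable f z) -> (forall z, sq a r z -> nc (f z) <= M) ->
  divided_diff f a (r / 2) (KT * M / r ^+ 2).
Proof.
move=> r0 df fM l m hl hm; have [c [_ hc]] := taylor1 r0 df fM.
have -> : m * (f (a + l) - f a) - l * (f (a + m) - f a) =
   m * (f (a + l) - f a - c * l) - l * (f (a + m) - f a - c * m) by ring.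
rewrite (le_trans (ncB _ _))// !ncM.
have := hc l hl; have := hc m hm.
set u := nc (f _ - _ - _); set v := nc (f _ - _ - _) => hu hv.
have := ler_wpM2l (nc_ge0 m) hv; have := ler_wpM2l (nc_ge0 l) hu.
have -> : KT * M / r ^+ 2 * (nc l * nc m * (nc l + nc m)) =
   nc m * (KT * M * nc l ^+ 2 / r ^+ 2) + nc l * (KT * M * nc m ^+ 2 / r ^+ 2) by ring.
by lra.
Qed.

(** The hypothesis says that the difference quotients [q l] and [q m] are at distance at most
    [B * (nc l + nc m)]: they satisfy a Cauchy condition at [0] with an explicit rate. The limit is
    taken along positive reals and then compared with the quotients for all complex increments. *)
Lemma divided_diff_differentiable (G : C -> C) z (r B : R) : 0 < r -> 0 <= B ->
  divided_diff G z r B -> differentiable G z.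
Proof.
move=> r0 B0 h.
pose q (l : C) := (G (z + l) - G z) / l.
have hq l m : l != 0 -> m != 0 -> nc l <= r -> nc m <= r -> nc (q l - q m) <= B * (nc l + nc m).
  move=> l0 m0 lr mr; have := h l m lr mr.
  have -> : m * (G (z + l) - G z) - l * (G (z + m) - G z) = (q l - q m) * (l * m).
    by rewrite /q; field; rewrite l0 m0.
  rewrite !ncM.
  have -> : B * (nc l * nc m * (nc l + nc m)) = B * (nc l + nc m) * (nc l * nc m) by ring.
  by rewrite ler_pM2r// mulr_gt0 ?nc_gt0.
have lim (p : C -> R) : (forall u v, `|p u - p v| <= nc (u - v)) ->
    exists L : R, forall s : R, 0 < s -> s <= r -> `|p (q s%:C) - L| <= B * s.
  (* The limit is the supremum of the lower bounds [p (q s%:C) - B * s], each of which lies below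
     every upper bound [p (q t%:C) + B * t]. *)
  move=> hp; pose A := [set p (q s%:C) - B * s | s in [set s : R | 0 < s <= r]].
  have hA s t : 0 < s <= r -> 0 < t <= r -> p (q s%:C) - B * s <= p (q t%:C) + B * t.
    move=> /andP[s0 sr] /andP[t0 tr].
    have S : nc s%:C = s by rewrite ncR gtr0_norm.
    have T : nc t%:C = t by rewrite ncR gtr0_norm.
    have := hq s%:C t%:C; rewrite -!nc_gt0 S T => /(_ s0 t0 sr tr) /(le_trans (hp _ _)).
    by rewrite ler_norml => /andP[_]; lra.
  exists (sup A) => s s0 sr.
  have hs : 0 < s <= r by rewrite s0.
  rewrite ler_norml lerNl opprB lerBlDl lerBlDr; apply/andP; split.
    by apply: ge_sup => [|_ [t ht <-]]; [exists (p (q s%:C) - B * s); exists s|exact: hA].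
  rewrite -lerBlDl; apply: ub_le_sup; last by exists s.
  by exists (p (q s%:C) + B * s) => _ [t ht <-]; exact: hA.
have [|a ha] := lim (@complex.Re R); first by move=> u v; rewrite -cReN -cReD Re_le_nc.
have [|b hb] := lim (@complex.Im R); first by move=> u v; rewrite -cImN -cImD Im_le_nc.
pose c : C := a +i* b.
have hc l : l != 0 -> nc l <= r -> nc (q l - c) <= 4 * B * nc l.
  move=> l0 lr; have l1 : 0 < nc l by rewrite nc_gt0.
  have n0 : (nc l)%:C != 0 :> C by rewrite -nc_gt0 ncR gtr0_norm.
  have := ncD (q l - q (nc l)%:C) (q (nc l)%:C - c); rewrite addrA subrK.
  have := hq l (nc l)%:C l0 n0 lr; rewrite ncR gtr0_norm// => /(_ lr).
  have := nc_le_ReIm (q (nc l)%:C - c); rewrite !(cReD, cImD, cReN, cImN).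
  have := ha _ l1 lr; have := hb _ l1 lr => /=; lra.
suff [] : differentiable G z /\ 'd G z = (fun v : C => c * v) :> (C -> C) by [].
apply: (@eps_diff R C G z _ (nc c)).
- by move=> k u v; rewrite /GRing.scale /=; ring.
- by move=> v; rewrite ncM vn_nc.
move=> e e0; exists (Num.min r (e / (4 * B + 1))).
  by rewrite lt_min r0 divr_gt0//; lra.
move=> v; rewrite vn_nc le_min => /andP[vr ve].
have [->|v0] := eqVneq v 0; first by rewrite addr0 mulr0 subr0 subrr nc0 mulr0.
have -> : G (z + v) - G z - c * v = (q v - c) * v by rewrite /q; field.
rewrite ncM ler_wpM2r ?nc_ge0// (le_trans (hc v v0 vr))//.
move: ve; rewrite ler_pdivlMr; last by lra.
by have := nc_ge0 v; lra.
Qed.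

(** Good approximants are bounded by one constant near [z], so they satisfy [divided_diff] with one
    constant, and this inequality passes to the limit. No sequence is extracted: the approximant may
    change with [e]. *)
Lemma weierstrass (G : C -> C) z (r : R) : 0 < r ->
  (forall e : R, 0 < e -> exists f, (forall w, sq z r w -> differentiable f w) /\
     forall w, sq z r w -> nc (f w - G w) <= e) ->
  differentiable G z.
Proof.
move=> r0 H.
have [f [df fG]] := H 1 ltr01.
have zz : sq z r z by rewrite sq_center// ltW.
have [d d0 hd] := (nearC z _).1 ((contP f z).1 (diff_cont (df z zz)) 1 ltr01).
pose s := Num.min r (d / 2).
have s0 : 0 < s by rewrite lt_min r0 divr_gt0.
have [sr sd] : s <= r /\ s <= d / 2 by rewrite /s !ge_min !lexx orbT.
(* One unit for the variation of [f] on the smaller square and one for the distance from [f] to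
   [G]. *)
pose M := nc (f z) + 2.
have n0 := nc_ge0 (f z).
have ss w : sq z s w -> sq z r w by apply: sqS; rewrite subrr nc0 add0r.
have GM w : sq z s w -> nc (G w) <= M.
  move=> hw; have := fG w (ss w hw).
  have := hd (w - z); rewrite [z + _]addrC subrK.
  have := nc_sq hw => h1 /(_ _) h2; have {h2} := h2 ltac:(lra).
  have := ncD (f w - f z) (f z); rewrite subrK.
  have := ncD (G w - f w) (f w); rewrite subrK nc_dist /M; lra.
have KB : 0 <= KT * (M + 1) / s ^+ 2.
  by rewrite divr_ge0 ?exprn_ge0 ?(ltW s0)// mulr_ge0 ?(ltW KT_gt0)// /M; lra.
apply: (@divided_diff_differentiable G z (s / 2) (KT * (M + 1) / s ^+ 2)) => //; first by rewrite divr_gt0.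
move=> l m hl hm; apply/ler_addgt0Pl => e e0.
pose L := nc m + nc l + 1.
have L0 : 0 < L by rewrite /L; have := nc_ge0 m; have := nc_ge0 l; lra.
pose e' := Num.min 1 (e / (2 * L)).
have e'0 : 0 < e' by rewrite lt_min ltr01 divr_gt0// mulr_gt0.
have [e1 e2] : e' <= 1 /\ e' <= e / (2 * L) by rewrite /e' !ge_min !lexx orbT.
have [g [dg gG]] := H e' e'0.
have gM w : sq z s w -> nc (g w) <= M + 1.
  by move=> hw; have := ncD (g w - G w) (G w); rewrite subrK; have := gG w (ss w hw); have := GM w hw; lra.
have := divided_diffP s0 (fun w hw => dg w (ss w hw)) gM hl hm.
have zs (h : C) : nc h <= s / 2 -> nc (g (z + h) - G (z + h)) <= e'.
  by move=> hh; apply: gG; apply: sq_nc; lra.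
have := zs l hl; have := zs m hm; have := zs 0; rewrite nc0 addr0.
set u0 := g z - G z; set u1 := g (z + m) - _; set u2 := g (z + l) - _ => /(_ _) h0 h1 h2.
have {}h0 := h0 ltac:(lra).
set T := m * (g _ - g z) - _ => hT.
have -> : m * (G (z + l) - G z) - l * (G (z + m) - G z) = T - (m * (u2 - u0) - l * (u1 - u0)).
  by rewrite /T /u0 /u1 /u2; ring.
have i1 : nc (m * (u2 - u0)) <= nc m * (2 * e').
  by rewrite ncM ler_wpM2l ?nc_ge0//; have := ncB u2 u0; lra.
have i2 : nc (l * (u1 - u0)) <= nc l * (2 * e').
  by rewrite ncM ler_wpM2l ?nc_ge0//; have := ncB u1 u0; lra.
have i3 : (nc m + nc l) * (2 * e') <= e.
  rewrite (le_trans (y := L * (2 * e')))//.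
    by rewrite ler_wpM2r ?mulr_ge0 ?(ltW e'0)// /L; lra.
  by move: e2; rewrite ler_pdivlMr ?mulr_gt0//; lra.
have := ncB T (m * (u2 - u0) - l * (u1 - u0)); have := ncB (m * (u2 - u0)) (l * (u1 - u0)).
by lra.
Qed.

(** The inequality [divided_diff], uniform in [s], is integrated over [s]; the derivative of the
    integrand is never formed. *)
Lemma differentiable_integral (F : C -> R -> C) z (r M a b : R) : 0 < r -> a <= b ->
  (forall w s, sq z r w -> a <= s <= b -> differentiable (F^~ s) w /\ nc (F w s) <= M) ->
  (forall w, sq z r w -> ci a b (F w)) ->
  differentiable (fun w => I a b (F w)) z.
Proof.
move=> r0 ab H Hc.
have zz : sq z r z by rewrite sq_center// ltW.
have M0 : 0 <= M.
  have as' : a <= a <= b by rewrite lexx.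
  by case: (H z a zz as') => _; exact: le_trans (nc_ge0 _).
pose B := 2 * (KT * M / r ^+ 2) * (b - a).
have K0 : 0 <= KT * M / r ^+ 2 by rewrite divr_ge0 ?exprn_ge0 ?(ltW r0)// mulr_ge0// ltW// KT_gt0.
apply: (@divided_diff_differentiable _ z (r / 2) B).
- by rewrite divr_gt0.
- by rewrite mulr_ge0 ?subr_ge0// mulr_ge0.
move=> l m hl hm.
have cl : ci a b (F (z + l)) by apply: Hc; apply: sq_nc; lra.
have cm : ci a b (F (z + m)) by apply: Hc; apply: sq_nc; lra.
have cz := Hc z zz.
have dl := ciB cl cz; have dm := ciB cm cz.
rewrite -(IB cl cz) -(IB cm cz) -(IZ m dl) -(IZ l dm).
have el := ciM (@ci_cst R a b m) dl; have em := ciM (@ci_cst R a b l) dm.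
rewrite -(IB el em).
have -> : B * (nc l * nc m * (nc l + nc m)) =
  2 * (KT * M / r ^+ 2 * (nc l * nc m * (nc l + nc m))) * (b - a) by rewrite /B; ring.
apply: (I_bound ab (ciB el em)) => s hs.
by apply: (divided_diffP r0 (f := F^~ s)) => // w hw; case: (H w s hw hs).
Qed.

End Taylor.

(** * A weighted Cauchy operator *)

Section ComplexExponential.
Context {R : realType}.
Local Notation C := R[i].
Implicit Types (z u : C).

Definition cexp z : C := (expR (complex.Re z))%:C * (cos (complex.Im z) +i* sin (complex.Im z)).

Lemma cexp0 : cexp 0 = 1.
Proof. by rewrite /cexp /= expR0 cos0 sin0 mul1r. Qed.

Lemma cexpD z u : cexp (z + u) = cexp z * cexp u.
Proof.
rewrite /cexp cReD cImD expRD cosD sinD rmorphM /=.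
rewrite mulrACA; congr (_ * _); apply: complex_ext => /=; ring.
Qed.

Lemma nc_cexp z : nc (cexp z) = expR (complex.Re z).
Proof.
rewrite /cexp ncM ncR ger0_norm ?expR_ge0//.
suff -> : nc (cos (complex.Im z) +i* sin (complex.Im z)) = 1 by rewrite mulr1.
by apply/eqP; rewrite -(@eqrXn2 _ 2)// ?nc_ge0// nc_sqr /= cos2Dsin2 expr1n.
Qed.

Lemma cexp_neq0 z : cexp z != 0.
Proof. by rewrite -nc_gt0 nc_cexp expR_gt0. Qed.

Lemma is_derive0_eps (f : R -> R) (l : R) : is_derive (0 : R) 1 f l -> forall e : R, 0 < e ->
  \forall h \near (0 : R), `|f h - f 0 - l * h| <= e * `|h|.
Proof.
move=> [df dfl] e e0.
have : (h^-1 *: (f (h *: 1 + 0) - f 0)) @[h --> (0 : R)^'] --> l by rewrite -dfl; exact: df.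
move=> /cvgr_RP H; have := H _ e0 => H1.
have H2 : \forall h \near (0 : R), h != 0 -> `|h^-1 *: (f (h *: 1 + 0) - f 0) - l| <= e by exact: H1.
apply: filterS H2 => h hh.
have [->|h0] := eqVneq h 0; first by rewrite subrr mulr0 subr0 normr0 mulr0.
have := hh h0; rewrite /GRing.scale /= mulr1 addr0 => {}hh.
have -> : f h - f 0 - l * h = (h^-1 * (f h - f 0) - l) * h by field.
by rewrite normrM ler_wpM2r.
Qed.

Lemma cexp_diff0 : forall e : R, 0 < e ->
  exists2 d : R, 0 < d & forall h : C, nc h <= d -> nc (cexp h - 1 - h) <= e * nc h.
Proof.
(* The three error terms below add up to at most [6 * e' * nc h]. *)
move=> e e0; pose e' := Num.min 1 (e / 8).
have e'0 : 0 < e' by rewrite lt_min ltr01 divr_gt0.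
have [e1 e8] : e' <= 1 /\ e' <= e / 8 by rewrite /e' !ge_min !lexx orbT.
have hE := is_derive0_eps (is_derive_expR (0 : R)) e'0.
have hS := is_derive0_eps (is_derive_sin (0 : R)) e'0.
have hC := is_derive0_eps (is_derive_cos (0 : R)) e'0.
have /nbhs_ballP[d /= d0 hd] : nbhs (0 : R) (fun h : R => [/\ `|expR h - 1 - h| <= e' * `|h|,
    `|sin h - h| <= e' * `|h| & `|cos h - 1| <= e' * `|h|]).
  apply: filterS3 hE hS hC => h.
  move=> p1 p2 p3; split; [move: p1|move: p2|move: p3];
    by rewrite ?expR0 ?sin0 ?cos0 ?oppr0 ?mul0r ?mul1r ?subr0 ?addr0.
exists (Num.min (d / 2) (Num.min (1/2) (e' / 2))).
  by rewrite !lt_min !divr_gt0.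
move=> h; rewrite !le_min => /and3P[hd2 h2 he].
set x := complex.Re h; set y := complex.Im h.
have xh : `|x| <= nc h by exact: Re_le_nc.
have yh : `|y| <= nc h by exact: Im_le_nc.
have bx : ball (0 : R) d x by rewrite /ball /= sub0r normrN; lra.
have by' : ball (0 : R) d y by rewrite /ball /= sub0r normrN; lra.
have [ex _ _] := hd x bx; have [_ sy cy] := hd y by'.
have E : cexp h - 1 - h = (expR x)%:C * ((cos y - 1)%:C + 'i * (sin y - y)%:C)
   + (expR x - 1 - x)%:C + 'i * (y * (expR x - 1))%:C.
  by apply: complex_ext; rewrite /cexp !(cReD, cImD, cReN, cImN, cReM, cImM) /= -/x -/y; ring.
have nx := normr_ge0 x; have ny := normr_ge0 y.
have ex1 : `|expR x - 1| <= 2 * `|x|.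
  by have := ler_normD (expR x - 1 - x) x; rewrite subrK; nra.
have ex2 : expR x <= 2 by move: ex1; rewrite ler_norml => /andP[_]; lra.
have ex0 := expR_ge0 x.
have A1 : nc ((expR x)%:C * ((cos y - 1)%:C + 'i * (sin y - y)%:C)) <= 2 * (2 * (e' * `|y|)).
  rewrite ncM ncR ger0_norm// ler_pM ?nc_ge0//.
  by rewrite (le_trans (ncD _ _))// ncM nci mul1r !ncR; lra.
have A3 : nc ('i * (y * (expR x - 1))%:C) <= e' * nc h.
  rewrite ncM nci mul1r ncR normrM mulrC ler_pM//.
  by rewrite (le_trans ex1)//; lra.
rewrite E; set a := _ * _ in A1 *; set b := (_ - _)%:C; set c := _ * _ in A3 *.
have nb : nc b = `|expR x - 1 - x| by rewrite ncR.
have := ncD (a + b) c; have := ncD a b; rewrite nb.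
have nh := nc_ge0 h.
have t1 : e' * `|y| <= e' * nc h by rewrite ler_wpM2l// ltW.
have t2 : e' * `|x| <= e' * nc h by rewrite ler_wpM2l// ltW.
have t3 : e' * nc h <= e / 8 * nc h by rewrite ler_wpM2r.
have t4 : 0 <= e * nc h by rewrite mulr_ge0// ltW.
by lra.
Qed.

Lemma differentiable_cexp z : differentiable cexp z.
Proof.
suff [] : differentiable cexp z /\ 'd cexp z = (fun v : C => cexp z * v) :> (C -> C) by [].
apply: (@eps_diff R C cexp z _ (nc (cexp z))).
- by move=> k u v; rewrite /GRing.scale /=; ring.
- by move=> v; rewrite ncM vn_nc.
move=> e e0; have z0 : 0 < nc (cexp z) by rewrite nc_gt0 cexp_neq0.
have [d d0 hd] := cexp_diff0 (divr_gt0 e0 z0); exists d => // v; rewrite vn_nc => /hd hv.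
have -> : cexp (z + v) - cexp z - cexp z * v = cexp z * (cexp v - 1 - v) by rewrite cexpD; ring.
by rewrite ncM mulrC -ler_pdivlMr// mulrAC.
Qed.

Lemma cexp_cont z : {for z, continuous cexp}.
Proof. exact: diff_cont (differentiable_cexp z). Qed.

Lemma diff_comp1 (V : normedModType C) (f : V -> C) (g : C -> C) v :
  differentiable f v -> differentiable g (f v) -> differentiable (fun x => g (f x)) v.
Proof. by move=> hf hg; exact: differentiable_comp hf hg. Qed.

Lemma cont_RC0 (s : R) : {for s, continuous (fun t : R => t%:C : C)}.
Proof. by apply: cvg_RC; exact: cvg_id. Qed.

Lemma cexp_line_ci u (a b : R) : ci a b (fun s : R => cexp (s%:C * u)).
Proof.
move=> s _; apply: (@cont_comp _ C C (fun s : R => s%:C * u) cexp); last exact: cexp_cont.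
exact: (contM (@cont_RC0 s) (cont_cst u s)).
Qed.

(* The entire function [(cexp u - 1) / u]. *)
Definition phi u : C := I 0 1 (fun s : R => cexp (s%:C * u)).

Lemma phi0 : phi 0 = 1.
Proof.
rewrite /phi (@I_ext _ _ _ _ (fun=> 1)); first by rewrite I_cst ?subr0 ?mulr1.
by move=> s _; rewrite mulr0 cexp0.
Qed.

Lemma phiE u : u * phi u = cexp u - 1.
Proof.
rewrite /phi -IZ; last exact: cexp_line_ci.
set a := complex.Re u; set b := complex.Im u.
have FTC (f F : R -> R) : (forall s, is_derive s (1 : R) F (f s)) -> (forall s, {for s, continuous f}) ->
    \int[lebesgue_measure]_(s in `[0, 1]) f s = F 1 - F 0.
  move=> dF cf; rewrite /Rintegral (@continuous_FTC2 R f F 0 1 ltr01)//.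
  - by apply: continuous_in_subspaceT => s _; exact: cf.
  - split.
    + by move=> s _; case: (dF s).
    + apply: cvg_at_right_filter; apply: differentiable_continuous; apply/derivable1_diffP; by case: (dF 0).
    + apply: cvg_at_left_filter; apply: differentiable_continuous; apply/derivable1_diffP; by case: (dF 1).
  by move=> s _; rewrite derive1E; case: (dF s).
have cc := ciM (@ci_cst R 0 1 u) (@cexp_line_ci u 0 1).
have cc' s : {for s, continuous (fun s : R => u * cexp (s%:C * u))}.
  have ss : s <= s <= s by rewrite lexx.
  exact: (contM (cont_cst u s) (@cexp_line_ci u s s s ss)).
have cRe : forall s, {for s, continuous (fun s : R => complex.Re (u * cexp (s%:C * u)))} by move=> s; exact: cont_Re (cc' s).
have cIm : forall s, {for s, continuous (fun s : R => complex.Im (u * cexp (s%:C * u)))} by move=> s; exact: cont_Im (cc' s).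
have d1 (s : R) : is_derive s (1 : R) (fun s => expR (s * a) * cos (s * b)) (complex.Re (u * cexp (s%:C * u))).
  apply: is_derive_eq.
  by rewrite /cexp !(cReM, cImM) /= -/a -/b /GRing.scale /= !mul0r !subr0 !addr0; ring.
have d2 (s : R) : is_derive s (1 : R) (fun s => expR (s * a) * sin (s * b)) (complex.Im (u * cexp (s%:C * u))).
  apply: is_derive_eq.
  by rewrite /cexp !(cReM, cImM) /= -/a -/b /GRing.scale /= !mul0r !subr0 !addr0; ring.
apply: complex_ext => /=.
  rewrite (FTC _ _ d1 cRe) !mul0r !mul1r expR0 cos0 -/a -/b; ring.
rewrite (FTC _ _ d2 cIm) !mul0r !mul1r expR0 sin0 -/a -/b; ring.
Qed.

Lemma nc_phi u : nc (phi u) <= 2 * expR (nc u).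
Proof.
have := @I_bound R 0 1 (fun s : R => cexp (s%:C * u)) (expR (nc u)) ler01 (@cexp_line_ci u 0 1).
rewrite subr0 mulr1; apply => s /andP[s0 s1].
rewrite nc_cexp ler_expR (le_trans (ler_norm _))// (le_trans (Re_le_nc _))//.
by rewrite ncM ncR ger0_norm// ler_piMl// nc_ge0.
Qed.

Lemma differentiable_phi z : differentiable phi z.
Proof.
have ci' w : sq z 1 w -> ci 0 1 (fun s : R => cexp (s%:C * w)) by move=> _; exact: cexp_line_ci.
apply: (differentiable_integral ltr01 ler01 (M := expR (nc z + 2)) _ ci').
move=> w s hw /andP[s0 s1]; split.
  apply: (@diff_comp1 _ (fun w : C => s%:C * w) cexp); last exact: differentiable_cexp.
  exact: diffM' (diff_cst' _ _) (diff_id' _).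
rewrite nc_cexp ler_expR (le_trans (ler_norm _))// (le_trans (Re_le_nc _))//.
rewrite ncM ncR ger0_norm//.
have := nc_sq hw; have := ncD (w - z) z; rewrite subrK; have := nc_ge0 w; nra.
Qed.

(* The kernel [(cexp ((z - w) * c) - 1) / (w - z)], extended across [w = z]. *)
Definition kap (c z w : C) : C := - c * phi ((z - w) * c).

Lemma kapE c z w : (w - z) * kap c z w = cexp ((z - w) * c) - 1.
Proof. by rewrite -phiE /kap; ring. Qed.

(** Moving the centre of the twist from one cell to a neighbouring one costs a term without pole, of
    bounded size when [c - d] is bounded. *)
Lemma kap_cexpB c d z w : kap c z w - kap d z w = cexp ((z - w) * d) * kap (c - d) z w.
Proof.
have [->|wz] := eqVneq w z.
  by rewrite /kap !subrr !mul0r cexp0 phi0; ring.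
have wz0 : w - z != 0 by rewrite subr_eq0.
apply: (mulfI wz0); rewrite mulrBr !kapE mulrCA kapE mulrBr -cexpD.
have -> : (z - w) * d + (z - w) * (c - d) = (z - w) * c by ring.
by ring.
Qed.

Lemma differentiable_kap_l c w z : differentiable (fun z => kap c z w) z.
Proof.
apply: (diffM' (diff_cst' _ _)).
apply: (@diff_comp1 _ (fun z : C => (z - w) * c) phi); last exact: differentiable_phi.
exact: diffM' (diff_subc w z) (diff_cst' _ _).
Qed.

Lemma differentiable_kap_r c z w : differentiable (kap c z) w.
Proof.
apply: (diffM' (diff_cst' _ _)).
apply: (@diff_comp1 _ (fun w : C => (z - w) * c) phi); last exact: differentiable_phi.
exact: diffM' (diffB (diff_cst' z w) (diff_id' w)) (diff_cst' _ _).
Qed.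

Lemma kap_cont (V : topologicalType) (f g : V -> C) c v : {for v, continuous f} ->
  {for v, continuous g} -> {for v, continuous (fun x => kap c (f x) (g x))}.
Proof.
move=> hf hg.
suff h : {for v, continuous (fun x => phi ((f x - g x) * c))} by exact: (contM (cont_cst (- c) v) h).
apply: (@cont_comp _ C C (fun x => (f x - g x) * c) phi).
  exact: contM (contB hf hg) (cont_cst c v).
exact: diff_cont (differentiable_phi _).
Qed.

Lemma nc_kap c z w : nc (kap c z w) <= nc c * (2 * expR (nc (z - w) * nc c)).
Proof. by rewrite /kap ncM ncN ler_wpM2l ?nc_ge0// -ncM nc_phi. Qed.

End ComplexExponential.

(** * Contour integrals depending on a parameter *)

Section KernelRegularity.
Context {R : realType}.
Local Notation C := R[i].

(** The tube lemma: compactness of the segment makes the neighbourhood of [p0] independent of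
    [s]. *)
Lemma segment_near (P : topologicalType) (p0 : P) (a b : R) (F : R -> P -> C) (e : R) : 0 < e ->
  (forall s, a <= s <= b -> {for (s, p0), continuous (fun q => F q.1 q.2)}) ->
  \forall p \near p0, forall s, a <= s <= b -> nc (F s p - F s p0) <= e.
Proof.
move=> e0 hF.
have K := (compact_near_coveringP _).1 (@segment_compact R a b).
have := @K P (nbhs p0) (fun p s => nc (F s p - F s p0) <= e) _ _.
move=> H; have : \forall p \near p0, `[a, b] `<=` (fun s => nc (F s p - F s p0) <= e).
  apply: H => s; rewrite /= in_itv /= => hs.
  have e2 : 0 < e / 2 by rewrite divr_gt0.
  have h1 := (contP _ _).1 (hF s hs) _ e2.
  case: h1 => -[A B] /= [nA nB] hAB.
  exists (A, B) => // -[s' p] /= [As Bp].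
  have u1 := hAB (s', p) (conj As Bp).
  have u2 := hAB (s', p0) (conj As (nbhs_singleton nB)).
  have := ncB (F s' p - F s p0) (F s' p0 - F s p0); rewrite opprB addrA subrK.
  by move: u1 u2 => /=; lra.
apply: filterS => p hp s hs; apply: hp; rewrite /= in_itv /=; exact: hs.
Qed.

Lemma cont_section1 (P : topologicalType) (F : R -> P -> C) s p :
  {for (s, p), continuous (fun q => F q.1 q.2)} -> {for s, continuous (F^~ p)}.
Proof.
move=> h; exact: (@cont_comp _ _ _ (fun s => (s, p)) (fun q => F q.1 q.2) s (cont_pair (cont_id s) (cont_cstW p s)) h).
Qed.

Lemma I_param_cont (P : topologicalType) (p0 : P) (a b : R) (F : R -> P -> C) : a <= b ->
  (\forall p \near p0, forall s, a <= s <= b -> {for (s, p), continuous (fun q => F q.1 q.2)}) ->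
  {for p0, continuous (fun p => I a b (F^~ p))}.
Proof.
move=> ab h; apply/contP => e e0.
pose e' := e / (2 * (b - a) + 1).
have d0 : 0 < 2 * (b - a) + 1 by lra.
have e'0 : 0 < e' by rewrite divr_gt0.
have h0 := nbhs_singleton h.
have c0 : ci a b (F^~ p0) by move=> s hs; exact: cont_section1 (h0 s hs).
have := segment_near e'0 h0.
apply: filterS2 h => p hp hn.
have c1 : ci a b (F^~ p) by move=> s hs; exact: cont_section1 (hp s hs).
rewrite -(IB c1 c0) (le_trans (I_bound ab (ciB c1 c0) hn))//.
have : e' * (2 * (b - a) + 1) = e by rewrite /e' divfK// gt_eqF.
by lra.
Qed.

Lemma compact_bounded_ci (a b : R) (f : R -> C) : ci a b f ->
  exists M : R, forall s, a <= s <= b -> nc (f s) <= M.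
Proof.
move=> hf.
have K := (compact_near_coveringP _).1 (@segment_compact R a b).
have := @K nat \oo (fun n s => nc (f s) <= n%:R) _ _.
move=> H; have : \forall n \near \oo, `[a, b] `<=` (fun s => nc (f s) <= n%:R).
  apply: H => s; rewrite /= in_itv /= => hs.
  have h1 := (contP _ _).1 (hf s hs) _ ltr01.
  near=> s' n => /=.
  have : nc (f s' - f s) <= 1 by near: s'.
  have : nc (f s) + 1 <= n%:R by near: n; exact: nbhs_infty_ger.
  have := ncD (f s' - f s) (f s); rewrite subrK; lra.
move=> [n _ /(_ n (leqnn n)) hn]; exists n%:R => s hs; apply: hn; rewrite /= in_itv /=; exact: hs.
Unshelve. all: by end_near. Qed.

(** [differentiable_integral] asks for a bound valid for all nearby parameters; it follows from
    boundedness on the compact segment at [u0] and from [segment_near]. *)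
Lemma I_param_diff (u0 : C) (a b : R) (F : R -> C -> C) : a <= b ->
  (\forall u \near u0, forall s, a <= s <= b ->
     {for (s, u), continuous (fun q => F q.1 q.2)} /\ differentiable (F s) u) ->
  differentiable (fun u => I a b (F^~ u)) u0.
Proof.
move=> ab h; have h0 := nbhs_singleton h.
have c0 : ci a b (F^~ u0) by move=> s hs; exact: cont_section1 (h0 s hs).1.
have [M hM] := compact_bounded_ci c0.
have hn := segment_near ltr01 (fun s hs => (h0 s hs).1).
have hh : \forall u \near u0, forall s, a <= s <= b ->
    [/\ {for (s, u), continuous (fun q => F q.1 q.2)}, differentiable (F s) u & nc (F s u) <= M + 1].
  apply: filterS2 h hn => u hu1 hu2 s hs; case: (hu1 s hs) => c1 c2; split => //.
  have := ncD (F s u - F s u0) (F s u0); rewrite subrK.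
  by have := hu2 s hs; have := hM s hs; lra.
have [d d0 hd] := (nearC _ _).1 hh.
have d2 : 0 < d / 2 by rewrite divr_gt0.
have hw w : sq u0 (d / 2) w -> forall s, a <= s <= b ->
    [/\ {for (s, w), continuous (fun q => F q.1 q.2)}, differentiable (F s) w & nc (F s w) <= M + 1].
  by move=> /nc_sq hw; have := hd (w - u0); rewrite [u0 + _]addrC subrK; apply; lra.
have H1 w s : sq u0 (d / 2) w -> a <= s <= b -> differentiable (F s) w /\ nc (F s w) <= M + 1.
  by move=> /hw k /k [_ k1 k2]; split; [exact: k1|exact: k2].
have H2 w : sq u0 (d / 2) w -> ci a b (fun s => F s w).
  by move=> /hw k s /k [k1 _ _]; exact: cont_section1 k1.
exact: (differentiable_integral d2 ab H1 H2).
Qed.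

Section Contours.
Variables (x0 x1 y0 y1 : R).
Hypotheses (x01 : x0 <= x1) (y01 : y0 <= y1).

Let X0 : x0 <= x0 <= x1. Proof. by rewrite lexx. Qed.
Let X1 : x0 <= x1 <= x1. Proof. by rewrite lexx x01. Qed.
Let Y0 : y0 <= y0 <= y1. Proof. by rewrite lexx. Qed.
Let Y1 : y0 <= y1 <= y1. Proof. by rewrite lexx y01. Qed.

Let B0 s : x0 <= s <= x1 -> bd x0 x1 y0 y1 (s +i* y0).
Proof. by move=> hs; rewrite /bd /rect /= hs Y0 eqxx ?orbT. Qed.
Let B1 s : x0 <= s <= x1 -> bd x0 x1 y0 y1 (s +i* y1).
Proof. by move=> hs; rewrite /bd /rect /= hs Y1 eqxx ?orbT. Qed.
Let C0 s : y0 <= s <= y1 -> bd x0 x1 y0 y1 (x0 +i* s).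
Proof. by move=> hs; rewrite /bd /rect /= hs X0 eqxx ?orbT. Qed.
Let C1 s : y0 <= s <= y1 -> bd x0 x1 y0 y1 (x1 +i* s).
Proof. by move=> hs; rewrite /bd /rect /= hs X1 eqxx ?orbT. Qed.

Lemma J_param_cont (P : topologicalType) (p0 : P) (F : C -> P -> C) :
  (\forall p \near p0, forall w, bd x0 x1 y0 y1 w -> {for (w, p), continuous (fun q => F q.1 q.2)}) ->
  {for p0, continuous (fun p => J x0 x1 y0 y1 (F^~ p))}.
Proof.
move=> h.
have E (a b : R) (g : R -> C) : a <= b -> (forall s, {for s, continuous g}) ->
    (forall s, a <= s <= b -> bd x0 x1 y0 y1 (g s)) ->
    {for p0, continuous (fun p => I a b (fun s => F (g s) p))}.
  move=> ab gc gb; apply: (@I_param_cont P p0 a b (fun s p => F (g s) p) ab).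
  apply: filterS h => p hp s hs.
  apply: (@cont_comp _ _ _ (fun q : R * P => (g q.1, q.2)) (fun q => F q.1 q.2) (s, p) _ (hp _ (gb s hs))).
  exact: (cont_pair (cont_comp (cont_fst (s, p)) (gc s)) (cont_snd (s, p))).
have h0 : {for p0, continuous (fun p => I x0 x1 (fun s => F (s +i* y0) p))}.
  exact: (E x0 x1 (fun s => s +i* y0) x01 (fun s => @cvg_hline R _ s) B0).
have h1 : {for p0, continuous (fun p => I x0 x1 (fun s => F (s +i* y1) p))}.
  exact: (E x0 x1 (fun s => s +i* y1) x01 (fun s => @cvg_hline R _ s) B1).
have v0 : {for p0, continuous (fun p => I y0 y1 (fun s => F (x0 +i* s) p))}.
  exact: (E y0 y1 (fun s => x0 +i* s) y01 (fun s => @cvg_vline R _ s) C0).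
have v1 : {for p0, continuous (fun p => I y0 y1 (fun s => F (x1 +i* s) p))}.
  exact: (E y0 y1 (fun s => x1 +i* s) y01 (fun s => @cvg_vline R _ s) C1).
exact: (contB (contB (contD h0 (contM (cont_cst 'i p0) v1)) h1) (contM (cont_cst 'i p0) v0)).
Qed.

Lemma J_param_diff (u0 : C) (F : C -> C -> C) :
  (\forall u \near u0, forall w, bd x0 x1 y0 y1 w ->
    {for (w, u), continuous (fun q => F q.1 q.2)} /\ differentiable (F w) u) ->
  differentiable (fun u => J x0 x1 y0 y1 (F^~ u)) u0.
Proof.
move=> h.
have E (a b : R) (g : R -> C) : a <= b -> (forall s, {for s, continuous g}) ->
    (forall s, a <= s <= b -> bd x0 x1 y0 y1 (g s)) ->
    differentiable (fun p => I a b (fun s => F (g s) p)) u0.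
  move=> ab gc gb; apply: (@I_param_diff u0 a b (fun s p => F (g s) p) ab).
  apply: filterS h => p hp s hs; case: (hp _ (gb s hs)) => k1 k2; split; last exact: k2.
  apply: (@cont_comp _ _ _ (fun q : R * C => (g q.1, q.2)) (fun q => F q.1 q.2) (s, p) _ k1).
  exact: (cont_pair (cont_comp (cont_fst (s, p)) (gc s)) (cont_snd (s, p))).
have h0 : differentiable (fun p => I x0 x1 (fun s => F (s +i* y0) p)) u0.
  exact: (E x0 x1 (fun s => s +i* y0) x01 (fun s => @cvg_hline R _ s) B0).
have h1 : differentiable (fun p => I x0 x1 (fun s => F (s +i* y1) p)) u0.
  exact: (E x0 x1 (fun s => s +i* y1) x01 (fun s => @cvg_hline R _ s) B1).
have v0 : differentiable (fun p => I y0 y1 (fun s => F (x0 +i* s) p)) u0.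
  exact: (E y0 y1 (fun s => x0 +i* s) y01 (fun s => @cvg_vline R _ s) C0).
have v1 : differentiable (fun p => I y0 y1 (fun s => F (x1 +i* s) p)) u0.
  exact: (E y0 y1 (fun s => x1 +i* s) y01 (fun s => @cvg_vline R _ s) C1).
exact: (diffB (diffB (diffD h0 (diffM' (diff_cst' 'i u0) v1)) h1) (diffM' (diff_cst' 'i u0) v0)).
Qed.

End Contours.
End KernelRegularity.

(** * Sums over the cells of a grid *)

Section GridSums.
Context {R : realType}.
Local Notation C := R[i].

Lemma J_degenerate_x (x y0 y1 : R) (f : C -> C) : J x x y0 y1 f = 0.
Proof.
have Z (h : R -> C) : I x x h = 0.
  apply: complex_ext; rewrite /= set_itv1; exact: Rintegral_set1.
by rewrite /J !Z; ring.
Qed.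

Lemma J_degenerate_y (x0 x1 y : R) (f : C -> C) : J x0 x1 y y f = 0.
Proof.
have Z (h : R -> C) : I y y h = 0.
  apply: complex_ext; rewrite /= set_itv1; exact: Rintegral_set1.
by rewrite /J !Z; ring.
Qed.

Variables (g : nat -> R).
Hypothesis (gm : {homo g : i j / (i <= j)%N >-> i <= j}).

Lemma J_grid (a b c d : nat) (f : C -> C) : (a <= b)%N -> (c <= d)%N ->
  rc (g a) (g b) (g c) (g d) f ->
  J (g a) (g b) (g c) (g d) f =
  \sum_(a <= i < b) \sum_(c <= j < d) J (g i) (g i.+1) (g j) (g j.+1) f.
Proof.
move=> ab cd hf.
have col i : (a <= i)%N -> (i < b)%N ->
    J (g i) (g i.+1) (g c) (g d) f = \sum_(c <= j < d) J (g i) (g i.+1) (g j) (g j.+1) f.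
  move=> ai ib; have {}hf : rc (g i) (g i.+1) (g c) (g d) f by apply: rcS hf => //; exact: gm.
  elim: d cd hf => [|d ih] cd hf.
    by move: cd; rewrite leqn0 => /eqP ->; rewrite big_geq// J_degenerate_y.
  move: cd; rewrite leq_eqVlt => /orP[/eqP <-|]; first by rewrite big_geq// J_degenerate_y.
  rewrite ltnS => cd; rewrite big_nat_recr//= -ih//; last first.
    by apply: rcS hf => //; exact: gm.
  rewrite (@J_splity _ (g i) (g i.+1) (g c) (g d.+1) _ (g d))//; first exact: gm.
  by apply/andP; split; exact: gm.
elim: b ab hf col => [|b ih] ab hf col.
  by move: ab; rewrite leqn0 => /eqP ->; rewrite big_geq// J_degenerate_x.
move: ab; rewrite leq_eqVlt => /orP[/eqP <-|]; first by rewrite big_geq// J_degenerate_x.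
rewrite ltnS => ab; rewrite big_nat_recr//= -ih//; last first.
- by move=> i ai ib; apply: col => //; exact: ltnW.
- by apply: rcS hf => //; exact: gm.
rewrite -col// (@J_splitx _ (g a) (g b.+1) (g c) (g d) _ (g b))//; first exact: gm.
by apply/andP; split; exact: gm.
Qed.

Lemma sum_window (V : nmodType) (n a b : nat) (F : nat -> V) : (a <= b)%N -> (b <= n)%N ->
  (forall i, ~~ (a <= i < b)%N -> F i = 0) -> \sum_(0 <= i < n) F i = \sum_(a <= i < b) F i.
Proof.
move=> ab bn h.
rewrite (big_cat_nat (n := a))//=; last exact: leq_trans bn.
rewrite (big_cat_nat (n := b) (m := a))//= [X in X + _]big1_seq ?add0r; last first.
  by move=> i; rewrite mem_index_iota => /andP[_ /andP[_ ia]]; apply: h; rewrite negb_and -ltnNge ia.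
rewrite [X in _ + X]big1_seq ?addr0// => i; rewrite mem_index_iota => /andP[_ /andP[bi _]].
by apply: h; rewrite negb_and -leqNgt bi orbT.
Qed.

(** Two geometric series, with sums at most [2] from [p] on and [1] before [p]. That the bound is
    free of [n] is what makes the operator uniform in the size of the grid. *)
Lemma sum_pow2_dist (n p : nat) : \sum_(0 <= i < n) (1 / 2 : R) ^+ `|i - p|%N <= 3.
Proof.
have H1 m : \sum_(0 <= i < m) (1 / 2 : R) ^+ i = 2 - 2 * (1 / 2) ^+ m.
  elim: m => [|m ih]; first by rewrite big_geq// expr0; ring.
  by rewrite big_nat_recr//= ih exprS; field.
have pos m : 0 <= (1 / 2 : R) ^+ m by rewrite exprn_ge0// divr_ge0.
have H2 q : \sum_(0 <= i < q) (1 / 2 : R) ^+ (q - i) <= 1.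
  elim: q => [|q ih]; first by rewrite big_geq.
  rewrite big_nat_recr//= subSnn expr1.
  rewrite (eq_big_nat _ _ (F2 := fun i => 1 / 2 * (1 / 2 : R) ^+ (q - i))); last first.
    by move=> i /andP[_ iq]; rewrite subSn ?exprS// ltnW.
  by rewrite -mulr_sumr; lra.
have [np|pn] := leqP n p.
  apply: (@le_trans _ _ 1) => //; last by lra.
  apply: le_trans (H2 p); rewrite (big_cat_nat (n := n) (p := p))//=.
  rewrite [X in X <= _](_ : _ = \sum_(0 <= i < n) (1 / 2 : R) ^+ (p - i)); last first.
    by apply: eq_big_nat => i /andP[_ ni]; rewrite distnEr// (leq_trans _ np)// ltnW.
  by rewrite lerDl sumr_ge0.
rewrite (big_cat_nat (n := p))//=; last exact: ltnW.
have -> : \sum_(0 <= i < p) (1 / 2 : R) ^+ `|i - p|%N = \sum_(0 <= i < p) (1 / 2 : R) ^+ (p - i).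
  by apply: eq_big_nat => i /andP[_ ip]; rewrite distnEr// ltnW.
have -> : \sum_(p <= i < n) (1 / 2 : R) ^+ `|i - p|%N = \sum_(0 <= i < n - p) (1 / 2 : R) ^+ i.
  rewrite -{1}[p]add0n big_addn; apply: eq_big_nat => i _.
  by rewrite distnEl ?leq_addl// addnK.
by have := H2 p; rewrite H1; have := pos (n - p)%N; lra.
Qed.

End GridSums.

(** * The weighted Cauchy operator in one variable *)

Section ModelOperator.
Context {R : realType}.
Local Notation C := R[i].
Implicit Types (v : C -> C) (z w : C).
Variable N : nat.

Definition gp (i : nat) : R := i%:R - N%:R.

Lemma gpS i : gp i.+1 = gp i + 1.
Proof. by rewrite /gp -addn1 natrD; ring. Qed.

Lemma gp_le : {homo gp : i j / (i <= j)%N >-> i <= j}.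
Proof. by move=> i j ij; rewrite /gp lerD2r ler_nat. Qed.

Lemma gp0 : gp 0 = - N%:R. Proof. by rewrite /gp; ring. Qed.
Lemma gp2N : gp (N + N) = N%:R. Proof. by rewrite /gp natrD; ring. Qed.

Definition ctr (i j : nat) : C := (gp i + 1 / 2) +i* (gp j + 1 / 2).

(* Adding the two terms over the unit cell centred at [c = ctr i j] turns the Cauchy kernel into
   [cexp ((z - w) * d) / (w - z)], [d] being the conjugate of [c], while keeping a holomorphic function of [z]. For the weight
   [expR (- nc w ^+ 2 / 2)] this kernel decays like [expR (- nc (z - c) ^+ 2 / 2)], so that the
   bounds do not depend on the size [N] of the grid. *)
Definition Qop v z : C := (J (gp 0) (gp (N + N)) (gp 0) (gp (N + N)) (fun w => v w / (w - z)) +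
  \sum_(0 <= i < N + N) \sum_(0 <= j < N + N)
     J (gp i) (gp i.+1) (gp j) (gp j.+1) (fun w => v w * kap (ctr i j)^* z w)) / W0.

(** Completing the square. An error of Gaussian size at [w], multiplied by the twist, is measured at
    [z] by the Gaussian weight times a decay in the distance from [z] to the centre [c], at the
    price of a factor that is bounded as long as [w] stays near [c]. *)
Lemma gauss_identity c z w :
  expR (nc w ^+ 2 / 2) * nc (cexp ((z - w) * c^*)) =
  expR (nc z ^+ 2 / 2) * expR (- (nc (z - c) ^+ 2 / 2)) * expR (nc (w - c) ^+ 2 / 2).
Proof.
rewrite nc_cexp -!expRD; congr expR.
rewrite !nc_sqr !(cReD, cImD, cReN, cImN, cReM, cImM).
have -> : complex.Re c^* = complex.Re c by case: c.
have -> : complex.Im c^* = - complex.Im c by case: c.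
by field.
Qed.

Lemma expR1_ge2 : 2 <= expR 1 :> R.
Proof. by have := expR_ge1Dx (1 : R); lra. Qed.

(** Geometric decay is enough and is summable over cells; it follows from
    [x ^+ 2 / 2 >= |x| - 1 / 2]. The half is the distance from a centre to the border of its
    cell. *)
Lemma gauss_decay (x : R) (n : nat) : n%:R - 1 / 2 <= `|x| -> expR (- (x ^+ 2 / 2)) <= 2 * (1 / 2) ^+ n.
Proof.
move=> h; case: n h => [|n] h.
  rewrite expr0 mulr1 (@le_trans _ _ 1)//; last by lra.
  by rewrite -[leRHS]expR0 ler_expR; have := sqr_ge0 x; lra.
have -> : 2 * (1 / 2 : R) ^+ n.+1 = (1 / 2) ^+ n by rewrite exprS; field.
have : expR (n%:R : R) <= expR (x ^+ 2 / 2).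
  rewrite ler_expR -(real_normK (num_real x)).
  have : `|x| - 1 / 2 <= `|x| ^+ 2 / 2 by have := sqr_ge0 (`|x| - 1); lra.
  by move: h; rewrite -addn1 natrD; lra.
have : (2 : R) ^+ n <= expR n%:R.
  rewrite -[n%:R]mulr1 expRM_natl; apply: lerXn2r; rewrite ?nnegrE ?expR_ge0//.
  exact: expR1_ge2.
move=> h1 h2; rewrite expRN div1r exprVn.
by rewrite lef_pV2 ?posrE ?expR_gt0 ?exprn_gt0// (le_trans h1).
Qed.

Lemma J_cell_bound i j (f : C -> C) (M : R) : re (gp i) (gp i.+1) (gp j) (gp j.+1) f ->
  (forall w, bd (gp i) (gp i.+1) (gp j) (gp j.+1) w -> nc (f w) <= M) ->
  nc (J (gp i) (gp i.+1) (gp j) (gp j.+1) f) <= 8 * M.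
Proof.
move=> hf hM; have gi k : gp k <= gp k.+1 by exact: gp_le.
have := J_bound (gi i) (gi j) hf hM; rewrite !gpS.
by have -> : 4 * M * (gp i + 1 - gp i + (gp j + 1 - gp j)) = 8 * M by ring.
Qed.

Lemma cell_dist (x : R) (p i : nat) : gp p <= x -> x <= gp p + 1 ->
  `|i - p|%N%:R - 1 / 2 <= `|x - (gp i + 1 / 2)|.
Proof.
rewrite /gp ler_normr => h1 h2; apply/orP; have [ip|pi] := leqP i p.
  by left; rewrite distnEr// natrB//; lra.
by right; rewrite distnEl ?(ltnW pi)// natrB ?(ltnW pi)//; lra.
Qed.

Let E8 : R := expR 8.
Let E4 : R := expR (9 / 2).

(** [E4] bounds the factor of [gauss_identity] up to distance [3] from the centre, and [E8] the
    exponential in [nc_kap] for [nc (z - w) <= 4] and centres at distance at most [2]. The [9] is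
    the square of the bound of [sum_pow2_dist], the [24] comes from [J_bound] on a square of side
    [3], and the last [1] accounts for the distance from [v] to its approximant at [z]. *)
Definition KQ : R := (9 * (128 * (E4 * E8)) + 24 * E4) / nc (@W0 R) + 1.

Lemma E8_ge1 : 1 <= E8.
Proof. by rewrite /E8 -[leLHS]expR0 ler_expR. Qed.

Lemma E4_ge1 : 1 <= E4.
Proof. by rewrite /E4 -[leLHS]expR0 ler_expR divr_ge0. Qed.

Lemma KQ_ge0 : 0 <= KQ.
Proof.
have e8 : 0 <= E8 by exact: expR_ge0.
have e4 : 0 <= E4 by exact: expR_ge0.
apply: addr_ge0; last exact: ler01.
apply: divr_ge0; last exact: nc_ge0.
by apply: addr_ge0; rewrite !mulr_ge0.
Qed.

Section Closeness.
Variables (v : C -> C) (eta : R) (z : C).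
Hypothesis (eta0 : 0 <= eta).
Let sqN w := rect (- N%:R) N%:R (- N%:R) N%:R w.
Hypothesis vc : rc (gp 0) (gp (N + N)) (gp 0) (gp (N + N)) v.
Hypothesis zN : `|complex.Re z| <= N%:R - 2 /\ `|complex.Im z| <= N%:R - 2.
Hypothesis approx : forall a, sqN a -> exists h : C -> C,
  (forall w, nc (w - a) < 5 -> differentiable h w) /\
  (forall w, nc (w - a) < 5 -> sqN w -> nc (v w - h w) <= eta * expR (nc w ^+ 2 / 2)).

Let p := Num.truncn (complex.Re z + N%:R).
Let q := Num.truncn (complex.Im z + N%:R).

Let cellp (x : R) : `|x| <= N%:R - 2 -> let m := Num.truncn (x + N%:R) in
  [/\ gp m <= x, x <= gp m + 1, (2 <= m)%N & (m + 2 <= N + N)%N].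
Proof.
rewrite ler_norml => /andP[x1 x2] m.
have x0 : 0 <= x + N%:R by lra.
have /andP[t1 t2] := truncn_itv x0; rewrite -/m in t1 t2.
split.
- by rewrite /gp; lra.
- by move: t2; rewrite -addn1 natrD /gp; lra.
- have : (2%:R : R) < m.+1%:R by apply: le_lt_trans t2; lra.
  by rewrite ltr_nat.
- have : (m + 2)%:R <= (N + N)%:R :> R by rewrite !natrD; lra.
  by rewrite ler_nat.
Qed.

Let hp : [/\ gp p <= complex.Re z, complex.Re z <= gp p + 1, (2 <= p)%N & (p + 2 <= N + N)%N].
Proof. by apply: cellp; case: zN. Qed.
Let hq : [/\ gp q <= complex.Im z, complex.Im z <= gp q + 1, (2 <= q)%N & (q + 2 <= N + N)%N].
Proof. by apply: cellp; case: zN. Qed.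

(** The block of nine cells around the one that contains [z]. The margin [2] in [zN] makes it fit in
    the grid. *)
Let inB i j := (p.-1 <= i < p.+2)%N && (q.-1 <= j < q.+2)%N.

Let T i j := J (gp i) (gp i.+1) (gp j) (gp j.+1) (fun w => v w * (kr 1 z w + kap (ctr i j)^* z w)).

Let Ez := expR (nc z ^+ 2 / 2).

Let gN i : (i <= N + N)%N -> - N%:R <= gp i <= N%:R.
Proof. by move=> iN; rewrite -gp0 -gp2N; apply/andP; split; exact: gp_le. Qed.

Let rc_cell (f : C -> C) i j : (i < N + N)%N -> (j < N + N)%N ->
  rc (gp 0) (gp (N + N)) (gp 0) (gp (N + N)) f -> rc (gp i) (gp i.+1) (gp j) (gp j.+1) f.
Proof. by move=> iN jN hf; apply: rcS hf; exact: gp_le. Qed.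

Let cell_ctr i j w : rect (gp i) (gp i.+1) (gp j) (gp j.+1) w ->
  `|complex.Re w - (gp i + 1/2)| <= 1/2 /\ `|complex.Im w - (gp j + 1/2)| <= 1/2.
Proof.
rewrite !gpS => /andP[/andP[w1 w2] /andP[w3 w4]]; rewrite !ler_norml.
by split; apply/andP; split; lra.
Qed.

Let cell_nc i j w : rect (gp i) (gp i.+1) (gp j) (gp j.+1) w -> nc (w - ctr i j) <= 1.
Proof.
move=> /cell_ctr[h1 h2]; rewrite (le_trans (nc_le_ReIm _))//.
by rewrite cReD cImD cReN cImN /=; lra.
Qed.

Let cell_sqN i j w : (i < N + N)%N -> (j < N + N)%N ->
  rect (gp i) (gp i.+1) (gp j) (gp j.+1) w -> sqN w.
Proof.
move=> iN jN /andP[/andP[w1 w2] /andP[w3 w4]].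
have /andP[a1 a2] := gN (ltnW iN); have /andP[b1 b2] := gN iN.
have /andP[c1 c2] := gN (ltnW jN); have /andP[d1 d2] := gN jN.
by rewrite /sqN /rect; apply/andP; split; apply/andP; split; lra.
Qed.

Let kr_rc x0 x1 y0 y1 : rc x0 x1 y0 y1 (kr 1 z).
Proof. by move=> w _; exact: kr_cont. Qed.

Let kap_rc c x0 x1 y0 y1 : rc x0 x1 y0 y1 (kap c z).
Proof. by move=> w _; exact: diff_cont (differentiable_kap_r c z w). Qed.

Let outer_far w : bd (gp 0) (gp (N + N)) (gp 0) (gp (N + N)) w -> 1 <= nc (w - z).
Proof.
case: zN => z1 z2; move: z1 z2; rewrite !ler_norml => /andP[z1 z2] /andP[z3 z4].
move=> /andP[_ /or4P[] /eqP E]; apply: nc_far; rewrite E ?gp0 ?gp2N; apply/orP;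
  [left|left|right|right]; rewrite ler_normr; apply/orP; [right|left|right|left]; lra.
Qed.

(** Regularising the Cauchy kernel at distance [1] does not change it on the outer contour, and
    makes it continuous on every cell, so that the outer integral can be cut along the grid. The
    values of the regularised kernel near [z] cancel along common edges. *)
Let QE : Qop v z * W0 = \sum_(0 <= i < N + N) \sum_(0 <= j < N + N) T i j.
Proof.
rewrite /Qop divfK ?W0_neq0//.
have c0 : rc (gp 0) (gp (N + N)) (gp 0) (gp (N + N)) (fun w => v w * kr 1 z w).
  exact: rcM vc (@kr_rc _ _ _ _).
have g0 : gp 0 <= gp (N + N) by exact: gp_le.
rewrite (@J_ext _ _ _ _ _ g0 g0 _ (fun w => v w * kr 1 z w)); last first.
  by move=> w hw; rewrite kr_eq// outer_far.
rewrite (J_grid gp_le (leq0n _) (leq0n _) c0) -big_split /=.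
apply: eq_big_nat => i /andP[_ iN]; rewrite -big_split /=.
apply: eq_big_nat => j /andP[_ jN].
have gi : gp i <= gp i.+1 by exact: gp_le.
have gj : gp j <= gp j.+1 by exact: gp_le.
have vk := rc_cell iN jN vc.
rewrite -(JD gi gj (rc_re (rcM vk (@kr_rc _ _ _ _))) (rc_re (rcM vk (@kap_rc _ _ _ _ _)))).
by congr J; apply/funext => w; rewrite mulrDr.
Qed.

Let e i j w := cexp ((z - w) * (ctr i j)^*).

Let kE i j w : 1 <= nc (w - z) -> kr 1 z w + kap (ctr i j)^* z w = e i j w / (w - z).
Proof.
move=> h; rewrite kr_eq//.
have wz : w - z != 0 by rewrite -nc_gt0 (lt_le_trans _ h).
by apply: (mulfI wz); rewrite mulrDr kapE /e divff// mulrCA divff// mulr1; ring.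
Qed.

Let diff_e i j w : differentiable (e i j) w.
Proof.
apply: (@diff_comp1 _ _ (fun w : C => (z - w) * (ctr i j)^*) cexp); last exact: differentiable_cexp.
exact: (diffM' (diffB (diff_cst' z w) (diff_id' w)) (diff_cst' _ _)).
Qed.

Let weight i j w d : rect (gp i) (gp i.+1) (gp j) (gp j.+1) w -> nc d <= eta * expR (nc w ^+ 2 / 2) ->
  nc d * nc (e i j w) <= eta * Ez * (expR (- (nc (z - ctr i j) ^+ 2 / 2)) * 2).
Proof.
move=> hw hd; have h := ler_wpM2r (nc_ge0 (e i j w)) hd; rewrite (le_trans h)//.
rewrite -[leLHS]mulrA (gauss_identity (ctr i j) z w) -/Ez -[leRHS]mulrA.
apply: ler_wpM2l => //; rewrite -mulrA; apply: ler_wpM2l; first exact: expR_ge0.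
apply: ler_wpM2l; first exact: expR_ge0.
have n1 : nc (w - ctr i j) ^+ 2 <= 1.
  by rewrite -(expr1n _ 2) lerXn2r ?nnegrE ?nc_ge0// cell_nc.
rewrite (@le_trans _ _ (expR (1/2)))//; first by rewrite ler_expR; lra.
(* That is, [exp 1 <= 4], which follows from [exp (- 1/2) >= 1/2]. *)
have : expR (1/2) * expR (1/2) <= 4 :> R.
  rewrite -expRD; have -> : 1/2 + 1/2 = 1 :> R by field.
  have : expR (-1) >= 1/4 :> R.
    have := @expR_ge1Dx R (- (1/2)); move=> h'.
    have -> : -1 = - (1/2) + - (1/2) :> R by field.
    by rewrite expRD; nra.
  rewrite expRN => h'; have := expR_gt0 (1 : R) => h''.
  have : expR 1 * (expR 1)^-1 = 1 :> R by rewrite divff// gt_eqF.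
  by nra.
by have := expR_ge0 (1/2 : R); nra.
Qed.

(** Away from [z] the twisted kernel is holomorphic in [w], so by Goursat's theorem the holomorphic
    approximant taken around the centre of the cell contributes nothing. Only the error of
    approximation is integrated, and the twist makes it decay with the distance of the cell from
    [z]. *)
Let T_out i j : (i < N + N)%N -> (j < N + N)%N -> ~~ inB i j ->
  nc (T i j) <= 8 * (eta * Ez * (2 * (1/2) ^+ `|i - p|%N * (2 * (1/2) ^+ `|j - q|%N) * 2)).
Proof.
move=> iN jN nB.
have gi : gp i <= gp i.+1 by exact: gp_le.
have gj : gp j <= gp j.+1 by exact: gp_le.
have far w : rect (gp i) (gp i.+1) (gp j) (gp j.+1) w -> 1 <= nc (w - z).
  case: hp => p1 p2 p3 p4; case: hq => q1 q2 q3 q4.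
  move=> /andP[/andP[w1 w2] /andP[w3 w4]]; apply: nc_far.
  move: nB; rewrite /inB !negb_and -!leqNgt -!ltnNge => /orP[/orP[]|/orP[]] h; apply/orP; [left|left|right|right].
  - have : gp i.+2 <= gp p by apply: gp_le; rewrite -(prednK (ltnW p3)).
    by rewrite 1!gpS ler_normr => h'; apply/orP; right; lra.
  - have : gp p.+2 <= gp i by apply: gp_le.
    by rewrite !gpS ler_normr => h'; apply/orP; left; lra.
  - have : gp j.+2 <= gp q by apply: gp_le; rewrite -(prednK (ltnW q3)).
    by rewrite 1!gpS ler_normr => h'; apply/orP; right; lra.
  - have : gp q.+2 <= gp j by apply: gp_le.
    by rewrite !gpS ler_normr => h'; apply/orP; left; lra.
have sc : sqN (ctr i j).
  apply: (cell_sqN iN jN); rewrite /rect /ctr /= !gpS.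
  by apply/andP; split; apply/andP; split; lra.
have [h [dh vh]] := approx sc.
have near w : rect (gp i) (gp i.+1) (gp j) (gp j.+1) w -> nc (w - ctr i j) < 5.
  by move=> /cell_nc; lra.
have vk := rc_cell iN jN vc.
have hk : rc (gp i) (gp i.+1) (gp j) (gp j.+1) h by move=> w /near /dh; exact: diff_cont.
have ek : rc (gp i) (gp i.+1) (gp j) (gp j.+1) (fun w => kr 1 z w + kap (ctr i j)^* z w).
  exact: rcD (@kr_rc _ _ _ _) (@kap_rc _ _ _ _ _).
have Z : J (gp i) (gp i.+1) (gp j) (gp j.+1) (fun w => h w * (kr 1 z w + kap (ctr i j)^* z w)) = 0.
  rewrite (@J_ext _ _ _ _ _ gi gj _ (fun w => (h w * e i j w) / (w - z))).
    apply: goursat gi gj _ => w hw; apply: diff_cauchy_kernel.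
      by apply: (diffM' _ (diff_e i j w)); apply: dh; exact: near.
    by rewrite -subr_eq0 -nc_gt0 (lt_le_trans _ (far w hw)).
  by move=> w /andP[/far hw _]; rewrite kE// mulrA.
have -> : T i j = J (gp i) (gp i.+1) (gp j) (gp j.+1) (fun w => (v w - h w) * (kr 1 z w + kap (ctr i j)^* z w)).
  rewrite -[LHS]subr0 -Z /T -(JB gi gj (rc_re (rcM vk ek)) (rc_re (rcM hk ek))).
  by congr J; apply/funext => w; rewrite mulrBl.
have G : expR (- (nc (z - ctr i j) ^+ 2 / 2)) <= 2 * (1/2) ^+ `|i - p|%N * (2 * (1/2) ^+ `|j - q|%N).
  rewrite nc_sqr mulrDl opprD expRD ler_pM ?expR_ge0//.
    by apply: gauss_decay; rewrite cReD cReN /=; case: hp => p1 p2 _ _; exact: cell_dist.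
  by apply: gauss_decay; rewrite cImD cImN /=; case: hq => p1 p2 _ _; exact: cell_dist.
apply: (J_cell_bound (rc_re (rcM (rcB vk hk) ek))).
move=> w /andP[hw _]; rewrite kE ?far// mulrA ncM [X in X * _]ncM ncV.
have W1 := weight hw (vh w (near w hw) (cell_sqN iN jN hw)).
have f1 : (nc (w - z))^-1 <= 1 by rewrite invf_le1 ?far// (lt_le_trans _ (far w hw)).
rewrite (le_trans (ler_pM _ _ W1 f1))// ?mulr_ge0 ?invr_ge0 ?nc_ge0// mulr1.
rewrite ler_wpM2l//; first by rewrite mulr_ge0 ?expR_ge0.
by rewrite ler_wpM2r.
Qed.

Let weight2 w d : nc (w - ctr p q) <= 3 -> nc d <= eta * expR (nc w ^+ 2 / 2) ->
  nc d * nc (e p q w) <= eta * Ez * E4.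
Proof.
move=> hw hd; have h := ler_wpM2r (nc_ge0 (e p q w)) hd; rewrite (le_trans h)//.
rewrite -[leLHS]mulrA (gauss_identity (ctr p q) z w) -/Ez -[leRHS]mulrA.
apply: ler_wpM2l => //; rewrite -mulrA; apply: ler_wpM2l; first exact: expR_ge0.
rewrite -[leRHS]mul1r; apply: ler_pM; rewrite ?expR_ge0//.
  by rewrite -[leRHS]expR0 ler_expR oppr_le0 divr_ge0// exprn_ge0// nc_ge0.
rewrite ler_expR ler_pM2r// (_ : 9 = 3 ^+ 2); last by ring.
by rewrite lerXn2r ?nnegrE ?nc_ge0.
Qed.

(** The bound [4] is the reason for the radius [5] in [approx]: one approximant, taken around [z],
    serves on the whole block. *)
Let zB w : gp p - 1 <= complex.Re w <= gp p + 2 -> gp q - 1 <= complex.Im w <= gp q + 2 ->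
  nc (w - z) <= 4 /\ nc (w - ctr p q) <= 3.
Proof.
case: hp => p1 p2 _ _; case: hq => q1 q2 _ _ /andP[w1 w2] /andP[w3 w4].
have a1 := nc_le_ReIm (w - z); have a2 := nc_le_ReIm (w - ctr p q).
move: a1 a2; rewrite !(cReD, cImD, cReN, cImN) /= => a1 a2; split.
  rewrite (le_trans a1)//.
  have : `|complex.Re w - complex.Re z| <= 2 by rewrite ler_norml; apply/andP; split; lra.
  have : `|complex.Im w - complex.Im z| <= 2 by rewrite ler_norml; apply/andP; split; lra.
  by lra.
rewrite (le_trans a2)//.
have : `|complex.Re w - (gp p + 1/2)| <= 3/2 by rewrite ler_norml; apply/andP; split; lra.
have : `|complex.Im w - (gp q + 1/2)| <= 3/2 by rewrite ler_norml; apply/andP; split; lra.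
by lra.
Qed.

Let gpP m : (2 <= m)%N -> gp m.-1 = gp m - 1.
Proof. by case: m => // m _; rewrite /= gpS; ring. Qed.

Let sqN_z : sqN z.
Proof.
case: zN; rewrite !ler_norml => /andP[z1 z2] /andP[z3 z4].
by rewrite /sqN /rect; apply/andP; split; apply/andP; split; lra.
Qed.

Let inB_cell i j w : inB i j -> rect (gp i) (gp i.+1) (gp j) (gp j.+1) w ->
  nc (w - z) <= 4 /\ nc (w - ctr p q) <= 3.
Proof.
case: hp => p1 p2 p3 p4; case: hq => q1 q2 q3 q4.
move=> /andP[/andP[i1 i2] /andP[j1 j2]] /andP[/andP[w1 w2] /andP[w3 w4]].
have := gp_le i1; have := gp_le i2; have := gp_le j1; have := gp_le j2.
by rewrite !gpP// !gpS in w2 w4 * => k1 k2 k3 k4; apply: zB; apply/andP; split; lra.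
Qed.

Let inB_bound i j : inB i j -> [/\ (i < N + N)%N, (j < N + N)%N,
  (`|i - p| <= 1)%N & (`|j - q| <= 1)%N].
Proof.
case: hp => _ _ p3 p4; case: hq => _ _ q3 q4 /andP[/andP[i1 i2] /andP[j1 j2]].
split; first by rewrite (leq_trans i2)// -addn2.
- by rewrite (leq_trans j2)// -addn2.
- have [ip|pi] := leqP i p; first by rewrite distnEr// leq_subLR addn1 -(prednK (ltnW p3)) ltnS.
  by rewrite distnEl ?(ltnW pi)// leq_subLR addn1.
- have [ip|pi] := leqP j q; first by rewrite distnEr// leq_subLR addn1 -(prednK (ltnW q3)) ltnS.
  by rewrite distnEl ?(ltnW pi)// leq_subLR addn1.
Qed.

Let wt i j : R := (1/2) ^+ `|i - p|%N * (1/2) ^+ `|j - q|%N.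
Let D : R := 128 * (eta * Ez * E4 * E8).

Let D_ge0 : 0 <= eta * Ez.
Proof. by rewrite mulr_ge0// expR_ge0. Qed.

Section Local.
Variable (h0 : C -> C).
Hypothesis dh0 : forall w, nc (w - z) < 5 -> differentiable h0 w.
Hypothesis vh0 : forall w, nc (w - z) < 5 -> sqN w -> nc (v w - h0 w) <= eta * expR (nc w ^+ 2 / 2).

(** In the block all twists are replaced by that of the central cell, so that the nine integrals add
    up to one over the border of the block. The approximant [h0] is left untwisted, as its product
    with the entire kernel [kap] integrates to zero. *)
Let A i j : C := if inB i j then
  J (gp i) (gp i.+1) (gp j) (gp j.+1) (fun w => h0 w * kr 1 z w + (v w - h0 w) * (kr 1 z w + kap (ctr p q)^* z w)) else 0.

(** The difference of the integrands is [h0] times an entire kernel, which integrates to zero, plus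
    the error [v - h0] times the pole-free kernel of [kap_cexpB]. In the block [wt] is at least
    [1 / 4], which allows the same form of bound as for the far cells. *)
Let T_in i j : inB i j -> nc (T i j - A i j) <= D * wt i j.
Proof.
move=> hB; have [iN jN ip jq] := inB_bound hB; rewrite /A hB.
have gi : gp i <= gp i.+1 by exact: gp_le.
have gj : gp j <= gp j.+1 by exact: gp_le.
have near w : rect (gp i) (gp i.+1) (gp j) (gp j.+1) w -> nc (w - z) < 5.
  by move=> /(inB_cell hB)[+ _]; lra.
have vk := rc_cell iN jN vc.
have hk : rc (gp i) (gp i.+1) (gp j) (gp j.+1) h0 by move=> w /near /dh0; exact: diff_cont.
have krc := @kr_rc (gp i) (gp i.+1) (gp j) (gp j.+1).
have k1 := @kap_rc (ctr i j)^* (gp i) (gp i.+1) (gp j) (gp j.+1).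
have k2 := @kap_rc (ctr p q)^* (gp i) (gp i.+1) (gp j) (gp j.+1).
have t1 := rcM vk (rcD krc k1).
have t2 := rcD (rcM hk krc) (rcM (rcB vk hk) (rcD krc k2)).
have t3 := rcM hk k1.
have t4 := rcM (rcB vk hk) (rcB k1 k2).
have Z : J (gp i) (gp i.+1) (gp j) (gp j.+1) (fun w => h0 w * kap (ctr i j)^* z w) = 0.
  apply: goursat gi gj _ => w hw; exact: (diffM' (dh0 (near w hw)) (differentiable_kap_r _ z w)).
rewrite /T -(JB gi gj (rc_re t1) (rc_re t2)).
rewrite (_ : J _ _ _ _ _ = J (gp i) (gp i.+1) (gp j) (gp j.+1)
   (fun w => h0 w * kap (ctr i j)^* z w + (v w - h0 w) * (kap (ctr i j)^* z w - kap (ctr p q)^* z w))); last first.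
  by congr J; apply/funext => w; ring.
rewrite (JD gi gj (rc_re t3) (rc_re t4)) Z add0r.
apply: (@le_trans _ _ (8 * (eta * Ez * E4 * (4 * E8)))).
  apply: (J_cell_bound (rc_re t4)) => w /andP[hw _].
  have [wz wc] := inB_cell hB hw.
  rewrite kap_cexpB ncM ncM mulrA; apply: ler_pM; rewrite ?nc_ge0 ?mulr_ge0 ?nc_ge0//.
    exact: weight2 wc (vh0 (near w hw) (cell_sqN iN jN hw)).
  apply: (le_trans (nc_kap _ _ _)).
  have cc : nc ((ctr i j)^* - (ctr p q)^*) <= 2.
    rewrite -rmorphB nc_conj (le_trans (nc_le_ReIm _))// cReD cImD cReN cImN /=.
    have dd (a b : nat) : (`|a - b| <= 1)%N -> `|gp a + 1/2 - (gp b + 1/2)| <= 1.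
      have -> : gp a + 1/2 - (gp b + 1/2) = a%:R - b%:R by rewrite /gp; ring.
      have [ab|ba] := leqP a b.
        rewrite distnEr// => hb; rewrite -opprB normrN -natrB// ger0_norm ?ler0n//.
        by rewrite -(ler_nat R) in hb.
      rewrite distnEl ?(ltnW ba)// => hb; rewrite -natrB ?(ltnW ba)// ger0_norm ?ler0n//.
      by rewrite -(ler_nat R) in hb.
    by have := dd i p ip; have := dd j q jq; lra.
  have -> : 4 * E8 = 2 * (2 * E8) by ring.
  apply: ler_pM; rewrite ?nc_ge0 ?mulr_ge0 ?expR_ge0// ler_pM2l// ler_expR.
  have -> : 8 = 4 * 2 :> R by ring.
  by apply: ler_pM; rewrite ?nc_ge0// nc_dist.
have w4 : 1/4 <= wt i j.
  have ge n : (n <= 1)%N -> 1/2 <= (1/2 : R) ^+ n by case: n => [|[|]]// _; rewrite ?expr0 ?expr1; lra.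
  by have := ge _ ip; have := ge _ jq; rewrite /wt; nra.
rewrite /D; have -> : 8 * (eta * Ez * E4 * (4 * E8)) = 128 * (eta * Ez * E4 * E8) * (1/4) by field.
by rewrite ler_wpM2l// mulr_ge0// !mulr_ge0// expR_ge0.
Qed.

Let T_all i j : (i < N + N)%N -> (j < N + N)%N -> nc (T i j - A i j) <= D * wt i j.
Proof.
move=> iN jN; have [hB|nB] := boolP (inB i j); first exact: T_in.
rewrite /A (negbTE nB) subr0 (le_trans (T_out iN jN nB))//.
have -> : 8 * (eta * Ez * (2 * (1 / 2) ^+ `|i - p|%N * (2 * (1 / 2) ^+ `|j - q|%N) * 2)) =
  64 * (eta * Ez) * wt i j by rewrite /wt; ring.
rewrite ler_wpM2r ?mulr_ge0 ?exprn_ge0 ?divr_ge0// /D.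
have := E4_ge1; have := E8_ge1; have := D_ge0; set a := eta * Ez; move=> a0 e8 e4.
have /(ler_wpM2l a0) : 1 <= E4 * E8 by nra.
by lra.
Qed.

Let A_sum : \sum_(0 <= i < N + N) \sum_(0 <= j < N + N) A i j =
  J (gp p - 1) (gp p + 2) (gp q - 1) (gp q + 2)
   (fun w => h0 w * kr 1 z w + (v w - h0 w) * (kr 1 z w + kap (ctr p q)^* z w)).
Proof.
case: hp => p1 p2 p3 p4; case: hq => q1 q2 q3 q4.
have pp : (p.-1 <= p.+2)%N by rewrite (leq_trans (leq_pred p)) ?leqW.
have qq : (q.-1 <= q.+2)%N by rewrite (leq_trans (leq_pred q)) ?leqW.
have pN : (p.+2 <= N + N)%N by rewrite -addn2.
have qN : (q.+2 <= N + N)%N by rewrite -addn2.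
rewrite (sum_window pp pN); last first.
  by move=> i hi; apply: big1_seq => j _; rewrite /A /inB (negbTE hi).
have gS2 m : gp m + 2 = gp m.+2 by rewrite !gpS; ring.
rewrite -!gpP// !gS2 (J_grid gp_le pp qq).
  apply: eq_big_nat => i hi; rewrite (sum_window qq qN); last first.
    by move=> j hj; rewrite /A /inB hi (negbTE hj).
  by apply: eq_big_nat => j hj; rewrite /A /inB hi hj.
have vk : rc (gp p.-1) (gp p.+2) (gp q.-1) (gp q.+2) v by apply: rcS vc; exact: gp_le.
have hk : rc (gp p.-1) (gp p.+2) (gp q.-1) (gp q.+2) h0.
  move=> w; rewrite !gpP// -!gS2 => /andP[hw1 hw2]; apply: diff_cont; apply: dh0.
  by have [+ _] := zB hw1 hw2; lra.
exact: (rcD (rcM hk (@kr_rc _ _ _ _)) (rcM (rcB vk hk) (rcD (@kr_rc _ _ _ _) (@kap_rc _ _ _ _ _)))).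
Qed.

(** The border of the block is at distance at least [1] from [z]: there Cauchy's formula evaluates
    the part in [h0], and the kernel applied to [v - h0] is bounded. *)
Let B_val : nc (J (gp p - 1) (gp p + 2) (gp q - 1) (gp q + 2)
   (fun w => h0 w * kr 1 z w + (v w - h0 w) * (kr 1 z w + kap (ctr p q)^* z w)) - h0 z * W0)
   <= 24 * (eta * Ez * E4).
Proof.
case: hp => p1 p2 p3 p4; case: hq => q1 q2 q3 q4.
have g1 : gp p - 1 <= gp p + 2 by lra.
have g2 : gp q - 1 <= gp q + 2 by lra.
have gS2 m : gp m + 2 = gp m.+2 by rewrite !gpS; ring.
have pN : (p.+2 <= N + N)%N by rewrite -addn2.
have qN : (q.+2 <= N + N)%N by rewrite -addn2.
have inN w : rect (gp p - 1) (gp p + 2) (gp q - 1) (gp q + 2) w -> sqN w.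
  rewrite -!gpP// !gS2 /sqN /rect -gp0 -gp2N => /andP[/andP[w1 w2] /andP[w3 w4]].
  have := gp_le (leq0n p.-1); have := gp_le pN; have := gp_le (leq0n q.-1); have := gp_le qN.
  by move=> *; apply/andP; split; apply/andP; split; lra.
have near w : rect (gp p - 1) (gp p + 2) (gp q - 1) (gp q + 2) w -> nc (w - z) < 5 /\ nc (w - ctr p q) <= 3.
  by move=> /andP[hw1 hw2]; have [? ?] := zB hw1 hw2; split=> //; lra.
have vk : rc (gp p - 1) (gp p + 2) (gp q - 1) (gp q + 2) v.
  by rewrite -!gpP// !gS2; apply: rcS vc; exact: gp_le.
have hk : rc (gp p - 1) (gp p + 2) (gp q - 1) (gp q + 2) h0.
  by move=> w /near[hw _]; exact: diff_cont (dh0 hw).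
have t1 := rcM hk (@kr_rc (gp p - 1) (gp p + 2) (gp q - 1) (gp q + 2)).
have t2 := rcM (rcB vk hk) (rcD (@kr_rc (gp p - 1) (gp p + 2) (gp q - 1) (gp q + 2)) (@kap_rc (ctr p q)^* _ _ _ _)).
have far w : bd (gp p - 1) (gp p + 2) (gp q - 1) (gp q + 2) w -> 1 <= nc (w - z).
  move=> /andP[_ /or4P[] /eqP E]; apply: nc_far; rewrite E; apply/orP;
    [left|left|right|right]; rewrite ler_normr; apply/orP; [right|left|right|left]; lra.
rewrite (JD g1 g2 (rc_re t1) (rc_re t2)).
have iz : inner (gp p - 1) (gp p + 2) (gp q - 1) (gp q + 2) z by rewrite /inner; split; lra.
rewrite (@J_ext _ _ _ _ _ g1 g2 (fun w => h0 w * kr 1 z w) (fun w => h0 w / (w - z))); last first.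
  by move=> w hw; rewrite kr_eq// far.
rewrite (cauchy_formula iz (fun w hw => dh0 (near w hw).1)) addrAC subrr add0r.
have := J_bound g1 g2 (rc_re t2) (M := eta * Ez * E4).
have -> : 4 * (eta * Ez * E4) * (gp p + 2 - (gp p - 1) + (gp q + 2 - (gp q - 1))) = 24 * (eta * Ez * E4) by ring.
apply => w hw; have hr : rect (gp p - 1) (gp p + 2) (gp q - 1) (gp q + 2) w by case/andP: hw.
rewrite kE ?far// mulrA ncM [X in X * _]ncM ncV.
have W1 := weight2 (near w hr).2 (vh0 (near w hr).1 (inN w hr)).
have f1 : (nc (w - z))^-1 <= 1 by rewrite invf_le1 ?far// (lt_le_trans _ (far w hw)).
have f0 : 0 <= (nc (w - z))^-1 by rewrite invr_ge0 nc_ge0.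
have := ler_pM (mulr_ge0 (nc_ge0 (v w - h0 w)) (nc_ge0 (e p q w))) f0 W1 f1.
by rewrite mulr1.
Qed.

Lemma Qop_close_local : nc (Qop v z - v z) <= KQ * (eta * expR (nc z ^+ 2 / 2)).
Proof.
rewrite -/Ez; have W0p : 0 < nc (@W0 R) by rewrite nc_gt0 W0_neq0.
have S1 : nc (\sum_(0 <= i < N + N) \sum_(0 <= j < N + N) (T i j - A i j)) <= 9 * D.
  apply: (@le_trans _ _ (\sum_(0 <= i < N + N) \sum_(0 <= j < N + N) D * wt i j)).
    rewrite (le_trans (nc_sum _ _ _))// big_seq [leRHS]big_seq; apply: ler_sum => i.
    rewrite mem_index_iota => /andP[_ iN].
    rewrite (le_trans (nc_sum _ _ _))// big_seq [leRHS]big_seq; apply: ler_sum => j.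
    by rewrite mem_index_iota => /andP[_ jN]; exact: T_all.
  have D0 : 0 <= D by rewrite /D mulr_ge0// !mulr_ge0// expR_ge0.
  have -> : \sum_(0 <= i < N + N) \sum_(0 <= j < N + N) D * wt i j =
     D * ((\sum_(0 <= i < N + N) (1/2 : R) ^+ `|i - p|%N) * (\sum_(0 <= j < N + N) (1/2 : R) ^+ `|j - q|%N)).
    rewrite mulr_suml mulr_sumr; apply: eq_bigr => i _.
    by rewrite mulr_sumr mulr_sumr.
  rewrite mulrC ler_wpM2r//; have -> : 9 = 3 * 3 :> R by ring.
  have nn m (a : nat -> nat) : 0 <= \sum_(0 <= i < m) (1/2 : R) ^+ a i.
    by apply: sumr_ge0 => i _; rewrite exprn_ge0// divr_ge0.
  by apply: ler_pM; rewrite ?nn// sum_pow2_dist.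
have E : (Qop v z - h0 z) * W0 = \sum_(0 <= i < N + N) \sum_(0 <= j < N + N) (T i j - A i j) +
   (J (gp p - 1) (gp p + 2) (gp q - 1) (gp q + 2)
   (fun w => h0 w * kr 1 z w + (v w - h0 w) * (kr 1 z w + kap (ctr p q)^* z w)) - h0 z * W0).
  rewrite mulrBl QE -A_sum.
  have -> : \sum_(0 <= i < N + N) \sum_(0 <= j < N + N) (T i j - A i j) =
     \sum_(0 <= i < N + N) \sum_(0 <= j < N + N) T i j - \sum_(0 <= i < N + N) \sum_(0 <= j < N + N) A i j.
    by rewrite -sumrB; apply: eq_bigr => i _; rewrite -sumrB.
  by ring.
have B1 : nc (Qop v z - h0 z) <= (9 * D + 24 * (eta * Ez * E4)) / nc (@W0 R).
  rewrite ler_pdivlMr// -ncM E (le_trans (ncD _ _))// lerD//; exact: B_val.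
have B2 : nc (v z - h0 z) <= eta * Ez by apply: vh0; rewrite ?subrr ?nc0.
have -> : Qop v z - v z = (Qop v z - h0 z) - (v z - h0 z) by ring.
rewrite (le_trans (ncB _ _))//.
have -> : KQ * (eta * Ez) = (9 * D + 24 * (eta * Ez * E4)) / nc (@W0 R) + eta * Ez.
  by rewrite /KQ /D; field; rewrite gt_eqF.
by rewrite lerD.
Qed.

End Local.

Lemma Qop_close : nc (Qop v z - v z) <= KQ * (eta * expR (nc z ^+ 2 / 2)).
Proof. by have [h [dh vh]] := approx sqN_z; exact: Qop_close_local dh vh. Qed.

End Closeness.
End ModelOperator.

(** * Several variables: Osgood's lemma *)

Section Coordinates.
Context {R : realType} {n : nat}.
Local Notation C := R[i].
Local Notation V := 'rV[C]_n.
Implicit Types (u v w : V) (f : V -> C).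

Lemma vn_lt_row v (e : R) : 0 < e -> (vn v < e) <-> (forall i, nc (v 0 i) < e).
Proof.
move=> e0; have B : ball (0 : V) e%:C v <-> vn v < e.
  by rewrite -ball_normE /= sub0r normrN vnE ltcR.
split => [/B h i|h].
  have [_ /(_ 0 i)] := h; rewrite mxE.
  by rewrite -ball_normE /= sub0r normrN ncE ltcR.
apply/B; split=> [|j i]; first by rewrite ltcR.
rewrite ord1 mxE -ball_normE /= sub0r normrN ncE ltcR; exact: h.
Qed.

Lemma nc_le_vn v i : nc (v 0 i) <= vn v.
Proof.
apply/ler_addgt0Pl => e e0; have h : vn v < e + vn v by rewrite ltrDr.
by have /(vn_lt_row v)[/(_ h i) /ltW] : 0 < e + vn v by rewrite (le_lt_trans _ h)// vn_ge0.
Qed.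

Lemma vn_le_row v (e : R) : 0 <= e -> (forall i, nc (v 0 i) <= e) -> vn v <= e.
Proof.
move=> e0 h; apply/ler_addgt0Pl => d d0; apply/ltW/vn_lt_row; first by rewrite ltr_wpDr.
by move=> i; rewrite (le_lt_trans (h i))// ltrDr.
Qed.

Lemma coord_cont i w : {for w, continuous (fun v : V => v 0 i)}.
Proof. exact: coord_continuous. Qed.

Arguments coord_cont i w : clear implicits.

Lemma cont_row (T : topologicalType) (f : 'I_n -> T -> C) t :
  (forall i, {for t, continuous (f i)}) -> {for t, continuous (fun s => \row_i f i s : V)}.
Proof.
move=> h A [e /= e0 hA].
have : \forall s \near t, forall i, i \in enum 'I_n -> e 0 i (f i s).
  elim: (enum 'I_n) => [|i s ih]; first by apply: nearW.
  have hi : \forall s \near t, e 0 i (f i s) by apply: (h i); have := e0 0 i; rewrite mxE.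
  by apply: filterS2 hi ih => x h1 h2 j; rewrite inE => /orP[/eqP ->|/h2].
apply: filterS => s hs; apply: hA => i j; rewrite ord1 mxE; apply: hs.
by rewrite mem_enum.
Qed.

Definition upd w (i : 'I_n) (x : C) : V := \row_j (if j == i then x else w 0 j).

Lemma upd_eq w i x : upd w i x 0 i = x.
Proof. by rewrite mxE eqxx. Qed.

Lemma upd_neq w i j x : j != i -> upd w i x 0 j = w 0 j.
Proof. by move=> ji; rewrite mxE (negbTE ji). Qed.

Lemma upd_id w i : upd w i (w 0 i) = w.
Proof. by apply/rowP => j; rewrite mxE; case: eqP => [->|]. Qed.

Lemma upd_upd w i x y : upd (upd w i x) i y = upd w i y.
Proof. by apply/rowP => j; rewrite !mxE; case: eqP. Qed.

Lemma upd_comm w i j x y : i != j -> upd (upd w i x) j y = upd (upd w j y) i x.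
Proof.
move=> ij; apply/rowP => k; rewrite !mxE; have [->|kj] := eqVneq k j.
  by rewrite eq_sym (negbTE ij).
by [].
Qed.

Lemma cont_upd (T : topologicalType) (f : T -> V) (g : T -> C) i t :
  {for t, continuous f} -> {for t, continuous g} ->
  {for t, continuous (fun s => upd (f s) i (g s))}.
Proof.
move=> hf hg; apply: (@cont_row T (fun j s => if j == i then g s else f s 0 j)) => j.
case: eqP => _; first exact: hg.
exact: (cont_comp hf (coord_cont j (f t))).
Qed.

Lemma row_sum_delta (u : V) : u = \sum_i u 0 i *: delta_mx 0 i.
Proof.
apply/rowP => j; rewrite summxE (bigD1 j)//= !mxE !eqxx mulr1 big1 ?addr0// => i ij.
by rewrite !mxE eqxx eq_sym (negbTE ij) mulr0.
Qed.

(** [taylor1] in each variable gives partial derivatives with a quadratic remainder, uniform near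
    [a] since [f] is bounded there. The partial derivatives are then shown to be continuous, and the
    increment of [f] is decomposed one coordinate at a time. *)
Lemma osgood f (a : V) :
  (\forall w \near a, {for w, continuous f} /\
     forall i, differentiable (fun x => f (upd w i x)) (w 0 i)) ->
  differentiable f a.
Proof.
move=> H.
have Hc : {for a, continuous f} by case: (nbhs_singleton H).
have [r r0 hr] : exists2 r : R, 0 < r & forall v, vn v <= r ->
    [/\ {for a + v, continuous f}, nc (f (a + v) - f a) <= 1 &
      forall i, differentiable (fun x => f (upd (a + v) i x)) ((a + v) 0 i)].
  have H2 := (contP _ _).1 Hc _ ltr01.
  apply/(nearV a (fun w => [/\ {for w, continuous f}, nc (f w - f a) <= 1 &
      forall i, differentiable (fun x => f (upd w i x)) (w 0 i)])).
  by apply: filterS2 H H2 => w [h1 h2] h3.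
pose M := nc (f a) + 1.
pose rho := r / 4.
have rho0 : 0 < rho by rewrite divr_gt0.
pose K := KT * M / rho ^+ 2.
have M0 : 0 <= M by rewrite addr_ge0 ?nc_ge0.
have K0 : 0 <= K by rewrite divr_ge0 ?exprn_ge0 ?(ltW rho0)// mulr_ge0// ltW// KT_gt0.
have updB v i x : vn v <= rho -> nc (x - (a + v) 0 i) <= 2 * rho ->
    exists2 v', vn v' <= r & upd (a + v) i x = a + v'.
  move=> hv hx; exists (upd (a + v) i x - a); last by rewrite [RHS]addrC subrK.
  apply: vn_le_row => [|j]; first exact: ltW.
  have := nc_le_vn v; move: hx; rewrite !mxE; have [->|ji] := eqVneq j i => hx hv'.
    have := ncD (x - (a 0 i + v 0 i)) (v 0 i).
    have -> : x - (a 0 i + v 0 i) + v 0 i = x - a 0 i by ring.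
    by have := hv' i; rewrite /rho in hx hv *; lra.
  by rewrite addrAC subrr add0r; have := hv' j; rewrite /rho in hv *; lra.
have T v i : vn v <= rho -> exists l : C, forall h, nc h <= rho / 2 ->
    nc (f (upd (a + v) i ((a + v) 0 i + h)) - f (a + v) - l * h) <= K * nc h ^+ 2.
  move=> hv; pose g x := f (upd (a + v) i x).
  have [|z hz|l [_ hl]] := @taylor1 R g ((a + v) 0 i) rho M rho0.
  - move=> z /nc_sq hz; have [v' hv' E] := updB v i z hv hz.
    have [_ _ /(_ i)] := hr v' hv'; rewrite -E upd_eq.
    by under eq_fun do rewrite upd_upd.
  - have [v' hv' E] := updB v i z hv (nc_sq hz); rewrite /g E.
    have [_ h1 _] := hr v' hv'; have := ncD (f (a + v') - f a) (f a); rewrite subrK /M; lra.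
  by exists l => h /hl; rewrite /g upd_id /K mulrAC.
have [l hl] : exists l : V -> 'I_n -> C, forall v i h, vn v <= rho -> nc h <= rho / 2 ->
    nc (f (upd (a + v) i ((a + v) 0 i + h)) - f (a + v) - l v i * h) <= K * nc h ^+ 2.
  have /choice[l hl] : forall vi : V * 'I_n, exists l : C, forall h, vn vi.1 <= rho -> nc h <= rho / 2 ->
    nc (f (upd (a + vi.1) vi.2 ((a + vi.1) 0 vi.2 + h)) - f (a + vi.1) - l * h) <= K * nc h ^+ 2.
    move=> [v i] /=; have [hv|hv] := leP (vn v) rho; last first.
      by exists 0.
    by have [l hl] := T v i hv; exists l => h _; exact: hl.
  by exists (fun v i => l (v, i)) => v i h hv hh; exact: (hl (v, i)).
(* For a fixed step [s], a partial derivative equals the difference quotient up to [K * s], and this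
   quotient depends continuously on the base point. *)
have lc i : forall e : R, 0 < e -> exists2 d : R, 0 < d & forall v, vn v <= d -> nc (l v i - l 0 i) <= e.
  move=> e e0; pose s := Num.min (rho / 2) (e / (4 * K + 1)).
  have s0 : 0 < s by rewrite lt_min !divr_gt0//; lra.
  have [s1 s2] : s <= rho / 2 /\ s <= e / (4 * K + 1) by rewrite /s !ge_min !lexx orbT.
  have sK : 4 * K * s <= e by move: s2; rewrite ler_pdivlMr; lra.
  have ns : nc s%:C = s by rewrite ncR gtr0_norm.
  have es : 0 < e * s / 4 by rewrite divr_gt0// mulr_gt0.
  have c1 := (contP _ _).1 Hc _ es.
  have v00 : vn (0 : V) <= rho by rewrite vn0 ltW.
  have [v' hv' E'] := updB 0 i ((a + 0) 0 i + s%:C) v00 ltac:(rewrite addrAC subrr add0r ns; lra).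
  have [c2' _ _] := hr v' hv'; rewrite -E' in c2'.
  have cg : {for (0 : V), continuous (fun v => upd (a + v) i ((a + v) 0 i + s%:C))}.
    have ca : {for (0 : V), continuous (fun v : V => a + v)}.
      by apply: continuousD; [exact: cont_cstW|exact: cont_id].
    have cg2 : {for (0 : V), continuous (fun v => (a + v) 0 i + s%:C)}.
      exact: (contD (cont_comp ca (coord_cont i (a + 0))) (cont_cst s%:C (0 : V))).
    have X := (@cont_upd V (fun v => a + v) (fun v => (a + v) 0 i + s%:C) i 0 ca cg2).
    exact: X.
  have c2 := (contP _ _).1 (cont_comp cg c2') _ es.
  have [d1 d10 hd1] := (nearV a _).1 c1; have [d2 d20 hd2] := (nearV (0 : V) _).1 c2.
  exists (Num.min rho (Num.min d1 d2)); first by rewrite !lt_min rho0 d10.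
  move=> v; rewrite !le_min => /and3P[vr v1 v2].
  have e1 := hd1 v v1; have := hd2 v v2; rewrite add0r addr0 => e2.
  have := hl v i s%:C vr; rewrite ns => /(_ s1) k1.
  have := hl 0 i s%:C v00; rewrite ns addr0 => /(_ s1) k2.
  set A := f (upd (a + v) i _) in e2 k1; set B := f (upd a i _) in e2 k2.
  have -> : l v i - l 0 i = (- (A - f (a + v) - l v i * s%:C) + (B - f a - l 0 i * s%:C) +
     (A - B) - (f (a + v) - f a)) / s%:C.
    by field; rewrite -nc_gt0 ns.
  rewrite ncM ncV ns ler_pdivrMr//.
  have := ncB (- (A - f (a + v) - l v i * s%:C) + (B - f a - l 0 i * s%:C) + (A - B)) (f (a + v) - f a).
  have := ncD (- (A - f (a + v) - l v i * s%:C) + (B - f a - l 0 i * s%:C)) (A - B).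
  have := ncD (- (A - f (a + v) - l v i * s%:C)) (B - f a - l 0 i * s%:C); rewrite ncN.
  have : 2 * (K * s ^+ 2) <= e * s / 2 by rewrite expr2; nra.
  by lra.
pose ld := fun v : V => \sum_i v 0 i * l 0 i.
suff [] : differentiable f a /\ 'd f a = ld :> (V -> C) by [].
apply: (@eps_diff R V f a ld (\sum_i nc (l 0 i))).
- move=> k u v; rewrite /ld mulr_sumr -big_split; apply: eq_bigr => i _.
  by rewrite !mxE /=; ring.
- move=> v; rewrite /ld (le_trans (nc_sum _ _ _))// mulr_suml; apply: ler_sum => i _.
  by rewrite ncM mulrC ler_wpM2l ?nc_ge0// nc_le_vn.
move=> e e0.
pose e' := e / (2 * n.+1%:R).
have e'0 : 0 < e' by rewrite divr_gt0// mulr_gt0.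
have /choice[dd hdd] : forall i, exists d : R, 0 < d /\ forall v, vn v <= d -> nc (l v i - l 0 i) <= e'.
  by move=> i; have [d d0 hd] := lc i e' e'0; exists d.
have [d d0 hd] : exists2 d : R, 0 < d & forall i, d <= dd i.
  exists (\big[Num.min/1]_i dd i); last by move=> i; exact: bigmin_le.
  by elim/big_ind: _ => // [x y x0 y0|i _]; [rewrite lt_min x0|case: (hdd i)].
exists (Num.min d (Num.min (rho / 2) (e' / (K + 1)))).
  by rewrite !lt_min d0 !divr_gt0//; lra.
move=> v; rewrite !le_min => /and3P[vd vr ve].
have Ke : K * vn v <= e'.
  move: ve; rewrite ler_pdivlMr; last by lra.
  by have := vn_ge0 v; lra.
(* The path from [a] to [a + v] that changes one coordinate at a time. *)
pose tr (k : nat) : V := \row_i (if (i < k)%N then v 0 i else 0).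
have vtr k : vn (tr k) <= vn v.
  apply: vn_le_row => [|i]; first exact: vn_ge0.
  by rewrite mxE; case: ifP => _; rewrite ?nc_le_vn// nc0 vn_ge0.
have step (k : 'I_n) : nc (f (a + tr k.+1) - f (a + tr k) - v 0 k * l 0 k) <= 2 * e' * vn v.
  have E : upd (a + tr k) k ((a + tr k) 0 k + v 0 k) = a + tr k.+1.
    apply/rowP => j; rewrite !mxE ltnn addr0; case: eqP => [->|/eqP jk]; first by rewrite ltnSn.
    have jk' : (j : nat) != k := jk.
    by rewrite [in RHS]ltnS [in LHS]ltn_neqAle jk'.
  have := hl (tr k) k (v 0 k); rewrite E => h1.
  have {}h1 := h1 ltac:(have := vtr k; lra) (le_trans (nc_le_vn v k) vr).
  have [_ /(_ (tr k))] := hdd k; have := hd k; have := vtr k => a1 a2 h2.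
  have {}h2 := h2 ltac:(lra).
  have -> : f (a + tr k.+1) - f (a + tr k) - v 0 k * l 0 k =
     (f (a + tr k.+1) - f (a + tr k) - l (tr k) k * v 0 k) + (l (tr k) k - l 0 k) * v 0 k by ring.
  rewrite (le_trans (ncD _ _))// ncM.
  have vk := nc_le_vn v k; have vk0 := nc_ge0 (v 0 k).
  have : nc (l (tr k) k - l 0 k) * nc (v 0 k) <= e' * vn v by rewrite ler_pM ?nc_ge0.
  have : K * nc (v 0 k) ^+ 2 <= e' * vn v.
    rewrite expr2 mulrA; apply: ler_pM => //; first exact: mulr_ge0.
    by apply: le_trans Ke; rewrite ler_wpM2l.
  by lra.
have -> : f (a + v) - f a - ld v = \sum_(i < n) (f (a + tr i.+1) - f (a + tr i) - v 0 i * l 0 i).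
  rewrite sumrB; congr (_ - _).
  rewrite -(big_mkord xpredT (fun i => f (a + tr i.+1) - f (a + tr i))) telescope_sumr//.
  congr (f _ - f _).
    by congr (_ + _); apply/rowP => j; rewrite mxE ltn_ord.
  by rewrite (_ : tr 0%N = 0) ?addr0//; apply/rowP => j; rewrite !mxE.
rewrite (le_trans (nc_sum _ _ _))// (@le_trans _ _ (\sum_(i < n) 2 * e' * vn v))//.
  by apply: ler_sum => i _; exact: step.
rewrite sumr_const card_ord -[leLHS]mulr_natl.
have -> : n%:R * (2 * e' * vn v) = e * (n%:R / n.+1%:R) * vn v.
  rewrite /e'; field; rewrite nat1r pnatr_eq0//.
apply: ler_wpM2r; first exact: vn_ge0.
by rewrite ler_piMr ?(ltW e0)// ler_pdivrMr// mul1r ler_nat.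
Qed.

End Coordinates.

Arguments coord_cont {R n} i w _ _.

(** * Regularity of the operator in its variable and in parameters *)

Section QopParameters.
Context {R : realType}.
Local Notation C := R[i].
Variable N : nat.

Definition osq (r : R) (z : C) := `|complex.Re z| < r /\ `|complex.Im z| < r.
Definition csq (r : R) (z : C) := `|complex.Re z| <= r /\ `|complex.Im z| <= r.

Lemma osq_near r z : osq r z -> \forall w \near z, osq r w.
Proof.
move=> [h1 h2]; pose d := Num.min ((r - `|complex.Re z|) / 2) ((r - `|complex.Im z|) / 2).
have d0 : 0 < d by rewrite lt_min !divr_gt0 ?subr_gt0.
have [d1 d2] : d <= (r - `|complex.Re z|) / 2 /\ d <= (r - `|complex.Im z|) / 2.
  by rewrite /d !ge_min !lexx orbT.
apply/nearC; exists d => // h hd; have a1 := Re_le_nc h; have a2 := Im_le_nc h.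
rewrite /osq cReD cImD; split; rewrite (le_lt_trans (ler_normD _ _))//; lra.
Qed.

Lemma csq_rect r z : csq r z <-> rect (- r) r (- r) r z.
Proof. by rewrite /csq /rect !ler_norml; split => [[-> ->]|/andP]. Qed.

Let G := @gp R N.
Let G0 : G 0 = - N%:R := gp0 N.
Let G1 : G (N + N)%N = N%:R := gp2N N.
Let gg i : G i <= G i.+1. Proof. exact: gp_le. Qed.
Let g0 : G 0 <= G (N + N). Proof. exact: gp_le. Qed.

Let outer_neq w z : osq N%:R z -> bd (G 0) (G (N + N)) (G 0) (G (N + N)) w -> w - z != 0.
Proof.
move=> [z1 z2] /andP[_]; rewrite G0 G1 => hw; rewrite subr_eq0; apply: contraTneq hw => ->.
move: z1 z2; rewrite !ltr_norml => /andP[a1 a2] /andP[a3 a4].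
by rewrite (gt_eqF a1) (lt_eqF a2) (gt_eqF a3) (lt_eqF a4).
Qed.

Let bd_csq w : bd (G 0) (G (N + N)) (G 0) (G (N + N)) w -> csq N%:R w.
Proof. by move=> /andP[hw _]; apply/csq_rect; rewrite -G0 -G1. Qed.

Let cell_csq i j w : (i < N + N)%N -> (j < N + N)%N -> bd (G i) (G i.+1) (G j) (G j.+1) w -> csq N%:R w.
Proof.
move=> iN jN /andP[/andP[/andP[w1 w2] /andP[w3 w4]] _]; apply/csq_rect.
have a1 : G 0 <= G i by exact: gp_le.
have a2 : G i.+1 <= G (N + N) by exact: gp_le.
have a3 : G 0 <= G j by exact: gp_le.
have a4 : G j.+1 <= G (N + N) by exact: gp_le.
by rewrite G0 G1 in a1 a2 a3 a4; rewrite /rect; apply/andP; split; apply/andP; split; lra.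
Qed.

Lemma cont_sum_nat (T : topologicalType) (f : nat -> T -> C) m t :
  (forall i, (i < m)%N -> {for t, continuous (f i)}) ->
  {for t, continuous (fun s => \sum_(0 <= i < m) f i s)}.
Proof.
elim: m => [|m ih] h; first by apply: cont_ext (cont_cst 0 t) => s; rewrite big_geq.
apply: cont_ext (contD (ih (fun i im => h i (ltnW im))) (h m (ltnSn m))) => s.
by rewrite big_nat_recr.
Qed.

Lemma diff_sum_nat (f : nat -> C -> C) m t :
  (forall i, (i < m)%N -> differentiable (f i) t) ->
  differentiable (fun s => \sum_(0 <= i < m) f i s) t.
Proof.
elim: m => [|m ih] h.
  by under eq_fun do rewrite big_geq//; exact: diff_cst'.
under eq_fun do rewrite big_nat_recr//=.
exact: diffD (ih (fun i im => h i (ltnW im))) (h m (ltnSn m)).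
Qed.

Lemma Qop_param_cont (P : topologicalType) (v : C -> P -> C) (z0 : C) (p0 : P) : osq N%:R z0 ->
  (\forall p \near p0, forall w, csq N%:R w -> {for (w, p), continuous (fun q => v q.1 q.2)}) ->
  {for (z0, p0), continuous (fun q : C * P => Qop N (v^~ q.2) q.1)}.
Proof.
move=> z0N hv.
have near2 : \forall q \near (z0, p0), osq N%:R q.1 /\
    forall w, csq N%:R w -> {for (w, q.2), continuous (fun q => v q.1 q.2)}.
  have k1 : \forall q \near (z0, p0), osq N%:R q.1 by exact: (cvg_fst (osq_near z0N)).
  have k2 : \forall q \near (z0, p0), forall w, csq N%:R w -> {for (w, q.2), continuous (fun q => v q.1 q.2)}.
    exact: (cvg_snd hv).
  by apply: filterS2 k1 k2 => q a b.
have vq w (q : C * P) : {for (w, q.2), continuous (fun q => v q.1 q.2)} ->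
    {for (w, q), continuous (fun s : C * (C * P) => v s.1 s.2.2)}.
  have h' := cont_pair (cont_fst (w, q)) (cont_comp (cont_snd (w, q)) (cont_snd q)).
  by move=> h; exact: (cont_comp h' h).
have zq w (q : C * P) : {for (w, q), continuous (fun s : C * (C * P) => s.2.1)}.
  exact: (cont_comp (cont_snd (w, q)) (cont_fst q)).
have O : {for (z0, p0), continuous (fun q : C * P =>
    J (G 0) (G (N + N)) (G 0) (G (N + N)) (fun w => v w q.2 / (w - q.1)))}.
  apply: (J_param_cont g0 g0 (F := fun w q => v w q.2 / (w - q.1))).
  apply: filterS near2 => q [qN hq] w hw.
  apply: (contM (vq w q (hq w (bd_csq hw)))).
  apply: (contV (contB (cont_fst (w, q)) (zq w q))); exact: outer_neq.
have S : {for (z0, p0), continuous (fun q : C * P => \sum_(0 <= i < N + N) \sum_(0 <= j < N + N)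
     J (G i) (G i.+1) (G j) (G j.+1) (fun w => v w q.2 * kap (ctr N i j)^* q.1 w))}.
  apply: cont_sum_nat => i iN; apply: cont_sum_nat => j jN.
  apply: (J_param_cont (gg i) (gg j) (F := fun w q => v w q.2 * kap (ctr N i j)^* q.1 w)).
  apply: filterS near2 => q [qN hq] w hw.
  apply: (contM (vq w q (hq w (cell_csq iN jN hw)))).
  exact: (kap_cont (zq w q) (cont_fst (w, q))).
exact: (contM (contD O S) (cont_cst W0^-1 (z0, p0))).
Qed.

(** The kernels alone are holomorphic in [z]; the function [v] is merely continuous. *)
Lemma Qop_diff (v : C -> C) (z : C) : osq N%:R z ->
  (forall w, csq N%:R w -> {for w, continuous v}) -> differentiable (Qop N v) z.
Proof.
move=> zN hv.
have near2 := osq_near zN.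
have vq w u : csq N%:R w -> {for (w, u), continuous (fun s : C * C => v s.1)}.
  by move=> /hv h; exact: (cont_comp (cont_fst (w, u)) h).
have O : differentiable (fun u =>
    J (G 0) (G (N + N)) (G 0) (G (N + N)) (fun w => v w / (w - u))) z.
  apply: (J_param_diff g0 g0 (F := fun w u => v w / (w - u))).
  apply: filterS near2 => u uN w hw; split.
    apply: (contM (vq w u (bd_csq hw))).
    apply: (contV (contB (cont_fst (w, u)) (cont_snd (w, u)))); exact: outer_neq.
  apply: (diffM' (diff_cst' _ _)); apply: (diffV' (diffB (diff_cst' w u) (diff_id' u))).
  exact: outer_neq.
have S : differentiable (fun u => \sum_(0 <= i < N + N) \sum_(0 <= j < N + N)
     J (G i) (G i.+1) (G j) (G j.+1) (fun w => v w * kap (ctr N i j)^* u w)) z.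
  apply: diff_sum_nat => i iN; apply: diff_sum_nat => j jN.
  apply: (J_param_diff (gg i) (gg j) (F := fun w u => v w * kap (ctr N i j)^* u w)).
  apply: filterS near2 => u _ w hw; split.
    apply: (contM (vq w u (cell_csq iN jN hw))).
    exact: (kap_cont (cont_snd (w, u)) (cont_fst (w, u))).
  exact: (diffM' (diff_cst' _ _) (differentiable_kap_l _ _ _)).
exact: (diffM' (diffD O S) (diff_cst' _ _)).
Qed.

(** Holomorphy gained in one variable survives when the operator is applied in another one. *)
Lemma Qop_param_diff (v : C -> C -> C) (z u0 : C) : osq N%:R z ->
  (\forall u \near u0, forall w, csq N%:R w ->
     {for (w, u), continuous (fun q => v q.1 q.2)} /\ differentiable (v w) u) ->
  differentiable (fun u => Qop N (v^~ u) z) u0.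
Proof.
move=> zN hv.
have O : differentiable (fun u =>
    J (G 0) (G (N + N)) (G 0) (G (N + N)) (fun w => v w u / (w - z))) u0.
  apply: (J_param_diff g0 g0 (F := fun w u => v w u / (w - z))).
  apply: filterS hv => u hu w hw; have [h1 h2] := hu w (bd_csq hw); split.
    apply: (contM h1).
    apply: (contV (contB (cont_fst (w, u)) (cont_cst z (w, u)))); exact: outer_neq.
  exact: (diffM' h2 (diff_cst' _ _)).
have S : differentiable (fun u => \sum_(0 <= i < N + N) \sum_(0 <= j < N + N)
     J (G i) (G i.+1) (G j) (G j.+1) (fun w => v w u * kap (ctr N i j)^* z w)) u0.
  apply: diff_sum_nat => i iN; apply: diff_sum_nat => j jN.
  apply: (J_param_diff (gg i) (gg j) (F := fun w u => v w u * kap (ctr N i j)^* z w)).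
  apply: filterS hv => u hu w hw; have [h1 h2] := hu w (cell_csq iN jN hw); split.
    by apply: (contM h1); exact: (kap_cont (cont_cst z (w, u)) (cont_fst (w, u))).
  exact: (diffM' h2 (diff_cst' _ _)).
exact: (diffM' (diffD O S) (diff_cst' _ _)).
Qed.

End QopParameters.

(** * The operator in several variables *)

Section ModelOperatorN.
Context {R : realType} {n : nat} (T : topologicalType).
Local Notation C := R[i].
Local Notation V := 'rV[C]_n.
Variable N : nat.
Implicit Types (w : V) (t : T) (v : V * T -> C) (s : seq 'I_n).

Definition Qj (j : 'I_n) v (p : V * T) : C := Qop N (fun x => v (upd p.1 j x, p.2)) (p.1 0 j).

Definition QM v : V * T -> C := foldl (fun v j => Qj j v) v (enum 'I_n).

(* [s] lists the variables already treated, in which the domain has shrunk. *)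
Definition odom s w := forall i, osq (if i \in s then N%:R else N%:R + 1) (w 0 i).

Definition regular s v (U : set T) := forall w t, odom s w -> U t ->
  {for (w, t), continuous v} /\
  forall i, i \in s -> differentiable (fun x => v (upd w i x, t)) (w 0 i).

Lemma odom_near s w : odom s w -> \forall w' \near w, odom s w'.
Proof.
move=> h; suff : nbhs w (fun w' : V => forall i, i \in enum 'I_n ->
    osq (if i \in s then N%:R else N%:R + 1) (w' 0 i)).
  by apply: filterS => w' hw i; apply: hw; rewrite mem_enum.
elim: (enum 'I_n) => [|i e ih]; first by apply: filterS filterT => w' _ i.
have hi : nbhs w (fun w' : V => osq (if i \in s then N%:R else N%:R + 1) (w' 0 i)).
  have := @coord_cont R n i w _ (osq_near (h i)); exact.
by apply: filterS2 hi ih => w' h1 h2 k; rewrite inE => /orP[/eqP ->|/h2].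
Qed.

(** The extra [1] in [odom] is spent here: the variable of integration runs over a closed square,
    which has to lie in an open domain of regularity. *)
Lemma odom_upd s w j x : j \notin s -> csq N%:R x -> odom (rcons s j) w -> odom s (upd w j x).
Proof.
move=> js [x1 x2] h i; rewrite mxE; have [->|ij] := eqVneq i j.
  by rewrite (negbTE js); split; rewrite (le_lt_trans x1, le_lt_trans x2)// ltrDl.
by have := h i; rewrite mem_rcons inE (negbTE ij).
Qed.

Lemma regular_step s v U j : open U -> j \notin s -> regular s v U -> regular (rcons s j) (Qj j v) U.
Proof.
move=> oU js hv w t hw Ut.
have wj : osq N%:R (w 0 j) by have := hw j; rewrite mem_rcons inE eqxx.
have cv (P : topologicalType) (f : P -> V * T) p x : {for p, continuous f} ->
    odom (rcons s j) (f p).1 -> U (f p).2 -> csq N%:R x ->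
    {for (x, p), continuous (fun q : C * P => v (upd (f q.2).1 j q.1, (f q.2).2))}.
  move=> cf h1 h2 hx.
  have c1 : {for (x, p), continuous (fun q : C * P => (f q.2).1)}.
    exact: (cont_comp (cont_comp (cont_snd (x, p)) cf) (cont_fst (f p))).
  have c2 : {for (x, p), continuous (fun q : C * P => (f q.2).2)}.
    exact: (cont_comp (cont_comp (cont_snd (x, p)) cf) (cont_snd (f p))).
  have [h _] := hv _ _ (odom_upd js hx h1) h2.
  have c3 := @cont_upd R n _ (fun q : C * P => (f q.2).1) (fun q => q.1) j (x, p) c1 (cont_fst (x, p)).
  exact: (@cont_comp _ _ _ (fun q : C * P => (upd (f q.2).1 j q.1, (f q.2).2)) v (x, p) (cont_pair c3 c2) h).
split.
  have ne : \forall q \near (w, t), odom (rcons s j) q.1 /\ U q.2.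
    have k1 : \forall q \near (w, t), odom (rcons s j) q.1 by exact: (cvg_fst (odom_near hw)).
    have k2 : \forall q \near (w, t), U q.2 by exact: (cvg_snd (open_nbhs_nbhs (conj oU Ut))).
    by apply: filterS2 k1 k2.
  have h := @Qop_param_cont R N (V * T)%type (fun x q => v (upd q.1 j x, q.2)) (w 0 j) (w, t) wj.
  have cpair : {for (w, t), continuous (fun q : V * T => (q.1 0 j, q))}.
    have c1 := @cont_comp _ _ _ (fun q : V * T => q.1) (fun w : V => w 0 j) (w, t) (cont_fst (w, t)) (coord_cont j w).
    exact: (@cont_pair _ _ _ (fun q : V * T => q.1 0 j) id (w, t) c1 (cont_id (w, t))).
  apply: (@cont_comp _ _ _ (fun q : V * T => (q.1 0 j, q)) (fun q : C * (V * T) => Qop N (fun x => v (upd q.2.1 j x, q.2.2)) q.1) (w, t) cpair).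
  apply: h; apply: filterS ne => q [q1 q2] x hx.
  exact: (cv _ id q x (cont_id q) q1 q2 hx).
move=> i; have [->|ij] := eqVneq i j.
  move=> _; have E x : Qj j v (upd w j x, t) = Qop N (fun y => v (upd w j y, t)) x.
    rewrite /Qj [in RHS](_ : (fun y => v (upd w j y, t)) = (fun y => v (upd (upd w j x) j y, t))).
      congr (Qop N _ _); exact: upd_eq.
    by apply/funext => y; rewrite upd_upd.
  under eq_fun do rewrite E.
  apply: Qop_diff => // x hx; have [h _] := hv _ _ (odom_upd js hx hw) Ut.
  have c1 := @cont_upd R n _ (fun _ : C => w) id j x (cont_cstW w x) (cont_id x).
  exact: (@cont_comp _ _ _ (fun x => (upd w j x, t)) v x (cont_pair c1 (cont_cstW t x)) h).
rewrite mem_rcons inE (negbTE ij) /= => is_.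
have ji : j != i by rewrite eq_sym.
have E x : Qj j v (upd w i x, t) = Qop N (fun y => v (upd (upd w i x) j y, t)) (w 0 j).
  by congr (Qop N _ _); exact: upd_neq.
under eq_fun do rewrite E.
apply: (@Qop_param_diff R N (fun y x => v (upd (upd w i x) j y, t)) (w 0 j) (w 0 i) wj).
have cu x : {for x, continuous (fun x => upd w i x)}.
  exact: (@cont_upd R n _ (fun _ : C => w) id i x (cont_cstW w x) (cont_id x)).
have ne : \forall x \near w 0 i, odom (rcons s j) (upd w i x).
  by apply: (cu (w 0 i)); rewrite upd_id; exact: odom_near.
apply: filterS ne => x hx y hy; split.
  exact: (cv _ (fun x => (upd w i x, t)) x y (cont_pair (cu x) (cont_cstW t x)) hx Ut hy).
have [_ /(_ i is_)] := hv _ _ (odom_upd js hy hx) Ut.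
rewrite (@upd_neq R n _ j i y ij) upd_eq.
have Ef : (fun z => v (upd (upd (upd w i x) j y) i z, t)) = (fun z => v (upd (upd w i z) j y, t)).
  by apply/funext => z; rewrite [upd (upd w i x) j y](@upd_comm R n w i j x y ij) upd_upd -(@upd_comm R n w i j z y ij).
rewrite Ef; exact.
Qed.

Lemma regular_fold s r v U : open U -> uniq (s ++ r) -> regular s v U ->
  regular (s ++ r) (foldl (fun v j => Qj j v) v r) U.
Proof.
move=> oU; elim: r s v => [|j r ih] s v; first by rewrite cats0.
rewrite -cat_rcons => us hv /=; apply: (ih _ _ us); apply: (regular_step oU _ hv).
by move: us; rewrite cat_uniq rcons_uniq => /andP[/andP[]].
Qed.

Lemma QM_regular v U : open U -> regular [::] v U -> forall w t, (forall i, osq N%:R (w 0 i)) -> U t ->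
  {for (w, t), continuous (QM v)} /\ differentiable (fun w => QM v (w, t)) w.
Proof.
move=> oU hv w t hw Ut.
have h := @regular_fold [::] (enum 'I_n) v U oU (enum_uniq _) hv.
have dom w' : (forall i, osq N%:R (w' 0 i)) -> odom ([::] ++ enum 'I_n) w'.
  by move=> h' i; rewrite /= mem_enum; exact: h'.
have [c1 _] := h w t (dom w hw) Ut; split; first exact: c1.
apply: osgood; have : \forall w' \near w, odom (enum 'I_n) w'.
  by apply: odom_near; exact: dom.
apply: filterS => w' hw'; have [c2 c3] := h w' t hw' Ut; split.
  exact: (cont_comp (cont_pair (cont_id w') (cont_cstW t w')) c2).
by move=> i; apply: c3; rewrite mem_enum.
Qed.

Definition gw (w : V) : R := expR (\sum_(i < n) nc (w 0 i) ^+ 2 / 2).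

(* Applying [Qop] in one more variable turns an error [c] into [c + KQ * (1 + c)]. *)
Definition KM : R := iter n (fun c => c + KQ * (1 + c)) 0.

Definition idom s w := forall i, csq (if i \in s then N%:R - 2 else N%:R) (w 0 i).

Definition approx_near v t (eta : R) := forall a : V, (forall i, csq N%:R (a 0 i)) ->
  exists h : V -> C,
    (forall w, (forall i, nc (w 0 i - a 0 i) < 5) ->
       forall i, differentiable (fun x => h (upd w i x)) (w 0 i)) /\
    (forall w, (forall i, nc (w 0 i - a 0 i) < 5) -> (forall i, csq N%:R (w 0 i)) ->
       nc (v (w, t) - h w) <= eta * gw w).

Lemma gw_upd w j x : gw (upd w j x) =
  expR (\sum_(i | i != j) nc (w 0 i) ^+ 2 / 2) * expR (nc x ^+ 2 / 2).
Proof.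
rewrite /gw -expRD (bigD1 j) ?[xpredT j]erefl// upd_eq addrC; congr (expR (_ + _)).
by apply: eq_bigr => i ij; rewrite upd_neq.
Qed.

Lemma idomN s w : idom s w -> forall i, csq N%:R (w 0 i).
Proof.
move=> h i; have := h i; case: ifP => // _ [h1 h2].
by split; [rewrite (le_trans h1)|rewrite (le_trans h2)] => //; rewrite lerBlDr lerDl.
Qed.

(** Holomorphic approximants are known for the initial function [v0] only. A function within
    [c * eta] of [v0] is within [(1 + c) * eta] of them, and this is the error fed into [Qop_close]
    for the next variable. *)
Lemma fold_close r s v0 v t eta c U : open U -> U t -> uniq (s ++ r) -> 0 <= eta -> 0 <= c ->
  regular s v U -> approx_near v0 t eta ->
  (forall w, idom s w -> nc (v (w, t) - v0 (w, t)) <= c * (eta * gw w)) ->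
  forall w, idom (s ++ r) w ->
  nc (foldl (fun v j => Qj j v) v r (w, t) - v0 (w, t)) <= iter (size r) (fun c => c + KQ * (1 + c)) c * (eta * gw w).
Proof.
move=> oU Ut; elim: r s v c => [|j r ih] s v c; first by rewrite cats0.
rewrite -cat_rcons => us eta0 c0 rv ap hv w; rewrite [size _]/= iterSr.
have js : j \notin s by move: us; rewrite cat_uniq rcons_uniq => /andP[/andP[]].
have KQ0 := @KQ_ge0 R.
apply: (ih _ _ _ us eta0 _ _ ap).
- by rewrite addr_ge0// mulr_ge0// addr_ge0.
- exact: (regular_step oU js rv).
move=> {}w hw.
have idu x : csq N%:R x -> idom s (upd w j x).
  move=> hx i; rewrite mxE; have [->|ij] := eqVneq i j; first by rewrite (negbTE js).
  by have := hw i; rewrite mem_rcons inE (negbTE ij).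
have wj : csq (N%:R - 2) (w 0 j) by have := hw j; rewrite mem_rcons inE eqxx.
have wjN : csq N%:R (w 0 j) by exact: (idomN hw).
have ws : idom s w by rewrite -(upd_id w j); exact: idu.
pose g := expR (\sum_(i | i != j) nc (w 0 i) ^+ 2 / 2) : R.
have Q1 : nc (Qj j v (w, t) - v (w, t)) <= KQ * ((1 + c) * (eta * gw w)).
  have := @Qop_close R N (fun x => v (upd w j x, t)) ((1 + c) * (eta * g)) (w 0 j).
  have -> : (1 + c) * (eta * g) * expR (nc (w 0 j) ^+ 2 / 2) = (1 + c) * (eta * gw w).
    by rewrite -[in RHS](upd_id w j) gw_upd -/g; ring.
  rewrite /= upd_id; apply.
  - by rewrite !mulr_ge0 ?expR_ge0// addr_ge0.
  - rewrite gp0 gp2N => x /csq_rect hx.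
    have od : odom s (upd w j x).
      apply: (odom_upd js hx) => i; have := hw i; case: ifP => _ [h1 h2]; split.
      + by rewrite (le_lt_trans h1)// ltrBlDr ltrDl.
      + by rewrite (le_lt_trans h2)// ltrBlDr ltrDl.
      + by rewrite (le_lt_trans h1)// ltrDl.
      + by rewrite (le_lt_trans h2)// ltrDl.
    have [h _] := rv _ _ od Ut.
    have c1 := @cont_upd R n _ (fun _ : C => w) id j x (cont_cstW w x) (cont_id x).
    exact: (@cont_comp _ _ _ (fun x => (upd w j x, t)) v x (cont_pair c1 (cont_cstW t x)) h).
  - by case: wj.
  move=> a /csq_rect ha.
  have [h [dh vh]] := ap (upd w j a) (idomN (idu a ha)).
  have near x : nc (x - a) < 5 -> forall i, nc (upd w j x 0 i - upd w j a 0 i) < 5.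
    by move=> hx i; rewrite !mxE; case: eqP => // _; rewrite subrr nc0.
  exists (fun x => h (upd w j x)); split.
    move=> x /near hx; have := dh _ hx j; rewrite upd_eq.
    by under eq_fun do rewrite upd_upd.
  move=> x hxa /csq_rect hx.
  have h1 := vh _ (near x hxa) (idomN (idu x hx)); have h2 := hv _ (idu x hx).
  have E : (1 + c) * (eta * g) * expR (nc x ^+ 2 / 2) = (1 + c) * (eta * gw (upd w j x)).
    by rewrite gw_upd -/g; ring.
  rewrite E; have := ncD (v (upd w j x, t) - v0 (upd w j x, t)) (v0 (upd w j x, t) - h (upd w j x)).
  by rewrite addrA subrK; lra.
have := ncD (Qj j v (w, t) - v (w, t)) (v (w, t) - v0 (w, t)); rewrite addrA subrK.
by have := hv w ws; lra.
Qed.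

Lemma QM_close v t eta U : open U -> U t -> 0 <= eta -> regular [::] v U -> approx_near v t eta ->
  forall w, (forall i, csq (N%:R - 2) (w 0 i)) ->
  nc (QM v (w, t) - v (w, t)) <= KM * (eta * gw w).
Proof.
move=> oU Ut eta0 rv ap w hw.
have := @fold_close (enum 'I_n) [::] v v t eta 0 U oU Ut (enum_uniq _) eta0 (lexx 0) rv ap.
rewrite size_enum_ord => h; apply: h.
  by move=> w' _; rewrite subrr nc0 mul0r.
by move=> i; rewrite /= mem_enum; exact: hw.
Qed.

Lemma KM_ge0 : 0 <= KM.
Proof.
by rewrite /KM; elim: n => //= k ih; rewrite addr_ge0// mulr_ge0 ?KQ_ge0// addr_ge0.
Qed.

End ModelOperatorN.

(** * Gluing *)

Section Gluing.
Context {R : realType} {X J : Type}.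
Local Notation C := R[i].
Variables (U : J -> set X) (ctr : J -> X) (mu : X -> R) (cont : (X -> C) -> Prop) (hol : J -> (X -> C) -> Prop).
Hypothesis ctrU : forall j, U j (ctr j).
Hypothesis mu0 : forall x, 0 < mu x.
Hypothesis hol_sum : forall j (I : finType) (a : I -> C) (f : I -> X -> C),
  (forall i, a i != 0 -> hol j (f i)) -> hol j (fun x => \sum_i a i * f i x).

Definition approx (u : X -> C) (eta : R) := cont u /\ forall j, exists h, hol j h /\
  forall x, U j x -> nc (u x - h x) * mu x <= eta.

(* Freezing the weights [psi] at [ctr j] gives a function holomorphic on [U j]; as the weights sum
   to [1], the error is [osc] times the distance from the [Q i u] to [u]. *)
Lemma glue_step (I : finType) (psi : I -> X -> R) (Q : I -> (X -> C) -> (X -> C)) (K osc eta : R) u :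
  0 <= K -> 0 <= eta -> K * osc <= 1 / 2 ->
  (forall i x, 0 <= psi i x) -> (forall x, \sum_i psi i x = 1) ->
  (forall i x, psi i x != 0 -> nc (Q i u x - u x) * mu x <= K * eta) ->
  (forall i j x, U j x -> psi i x != 0 -> hol j (Q i u) /\
     forall y, U j y -> nc (Q i u y - u y) * mu y <= K * eta) ->
  (forall j x, U j x -> \sum_i `|psi i x - psi i (ctr j)| <= osc) ->
  cont (fun x => \sum_i (psi i x)%:C * Q i u x) ->
  exists u', (forall x, nc (u' x - u x) * mu x <= K * eta) /\ approx u' (eta / 2).
Proof.
move=> K0 eta0 Kosc psi0 psi1 close1 close2 hosc ct.
exists (fun x => \sum_i (psi i x)%:C * Q i u x); split.
  move=> x; have -> : \sum_i (psi i x)%:C * Q i u x - u x = \sum_i (psi i x)%:C * (Q i u x - u x).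
    under [RHS]eq_bigr do rewrite mulrBr; rewrite sumrB -mulr_suml.
    by rewrite -rmorph_sum psi1 mul1r.
  have -> : K * eta = \sum_i psi i x * (K * eta) by rewrite -mulr_suml psi1 mul1r.
  rewrite (le_trans (ler_wpM2r (ltW (mu0 x)) (nc_sum _ _ _)))// mulr_suml; apply: ler_sum => i _.
  rewrite ncM ncR ger0_norm// -mulrA; have [->|p0] := eqVneq (psi i x) 0; first by rewrite !mul0r.
  by rewrite ler_wpM2l// close1.
split=> // j; exists (fun x => \sum_i (psi i (ctr j))%:C * Q i u x); split.
  apply: hol_sum => i p0; have {}p0 : psi i (ctr j) != 0 by apply: contra p0 => /eqP ->.
  by have [] := close2 i j (ctr j) (ctrU j) p0.
move=> x Ux; have -> : \sum_i (psi i x)%:C * Q i u x - \sum_i (psi i (ctr j))%:C * Q i u x =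
    \sum_i (psi i x - psi i (ctr j))%:C * (Q i u x - u x).
  transitivity (\sum_i (psi i x - psi i (ctr j))%:C * Q i u x - (\sum_i (psi i x - psi i (ctr j))%:C) * u x).
    rewrite -rmorph_sum sumrB !psi1 subrr mul0r subr0 -sumrB; apply: eq_bigr => i _.
    by rewrite rmorphB mulrBl.
  by rewrite mulr_suml -sumrB; apply: eq_bigr => i _; rewrite mulrBr.
rewrite (le_trans (ler_wpM2r (ltW (mu0 x)) (nc_sum _ _ _)))// mulr_suml.
apply: (@le_trans _ _ (\sum_i `|psi i x - psi i (ctr j)| * (K * eta))).
  apply: ler_sum => i _; rewrite ncM ncR -mulrA.
  have [p0|p0] := eqVneq (psi i x) 0; last first.
    by rewrite ler_wpM2l//; have [_] := close2 i j x Ux p0; exact.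
  have [q0|q0] := eqVneq (psi i (ctr j)) 0; first by rewrite p0 q0 subrr normr0 !mul0r.
  by rewrite ler_wpM2l//; have [_] := close2 i j _ (ctrU j) q0; exact.
rewrite -mulr_suml; have := hosc j x Ux; have : 0 <= K * eta by exact: mulr_ge0.
move=> a1 a2; apply: (le_trans (ler_wpM2r a1 a2)).
by rewrite mulrA [eta / 2]mulrC ler_wpM2r// mulrC; lra.
Qed.

(** The displacements [K * eta / 2 ^+ m] sum to [2 * K * eta]. As [cont] and [hol] are abstract, the
    conclusion does not assert them of the limit, but provides arbitrarily good approximate
    solutions arbitrarily close to it. *)
Lemma glue_limit (K eta : R) u0 : 0 <= K -> 0 <= eta -> approx u0 eta ->
  (forall u e, 0 <= e -> approx u e -> exists u', (forall x, nc (u' x - u x) * mu x <= K * e) /\ approx u' (e / 2)) ->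
  exists u, (forall x, nc (u x - u0 x) * mu x <= 2 * K * eta) /\
    forall e, 0 < e -> exists v, approx v e /\ forall x, nc (u x - v x) * mu x <= e.
Proof.
move=> K0 eta0 ap0 step.
(* Outside the hypotheses the step returns its argument, and so becomes a total function that can be
   iterated. *)
have /choice[F hF] : forall ue : (X -> C) * R, exists u', 0 <= ue.2 -> approx ue.1 ue.2 ->
    (forall x, nc (u' x - ue.1 x) * mu x <= K * ue.2) /\ approx u' (ue.2 / 2).
  move=> [u e] /=; have [e0|e0] := leP 0 e; last by exists u.
  by have [ap|nap] := pselect (approx u e); [have [u' h] := step u e e0 ap; exists u'|exists u].
pose e m := eta / 2 ^+ m.
have e0 m : 0 <= e m by rewrite divr_ge0// exprn_ge0.
have eS m : e m.+1 = e m / 2 by rewrite /e exprS invfM; ring.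
pose u := fix u m := if m is m'.+1 then F (u m', e m') else u0.
have apu m : approx (u m) (e m).
  elim: m => [|m ih]; first by rewrite /e expr0 divr1.
  by rewrite eS; have [_ h] := hF (u m, e m) (e0 m) ih; exact: h.
have uS m x : nc (u m.+1 x - u m x) * mu x <= K * e m.
  by have [h _] := hF (u m, e m) (e0 m) (apu m); exact: h.
have ud m p x : nc (u (m + p)%N x - u m x) * mu x <= 2 * K * (e m - e (m + p)%N).
  elim: p => [|p ih]; first by rewrite addn0 !subrr nc0 mul0r mulr0.
  rewrite addnS; have := ler_wpM2r (ltW (mu0 x)) (ncD (u (m + p).+1 x - u (m + p)%N x) (u (m + p)%N x - u m x)).
  rewrite addrA subrK mulrDl; have := uS (m + p)%N x; have := eS (m + p)%N; move: ih.
  have E : 2 * K * (e m - e (m + p)%N / 2) = 2 * K * (e m - e (m + p)%N) + K * e (m + p)%N by field.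
  by move=> h1 -> h2 h3; rewrite E; lra.
have e_small d : 0 < d -> exists m, e m <= d.
  move=> d0; have [m hm] : exists m : nat, eta / d < m%:R.
    by have := archi_boundP (divr_ge0 eta0 (ltW d0)); exists (Num.bound (eta / d)).
  exists m; rewrite /e ler_pdivrMr ?exprn_gt0// -ler_pdivrMl// mulrC.
  apply: (le_trans (ltW hm)); rewrite -natrX ler_nat.
  exact: ltnW (ltn_expl m (isT : (1 < 2)%N)).
have e_mon m p : e (m + p)%N <= e m.
  by rewrite /e exprD ler_wpM2l// lef_pV2 ?posrE ?mulr_gt0 ?exprn_gt0// ler_peMr ?exprn_ge0// exprn_ege1 ?ler1n.
have lim x : exists l : C, forall m, nc (l - u m x) * mu x <= 2 * K * e m.
  have ab m p : nc (u (m + p)%N x - u m x) * mu x <= 2 * K * e m.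
    by rewrite (le_trans (ud m p x))// ler_wpM2l ?mulr_ge0// gerBl.
  have cau (f : C -> R) : (forall a b, `|f a - f b| <= nc (a - b)) -> cvgn (fun m => f (u m x)).
    move=> hf; apply/cauchy_cvgP/cauchy_exP => d d0.
    have [m hm] := e_small (d * mu x / (8 * K + 8)) ltac:(by rewrite divr_gt0 ?mulr_gt0//; lra).
    have bound q : (m <= q)%N -> `|f (u q x) - f (u m x)| <= d / 4.
      move=> mq; rewrite (le_trans (hf _ _))// -(ler_pM2r (mu0 x)).
      have := ab m (q - m)%N; rewrite subnKC// => h1; apply: (le_trans h1).
      move: hm; rewrite ler_pdivlMr; last by lra.
      by have := e0 m; have := mu0 x; nra.
    exists (f (u m x)).
    have : \forall q \near \oo, ball (f (u m x)) d (f (u q x)).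
      near=> q; have mq : (m <= q)%N by near: q; exact: nbhs_infty_ge.
      have := bound q mq; rewrite -ball_normE /= distrC; lra.
    by apply.
  have [c1 c2] : cvgn (fun m => complex.Re (u m x)) /\ cvgn (fun m => complex.Im (u m x)).
    split; apply: cau => a b.
    - by rewrite -raddfB; exact: Re_le_nc.
    - by rewrite -raddfB; exact: Im_le_nc.
  pose l := (limn (fun m => complex.Re (u m x)))%:C + 'i%C * (limn (fun m => complex.Im (u m x)))%:C.
  exists l => m.
  have cl : (fun p => nc (u p x - u m x) * mu x) @ \oo --> nc (l - u m x) * mu x.
    apply: cvgM; last exact: cvg_cst.
    apply: cvg_nc; apply: cvg_cB; last exact: cvg_cst.
    have -> : (fun p => u p x) = (fun p => (complex.Re (u p x))%:C + 'i%C * (complex.Im (u p x))%:C).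
      by apply/funext => p; rewrite -complexE'.
    apply: cvg_cD; first exact: (cvg_RC c1).
    by apply: cvg_cM; [exact: cvg_cst|exact: (cvg_RC c2)].
  apply/ler_addgt0Pl => d d0; have h : \forall p \near \oo, `|nc (u p x - u m x) * mu x - nc (l - u m x) * mu x| <= d.
    by move: cl => /cvgr_RP/(_ d d0).
  have [p [hp mp]] := filter_ex (filterI h (nbhs_infty_ge m)).
  have := ab m (p - m)%N; rewrite subnKC//; move: hp; rewrite ler_norml => /andP[].
  by lra.
have [l hl] := choice lim; exists l; split.
  by move=> x; have := hl x 0%N; rewrite /e expr0 divr1.
move=> d d0; have [m hm] := e_small (Num.min d (d / (2 * K + 1))) ltac:(by rewrite lt_min d0 divr_gt0//; lra).
move: hm; rewrite le_min => /andP[h1 h2].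
exists (u m); split.
  have [cu hu] := apu m; split=> // j; have [h [hh hx]] := hu j; exists h; split=> // x Ux.
  exact: le_trans (hx x Ux) h1.
move=> x; apply: (le_trans (hl x m)); move: h2; rewrite ler_pdivlMr; last by lra.
by have := e0 m; lra.
Unshelve. all: by end_near.
Qed.

End Gluing.

(** * Tent functions and the variation of their products *)

Section Tents.
Context {R : realType}.
Implicit Types (s t : R).

Definition clamp (M s : R) : R := Num.max 0 (Num.min M s).
Definition clip := clamp 1.
(** Written as a difference, the integer translates telescope, and their total variation reduces to
    that of the translates of [clip]. *)
Definition tent s : R := clip (s + 1) - clip s.

Lemma clampP M s : 0 <= M ->
  [\/ s <= 0 /\ clamp M s = 0, 0 <= s <= M /\ clamp M s = s | M <= s /\ clamp M s = M].
Proof.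
move=> M0; rewrite /clamp; have [Ms|/ltW sM] := leP M s.
  by apply: Or33; split=> //; apply/max_idPr.
have [s0|/ltW s0] := leP s 0; first by apply: Or31; split=> //; apply/max_idPl.
by apply: Or32; rewrite s0 sM; split=> //; apply/max_idPr.
Qed.

Lemma clamp_le M s t : 0 <= M -> s <= t -> clamp M s <= clamp M t <= clamp M s + (t - s).
Proof.
move=> M0 st; case: (clampP s M0) => -[h ->]; case: (clampP t M0) => -[h' ->];
  try (move/andP: h => [h1 h2]); try (move/andP: h' => [h3 h4]); apply/andP; split; lra.
Qed.

Lemma clampS M s : 0 <= M -> clamp M s + clip (s - M) = clamp (M + 1) s.
Proof.
move=> M0; have M1 : 0 <= M + 1 by lra.
rewrite /clip; case: (clampP s M0) => -[h ->]; case: (clampP s M1) => -[h' ->]; case: (clampP (s - M) ler01) => -[h2 ->];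
  try (move/andP: h => [? ?]); try (move/andP: h' => [? ?]); try (move/andP: h2 => [? ?]); lra.
Qed.

Lemma clip_le s t : s <= t -> clip s <= clip t.
Proof. by move=> st; have /andP[] := clamp_le ler01 st. Qed.

Lemma clip_lo s : s <= 0 -> clip s = 0.
Proof. by move=> h; rewrite /clip; case: (clampP s ler01) => -[]; [|move=> /andP[]|]; lra. Qed.

Lemma clip_hi s : 1 <= s -> clip s = 1.
Proof. by move=> h; rewrite /clip; case: (clampP s ler01) => -[]; [|move=> /andP[]|]; lra. Qed.

Lemma tent_ge0 s : 0 <= tent s.
Proof. by rewrite subr_ge0 clip_le// lerDl. Qed.

Lemma tent_supp s : tent s != 0 -> `|s| < 1.
Proof.
apply: contraNT; rewrite -leNgt ler_normr => /orP[] h; apply/eqP; rewrite /tent.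
  by rewrite !clip_hi ?subrr//; lra.
by rewrite !clip_lo ?subrr//; lra.
Qed.

Lemma tent_sum (M : nat) s : 0 <= s -> s <= M%:R -> \sum_(p < M.+1) tent (s - p%:R) = 1.
Proof.
move=> s0 sM; have h m : \sum_(p < m.+1) tent (s - p%:R) = clip (s + 1) - clip (s - m%:R).
  elim: m => [|m ih]; first by rewrite big_ord1 subr0.
  rewrite big_ord_recr /= ih /tent -natr1.
  have -> : s - (m%:R + 1) + 1 = s - m%:R by ring.
  by ring.
by rewrite h clip_hi ?clip_lo ?subr0//; lra.
Qed.

Lemma tent_cont s : {for s, continuous tent}.
Proof.
have cc t : {for t, continuous clip}.
  apply: continuous_max; first exact: cst_continuous.
  by apply: continuous_min; [exact: cst_continuous|exact: cvg_id].
apply: cvgB; last exact: cc.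
apply: (@continuous_comp _ _ _ (fun s => s + 1) clip); last exact: cc.
by apply: cvgD; [exact: cvg_id|exact: cvg_cst].
Qed.

(** All increments have the same sign, and the translates sum to [clamp M], a function with
    Lipschitz constant [1]. The bound is thus free of the number of translates. *)
Lemma clip_sum_lip (M : nat) s t : \sum_(p < M) `|clip (s - p%:R) - clip (t - p%:R)| <= `|s - t|.
Proof.
wlog st : s t / t <= s.
  move=> h; have [|/ltW] := leP t s; first exact: h.
  move=> /h; rewrite distrC; under eq_bigr do rewrite distrC; exact.
rewrite ger0_norm ?subr_ge0//.
have -> : \sum_(p < M) `|clip (s - p%:R) - clip (t - p%:R)| = \sum_(p < M) (clip (s - p%:R) - clip (t - p%:R)).
  by apply: eq_bigr => p _; rewrite ger0_norm// subr_ge0 clip_le// lerD2r.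
have cs m r : \sum_(p < m) clip (r - p%:R) = clamp m%:R r.
  elim: m => [|m ih]; last by rewrite big_ord_recr /= ih clampS// natr1.
  by rewrite big_ord0; case: (clampP r (lexx 0)) => -[]; [|move=> /andP[]|]; lra.
by rewrite sumrB !cs; have /andP[] := clamp_le (ler0n R M) st; lra.
Qed.

Lemma tent_sum_lip (M : nat) s t : \sum_(p < M) `|tent (s - p%:R) - tent (t - p%:R)| <= 2 * `|s - t|.
Proof.
apply: (@le_trans _ _ (\sum_(p < M) `|clip (s + 1 - p%:R) - clip (t + 1 - p%:R)| + \sum_(p < M) `|clip (s - p%:R) - clip (t - p%:R)|)).
  rewrite -big_split /=; apply: ler_sum => p _; rewrite /tent.
  have -> : s - p%:R + 1 = s + 1 - p%:R by ring.
  have -> : t - p%:R + 1 = t + 1 - p%:R by ring.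
  rewrite (le_trans _ (ler_normB _ _))// le_eqVlt; apply/orP; left; apply/eqP; congr `|_|; ring.
have h1 := clip_sum_lip M (s + 1) (t + 1); have h2 := clip_sum_lip M s t.
have e : s + 1 - (t + 1) = s - t by ring.
by rewrite e in h1; lra.
Qed.

(* Hybrid argument: replace the factors one at a time. *)
Lemma prod_dist (K P : finType) (a b : K -> P -> R) :
  (forall k p, 0 <= a k p) -> (forall k p, 0 <= b k p) ->
  (forall k, \sum_p a k p = 1) -> (forall k, \sum_p b k p = 1) ->
  \sum_(f : {ffun K -> P}) `|\prod_k a k (f k) - \prod_k b k (f k)| <= \sum_k \sum_p `|a k p - b k p|.
Proof.
move=> a0 b0 a1 b1.
pose c (s : seq K) k p := if k \in s then a k p else b k p.
have c0 (s : seq K) k p : 0 <= c s k p by rewrite /c; case: ifP.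
have c1 (s : seq K) k : \sum_p c s k p = 1 by rewrite /c; case: (k \in s).
suff h (s : seq K) : uniq s -> \sum_(f : {ffun K -> P}) `|\prod_k c s k (f k) - \prod_k b k (f k)| <=
    \sum_(k <- s) \sum_p `|a k p - b k p|.
  have := h (enum K) (enum_uniq _); rewrite big_enum /=; apply: le_trans; apply: ler_sum => f _.
  by rewrite /c; under [in X in _ <= `|X - _|]eq_bigr do rewrite mem_enum.
elim: s => [|k0 s ih] /=.
  move=> _; rewrite big_nil; under eq_bigr do rewrite subrr normr0.
  by rewrite big1.
move=> /andP[ks us]; rewrite big_cons.
pose d k p := if k == k0 then `|a k p - b k p| else c s k p.
have dE : \sum_(f : {ffun K -> P}) \prod_k d k (f k) = \sum_p `|a k0 p - b k0 p|.
  rewrite -bigA_distr_bigA (bigD1 k0)//= [X in _ * X]big1 ?mulr1.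
    by apply: eq_bigr => p _; rewrite /d eqxx.
  by move=> k kk; rewrite /d (negbTE kk) c1.
rewrite -dE (le_trans _ (lerD (lexx _) (ih us)))// -big_split; apply: ler_sum => f _ /=.
have -> : \prod_k d k (f k) = `|\prod_k c (k0 :: s) k (f k) - \prod_k c s k (f k)|.
  rewrite (bigD1 k0)//= [X in X - _](bigD1 k0)//= [X in _ - X](bigD1 k0)//=.
  have E1 : \prod_(i | i != k0) c (k0 :: s) i (f i) = \prod_(i | i != k0) c s i (f i).
    by apply: eq_bigr => i ik; rewrite /c inE (negbTE ik).
  have E2 : \prod_(i | i != k0) d i (f i) = \prod_(i | i != k0) c s i (f i).
    by apply: eq_bigr => i ik; rewrite /d (negbTE ik).
  rewrite E1 E2 -mulrBl normrM /d /c inE eqxx (negbTE ks) /=; congr (_ * _).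
  by rewrite ger0_norm//; apply: prodr_ge0 => i _; case: (i \in s).
have := ler_normD (\prod_k c (k0 :: s) k (f k) - \prod_k c s k (f k)) (\prod_k c s k (f k) - \prod_k b k (f k)).
by rewrite addrA subrK.
Qed.

End Tents.

(** * Foliated charts and sections of powers *)

Section AffineMaps.
Context {R : realType} {n : nat}.
Local Notation C := R[i].
Local Notation V := 'rV[C]_n.
Implicit Types (w z : V) (B : 'M[C]_n).

Lemma vn_cont w : {for w, continuous (@vn R V)}.
Proof.
apply/contRP => e e0; apply/(nearV w (fun x => `|vn x - vn w| <= e)).
exists e => // h he; apply: le_trans he.
have a1 := vnD w h; have a2 := vnD (w + h) (- h); rewrite addrK vnN in a2.
by rewrite ler_norml; apply/andP; split; lra.
Qed.

Lemma unit_ballE w : unit_ball w <-> \sum_i nc (w 0 i) ^+ 2 < 1.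
Proof.
rewrite /unit_ball /= -ltcR rmorph_sum /=.
by under [X in _ <-> X < _]eq_bigr do rewrite rmorphXn /= -ncE.
Qed.

Lemma open_unit_ball : open (@unit_ball R n).
Proof.
rewrite openE => w hw; have {}hw := (unit_ballE w).1 hw.
pose f := fun z : V => \sum_i ((nc (z 0 i))%:C) ^+ 2 : C.
have cf : {for w, continuous f}.
  apply: cont_sum => i; apply: contX; apply: cont_RC; apply: (@cont_nc R V); exact: coord_cont.
have fE z : complex.Re (f z) = \sum_i nc (z 0 i) ^+ 2.
  rewrite /f Re_sum; apply: eq_bigr => i _.
  by rewrite -rmorphXn.
have /contRP h := @cont_Re R V f w cf.
have {h} := h ((1 - \sum_i nc (w 0 i) ^+ 2) / 2) ltac:(lra).
apply: filterS => z; rewrite !fE => hz; apply/unit_ballE; move: hz; rewrite ler_norml; lra.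
Qed.

Lemma unit_ball_near w : unit_ball w -> \forall z \near w, unit_ball z.
Proof. by move=> h; exact: (open_nbhs_nbhs (conj open_unit_ball h)). Qed.

Lemma cont_mulmx B w : {for w, continuous (fun z : V => z *m B)}.
Proof.
have E : (fun z : V => \row_j (\sum_k z 0 k * B k j)) =1 (fun z : V => z *m B).
  by move=> z; apply/rowP => j; rewrite !mxE.
apply: (cont_ext E); apply: (@cont_row R n V (fun j z => \sum_k z 0 k * B k j)) => j.
by apply: cont_sum => k; apply: contM; [exact: coord_cont|exact: cont_cst].
Qed.

Lemma diff_mulmx B w : differentiable (fun z : V => z *m B) w.
Proof. by apply: (@linear_differentiable C V V (mulmxr B) w) => z; exact: cont_mulmx. Qed.

Lemma diff_affine z0 B w : differentiable (fun z : V => z0 + z *m B) w.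
Proof. by apply: differentiableD; [exact: differentiable_cst|exact: diff_mulmx]. Qed.

Lemma diff_affineV z0 B w : differentiable (fun z : V => (z - z0) *m B) w.
Proof.
have -> : (fun z : V => (z - z0) *m B) = (fun z : V => - (z0 *m B) + z *m B).
  by apply/funext => z; rewrite mulmxBl addrC.
exact: diff_affine.
Qed.

Lemma diff_coord i w : differentiable (fun z : V => z 0 i) w.
Proof. exact: differentiable_coord. Qed.

Lemma diff_compV (f : V -> V) (g : V -> C) w :
  differentiable f w -> differentiable g (f w) -> differentiable (fun z => g (f z)) w.
Proof. by move=> hf hg; exact: differentiable_comp hf hg. Qed.

Lemma diff_coord_of (f : V -> V) i w : differentiable f w -> differentiable (fun z => f z 0 i) w.
Proof. by move=> hf; exact: (@diff_compV f (fun z => z 0 i) w hf (diff_coord i (f w))). Qed.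

Lemma diff_upd (f : V -> C) w i x : differentiable f (upd w i x) ->
  differentiable (fun y => f (upd w i y)) x.
Proof.
move=> hf; have h : differentiable (fun y : C => upd w i 0 + y *: delta_mx 0 i) x.
  apply: differentiableD; first exact: differentiable_cst.
  exact: (@differentiableZl _ C V id (delta_mx 0 i : V) x (diff_id' x)).
have E y : upd w i y = upd w i 0 + y *: delta_mx 0 i.
  apply/rowP => j; rewrite !mxE eqxx /=; case: eqP => _; first by rewrite mulr1 add0r.
  by rewrite mulr0 addr0.
rewrite E in hf; have -> : (fun y => f (upd w i y)) = f \o (fun y : C => upd w i 0 + y *: delta_mx 0 i).
  by apply/funext => y; rewrite /= -E.
exact: (differentiable_comp h hf).
Qed.

Lemma diff_line (f : V -> C) (z v : V) (x : C) : differentiable f (z + x *: v) ->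
  differentiable (fun y : C => f (z + y *: v)) x.
Proof.
move=> hf; have h : differentiable (fun y : C => z + y *: v) x.
  apply: differentiableD; first exact: differentiable_cst.
  exact: (@differentiableZl _ C V id v x (diff_id' x)).
exact: (differentiable_comp h hf).
Qed.

(** Osgood's lemma reduces this to the uniform continuity argument for limits and to [weierstrass]
    on each coordinate line. *)
Lemma weierstrassN (G : V -> C) (a : V) (r : R) : 0 < r ->
  (forall e : R, 0 < e -> exists f, (forall w, vn (w - a) < r -> differentiable f w) /\
     forall w, vn (w - a) < r -> nc (f w - G w) <= e) ->
  differentiable G a.
Proof.
move=> r0 H; apply: osgood; apply/(nearV a (fun w => {for w, continuous G} /\
   forall i, differentiable (fun x => G (upd w i x)) (w 0 i))).
exists (r / 8); first by rewrite divr_gt0.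
move=> h hr; set w := a + h.
have wa : vn (w - a) < r by rewrite /w addrAC subrr add0r; lra.
split.
  apply/contP => e e0; have e3 : 0 < e / 3 by rewrite divr_gt0.
  have [f [df fG]] := H (e / 3) e3.
  have c1 := (contP f w).1 (diff_cont (df w wa)) (e / 3) e3.
  have c2 : \forall z \near w, vn (z - a) < r.
    apply/(nearV w (fun z => vn (z - a) < r)); exists (r / 8); first by rewrite divr_gt0.
    move=> u hu; have := vnD (w - a) u; rewrite addrAC => E; apply: (le_lt_trans E).
    by rewrite /w addrAC subrr add0r; lra.
  apply: filterS2 c1 c2 => z h1 h2; have := fG z h2; have := fG w wa.
  have := ncB (f z - f w) (f z - G z); have := ncD (f z - f w - (f z - G z)) (f w - G w).
  have -> : f z - f w - (f z - G z) + (f w - G w) = G z - G w by ring.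
  by lra.
move=> i; apply: (@weierstrass R (fun x => G (upd w i x)) (w 0 i) (r / 8)); first by rewrite divr_gt0.
move=> e e0; have [f [df fG]] := H e e0; exists (fun x => f (upd w i x)).
have B x : sq (w 0 i) (r / 8) x -> vn (upd w i x - a) < r.
  move=> /nc_sq hx; apply: (@le_lt_trans _ _ (r / 2)); last by lra.
  apply: vn_le_row => [|j]; first by lra.
  have hj := nc_le_vn h; rewrite !mxE; case: eqP => [->|_].
    have := ncD (x - w 0 i) (h 0 i); have := hj i.
    have -> : x - w 0 i + h 0 i = x - a 0 i by rewrite /w mxE; ring.
    by lra.
  by have -> : a 0 j + h 0 j - a 0 j = h 0 j; [ring|have := hj j; lra].
split=> x /B hx; last exact: fG.
by apply: diff_upd; exact: df.
Qed.

End AffineMaps.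

(** * Plaques and holomorphy along the leaves *)

Section Plaques.
Context {R : realType} {X : topologicalType} {n : nat} (L : lamination R X n).
Local Notation C := R[i].
Local Notation V := 'rV[C]_n.
Implicit Types (c d : chart R X n) (f : X -> C).

Lemma chart_invK' c z t : unit_ball z -> chart_map c (chart_inv c (z, t)) = (z, t).
Proof. by move=> h; apply: (@chart_invK R X n c); rewrite inE. Qed.

Lemma chart_mapK' c x : chart_dom c x -> chart_inv c (chart_map c x) = x.
Proof. by move=> h; apply: (@chart_mapK R X n c); rewrite inE. Qed.

Lemma chart_ball c x : chart_dom c x -> unit_ball (chart_map c x).1.
Proof. by move=> /(chart_map_box (c := c)). Qed.

Lemma chart_inv_dom' c z t : unit_ball z -> chart_dom c (chart_inv c (z, t)).
Proof. by move=> h; exact: chart_inv_dom. Qed.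

Lemma open_box (T : topologicalType) : open (@box R n T).
Proof. by apply: (@open_comp _ _ fst) => [p _|]; [exact: cont_fst|exact: open_unit_ball]. Qed.

Lemma chart_map_cont c x : chart_dom c x -> {for x, continuous (chart_map c)}.
Proof.
move=> h; have := @chart_map_continuous R X n c; rewrite continuous_open_subspace; last exact: chart_dom_open.
by move=> /(_ x); apply; rewrite inE.
Qed.

Lemma chart_inv_cont c z t : unit_ball z -> {for (z, t), continuous (chart_inv c)}.
Proof.
move=> h; have := @chart_inv_continuous R X n c; rewrite continuous_open_subspace; last exact: open_box.
by move=> /(_ (z, t)); apply; rewrite inE.
Qed.

Lemma plaque_cont c z t : unit_ball z -> {for z, continuous (fun w => chart_inv c (w, t))}.
Proof.
move=> h; have c1 : {for z, continuous (fun w : V => (w, t))} := cont_pair (cont_id z) (cont_cstW t z).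
exact: (@cont_comp _ _ _ (fun w : V => (w, t)) (chart_inv c) z c1 (@chart_inv_cont c z t h)).
Qed.

Lemma plaque_near c z t (P : set X) : unit_ball z -> (\forall y \near chart_inv c (z, t), P y) ->
  nbhs z (fun w : V => P (chart_inv c (w, t))).
Proof. by move=> h; exact: (@plaque_cont c z t h P). Qed.

(** A plaque of [c] can leave [d] and come back in another plaque of [d], so the transverse
    coordinate is constant only near [z]. *)
Lemma plaque c d z t : atlas L c -> atlas L d -> unit_ball z -> chart_dom d (chart_inv c (z, t)) ->
  \forall w \near z, [/\ unit_ball w, chart_dom d (chart_inv c (w, t)),
    (chart_map d (chart_inv c (w, t))).2 = (chart_map d (chart_inv c (z, t))).2
    & differentiable (fun w => (chart_map d (chart_inv c (w, t))).1) w].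
Proof.
move=> ac ad hz hd; have [[ht hdiff] _] := atlas_compatible ac ad.
have [t' ht'] := ht (z, t) (conj hz hd).
have k1 := unit_ball_near hz.
have k2 : nbhs z (fun w : V => chart_dom d (chart_inv c (w, t))).
  exact: (plaque_near hz (open_nbhs_nbhs (conj (chart_dom_open d) hd))).
have k3 : nbhs z (fun w : V => (transition d (w, t)).2 = t' t).
  exact: (cont_pair (cont_id z) (cont_cstW t z) ht').
have ez := nbhs_singleton k3.
apply: filterS2 (filterI k1 k2) k3 => w [h1 h2] h3; split=> //.
- by move: ez h3; rewrite /transition => -> ->.
- exact: (hdiff w t (conj h1 h2)).
Qed.

Definition hol f x := forall c z t, atlas L c -> unit_ball z -> chart_inv c (z, t) = x ->
  differentiable (fun w => f (chart_inv c (w, t))) z.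

(** Near [x], a plaque of any other chart is mapped holomorphically into the plaque of [d] through
    [x]. *)
Lemma hol_chart d f x : atlas L d -> chart_dom d x ->
  differentiable (fun w => f (chart_inv d (w, (chart_map d x).2))) (chart_map d x).1 -> hol f x.
Proof.
move=> ad hx hf c z t ac hz ex.
have pl := plaque ac ad hz (t := t); rewrite ex in pl; have {}pl := pl hx.
have [_ _ _ d1] := nbhs_singleton pl.
have h : differentiable (fun w => f (chart_inv d ((chart_map d (chart_inv c (w, t))).1, (chart_map d x).2))) z.
  apply: (@diff_compV R n (fun w => (chart_map d (chart_inv c (w, t))).1)
     (fun w => f (chart_inv d (w, (chart_map d x).2)))); first exact: d1.
  rewrite ex; exact: hf.
have [] := @diff_near R V _ (fun w => f (chart_inv c (w, t))) z _ h; last by [].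
apply: filterS pl => w [_ h1 h2 _].
by rewrite -h2 -surjective_pairing chart_mapK'.
Qed.

Lemma hol_near f h x : (\forall y \near x, f y = h y) -> hol f x -> hol h x.
Proof.
move=> fh hf c z t ac hz ex; have df := hf c z t ac hz ex.
have k : nbhs z (fun w : V => f (chart_inv c (w, t)) = h (chart_inv c (w, t))).
  by apply: (@plaque_near c z t (fun y => f y = h y) hz); rewrite ex.
by have [] := @diff_near R V _ (fun w => h (chart_inv c (w, t))) z k df.
Qed.

Lemma holM f h x : hol f x -> hol h x -> hol (fun y => f y * h y) x.
Proof. by move=> h1 h2 c z t ac hz ex; exact: diffM' (h1 c z t ac hz ex) (h2 c z t ac hz ex). Qed.

Lemma holX f k x : hol f x -> hol (fun y => f y ^+ k) x.
Proof. by move=> h1 c z t ac hz ex; exact: (diffX k (h1 c z t ac hz ex)). Qed.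

Lemma hol_sum (I : finType) (a : I -> C) (f : I -> X -> C) x :
  (forall i, a i != 0 -> hol (f i) x) -> hol (fun y => \sum_i a i * f i y) x.
Proof.
move=> h c z t ac hz ex; apply: (@diff_sum R V I (fun i w => a i * f i (chart_inv c (w, t)))) => i.
have [->|ai] := eqVneq (a i) 0; last exact: (diffM' (diff_cst' _ _) (h i ai c z t ac hz ex)).
by under eq_fun do rewrite mul0r; exact: diff_cst'.
Qed.

Lemma holomorphic_on_hol U f x : open U -> U x -> holomorphic_on L U f -> hol f x.
Proof. by move=> oU Ux [_ h] c z t ac hz ex; apply: h => //; rewrite ex. Qed.

Lemma holomorphic_on_cont U f x : open U -> U x -> holomorphic_on L U f -> {for x, continuous f}.
Proof.
move=> oU Ux [h _]; move: h; rewrite continuous_open_subspace//.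
by move=> /(_ x); apply; rewrite inE.
Qed.

End Plaques.

(** * Sections of the powers of the bundle and their limits *)

Section SectionsOfPowers.
Context {R : realType} {X : topologicalType} {n : nat} (L : lamination R X n) (g : cocycle L) (k : nat).
Local Notation C := R[i].
Local Notation V := 'rV[C]_n.
Implicit Types (i j : cov_idx g) (s : X -> C).
Local Notation G := (cocycle_fun (c := g)).

(* A section of the k-th power of the bundle is encoded by a function on [X]:
   its value at [x] in the frame of index [iota x]. *)
Definition iota x := sval (cid (cov_cover g x)).

Lemma iotaP x : cov (iota x) x.
Proof. by rewrite /iota; case: cid. Qed.

Lemma cocycle_neq0 i j x : cov i x -> cov j x -> G i j x != 0.
Proof. by move=> hi hj; have [_] := cocycle_unit (c := g) i j; apply. Qed.

Lemma cocycle_id i x : cov i x -> G i i x = 1.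
Proof.
move=> h; have := cocycleP (c := g) h h h => e; apply: (mulfI (cocycle_neq0 h h)).
by rewrite e mulr1.
Qed.

(** The coordinate in the fixed frame [i]. Regularity is tested on these coordinates, since [iota]
    is chosen point by point and the function [s] itself may jump. *)
Definition rep i s x : C := G i (iota x) x ^+ k * s x.
Definition unrep i (f : X -> C) x : C := G (iota x) i x ^+ k * f x.

Lemma rep_unrep i f x : cov i x -> rep i (unrep i f) x = f x.
Proof.
move=> h; have h' := iotaP x.
by rewrite /rep /unrep mulrA -exprMn (cocycleP (c := g) h h' h) cocycle_id// expr1n mul1r.
Qed.

Lemma rep_rep i j s x : cov i x -> cov j x -> rep j s x = G j i x ^+ k * rep i s x.
Proof.
move=> hi hj; have h' := iotaP x.
by rewrite /rep mulrA -exprMn (cocycleP (c := g) hj hi h').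
Qed.

Definition contS s x := forall i, cov i x -> {for x, continuous (rep i s)}.
Definition holS s x := forall i, cov i x -> hol L (rep i s) x.

Lemma cov_near i x : cov i x -> \forall y \near x, cov i y.
Proof. by move=> h; exact: (open_nbhs_nbhs (conj (cov_open i) h)). Qed.

Let near_rep i j s x : cov i x -> cov j x -> \forall y \near x, G j i y ^+ k * rep i s y = rep j s y.
Proof.
by move=> hi hj; apply: filterS2 (cov_near hi) (cov_near hj) => y h1 h2; rewrite (rep_rep s h1 h2).
Qed.

Lemma contS1 i s x : cov i x -> {for x, continuous (rep i s)} -> contS s x.
Proof.
move=> hi hs j hj; apply: (cont_near (near_rep s hi hj)).
apply: (contM _ hs); apply: contX.
have [h _] := cocycle_unit (c := g) j i.
by apply: (holomorphic_on_cont _ _ h) => //; apply: openI; exact: cov_open.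
Qed.

Lemma holS1 i s x : cov i x -> hol L (rep i s) x -> holS s x.
Proof.
move=> hi hs j hj; apply: (hol_near (near_rep s hi hj)).
apply: (holM _ hs); apply: holX.
have [h _] := cocycle_unit (c := g) j i.
by apply: (holomorphic_on_hol _ _ h) => //; apply: openI; exact: cov_open.
Qed.

Lemma contS_unrep i f x : cov i x -> {for x, continuous f} -> contS (unrep i f) x.
Proof.
move=> hi hf; apply: (contS1 hi); apply: (cont_near _ hf).
by apply: filterS (cov_near hi) => y hy; rewrite rep_unrep.
Qed.

Lemma holS_unrep i f x : cov i x -> hol L f x -> holS (unrep i f) x.
Proof.
move=> hi hf; apply: (holS1 hi); apply: (hol_near _ hf).
by apply: filterS (cov_near hi) => y hy; rewrite rep_unrep.
Qed.

Lemma holS_sum (I : finType) (a : I -> C) (f : I -> X -> C) x :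
  (forall i : I, a i != 0 -> holS (f i) x) -> holS (fun y => \sum_(i : I) a i * f i y) x.
Proof.
move=> h j hj; have E y : \sum_(i : I) a i * rep j (f i) y = rep j (fun y => \sum_(i : I) a i * f i y) y.
  by rewrite /rep mulr_sumr; apply: eq_bigr => i _; rewrite mulrCA.
have := @hol_sum R X n L I a (fun i : I => rep j (f i)) x (fun (i : I) ai => h i ai j hj).
by rewrite (funext E).
Qed.

Lemma contS_sum (I : finType) (f : I -> X -> C) x :
  (forall i : I, contS (f i) x) -> contS (fun y => \sum_(i : I) f i y) x.
Proof.
move=> h j hj; have E y : \sum_(i : I) rep j (f i) y = rep j (fun y => \sum_(i : I) f i y) y.
  by rewrite /rep mulr_sumr.
by apply: (cont_ext E); apply: cont_sum => i; exact: h.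
Qed.

Variable m : hermitian_metric g.

Definition mu x : R := metric_weight m (iota x) x ^+ k.

Lemma mu_gt0 x : 0 < mu x.
Proof. by rewrite exprn_gt0// metric_weight_gt0//; exact: iotaP. Qed.

Lemma mu_rep i s x : cov i x -> nc (s x) * mu x = nc (rep i s x) * metric_weight m i x ^+ k.
Proof.
move=> hi; rewrite /rep /mu ncM ncX -(metric_weightP m hi (iotaP x)) exprMn.
by rewrite mulrAC mulrC.
Qed.

Lemma rep_sub i s s' x : rep i (fun y => s y - s' y) x = rep i s x - rep i s' x.
Proof. exact: mulrBr. Qed.

Lemma mu_dist i s s' x : cov i x ->
  nc (s x - s' x) * mu x = nc (rep i s x - rep i s' x) * metric_weight m i x ^+ k.
Proof. by move=> hi; rewrite (mu_rep (fun y => s y - s' y) hi) rep_sub. Qed.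

Hypothesis wcont : forall i x, cov i x -> {for x, continuous (metric_weight m i)}.

Lemma weight_near i x : cov i x -> exists2 e : R, 0 < e & \forall y \near x, e <= metric_weight m i y ^+ k.
Proof.
move=> hi; have w0 := metric_weight_gt0 m hi; set w := metric_weight m i x in w0.
exists ((w / 2) ^+ k); first by rewrite exprn_gt0// divr_gt0.
have := (contRP _ _).1 (wcont hi) (w / 2) ltac:(lra).
apply: filterS => y; rewrite -/w ler_norml => /andP[h1 h2]; apply: lerXn2r; rewrite ?nnegrE; lra.
Qed.

Lemma contS_lim s x : (forall e, 0 < e -> exists s', contS s' x /\ forall y, nc (s y - s' y) * mu y <= e) ->
  contS s x.
Proof.
move=> H; apply: (@contS1 (iota x)); first exact: iotaP.
have hi := iotaP x; set i := iota x in hi *.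
have [w w0 hw] := weight_near hi.
apply/contP => e e0; have e3 : 0 < e / 3 by lra.
have [s' [cs' hs']] := H (e / 3 * w) ltac:(exact: mulr_gt0).
have cl y : cov i y -> w <= metric_weight m i y ^+ k -> nc (rep i s y - rep i s' y) <= e / 3.
  move=> hy wy; have := hs' y; rewrite (mu_dist s s' hy) => h.
  rewrite -(ler_pM2r w0); apply: le_trans h; rewrite ler_wpM2l ?nc_ge0//.
have k1 := (contP _ _).1 (cs' i hi) (e / 3) e3; have hwx := nbhs_singleton hw.
apply: filterS3 k1 hw (cov_near hi) => y h1 h2 h3.
have := cl y h3 h2; have := cl x hi hwx.
have := ncD (rep i s y - rep i s' y) (rep i s' y - rep i s' x).
have := ncB (rep i s y - rep i s' y + (rep i s' y - rep i s' x)) (rep i s x - rep i s' x).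
have -> : rep i s y - rep i s' y + (rep i s' y - rep i s' x) - (rep i s x - rep i s' x) = rep i s y - rep i s x by ring.
by lra.
Qed.

(** The approximants change with [e] and are holomorphic only on a disc of one plaque; as this disc
    is the same for all [e], [weierstrassN] applies in a fixed frame, where the weight is bounded
    below. *)
Lemma holS_lim c s z t (r : R) : atlas L c -> unit_ball z -> 0 < r ->
  (forall w, vn (w - z) < r -> unit_ball w) ->
  (forall e, 0 < e -> exists s', (forall w, vn (w - z) < r -> holS s' (chart_inv c (w, t))) /\
     forall w, vn (w - z) < r -> nc (s (chart_inv c (w, t)) - s' (chart_inv c (w, t))) * mu (chart_inv c (w, t)) <= e) ->
  holS s (chart_inv c (z, t)).
Proof.
move=> ac hz r0 hr H; have hi := iotaP (chart_inv c (z, t)); set x := chart_inv c (z, t) in hi *.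
apply: (holS1 hi); set i := iota x in hi *.
have [e0 e00 hw] := weight_near hi.
have near2 : nbhs z (fun w : V => cov i (chart_inv c (w, t)) /\ e0 <= metric_weight m i (chart_inv c (w, t)) ^+ k).
  have k1 : nbhs z (fun w : V => cov i (chart_inv c (w, t))) by exact: (plaque_near hz (cov_near hi)).
  have k2 : nbhs z (fun w : V => e0 <= metric_weight m i (chart_inv c (w, t)) ^+ k) by exact: (plaque_near hz hw).
  exact: filterI k1 k2.
have [d d0 hd] := (nearV z _).1 near2.
apply: (@hol_chart R X n L c); [exact: ac|exact: chart_inv_dom'|].
rewrite /x (chart_invK' t hz) /=.
apply: (@weierstrassN R n _ z (Num.min r d)); first by rewrite lt_min r0 d0.
move=> e ee0; have [s' [hs' hss]] := H (e * e0) ltac:(exact: mulr_gt0).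
exists (fun w => rep i s' (chart_inv c (w, t))); split=> w; rewrite lt_min => /andP[w1 w2].
  have [cw _] : cov i (chart_inv c (w, t)) /\ e0 <= metric_weight m i (chart_inv c (w, t)) ^+ k.
    by have := hd (w - z) (ltW w2); rewrite addrC subrK.
  exact: (hs' w w1 i cw c w t ac (hr w w1) erefl).
have [cw mw] : cov i (chart_inv c (w, t)) /\ e0 <= metric_weight m i (chart_inv c (w, t)) ^+ k.
  by have := hd (w - z) (ltW w2); rewrite addrC subrK.
have := hss w w1; rewrite (mu_dist s s' cw) => h.
rewrite -(ler_pM2r e00); apply: le_trans h; rewrite nc_dist ler_wpM2l ?nc_ge0//.
Qed.

End SectionsOfPowers.

(** * Leafwise Hessians and positivity *)

Section RealDirectionalDerivatives.
Context {R : realType} {n : nat}.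
Local Notation C := R[i].
Local Notation V := 'rV[C]_n.
Implicit Types (u v w z : V) (f g : V -> R).

Definition rd v f z (d : R) := is_derive (0 : R) 1 (fun s : R => f (z + s%:C *: v)) d.

Lemma rdP v f z : real_derivable v f z -> rd v f z (real_derive v f z).
Proof. by move=> h; rewrite /rd /real_derive derive1E; exact: derivableP. Qed.

Lemma rd_val v f z d : rd v f z d -> real_derivable v f z /\ real_derive v f z = d.
Proof. by move=> [h1 h2]; split; [exact: h1|rewrite /real_derive derive1E]. Qed.

Lemma line_cont z v (s : R) : {for s, continuous (fun t : R => z + t%:C *: v)}.
Proof.
have E : (fun t : R => \row_i (z 0 i + t%:C * v 0 i)) =1 (fun t : R => z + t%:C *: v).
  by move=> t; apply/rowP => i; rewrite !mxE.
apply: (cont_ext E); apply: (@cont_row R n R (fun i t => z 0 i + t%:C * v 0 i)) => i.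
apply: cvg_cD; first exact: cvg_cst.
by apply: cvg_cM; [exact: cont_RC0|exact: cvg_cst].
Qed.

Lemma rd_near v f g z d : (\forall w \near z, f w = g w) -> rd v f z d -> rd v g z d.
Proof.
move=> fg; apply: near_eq_is_derive; apply: (@line_cont z v 0 (fun w => f w = g w)).
by rewrite scale0r addr0.
Qed.

Lemma rdD v f g z a b : rd v f z a -> rd v g z b -> rd v (fun w => f w + g w) z (a + b).
Proof. by move=> h1 h2; exact: is_deriveD. Qed.

Lemma rdM v f g z a b : rd v f z a -> rd v g z b -> rd v (fun w => f w * g w) z (f z * b + g z * a).
Proof. by move=> h1 h2; have := is_deriveM h1 h2; rewrite /= scale0r addr0. Qed.

Lemma rd_cst v (k : R) z : rd v (fun=> k) z 0.
Proof. exact: is_derive_cst. Qed.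

Lemma rdZ v f z a k : rd v f z a -> rd v (fun w => k * f w) z (k * a).
Proof. by move=> h; have := rdM (rd_cst v k z) h; rewrite mulr0 addr0. Qed.

Lemma rd_comp v f z a (h : R -> R) b : rd v f z a -> is_derive (f z) 1 h b -> rd v (fun w => h (f w)) z (b * a).
Proof.
move=> h1 h2; apply: (@is_derive1_comp R h (fun s : R => f (z + s%:C *: v)) 0 b a _ h1).
by rewrite scale0r addr0.
Qed.

Lemma rd_sum v (I : finType) (f : I -> V -> R) z (a : I -> R) : (forall i, rd v (f i) z (a i)) ->
  rd v (fun w => \sum_i f i w) z (\sum_i a i).
Proof.
move=> h; elim: (index_enum I) => [|i s ih].
  by rewrite big_nil; under eq_fun do rewrite big_nil; exact: rd_cst.
by rewrite big_cons; under eq_fun do rewrite big_cons; exact: rdD.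
Qed.

Lemma rd_line v f z (s : R) : real_derivable v f (z + s%:C *: v) ->
  is_derive s 1 (fun t : R => f (z + t%:C *: v)) (real_derive v f (z + s%:C *: v)).
Proof.
move=> /rdP h; have h1 : is_derive s 1 (fun t : R => t - s) 1.
  by have := is_deriveB (is_derive_id s (1 : R)) (is_derive_cst s s (1 : R)); rewrite subr0.
have h2 : is_derive (s - s) 1 (fun t : R => f (z + s%:C *: v + t%:C *: v)) (real_derive v f (z + s%:C *: v)).
  by rewrite subrr.
have := @is_derive1_comp R (fun t : R => f (z + s%:C *: v + t%:C *: v)) (fun t => t - s) s _ _ h2 h1; rewrite mulr1.
have -> // : (fun t : R => f (z + s%:C *: v + t%:C *: v)) \o (fun t => t - s) = (fun t : R => f (z + t%:C *: v)).
by apply/funext => t /=; rewrite -addrA -scalerDl -rmorphD [s + _]addrC subrK.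
Qed.

Lemma rd_scale v f z (a : R) : real_derivable v f z -> rd (a%:C *: v) f z (a * real_derive v f z).
Proof.
move=> /rdP h; have h1 : is_derive (0 : R) 1 (fun t : R => a * t) a.
  by have := is_deriveZ a (is_derive_id (0 : R) (1 : R)); rewrite /GRing.scale /= mulr1.
have h2 : is_derive (a * 0) 1 (fun t : R => f (z + t%:C *: v)) (real_derive v f z) by rewrite mulr0.
have := @is_derive1_comp R (fun t : R => f (z + t%:C *: v)) (fun t => a * t) 0 _ _ h2 h1; rewrite mulrC.
have -> // : (fun t : R => f (z + t%:C *: v)) \o (fun t => a * t) = (fun t : R => f (z + t%:C *: (a%:C *: v))).
by apply/funext => t /=; rewrite scalerA mulrC rmorphM.
Qed.

Lemma rd_mvt v f z (h : R) : 0 <= h -> (forall s : R, 0 <= s <= h -> real_derivable v f (z + s%:C *: v)) ->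
  exists2 s : R, 0 <= s <= h & f (z + h%:C *: v) - f z = h * real_derive v f (z + s%:C *: v).
Proof.
move=> h0 hd; pose F (t : R) := f (z + t%:C *: v).
have dF (s : R) : 0 <= s <= h -> is_derive s 1 F (real_derive v f (z + s%:C *: v)) by move=> /hd /rd_line.
have [||s sI E] := @MVT_segment R F (fun s => real_derive v f (z + s%:C *: v)) 0 h h0.
- by move=> x; rewrite in_itv /= => /andP[x0 xh]; apply: dF; rewrite (ltW x0) (ltW xh).
- by apply: derivable_within_continuous => x; rewrite in_itv /= => /dF[].
by exists s => //; move: E; rewrite /F scale0r addr0 subr0 mulrC.
Qed.

Lemma rd_quot v f z d : rd v f z d -> forall e : R, 0 < e -> exists2 r : R, 0 < r &
  forall h : R, 0 < h <= r -> `|f (z + h%:C *: v) - f z - h * d| <= e * h.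
Proof.
move=> [h1 h2] e e0; have {h1}h1 : (fun h => h^-1 *: (((fun s : R => f (z + s%:C *: v)) \o shift 0) (h *: (1 : R)) -
    (fun s : R => f (z + s%:C *: v)) 0)) @ 0^' --> d by rewrite -h2; exact: h1.
have [r /= r0 hr] := (cvgr_RP _ _).1 h1 e e0.
exists (r / 2); first by rewrite divr_gt0.
move=> h /andP[h0 hh]; have := hr h; rewrite /= sub0r normrN gtr0_norm// => /(_ ltac:(lra)).
have -> : z + (0 : R)%:C *: v = z by rewrite scale0r addr0.
have -> : (h%:A + 0 : R) = h by rewrite addr0 [_%:A]mulr1.
rewrite [_ *: _]/(_ * _) => /(_ (lt0r_neq0 h0)) E.
rewrite -(ler_pM2l (_ : 0 < h^-1)) ?invr_gt0// mulrCA mulVf ?gt_eqF// mulr1.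
apply: le_trans E; rewrite -{1}(gtr0_norm (_ : 0 < h^-1)) ?invr_gt0// -normrM mulrBr mulrA mulVf ?gt_eqF//.
by rewrite mul1r.
Qed.

Lemma dist_sum (a b c b' c' e : R) : `|c' + b' - a| <= e / 4 -> `|b' - b| <= e / 4 -> `|c' - c| <= e / 4 ->
  `|a - (b + c)| <= e.
Proof. by rewrite !ler_norml => /andP[? ?] /andP[? ?] /andP[? ?]; apply/andP; split; lra. Qed.

(** Smoothness is stated through derivatives in single directions, so additivity in the direction
    has to be derived: the increment along [h * (u + v)] is split into two sides of a parallelogram,
    the mean value theorem is applied on each, and [h] is small. *)
Lemma rd_add u v f z :
  (\forall w \near z, real_derivable u f w /\ real_derivable v f w) ->
  {for z, continuous (real_derive u f)} -> {for z, continuous (real_derive v f)} ->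
  real_derivable (u + v) f z -> real_derive (u + v) f z = real_derive u f z + real_derive v f z.
Proof.
move=> hd cu cv duv; apply/eqP; rewrite -subr_eq0 -normr_eq0 eq_le normr_ge0 andbT.
apply/ler_addgt0Pl => e e0; rewrite addr0.
have e4 : 0 < e / 4 by lra.
have near3 : \forall w \near z, [/\ real_derivable u f w /\ real_derivable v f w,
   `|real_derive u f w - real_derive u f z| <= e / 4 & `|real_derive v f w - real_derive v f z| <= e / 4].
  by apply: filterS3 hd ((contRP _ _).1 cu _ e4) ((contRP _ _).1 cv _ e4) => w a b c.
have [r r0 hr] := (nearV z _).1 near3.
have [r' r'0 hr'] := rd_quot (rdP duv) e4.
pose M := vn u + vn v + 1.
have M0 : 0 < M by rewrite /M; have := vn_ge0 u; have := vn_ge0 v; lra.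
pose h := Num.min r' (r / M).
have h0 : 0 < h by rewrite lt_min r'0 divr_gt0.
have [hr1 hr2] : h <= r' /\ h * M <= r by rewrite -ler_pdivlMr// /h !ge_min !lexx orbT.
have small (s t : R) : 0 <= s <= h -> 0 <= t <= h -> vn (s%:C *: u + t%:C *: v) <= r.
  move=> /andP[s0 sh] /andP[t0 th]; apply: le_trans hr2; apply: (le_trans (vnD _ _)).
  rewrite !vnZ !ncR !ger0_norm// /M; have := vn_ge0 u; have := vn_ge0 v => a b.
  have c1 : s * vn u <= h * vn u by rewrite ler_wpM2r.
  have c2 : t * vn v <= h * vn v by rewrite ler_wpM2r.
  by lra.
have hh : 0 <= h <= h by rewrite lexx (ltW h0).
have z0 : (0 : R) <= 0 <= h by rewrite lexx (ltW h0).
have [|s sI E1] := @rd_mvt u f z h (ltW h0).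
  move=> s sI; have := hr _ (small s 0 sI z0); rewrite scale0r addr0 => -[[h1 *]]; exact: h1.
have [|t tI E2] := @rd_mvt v f (z + h%:C *: u) h (ltW h0).
  by move=> t tI; have := hr _ (small h t hh tI); rewrite addrA => -[[]].
have E3 := hr' h ltac:(by rewrite h0 hr1).
have [_ b1 _] := hr _ (small s 0 sI z0); have [_ _ b2] := hr _ (small h t hh tI).
rewrite scale0r addr0 in b1; rewrite addrA in b2.
have Euv : z + h%:C *: (u + v) = z + h%:C *: u + h%:C *: v by rewrite scalerDr addrA.
rewrite Euv in E3.
have E4 : f (z + h%:C *: u + h%:C *: v) - f z = h * (real_derive v f (z + h%:C *: u + t%:C *: v) + real_derive u f (z + s%:C *: u)).
  by rewrite mulrDr -E1 -E2; ring.
rewrite E4 -mulrBr normrM (gtr0_norm h0) mulrC ler_pM2r// in E3.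
exact: (dist_sum E3 b1 b2).
Qed.

(* The mean value theorem is applied twice, hence the crude constant. *)
Lemma rd_taylor2 v f z (Q e : R) :
  (forall s : R, 0 <= s <= 1 -> real_derivable v f (z + s%:C *: v) /\
     real_derivable v (real_derive v f) (z + s%:C *: v) /\
     `|real_derive v (real_derive v f) (z + s%:C *: v) - Q| <= e) ->
  `|f (z + v) - f z - real_derive v f z - Q / 2| <= e.
Proof.
move=> H; pose F (s : R) := f (z + s%:C *: v) - s * real_derive v f z - s ^+ 2 * (Q / 2).
pose dF (s : R) := real_derive v f (z + s%:C *: v) - real_derive v f z - s * Q.
have d2 (s : R) : 0 <= s <= 1 -> is_derive s 1 F (dF s).
  move=> /H[h _]; have h1 := rd_line h.
  have h2 := is_deriveM (is_derive_id s (1 : R)) (is_derive_cst (real_derive v f z) s (1 : R)).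
  have h3 := is_deriveM (is_deriveX 2 (is_derive_id s (1 : R))) (is_derive_cst (Q / 2) s (1 : R)).
  have h4 := is_deriveB (is_deriveB h1 h2) h3; apply: (is_derive_eq h4).
  by rewrite /dF /cst /GRing.scale /= !fctE /=; field.
have bnd (s : R) : 0 <= s <= 1 -> `|dF s| <= e.
  move=> /andP[s0 s1]; have [|t /andP[t0 ts] E] := @rd_mvt v (real_derive v f) z s s0.
    by move=> t /andP[t0 ts]; have [|_ []//] := H t; rewrite t0 (le_trans ts).
  have [|_ [_ b]] := H t; first by rewrite t0 (le_trans ts).
  rewrite /dF E -mulrBr normrM (ger0_norm s0); apply: (@le_trans _ _ (1 * e)); last by rewrite mul1r.
  by rewrite ler_pM.
have [||s sI E] := @MVT_segment R F dF 0 1 ler01.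
- by move=> x; rewrite in_itv /= => /andP[x0 xh]; apply: d2; rewrite (ltW x0) (ltW xh).
- by apply: derivable_within_continuous => x; rewrite in_itv /= => /d2[].
have := bnd s; rewrite in_itv /= in sI; rewrite sI => /(_ isT).
move: E; rewrite /F scale0r addr0 scale1r subr0 mulr1 => <-.
rewrite expr0n /= !mul0r !subr0 expr1n !mul1r.
have -> // : f (z + v) - real_derive v f z - Q / 2 - f z = f (z + v) - f z - real_derive v f z - Q / 2.
by ring.
Qed.

End RealDirectionalDerivatives.

(** * Second derivatives along the leaves and the Levi form *)

Section LeviForm.
Context {R : realType} {n : nat} {T : topologicalType}.
Local Notation C := R[i].
Local Notation V := 'rV[C]_n.
Implicit Types (u v w z : V) (f g : V * T -> R) (W : set (V * T)) (p : V * T).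

Definition Dv v f p : R := real_derive v (fun z => f (z, p.2)) p.1.

Definition C1_on W f := forall p, W p -> forall v,
  real_derivable v (fun z => f (z, p.2)) p.1 /\ {for p, continuous (Dv v f)}.

Definition C2_on W f := C1_on W f /\ forall v, C1_on W (Dv v f).

Lemma leaf_near W p : open W -> W p -> nbhs p.1 (fun z => W (z, p.2)).
Proof.
move=> oW Wp; have c : {for p.1, continuous (fun z : V => (z, p.2))} := cont_pair (cont_id p.1) (cont_cstW p.2 p.1).
by apply: c; apply: open_nbhs_nbhs; split => //; rewrite -surjective_pairing.
Qed.

Lemma leaf_smooth_C2 W f : leaf_smooth_on W f -> (forall p, W p -> {for p, continuous f}) /\ C2_on W f.
Proof.
move=> h; split; first by move=> p /(h [::] p)[].
split.
  move=> p Wp v; have [_ h1] := h [::] p Wp; have [h2 _] := h [:: v] p Wp.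
  by split; [exact: h1|exact: h2].
move=> v p Wp u; have [_ h1] := h [:: v] p Wp; have [h2 _] := h [:: u; v] p Wp.
by split; [exact: h1|exact: h2].
Qed.

Lemma C1_rd W f p v : C1_on W f -> W p -> rd v (fun z => f (z, p.2)) p.1 (Dv v f p).
Proof. by move=> h Wp; apply: rdP; have [] := h p Wp v. Qed.

Lemma Dv_eqn W f g v : open W -> (forall p, W p -> f p = g p) -> forall p, W p -> C1_on W f ->
  rd v (fun z => g (z, p.2)) p.1 (Dv v f p).
Proof.
move=> oW fg p Wp hf; apply: (rd_near _ (C1_rd v hf Wp)).
by apply: filterS (leaf_near oW Wp) => z /fg.
Qed.

Lemma C1_eq W f g : open W -> (forall p, W p -> f p = g p) -> C1_on W f ->
  C1_on W g /\ forall v p, W p -> Dv v g p = Dv v f p.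
Proof.
move=> oW fg hf.
have E v p : W p -> Dv v g p = Dv v f p.
  by move=> Wp; have [_] := rd_val (Dv_eqn v oW fg Wp hf).
split=> // p Wp v; split; first by have [] := rd_val (Dv_eqn v oW fg Wp hf).
have [_ c] := hf p Wp v; have ne := open_nbhs_nbhs (conj oW Wp).
have Ep := E v p Wp; apply/contRP => e e0; have := (contRP _ _).1 c e e0.
by apply: filterS2 ne => q Wq; rewrite Ep (E v q Wq).
Qed.

Lemma Dv_lin W f p v : open W -> C1_on W f -> W p ->
  Dv v f p = \sum_j (complex.Re (v 0 j) * Dv (delta_mx 0 j) f p + complex.Im (v 0 j) * Dv ('i *: delta_mx 0 j) f p).
Proof.
move=> oW hf Wp; have ne := leaf_near oW Wp.
have add u w : Dv (u + w) f p = Dv u f p + Dv w f p.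
  have cc u' : {for p.1, continuous (real_derive u' (fun z => f (z, p.2)))}.
    have [_ c] := hf p Wp u'.
    have c' : {for p.1, continuous (fun z : V => (z, p.2))} := cont_pair (cont_id p.1) (cont_cstW p.2 p.1).
    rewrite (surjective_pairing p) in c.
    exact: (@cont_comp _ _ _ (fun z : V => (z, p.2)) (Dv u' f) p.1 c' c).
  apply: rd_add; [|exact: cc|exact: cc|by have [] := hf p Wp (u + w)].
  by apply: filterS ne => z Wz; have [h1 _] := hf _ Wz u; have [h2 _] := hf _ Wz w; split; [exact: h1|exact: h2].
have scale a u : Dv (a%:C *: u) f p = a * Dv u f p.
  by have [hd _] := hf p Wp u; have [_] := rd_val (rd_scale a hd).
have D0 : Dv 0 f p = 0 by have := scale 0 0; rewrite scale0r mul0r.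
have sum (F : 'I_n -> V) : Dv (\sum_j F j) f p = \sum_j Dv (F j) f p.
  elim: (index_enum _) => [|i s ih]; first by rewrite !big_nil.
  by rewrite !big_cons add ih.
rewrite {1}(row_sum_delta v) sum; apply: eq_bigr => j _.
rewrite {1}(complexE' (v 0 j)) scalerDl add scale ['i * _]mulrC -scalerA scale.
by [].
Qed.

Definition Dxx l j f p := Dv (delta_mx 0 l) (Dv (delta_mx 0 j) f) p.
Definition Dxy l j f p := Dv (delta_mx 0 l) (Dv ('i *: delta_mx 0 j) f) p.
Definition Dyx l j f p := Dv ('i *: delta_mx 0 l) (Dv (delta_mx 0 j) f) p.
Definition Dyy l j f p := Dv ('i *: delta_mx 0 l) (Dv ('i *: delta_mx 0 j) f) p.

(** With [dzz] and [dzbz], the Wirtinger derivatives [d/dz_j], [d^2/dz_l dz_j] and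
    [d^2/dzbar_l dz_j] in real terms. The mixed derivatives [Dxy] and [Dyx] are kept apart, so that
    derivatives are never exchanged. *)
Definition dz j f p : C := (Dv (delta_mx 0 j) f p +i* - Dv ('i *: delta_mx 0 j) f p) / 2.
Definition dzz l j f p : C := ((Dxx l j f p - Dyy l j f p) +i* - (Dxy l j f p + Dyx l j f p)) / 4.
Definition dzbz l j f p : C := ((Dxx l j f p + Dyy l j f p) +i* (Dyx l j f p - Dxy l j f p)) / 4.

Definition lin_part f p v : C := \sum_j dz j f p * v 0 j.
Definition quad_part f p v : C := \sum_j \sum_l dzz l j f p * (v 0 l * v 0 j).
Definition levi f p v : C := \sum_j \sum_l dzbz l j f p * ((v 0 l)^* * v 0 j).

Lemma Re_quarter (a b c d : R) : complex.Re ((a +i* b) / 4 * (c +i* d)) = (a * c - b * d) / 4.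
Proof.
have -> : (4 : C) = (4 : R)%:C by rewrite -(rmorph_nat (real_complex R) 4).
by rewrite -fmorphV !cReM !cImM /=; ring.
Qed.

Lemma Dv_lin_part W f p v : open W -> C1_on W f -> W p -> Dv v f p = 2 * complex.Re (lin_part f p v).
Proof.
move=> oW hf Wp; rewrite (Dv_lin v oW hf Wp) /lin_part Re_sum mulr_sumr; apply: eq_bigr => j _.
rewrite /dz (_ : (2 : C) = (2 : R)%:C); last by rewrite rmorphD rmorph1.
move: (Dv _ f p) (Dv _ f p) => a b.
by case: (v 0 j) => x y; rewrite -fmorphV !cReM !cImM /=; field.
Qed.

Lemma D2_expand W f p v : open W -> C2_on W f -> W p -> Dv v (Dv v f) p =
  \sum_l \sum_j (complex.Re (v 0 l) * (complex.Re (v 0 j) * Dxx l j f p + complex.Im (v 0 j) * Dxy l j f p) +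
                 complex.Im (v 0 l) * (complex.Re (v 0 j) * Dyx l j f p + complex.Im (v 0 j) * Dyy l j f p)).
Proof.
move=> oW [h1 h2] Wp; rewrite (Dv_lin v oW (h2 v) Wp); apply: eq_bigr => l _.
pose F q := \sum_j (complex.Re (v 0 j) * Dv (delta_mx 0 j) f q + complex.Im (v 0 j) * Dv ('i *: delta_mx 0 j) f q).
have E u : Dv u (Dv v f) p = \sum_j (complex.Re (v 0 j) * Dv u (Dv (delta_mx 0 j) f) p + complex.Im (v 0 j) * Dv u (Dv ('i *: delta_mx 0 j) f) p).
  have rF : rd u (fun z => F (z, p.2)) p.1 (\sum_j (complex.Re (v 0 j) * Dv u (Dv (delta_mx 0 j) f) p + complex.Im (v 0 j) * Dv u (Dv ('i *: delta_mx 0 j) f) p)).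
    by apply: rd_sum => j; apply: rdD; apply: rdZ; exact: (C1_rd _ (h2 _) Wp).
  have rG : rd u (fun z => Dv v f (z, p.2)) p.1 (\sum_j (complex.Re (v 0 j) * Dv u (Dv (delta_mx 0 j) f) p + complex.Im (v 0 j) * Dv u (Dv ('i *: delta_mx 0 j) f) p)).
    apply: (rd_near _ rF); apply: filterS (leaf_near oW Wp) => z Wz.
    by rewrite (Dv_lin v oW h1 Wz).
  by have [_] := rd_val rG.
by rewrite !E !mulr_sumr -big_split.
Qed.

(** The first term is the real part of a holomorphic polynomial in [v] and will be absorbed by the
    gauge; the Levi form is what remains and becomes the Gaussian. *)
Lemma D2_levi W f p v : open W -> C2_on W f -> W p ->
  Dv v (Dv v f) p / 2 = complex.Re (quad_part f p v) + complex.Re (levi f p v).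
Proof.
move=> oW hf Wp; rewrite (D2_expand v oW hf Wp) exchange_big /= /quad_part /levi -cReD -big_split Re_sum mulr_suml.
apply: eq_bigr => j _; rewrite -big_split Re_sum mulr_suml; apply: eq_bigr => l _ /=.
case: (v 0 l) => x y; case: (v 0 j) => x' y'.
have -> : (x +i* y) * (x' +i* y') = (x * x' - y * y') +i* (x * y' + y * x') by [].
have -> : (x +i* y)^* * (x' +i* y') = (x * x' + y * y') +i* (x * y' - y * x').
  by apply: complex_ext; rewrite ?cReM ?cImM /=; ring.
by rewrite cReD !Re_quarter /=; field.
Qed.

Lemma Dxx_cont W f : C2_on W f -> forall p, W p -> forall l j,
  [/\ {for p, continuous (Dxx l j f)}, {for p, continuous (Dxy l j f)},
      {for p, continuous (Dyx l j f)} & {for p, continuous (Dyy l j f)}].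
Proof. by move=> [_ h] p Wp l j; split; [have [_ c] := h (delta_mx 0 j) p Wp (delta_mx 0 l)|have [_ c] := h ('i *: delta_mx 0 j) p Wp (delta_mx 0 l)|have [_ c] := h (delta_mx 0 j) p Wp ('i *: delta_mx 0 l)|have [_ c] := h ('i *: delta_mx 0 j) p Wp ('i *: delta_mx 0 l)]; exact: c. Qed.

Lemma continuous_complex (S : topologicalType) (a b : S -> R) s :
  {for s, continuous a} -> {for s, continuous b} -> {for s, continuous (fun t => a t +i* b t : C)}.
Proof.
move=> ca cb; have E : (fun t => (a t)%:C + 'i * (b t)%:C) =1 (fun t => a t +i* b t).
  by move=> t; rewrite [RHS]complexE'.
by apply: (cont_ext E); apply: contD; [exact: cont_RC|apply: contM; [exact: cont_cst|exact: cont_RC]].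
Qed.

Lemma dz_cont W f p j : C1_on W f -> W p -> {for p, continuous (dz j f)}.
Proof.
move=> h Wp; apply: contM; last exact: cont_cst.
apply: continuous_complex; first by have [_] := h p Wp (delta_mx 0 j); exact.
by apply: cvgN; have [_] := h p Wp ('i *: delta_mx 0 j); exact.
Qed.

Let bilin4 (m e x1 y1 x2 y2 a b c d a' b' c' d' : R) :
  `|x1| <= m -> `|y1| <= m -> `|x2| <= m -> `|y2| <= m ->
  `|a - a'| <= e -> `|b - b'| <= e -> `|c - c'| <= e -> `|d - d'| <= e ->
  `|x1 * (x2 * a + y2 * b) + y1 * (x2 * c + y2 * d) - (x1 * (x2 * a' + y2 * b') + y1 * (x2 * c' + y2 * d'))| <= 4 * e * m ^+ 2.
Proof.
have tri (x y s t : R) : `|x| <= m -> `|y| <= m -> `|s - t| <= e -> `|x * (y * (s - t))| <= e * m ^+ 2.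
  move=> hx hy hs; rewrite !normrM.
  have -> : e * m ^+ 2 = m * (m * e) by ring.
  by apply: ler_pM => //; exact: ler_pM.
move=> x1m y1m x2m y2m ha hb hc hd.
have t1 := tri _ _ _ _ x1m x2m ha; have t2 := tri _ _ _ _ x1m y2m hb.
have t3 := tri _ _ _ _ y1m x2m hc; have t4 := tri _ _ _ _ y1m y2m hd.
have -> : x1 * (x2 * a + y2 * b) + y1 * (x2 * c + y2 * d) - (x1 * (x2 * a' + y2 * b') + y1 * (x2 * c' + y2 * d')) =
  x1 * (x2 * (a - a')) + x1 * (y2 * (b - b')) + y1 * (x2 * (c - c')) + y1 * (y2 * (d - d')) by ring.
have n1 := ler_normD (x1 * (x2 * (a - a')) + x1 * (y2 * (b - b')) + y1 * (x2 * (c - c'))) (y1 * (y2 * (d - d'))).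
have n2 := ler_normD (x1 * (x2 * (a - a')) + x1 * (y2 * (b - b'))) (y1 * (x2 * (c - c'))).
have n3 := ler_normD (x1 * (x2 * (a - a'))) (x1 * (y2 * (b - b'))).
by lra.
Qed.

Lemma D2_near W f p (e : R) : open W -> C2_on W f -> W p -> 0 < e ->
  \forall q \near p, forall v, `|Dv v (Dv v f) q - Dv v (Dv v f) p| <= e * vn v ^+ 2.
Proof.
(* There are [n ^ 2] pairs of indices with four derivatives each; the successor avoids a division by
   zero when the leaves are points. *)
move=> oW hf Wp e0; pose e' := e / (4 * n.+1%:R ^+ 2).
have e'0 : 0 < e' by rewrite divr_gt0// mulr_gt0// exprn_gt0.
pose P l j q := [/\ `|Dxx l j f q - Dxx l j f p| <= e', `|Dxy l j f q - Dxy l j f p| <= e',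
   `|Dyx l j f q - Dyx l j f p| <= e' & `|Dyy l j f q - Dyy l j f p| <= e'].
have nP l j : \forall q \near p, P l j q.
  have [c1 c2 c3 c4] := Dxx_cont hf Wp l j.
  have k1 := (contRP _ _).1 c1 e' e'0; have k2 := (contRP _ _).1 c2 e' e'0.
  have k3 := (contRP _ _).1 c3 e' e'0; have k4 := (contRP _ _).1 c4 e' e'0.
  by apply: filterS2 (filterI k1 k2) (filterI k3 k4) => q [? ?] [? ?].
have nA : \forall q \near p, forall lj : 'I_n * 'I_n, P lj.1 lj.2 q.
  have : \forall q \near p, forall lj : 'I_n * 'I_n, lj \in enum {: 'I_n * 'I_n} -> P lj.1 lj.2 q.
    elim: (enum _) => [|lj s ih]; first by apply: filterS filterT.
    apply: filterS2 (nP lj.1 lj.2) ih => q h1 h2 lj'; rewrite inE => /orP[/eqP ->|hl]; first exact: h1.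
    exact: h2.
  by apply: filterS => q h lj; apply: h; rewrite mem_enum.
apply: filterS2 (open_nbhs_nbhs (conj oW Wp)) nA => q Wq hq v.
rewrite (D2_expand v oW hf Wp) (D2_expand v oW hf Wq) -sumrB.
have [b0 bv] : 0 <= vn v /\ forall l, `|complex.Re (v 0 l)| <= vn v /\ `|complex.Im (v 0 l)| <= vn v.
  split=> [|l]; first exact: vn_ge0.
  by split; apply: le_trans (nc_le_vn v l); [exact: Re_le_nc|exact: Im_le_nc].
apply: (@le_trans _ _ (\sum_(l < n) \sum_(j < n) 4 * e' * vn v ^+ 2)); last first.
  rewrite !sumr_const !card_ord -mulrnA -[leLHS]mulr_natl.
  have -> : (n * n)%:R * (4 * e' * vn v ^+ 2) = ((n * n)%:R / n.+1%:R ^+ 2) * (e * vn v ^+ 2) :> R.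
    by rewrite /e'; field; rewrite nat1r pnatr_eq0.
  apply: ler_piMl; first by rewrite mulr_ge0 ?(ltW e0)// exprn_ge0.
  rewrite ler_pdivrMr ?exprn_gt0// mul1r -natrX ler_nat -mulnn leq_mul//.
apply: (le_trans (ler_norm_sum _ _ _)); apply: ler_sum => l _; rewrite -sumrB.
apply: (le_trans (ler_norm_sum _ _ _)); apply: ler_sum => j _.
have [h1 h2 h3 h4] := hq (l, j); have [x1 y1] := bv l; have [x2 y2] := bv j.
exact: (bilin4 x1 y1 x2 y2 h1 h2 h3 h4).
Qed.

Lemma Dv_ln W f : open W -> (forall p, W p -> {for p, continuous f}) -> (forall p, W p -> 0 < f p) -> C2_on W f ->
  C2_on W (fun p => ln (f p ^+ 2)).
Proof.
move=> oW cf f0 [h1 h2].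
have r1 v p : W p -> rd v (fun z => ln (f (z, p.2) ^+ 2)) p.1 (2 * Dv v f p * (f p)^-1).
  move=> Wp; have fp := f0 p Wp; have h := C1_rd v h1 Wp.
  have hX : is_derive (f p) 1 (fun x : R => ln (x ^+ 2)) ((f p ^+ 2)^-1 * (2 * f p)).
    have := @is_derive1_comp R (@ln R) (fun x => x ^+ 2) (f p) _ _ (is_derive1_ln (exprn_gt0 2 fp)) (is_deriveX 2 (is_derive_id (f p) (1 : R))).
    by rewrite /GRing.scale /= mulr1 expr1.
  rewrite (surjective_pairing p) in hX.
  have := rd_comp h hX; rewrite -surjective_pairing.
  have -> // : (f p ^+ 2)^-1 * (2 * f p) * Dv v f p = 2 * Dv v f p / f p.
  by field; rewrite gt_eqF.
have E v p : W p -> Dv v (fun q => ln (f q ^+ 2)) p = 2 * Dv v f p * (f p)^-1.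
  by move=> Wp; have [_] := rd_val (r1 v p Wp).
have cinv p : W p -> {for p, continuous (fun q => (f q)^-1)}.
  by move=> Wp; apply: cvgV; [rewrite gt_eqF ?f0|exact: cf].
have c1 v : forall p, W p -> {for p, continuous (fun p => 2 * Dv v f p * (f p)^-1)}.
  move=> p Wp; apply: cvgM; last exact: cinv.
  by apply: cvgM; [exact: cvg_cst|have [_] := h1 p Wp v; exact].
have C1G v : C1_on W (fun p => 2 * Dv v f p * (f p)^-1).
  move=> p Wp u; pose dG p := 2 * Dv v f p * (- ((f p)^-1 ^+ 2) * Dv u f p) + (f p)^-1 * (2 * Dv u (Dv v f) p).
  have rG q : W q -> rd u (fun z => 2 * Dv v f (z, q.2) * (f (z, q.2))^-1) q.1 (dG q).
    move=> Wq; have fq := f0 q Wq.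
    have hV : is_derive (f q) 1 (fun x : R => x^-1) (- ((f q)^-1 ^+ 2)).
      have := @is_deriveV R id (f q) 1 1 (lt0r_neq0 fq) (is_derive_id (f q) (1 : R)).
      by rewrite /GRing.scale /= mulr1 exprVn.
    rewrite (surjective_pairing q) in hV.
    have hr := rd_comp (C1_rd u h1 Wq) hV.
    have := rdM (rdZ 2 (C1_rd u (h2 v) Wq)) hr; rewrite /dG -surjective_pairing.
    exact.
  split; first by have [] := rd_val (rG p Wp).
  have cG : {for p, continuous dG}.
    have cv := cinv p Wp; have [_ a1] := h1 p Wp v; have [_ a2] := h1 p Wp u; have [_ a3] := h2 v p Wp u.
    apply: cvgD; apply: cvgM; [|apply: cvgM| |].
    - by apply: cvgM; [exact: cvg_cst|exact: a1].
    - by apply: cvgN; exact: (cvgM cv cv).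
    - exact: a2.
    - exact: cv.
    - by apply: cvgM; [exact: cvg_cst|exact: a3].
  have Ed q : W q -> Dv u (fun p => 2 * Dv v f p * (f p)^-1) q = dG q by move=> Wq; have [_] := rd_val (rG q Wq).
  apply/contRP => e e0; have := (contRP _ _).1 cG e e0.
  by apply: filterS2 (open_nbhs_nbhs (conj oW Wp)) => q Wq; rewrite (Ed q Wq) (Ed p Wp).
split=> [p Wp v|v].
  split; first by have [] := rd_val (r1 v p Wp).
  apply/contRP => e e0; have := (contRP _ _).1 (c1 v p Wp) e e0.
  by apply: filterS2 (open_nbhs_nbhs (conj oW Wp)) => q Wq; rewrite (E v q Wq) (E v p Wp).
by have [] := C1_eq oW (fun p Wp => esym (E v p Wp)) (C1G v).
Qed.

Let dzbar_alg (a b c d : R) :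
  ((a / 2) +i* (- (b / 2)) + 'i * ((c / 2) +i* (- (d / 2)))) / 2 = ((a + d) +i* (c - b)) / 4 :> C.
Proof.
rewrite (_ : (2 : C) = (2 : R)%:C); last by rewrite rmorphD rmorph1.
rewrite (_ : (4 : C) = (4 : R)%:C); last by rewrite -(rmorph_nat (real_complex R) 4).
by rewrite -!fmorphV; apply: complex_ext; rewrite !(cReM, cImM, cReD, cImD, cReN, cImN) /=; field.
Qed.

Lemma dzbar_dz W f p l j : C2_on W f -> W p ->
  d_dzbar l (d_dz j (fun z => (f (z, p.2))%:C)) p.1 = dzbz l j f p.
Proof.
move=> [h1 h2] Wp.
have c2 : (2 : C) = (2 : R)%:C by rewrite rmorphD rmorph1.
have dE z : d_dz j (fun z => (f (z, p.2))%:C) z = (Dv (delta_mx 0 j) f (z, p.2) / 2) +i* (- (Dv ('i *: delta_mx 0 j) f (z, p.2) / 2)).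
  have Im0 u : complex_derive u (fun z => (f (z, p.2))%:C) z = (Dv u f (z, p.2))%:C.
    rewrite /complex_derive /real_derive.
    have -> : (fun s : R => complex.Im (f (z + s%:C *: u, p.2))%:C) = cst 0 by [].
    by rewrite derive1_cst.
  rewrite /d_dz !Im0; move: (Dv _ f _) (Dv _ f _) => a b; rewrite c2 -fmorphV.
  by apply: complex_ext; rewrite !(cReM, cImM, cReD, cImD, cReN, cImN) /=; ring.
have rr u v : rd u (fun z => Dv v f (z, p.2) / 2) p.1 (Dv u (Dv v f) p / 2).
  have := rdZ 2^-1 (C1_rd u (h2 v) Wp); rewrite mulrC.
  by under eq_fun do rewrite mulrC.
have cE u : complex_derive u (d_dz j (fun z => (f (z, p.2))%:C)) p.1 =
    (Dv u (Dv (delta_mx 0 j) f) p / 2) +i* (- (Dv u (Dv ('i *: delta_mx 0 j) f) p / 2)).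
  rewrite (funext dE) /complex_derive /=; congr (_ +i* _).
    by have [_ ->] := rd_val (rr u (delta_mx 0 j)).
  have := rdZ (- 1) (rr u ('i *: delta_mx 0 j)); rewrite mulN1r => h.
  have {}h : rd u (fun z => - (Dv ('i *: delta_mx 0 j) f (z, p.2) / 2)) p.1 (- (Dv u (Dv ('i *: delta_mx 0 j) f) p / 2)).
    by move: h; under eq_fun do rewrite mulN1r.
  by have [_ ->] := rd_val h.
rewrite /d_dzbar !cE; exact: dzbar_alg.
Qed.

End LeviForm.

(** * Diagonalization of positive Hermitian forms *)

Section PositiveHermitianForms.
Context {R : realType} {n : nat}.
Local Notation C := R[i].
Local Notation V := 'rV[C]_n.
Implicit Types (u v w : V) (A M : 'M[C]_n).

Definition sqn w : R := \sum_j nc (w 0 j) ^+ 2.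

Lemma sqn_ge0 w : 0 <= sqn w.
Proof. by apply: sumr_ge0 => j _; rewrite exprn_ge0// nc_ge0. Qed.

Lemma vn_sqn w : vn w ^+ 2 <= sqn w.
Proof.
have h : vn w <= Num.sqrt (sqn w).
  apply: vn_le_row => [|i]; first exact: sqrtr_ge0.
  rewrite -[leLHS]ger0_norm ?nc_ge0// -sqrtr_sqr ler_wsqrtr// /sqn (bigD1 i)//= lerDl.
  by apply: sumr_ge0 => j _; rewrite exprn_ge0// nc_ge0.
rewrite -(sqr_sqrtr (sqn_ge0 w)); apply: lerXn2r => //; rewrite nnegrE ?vn_ge0 ?sqrtr_ge0//.
Qed.

Lemma sqn_vn w : sqn w <= n%:R * vn w ^+ 2.
Proof.
apply: (@le_trans _ _ (\sum_(j < n) vn w ^+ 2)); last by rewrite sumr_const card_ord mulr_natl.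
by apply: ler_sum => j _; apply: lerXn2r; rewrite ?nnegrE ?nc_ge0 ?vn_ge0//; exact: nc_le_vn.
Qed.

Definition herm M v : C := \sum_j \sum_l M j l * ((v 0 l)^* * v 0 j).

Let hermE M v : herm M v = (v *m M *m (map_mx Num.conj v^T)) 0 0.
Proof.
rewrite mxE /herm exchange_big; apply: eq_bigr => l _ /=.
rewrite !mxE mulr_suml; apply: eq_bigr => j _.
by ring.
Qed.

Let ImD_real (z : C) : 0 <= z -> complex.Im z = 0.
Proof. by rewrite lecE /= => /andP[/eqP -> _]. Qed.

(** A positive element of [R[i]] is real, and polarization on basis vectors multiplied by [1] and
    ['i] turns real values into Hermitian symmetry. The complex Hessian is thus Hermitian by
    positivity of the curvature. *)
Lemma herm_sym M : (forall v, v != 0 -> 0 < herm M v) -> map_mx Num.conj M^T = M.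
Proof.
move=> pos; have H0 v : complex.Im (herm M v) = 0.
  have [->|v0] := eqVneq v 0; last exact/ImD_real/ltW/pos.
  by rewrite hermE !mul0mx mxE.
pose b u v : C := (u *m M *m (map_mx Num.conj v^T)) 0 0.
have bD u v : herm M (u + v) = herm M u + herm M v + (b u v + b v u).
  by rewrite !hermE /b !linearD /= map_mxD !mulmxDl !mulmxDr !mxE; ring.
have sym u v : complex.Im (b u v + b v u) = 0.
  by rewrite cImD; have := H0 (u + v); rewrite bD !cImD !H0 !add0r.
have bE i j (c d : C) : b (c *: delta_mx 0 i) (d *: delta_mx 0 j) = c * d^* * M i j.
  rewrite /b !linearZ /= map_mxZ -scalemxAl -scalemxAr -scalemxAl !mxE (bigD1 j)//= !mxE.
  rewrite (bigD1 i)//= !mxE !eqxx big1 ?addr0; last by move=> k ki; rewrite !mxE (negbTE ki) andbF mul0r.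
  rewrite big1 ?addr0; last by move=> k ki; rewrite !mxE (negbTE ki) conjC0 mulr0.
  by rewrite conjC1 mul1r mulr1 mulrCA mulrA.
apply/matrixP => i j; rewrite !mxE.
have s1 := sym (1 *: delta_mx 0 i) (1 *: delta_mx 0 j); have s2 := sym ('i *: delta_mx 0 i) (1 *: delta_mx 0 j).
rewrite !bE conjC1 !mul1r in s1; rewrite !bE conjC1 mulr1 mul1r in s2.
move: s1 s2; case: (M i j) => a c; case: (M j i) => a' c'.
by rewrite !cImD !cImM /= => s1 s2; apply: complex_ext => /=; lra.
Qed.

(** The spectral theorem, followed by a rescaling by the square roots of the eigenvalues, which are
    positive since they are values of the form. *)
Lemma herm_diag M : (forall v, v != 0 -> 0 < herm M v) ->
  exists2 A, A \in unitmx & forall v, herm M v = (sqn (v *m A))%:C.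
Proof.
move=> pos; have Ms := herm_sym pos.
have /orthomx_spectralP : M \is normalmx by apply/normalmxP; rewrite Ms.
set P := spectralmx M; set d := spectral_diag M => ME.
have Pu : P \is unitarymx := spectral_unitarymx M.
have Pi : invmx P = map_mx Num.conj P^T := invmx_unitary Pu.
have PU : P \in unitmx := spectral_unit M.
pose y v := v *m invmx P.
have hE v : herm M v = \sum_j d 0 j * (nc (y v 0 j) ^+ 2)%:C.
  have -> : herm M v = (y v *m diag_mx d *m map_mx Num.conj (y v)^T) 0 0.
    rewrite hermE ME /y Pi trmx_mul map_mxM !mulmxA; congr ((_ *m _) 0 0).
    congr (_ *m _); apply/matrixP => i j; rewrite !mxE.
    exact/esym/conjCK.
  rewrite mul_mx_diag mxE; apply: eq_bigr => j _; rewrite !mxE.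
  by rewrite -nc_mulconj; ring.
have dpos j : 0 < d 0 j.
  have := pos (delta_mx 0 j *m P); rewrite hE /y mulmxK// => h.
  have v0 : delta_mx 0 j *m P != 0 :> V.
    apply/eqP => e; have := congr1 (fun w : V => (w *m invmx P) 0 j) e.
    by rewrite mulmxK// mul0mx !mxE !eqxx => /eqP; rewrite oner_eq0.
  have := h v0; rewrite (bigD1 j)//= big1 ?addr0; last first.
    by move=> k kj; rewrite mxE (negbTE kj) andbF nc0 expr0n mulr0.
  by rewrite mxE !eqxx nc1 expr1n mulr1.
pose s := \row_j (Num.sqrt (complex.Re (d 0 j)))%:C : V.
have dE j : d 0 j = (complex.Re (d 0 j))%:C /\ 0 < complex.Re (d 0 j) by exact: gt0_complexE.
exists (invmx P *m diag_mx s).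
  rewrite unitmx_mul unitmx_inv PU unitmxE det_diag unitfE /=; apply/prodf_neq0 => j _.
  by rewrite mxE -nc_gt0 ncR gtr0_norm sqrtr_gt0; case: (dE j).
move=> v; rewrite hE /sqn rmorph_sum; apply: eq_bigr => j _ /=.
have [e1 e2] := dE j; rewrite mulmxA mul_mx_diag !mxE ncM ncR e1.
rewrite exprMn ger0_norm ?sqrtr_ge0// sqr_sqrtr ?(ltW e2)//= -rmorphM mulrC.
by [].
Qed.

Lemma mulmx_bound M : exists2 K : R, 0 < K & forall v, vn (v *m M) <= K * vn v.
Proof.
exists (\sum_i \sum_j nc (M i j) + 1).
  by rewrite ltr_wpDl// sumr_ge0// => i _; rewrite sumr_ge0// => j _; exact: nc_ge0.
move=> v; apply: vn_le_row => [|j].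
  by rewrite mulr_ge0 ?vn_ge0// addr_ge0// sumr_ge0// => i _; rewrite sumr_ge0// => j _; exact: nc_ge0.
rewrite mxE; apply: (le_trans (nc_sum _ _ _)); rewrite mulrDl mul1r ler_wpDr ?vn_ge0// mulr_suml.
apply: ler_sum => i _; rewrite ncM mulrC; apply: ler_pM; rewrite ?nc_ge0 ?nc_le_vn//.
by rewrite (bigD1 j)//= lerDl sumr_ge0// => k _; exact: nc_ge0.
Qed.

End PositiveHermitianForms.

(** * Weights of the metric in the local frames *)

Section MetricWeights.
Context {R : realType} {X : topologicalType} {n : nat} (L : lamination R X n) (g : cocycle L).
Variable m : hermitian_metric g.
Hypothesis msmooth : smooth_metric m.
Hypothesis mpos : positive_curvature m.
Local Notation C := R[i].
Local Notation V := 'rV[C]_n.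
Implicit Types (c : chart R X n) (i : cov_idx g).

Let frame_hol i j : holomorphic_on L (cov i `&` cov j) (cocycle_fun j i).
Proof. by have [h _] := cocycle_unit (c := g) j i; rewrite setIC. Qed.

Let frameP i j l x : cov i x -> cov j x -> cov l x -> cocycle_fun (c := g) j i x = cocycle_fun j l x * cocycle_fun l i x.
Proof. by move=> hi hj hl; rewrite (cocycleP (c := g) hj hl hi). Qed.

(** The section equal to [1] in the frame [i]. The hypotheses on the metric concern norms of nowhere
    zero sections; this one gives access to the weight itself. *)
Definition frame_section i : holomorphic_section g (cov i) :=
  HolomorphicSection (frame_hol i) (@frameP i).

Definition wt i x : R := section_norm m (frame_section i) x.

Lemma wtE i x : cov i x -> wt i x = metric_weight m i x.
Proof. by move=> hi; exact: (metric_weightP m (iotaP g x) hi). Qed.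

Definition Wd c i : set (V * chart_trans c) := [set p | box p /\ cov i (chart_inv c p)].

Arguments Wd c i : clear implicits.

Definition lw c i (p : V * chart_trans c) : R := ln (wt i (chart_inv c p) ^+ 2).

Arguments lw c i p : clear implicits.

Lemma open_Wd c i : open (Wd c i).
Proof.
rewrite openE => -[z t] [/= hz hc].
have k1 : \forall p \near (z, t), box p by apply: open_nbhs_nbhs; split => //; exact: open_box.
have k2 : \forall p \near (z, t), cov i (chart_inv c p).
  exact: (@chart_inv_cont R X n c z t hz _ (open_nbhs_nbhs (conj (cov_open i) hc))).
by apply: filterS2 k1 k2.
Qed.

Lemma wt_gt0 c i p : Wd c i p -> 0 < wt i (chart_inv c p).
Proof. by move=> [_ h]; rewrite wtE// metric_weight_gt0. Qed.

Lemma wt_C2 c i : atlas L c -> (forall p, Wd c i p -> {for p, continuous (wt i \o chart_inv c)}) /\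
  C2_on (Wd c i) (wt i \o chart_inv c).
Proof.
move=> ac; apply: leaf_smooth_C2; apply: (msmooth (s := frame_section i)) => //; first exact: cov_open.
by move=> j x hi hj; exact: cocycle_neq0.
Qed.

Lemma lw_C2 c i : atlas L c -> C2_on (Wd c i) (lw c i).
Proof.
move=> ac; have [h1 h2] := wt_C2 i ac.
exact: (@Dv_ln R n _ (Wd c i) (wt i \o chart_inv c) (@open_Wd c i) h1 (@wt_gt0 c i) h2).
Qed.

Lemma weight_exp c i p : Wd c i p -> metric_weight m i (chart_inv c p) = expR (lw c i p / 2).
Proof.
move=> hp; have h0 := wt_gt0 hp; have [_ hc] := hp; rewrite -(wtE hc) /lw.
have -> : ln (wt i (chart_inv c p) ^+ 2) / 2 = ln (wt i (chart_inv c p)).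
  by rewrite lnXn// -mulr_natr; field.
by rewrite lnK.
Qed.

Lemma weight_cont i x : cov i x -> {for x, continuous (metric_weight m i)}.
Proof.
move=> hi; have [c ac hc] := atlas_cover L x.
have Wx : Wd c i (chart_map c x) by split; [exact: chart_ball|rewrite chart_mapK'].
have [h1 _] := wt_C2 i ac; have cw := h1 _ Wx.
have c2 := @cont_comp _ _ _ (chart_map c) (wt i \o chart_inv c) x (chart_map_cont hc) cw.
apply/contRP => e e0; have k := (contRP _ _).1 c2 e e0.
have k2 : \forall y \near x, chart_dom c y by apply: open_nbhs_nbhs; split => //; exact: chart_dom_open.
apply: filterS3 k k2 (cov_near hi) => y; rewrite /= (chart_mapK' hc) => hy dy cy.
by move: hy; rewrite chart_mapK'// !wtE.
Qed.

(** On the pair [v], ['i *: v] the form ['i * dbar_d] takes [-2] times the value of the Levi form.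
    Positive curvature therefore makes the Levi form of the logarithmic weight negative, as that of
    a decaying Gaussian. *)
Lemma levi_neg c i p v : atlas L c -> Wd c i p -> v != 0 -> 0 < - levi (lw c i) p v.
Proof.
move=> ac Wp v0; have := mpos (cov_open i) (s := frame_section i) _ ac Wp.1 _ v0.
move=> /(_ _ p.2); rewrite -surjective_pairing => /(_ _ Wp.2) h.
have {}h : 0 < curvature m (frame_section i) p.2 p.1 v ('i *: v).
  by apply: h => j x hi hj; exact: cocycle_neq0.
move: h; rewrite /curvature.
have -> : (fun w => (ln (section_norm m (frame_section i) (chart_inv c (w, p.2)) ^+ 2))%:C) = (fun w => (lw c i (w, p.2))%:C) by [].
have -> : 'i * dbar_d (fun w => (lw c i (w, p.2))%:C) p.1 v ('i *: v) = 2 * - levi (lw c i) p v.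
  rewrite /dbar_d /levi mulr_sumr -sumrN mulr_sumr; apply: eq_bigr => j _.
  rewrite mulr_sumr -sumrN mulr_sumr; apply: eq_bigr => l _.
  rewrite (dzbar_dz _ _ (lw_C2 i ac) Wp) !mxE.
  move: (dzbz l j _ p) => a; case: a => a b; case: (v 0 l) => x y; case: (v 0 j) => x' y'.
  by apply: complex_ext => /=; ring.
by rewrite pmulr_rgt0// ltr0n.
Qed.

Lemma levi_diag c i p : atlas L c -> Wd c i p ->
  exists2 A : 'M[C]_n, A \in unitmx & forall v, - levi (lw c i) p v = (sqn (v *m A))%:C.
Proof.
move=> ac Wp; pose M := \matrix_(j < n, l < n) - dzbz l j (lw c i) p.
have E v : herm M v = - levi (lw c i) p v.
  rewrite /herm /levi -sumrN; apply: eq_bigr => j _; rewrite -sumrN; apply: eq_bigr => l _.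
  by rewrite mxE mulNr.
have [v v0|A uA hA] := @herm_diag R n M; first by rewrite E; exact: levi_neg.
by exists A => // v; rewrite -E hA.
Qed.

End MetricWeights.

Arguments Wd {R X n L g} c i.
Arguments lw {R X n L g} m c i p.

(** * Uniformity on compact laminations *)

Section Compactness.
Context {R : realType} {X : topologicalType}.
Hypothesis cX : compact [set: X].

Lemma finite_cover (f : X -> set X) : (forall x, nbhs x (f x)) ->
  exists (N : nat) (p : 'I_N -> X), forall y : X, exists b, nbhs y (f (p b)).
Proof.
move=> hf; have /compact_near_coveringP cov := cX.
(* The filter of sufficiently large finite lists of points. Along it, the near-covering form of
   compactness yields a finite subcover. *)
pose F : set_system (seq X) := fun A => exists s0 : seq X, forall s, {subset s0 <= s} -> A s.
have FF : Filter F.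
  split=> [|A B [s1 h1] [s2 h2]|A B AB [s1 h1]]; first by exists [::].
    exists (s1 ++ s2) => s hs; split; [apply: h1|apply: h2] => x hx; apply: hs;
      by rewrite mem_cat hx ?orbT.
  by exists s1 => s /h1 /AB.
have [] := cov _ F (fun s y => exists2 x, x \in s & nbhs y (f x)) FF.
  move=> x _; exists ((f x)^°%classic, [set s : seq X | x \in s]); last first.
    by move=> [y s] /= [hy hs]; exists x.
  split=> /=; first by apply: open_nbhs_nbhs; split; [exact: open_interior|exact: hf].
  by exists [:: x] => s hs; apply: hs; rewrite inE.
move=> s /(_ s (fun x h => h)) hs.
exists (size s), (fun i => tnth (in_tuple s) i) => y.
have [x xs hx] := hs y Logic.I.
have ix : (index x s < size s)%N by rewrite index_mem.
by exists (Ordinal ix); rewrite (tnth_nth x) /= nth_index.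
Qed.

Lemma unif (K : set X) (Q : R -> X -> Prop) : closed K ->
  (forall x, K x -> exists2 e : R, 0 < e & \forall y \near x, Q e y) ->
  (forall (e e' : R) y, 0 < e <= e' -> Q e' y -> Q e y) ->
  exists2 e : R, 0 < e & forall y, K y -> Q e y.
Proof.
move=> cK h mono.
have H : forall x : X, exists e : R, 0 < e /\ \forall y \near x, K y -> Q e y.
  move=> x; have [/h[e e0 he]|nK] := pselect (K x).
    by exists e; split=> //; apply: filterS he.
  exists 1; split=> //; have : \forall y \near x, (~` K) y by apply: open_nbhs_nbhs; split=> //; exact: closed_openC.
  by apply: filterS => y nKy /nKy.
have [e he] := choice H.
have [N [p hp]] := @finite_cover (fun x => [set y | K y -> Q (e x) y]) (fun x => (he x).2).
exists (\big[Num.min/1]_(b < N) e (p b)).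
  by elim/big_ind: _ => // [a b a0 b0|b _]; [rewrite lt_min a0|case: (he (p b))].
move=> y Ky; have [b /nbhs_singleton /(_ Ky)] := hp y; apply: mono.
rewrite bigmin_le //= andbT.
by elim/big_ind: _ => // [u v u0 v0|i _]; [rewrite lt_min u0|case: (he (p i))].
Qed.

Lemma all_fin_unif (I : finType) (Q : I -> R -> Prop) :
  (forall i, exists2 e : R, 0 < e & Q i e) -> (forall i (e e' : R), 0 < e <= e' -> Q i e' -> Q i e) ->
  exists2 e : R, 0 < e & forall i, Q i e.
Proof.
move=> h mono; have /choice[e he] : forall i, exists e : R, 0 < e /\ Q i e by move=> i; have [e e0 he] := h i; exists e.
have e0 : 0 < \big[Num.min/1]_i e i.
  by elim/big_ind: _ => // [a b a0 b0|b _]; [rewrite lt_min a0|case: (he b)].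
exists (\big[Num.min/1]_i e i) => // i; apply: mono (he i).2.
by rewrite e0 bigmin_le.
Qed.

End Compactness.

(** * A Lipschitz estimate for bounded holomorphic functions *)

Section HolomorphicLipschitz.
Context {R : realType} {n : nat}.
Local Notation C := R[i].
Local Notation V := 'rV[C]_n.

Let lip_alg (K t d : R) : 0 <= K -> 0 < d -> 0 < t -> t < d / 8 ->
  K * t ^+ 2 / (d / 4) ^+ 2 + K / (d / 4) * t <= 8 * K / d * t.
Proof.
move=> K0 d0 t0 td.
have -> : K * t ^+ 2 / (d / 4) ^+ 2 + K / (d / 4) * t = (K / d * t) * (16 * t / d + 4).
  by field; rewrite gt_eqF.
have -> : 8 * K / d * t = (K / d * t) * 8 by field; rewrite gt_eqF.
apply: ler_wpM2l; first by rewrite mulr_ge0 ?divr_ge0 ?(ltW d0) ?(ltW t0).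
have : 16 * t / d <= 4 by rewrite ler_pdivrMr//; lra.
by lra.
Qed.

(** [taylor1] on the complex line through [z1] and [z2]; the increment is small compared with the
    radius, so that the linear term dominates. *)
Lemma holo_lip (f : V -> C) (a : V) (d M : R) : 0 < d ->
  (forall z, vn (z - a) < d -> differentiable f z) -> (forall z, vn (z - a) < d -> nc (f z) <= M) ->
  forall z1 z2, vn (z1 - a) < d / 16 -> vn (z2 - a) < d / 16 ->
  nc (f z2 - f z1) <= 8 * KT * M / d * vn (z2 - z1).
Proof.
move=> d0 df fM z1 z2 h1 h2; have KT0 := @KT_gt0 R.
have M0 : 0 <= M by apply: le_trans (fM a _); rewrite ?nc_ge0// subrr vn0.
set u := z2 - z1; have [u0|u0] := eqVneq u 0.
  have E : z2 = z1 by apply/eqP; rewrite -subr_eq0; apply/eqP.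
  by rewrite u0 E subrr nc0 vn0 mulr0.
have du : vn u < d / 8.
  have := vnD (z2 - a) (- (z1 - a)); rewrite vnN opprB addrA subrK -/u; lra.
have un : 0 < vn u by rewrite lt_neqAle eq_sym vn_eq0 u0 vn_ge0.
pose e : V := (vn u)^-1%:C *: u.
have ve : vn e = 1 by rewrite vnZ ncR gtr0_norm ?invr_gt0// mulVf// gt_eqF.
pose F (x : C) := f (z1 + x *: e).
have near x : sq 0 (d / 4) x -> vn (z1 + x *: e - a) < d.
  move=> /nc_sq; rewrite subr0 => hx; have := vnD (z1 - a) (x *: e); rewrite addrAC vnZ ve mulr1; lra.
have [||x hx|l [hl1 hl2]] := @taylor1 R F 0 (d / 4) M; first by rewrite divr_gt0.
- by move=> x hx; apply: (@diff_line R n f z1 e x); apply: df; exact: near.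
- by apply: fM; exact: near.
have nu : nc (vn u)%:C = vn u by rewrite ncR gtr0_norm.
have := hl2 (vn u)%:C; rewrite nu add0r => /(_ ltac:(lra)).
have -> : F (vn u)%:C = f z2.
  rewrite /F /e scalerA -rmorphM mulfV ?gt_eqF// rmorph1 scale1r /u.
  by rewrite addrC subrK.
have -> : F 0 = f z1 by rewrite /F scale0r addr0.
move=> h; have := ncD (f z2 - f z1 - l * (vn u)%:C) (l * (vn u)%:C); rewrite subrK ncM nu => h'.
apply: (le_trans h'); apply: (le_trans (lerD h (ler_wpM2r (ltW un) hl1))).
have KM0 : 0 <= KT * M by rewrite mulr_ge0// ltW.
by rewrite -(mulrA 8); exact: lip_alg.
Qed.

End HolomorphicLipschitz.

Section LeviEstimates.
Context {R : realType} {n : nat} {T : topologicalType}.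
Local Notation C := R[i].
Local Notation V := 'rV[C]_n.

Let alg1 (a b q l : R) : a / 2 = q + l -> b / 2 = - q + l -> l = (a + b) / 4.
Proof. lra. Qed.

Let alg2 (lp lq a b c d k : R) : lp = (c + d) / 4 -> lq = (a + b) / 4 -> 0 <= k ->
  `|a - c| <= k -> `|b - d| <= k -> `|lq - lp| <= k.
Proof. by move=> -> -> k0; rewrite !ler_norml => /andP[? ?] /andP[? ?]; apply/andP; split; lra. Qed.

(** Replacing [v] by ['i *: v] changes the sign of the quadratic part and preserves the Levi form,
    so the sum isolates the latter. Continuity estimates for second derivatives thereby pass to the
    Levi form. *)
Lemma levi_D2 (W : set (V * T)) f p (v : V) : open W -> C2_on W f -> W p ->
  complex.Re (levi f p v) = (Dv v (Dv v f) p + Dv ('i *: v) (Dv ('i *: v) f) p) / 4.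
Proof.
move=> oW hf Wp; have h1 := D2_levi v oW hf Wp; have h2 := D2_levi ('i *: v) oW hf Wp.
have e1 : quad_part f p ('i *: v) = - quad_part f p v.
  rewrite /quad_part -sumrN; apply: eq_bigr => j _; rewrite -sumrN; apply: eq_bigr => l _.
  have ii : 'i * 'i = -1 :> C by apply: complex_ext; rewrite ?cReM ?cImM /=; ring.
  by rewrite !mxE [_ * ('i * _)]mulrACA ii mulN1r mulrN.
have e2 : levi f p ('i *: v) = levi f p v.
  rewrite /levi; apply: eq_bigr => j _; apply: eq_bigr => l _; congr (_ * _).
  by rewrite !mxE; case: (v 0 l) => x y; case: (v 0 j) => x' y'; apply: complex_ext; rewrite !(cReM, cImM) /= ?(cReM, cImM) /=; ring.
rewrite e1 e2 cReN in h2.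
exact: (alg1 h1 h2).
Qed.

Lemma levi_near (W : set (V * T)) f p (e : R) : open W -> C2_on W f -> W p -> 0 < e ->
  \forall q \near p, forall v, `|complex.Re (levi f q v) - complex.Re (levi f p v)| <= e * vn v ^+ 2.
Proof.
move=> oW hf Wp e0; have k := D2_near oW hf Wp e0.
apply: filterS2 (open_nbhs_nbhs (conj oW Wp)) k => q Wq h v.
have := h ('i *: v); rewrite vnZ nci mul1r => h2.
have m0 : 0 <= e * vn v ^+ 2 by rewrite mulr_ge0 ?(ltW e0)// exprn_ge0// vn_ge0.
exact: (alg2 (levi_D2 v oW hf Wp) (levi_D2 v oW hf Wq) m0 (h v) h2).
Qed.

End LeviEstimates.

(** * Finitely many charts with uniform bounds *)

Section Background.
Context {R : realType} {X : topologicalType} {n : nat} (L : lamination R X n) (g : cocycle L).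
Variable m : hermitian_metric g.
Hypothesis msmooth : smooth_metric m.
Hypothesis mpos : positive_curvature m.
Hypothesis cX : compact [set: X].
Hypothesis hX : hausdorff_space X.
Local Notation C := R[i].
Local Notation V := 'rV[C]_n.
Implicit Types (c d : chart R X n).

(* Finitely many foliated charts, with closed sets [bK] whose interiors cover [X], on which the
   transition maps, the leafwise discs of radius [br] and the Levi form of the weights are uniformly
   controlled. *)
Record background := Background {
  bN : nat;
  bc : 'I_bN -> chart R X n;
  bi : 'I_bN -> cov_idx g;
  bK : 'I_bN -> set X;
  br : R;
  br_gt0 : 0 < br;
  b_atlas : forall b, atlas L (bc b);
  b_closed : forall b, closed (bK b);
  b_cover : forall x : X, exists b, nbhs x (bK b);
  b_dom : forall b x, bK b x -> chart_dom (bc b) x;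
  b_cov : forall b x, bK b x -> cov (bi b) x;
  b_ball : forall b y z, bK b y -> vn (z - (chart_map (bc b) y).1) < br -> unit_ball z;
  b_trans : forall b b' y z z1 z2, bK b y ->
    vn (z - (chart_map (bc b) y).1) < br -> vn (z1 - (chart_map (bc b) y).1) < br ->
    vn (z2 - (chart_map (bc b) y).1) < br ->
    bK b' (chart_inv (bc b) (z, (chart_map (bc b) y).2)) ->
    let x1 := chart_inv (bc b) (z1, (chart_map (bc b) y).2) in
    let x2 := chart_inv (bc b) (z2, (chart_map (bc b) y).2) in
    [/\ chart_dom (bc b') x1, (chart_map (bc b') x1).2 = (chart_map (bc b') x2).2
      & vn ((chart_map (bc b') x1).1 - (chart_map (bc b') x2).1) <= br^-1 * vn (z1 - z2)];
  b_levi : forall b y v, bK b y ->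
    br * vn v ^+ 2 <= - complex.Re (levi (lw m (bc b) (bi b)) (chart_map (bc b) y) v) <= br^-1 * vn v ^+ 2
}.

Lemma disc_near c y0 (P : set X) : chart_dom c y0 -> nbhs y0 P -> exists2 e : R, 0 < e &
  \forall y \near y0, chart_dom c y /\ forall z, vn (z - (chart_map c y).1) < e ->
    unit_ball z /\ P (chart_inv c (z, (chart_map c y).2)).
Proof.
move=> hy hP; have hz := chart_ball hy; set p0 := chart_map c y0 in hz *.
have near_p : \forall p \near p0, box p /\ P (chart_inv c p).
  have k1 : \forall p \near p0, box p by apply: open_nbhs_nbhs; split => //; exact: open_box.
  have k2 : \forall p \near p0, P (chart_inv c p).
    have := @chart_inv_cont R X n c p0.1 p0.2 hz P; rewrite -surjective_pairing; apply.
    by rewrite chart_mapK'.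
  exact: filterI.
rewrite (surjective_pairing p0) in near_p.
have [[A B] /= [nA nB] AB] := near_p.
have [d d0 hd] := (nearV p0.1 _).1 nA.
exists (d / 2); first by rewrite divr_gt0.
have cm := chart_map_cont hy.
have k1 : \forall y \near y0, B (chart_map c y).2 by exact: (cont_comp cm (cont_snd p0) nB).
have k2 : \forall y \near y0, vn ((chart_map c y).1 - p0.1) <= d / 2.
  have c1 := cont_comp cm (cont_fst p0).
  have : nbhs p0.1 (fun z : V => vn (z - p0.1) <= d / 2).
    apply/(nearV p0.1 (fun z : V => vn (z - p0.1) <= d / 2)); exists (d / 2); first by rewrite divr_gt0.
    by move=> h; rewrite addrAC subrr add0r.
  exact: c1.
have k3 : \forall y \near y0, chart_dom c y by apply: open_nbhs_nbhs; split => //; exact: chart_dom_open.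
apply: filterS3 k1 k2 k3 => y h1 h2 h3; split=> // z hzz.
have hzd : vn (z - p0.1) <= d.
  have := vnD (z - (chart_map c y).1) ((chart_map c y).1 - p0.1); rewrite addrA subrK; lra.
have Az : A z by have := hd _ hzd; rewrite addrC subrK.
by have [h _] := AB (z, (chart_map c y).2) (conj Az h1); split=> //; have [_] := AB (z, (chart_map c y).2) (conj Az h1).
Qed.

(** The coordinates in [d] are bounded near [y0], and [holo_lip] turns this into a Lipschitz
    constant independent of the nearby point [y]. One number [e] serves as radius and as inverse of
    the constant, so that a single quantity has to be made uniform by compactness. *)
Lemma trans_near c d y0 : atlas L c -> atlas L d -> chart_dom c y0 -> chart_dom d y0 ->
  exists2 e : R, 0 < e & \forall y \near y0, forall z1 z2, vn (z1 - (chart_map c y).1) < e ->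
    vn (z2 - (chart_map c y).1) < e ->
    let x1 := chart_inv c (z1, (chart_map c y).2) in
    let x2 := chart_inv c (z2, (chart_map c y).2) in
    [/\ chart_dom d x1, (chart_map d x1).2 = (chart_map d x2).2
      & vn ((chart_map d x1).1 - (chart_map d x2).1) <= e^-1 * vn (z1 - z2)].
Proof.
move=> ac ad hc hd; set p0 := chart_map c y0; set q0 := chart_map d y0.
have [[ht hdiff] _] := atlas_compatible ac ad.
have e0 : chart_inv c p0 = y0 by rewrite chart_mapK'.
have ov : overlap d p0 by split; [exact: chart_ball|rewrite e0].
have [t' ht'] := ht p0 ov.
pose P := [set x | chart_dom d x /\ vn ((chart_map d x).1 - q0.1) <= 1].
have nP : nbhs y0 P.
  have k1 : \forall x \near y0, chart_dom d x by apply: open_nbhs_nbhs; split => //; exact: chart_dom_open.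
  have c1 := cont_comp (chart_map_cont hd) (cont_fst q0).
  have k2 : nbhs q0.1 (fun z : V => vn (z - q0.1) <= 1).
    by apply/(nearV q0.1 (fun z : V => vn (z - q0.1) <= 1)); exists 1 => // h; rewrite addrAC subrr add0r.
  by apply: filterS2 k1 (c1 _ k2).
pose Q := [set x | P x /\ chart_dom c x /\ (chart_map d x).2 = t' (chart_map c x).2].
have nQ : nbhs y0 Q.
  have k3 : \forall x \near y0, chart_dom c x by apply: open_nbhs_nbhs; split => //; exact: chart_dom_open.
  have k4 : \forall x \near y0, (transition d (chart_map c x)).2 = t' (chart_map c x).2.
    exact: (chart_map_cont hc ht').
  apply: filterS3 nP k3 k4 => x h1 h2 h3; split=> //; split=> //.
  by rewrite -h3 /transition chart_mapK'.
have [r r0 hr] := disc_near hc nQ.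
pose M := vn q0.1 + 1.
have M0 : 0 < M by rewrite /M; have := vn_ge0 q0.1; lra.
pose K := 8 * KT * M / r.
have K0 : 0 < K by rewrite divr_gt0// mulr_gt0// mulr_gt0// KT_gt0.
exists (Num.min (r / 16) K^-1); first by rewrite lt_min divr_gt0 ?invr_gt0.
apply: filterS hr => y [_ hr] z1 z2; rewrite !lt_min => /andP[z1r _] /andP[z2r _].
have r16 : r / 16 < r by lra.
have [u1 [[d1 _] [cc1 t1]]] := hr z1 (lt_trans z1r r16).
have [u2 [[d2 _] [cc2 t2]]] := hr z2 (lt_trans z2r r16).
split; first exact: d1.
  by rewrite t1 t2 !chart_invK'.
apply: (@le_trans _ _ (K * vn (z1 - z2))); last first.
  rewrite ler_wpM2r ?vn_ge0// -[leLHS]invrK lef_pV2 ?posrE ?invr_gt0// ?ge_min ?lexx ?orbT//.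
  by rewrite lt_min invr_gt0 K0 divr_gt0.
apply: vn_le_row => [|j]; first by rewrite mulr_ge0 ?vn_ge0// ltW.
rewrite !mxE; apply: (@holo_lip R n (fun z => (chart_map d (chart_inv c (z, (chart_map c y).2))).1 0 j) (chart_map c y).1 r M r0) => //.
- move=> z hz; have [uz [[dz _] _]] := hr z hz.
  have hh := hdiff z (chart_map c y).2 (conj uz dz).
  exact: (@diff_coord_of R n (fun z => (chart_map d (chart_inv c (z, (chart_map c y).2))).1) j z hh).
- move=> z hz; have [uz [[_ dz] _]] := hr z hz.
  apply: (le_trans (nc_le_vn _ j)); have := vnD ((chart_map d (chart_inv c (z, (chart_map c y).2))).1 - q0.1) q0.1.
  by rewrite subrK /M; lra.
Qed.

Let lev_alg (a B s t lv lv0 : R) : 0 < a -> 0 < B + 1 -> 0 <= t -> lv0 = - s ->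
  `|lv - lv0| <= Num.min (a^-1 / 2) 1 * t -> t <= a * s -> s <= B * t ->
  Num.min (a^-1 / 2) (B + 1)^-1 * t <= - lv <= (Num.min (a^-1 / 2) (B + 1)^-1)^-1 * t.
Proof.
move=> a0 B0 t0 -> hv; rewrite -ler_pdivrMl// => b2 b1.
have a20 : 0 < a^-1 / 2 by rewrite divr_gt0 ?invr_gt0.
set e := Num.min (a^-1 / 2) (B + 1)^-1.
have m1 : Num.min (a^-1 / 2) 1 <= a^-1 / 2 by rewrite ge_min lexx.
have m2 : Num.min (a^-1 / 2) 1 <= 1 by rewrite ge_min lexx orbT.
have n1 : e <= a^-1 / 2 by rewrite /e ge_min lexx.
have n2 : B + 1 <= e^-1.
  by rewrite -[leLHS]invrK lef_pV2 ?posrE ?invr_gt0// /e ?lt_min ?a20 ?invr_gt0// ge_min lexx orbT.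
have q1 := ler_wpM2r t0 m1; have q2 := ler_wpM2r t0 m2; have q3 := ler_wpM2r t0 n1; have q4 := ler_wpM2r t0 n2.
move: hv; rewrite ler_norml => /andP[hv1 hv2].
have E : a^-1 * t = 2 * (a^-1 / 2 * t) by field; rewrite gt_eqF.
by apply/andP; split; lra.
Qed.

Lemma exists_background : inhabited background.
Proof.
have /choice[c hc] : forall x, exists c, atlas L c /\ chart_dom c x.
  by move=> x; have [c ac dc] := atlas_cover L x; exists c.
(* A compact Hausdorff space is regular, which leaves room for a closed neighbourhood inside the
   domains of a chart and of a frame. *)
have /choice[K hK] : forall x, exists K : set X, [/\ closed K, nbhs x K, K `<=` chart_dom (c x) & K `<=` cov (iota g x)].
  move=> x; have : nbhs x (chart_dom (c x) `&` cov (iota g x)).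
    apply: open_nbhs_nbhs; split; first by apply: openI; [exact: chart_dom_open|exact: cov_open].
    by split; [exact: (hc x).2|exact: iotaP].
  have rg : regular_space X by move=> y; apply: (@compact_regular X y setT hX cX); exact: filterT.
  move=> /(rg x)[B /= nB hB]; exists (closure B); split; first exact: closed_closure.
  - by apply: filterS nB; exact: subset_closure.
  - by move=> y /hB[].
  - by move=> y /hB[].
have [N [p hp]] := @finite_cover X cX K (fun x => (let: And4 _ h _ _ := hK x in h)).
pose zc (b : 'I_N) y := (chart_map (c (p b)) y).1.
pose tc (b : 'I_N) y := (chart_map (c (p b)) y).2.
pose Q1 b (e : R) y := forall z, vn (z - zc b y) < e -> unit_ball z.
have [e1 e10 he1] : exists2 e : R, 0 < e & forall b : 'I_N, forall y, K (p b) y -> Q1 b e y.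
  apply: all_fin_unif => [b|b e e' /andP[_ ee] h y Ky z hz]; last by apply: (h y Ky); exact: lt_le_trans hz ee.
  have [cK _ dK _] := hK (p b); apply: (unif cX cK) => [y /dK dy|e e' y /andP[_ ee] h z hz]; last first.
    by apply: h; exact: lt_le_trans hz ee.
  have [e e0 he] := disc_near dy (@filterT _ (nbhs y) _); exists e => //.
  by apply: filterS he => y' [_ h] z /h[].
pose Q2 (bb : 'I_N * 'I_N) (e : R) y := forall z z1 z2, vn (z - zc bb.1 y) < e -> vn (z1 - zc bb.1 y) < e ->
    vn (z2 - zc bb.1 y) < e -> K (p bb.2) (chart_inv (c (p bb.1)) (z, tc bb.1 y)) ->
    let x1 := chart_inv (c (p bb.1)) (z1, tc bb.1 y) in
    let x2 := chart_inv (c (p bb.1)) (z2, tc bb.1 y) in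
    [/\ chart_dom (c (p bb.2)) x1, (chart_map (c (p bb.2)) x1).2 = (chart_map (c (p bb.2)) x2).2
      & vn ((chart_map (c (p bb.2)) x1).1 - (chart_map (c (p bb.2)) x2).1) <= e^-1 * vn (z1 - z2)].
have Q2m bb (e e' : R) y : 0 < e <= e' -> Q2 bb e' y -> Q2 bb e y.
  move=> /andP[e0 ee] h z z1 z2 hz hz1 hz2 hk x1 x2.
  have [h1 h2 h3] := h z z1 z2 (lt_le_trans hz ee) (lt_le_trans hz1 ee) (lt_le_trans hz2 ee) hk.
  split=> //; apply: (le_trans h3); rewrite ler_wpM2r ?vn_ge0// lef_pV2 ?posrE//.
  exact: lt_le_trans e0 ee.
have [e2 e20 he2] : exists2 e : R, 0 < e & forall bb y, K (p bb.1) y -> Q2 bb e y.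
  apply: all_fin_unif => [[b b']|bb e e' ee h y Ky]; last exact: Q2m ee (h y Ky).
  have [cK _ dK _] := hK (p b); have [cK' _ dK' _] := hK (p b').
  apply: (unif cX cK) => [y Ky|e e' y ee]; last exact: Q2m.
  (* If [y] is outside the closed set [K (p b')], small discs around [y] avoid it and the
     requirement is void. *)
  have [/dK' dy'|nK'] := pselect (K (p b') y).
    have [e e0 he] := trans_near (hc (p b)).1 (hc (p b')).1 (dK y Ky) dy'; exists e => //.
    by apply: filterS he => y' h z z1 z2 _ hz1 hz2 _; exact: h.
  have nn : nbhs y (~` K (p b')) by apply: open_nbhs_nbhs; split=> //; exact: closed_openC.
  have [e e0 he] := disc_near (dK y Ky) nn; exists e => //.
  by apply: filterS he => y' [_ h] z z1 z2 /h[_ nz] _ _ /nz.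
pose lev b y v := - complex.Re (levi (lw m (c (p b)) (iota g (p b))) (chart_map (c (p b)) y) v).
pose Q3 b (e : R) y := forall v, e * vn v ^+ 2 <= lev b y v <= e^-1 * vn v ^+ 2.
have Q3m b (e e' : R) y : 0 < e <= e' -> Q3 b e' y -> Q3 b e y.
  move=> /andP[e0 ee] h v; have /andP[h1 h2] := h v; have v0 : 0 <= vn v ^+ 2 by rewrite exprn_ge0// vn_ge0.
  rewrite (le_trans (ler_wpM2r v0 ee) h1) (le_trans h2)// ler_wpM2r// lef_pV2 ?posrE//.
  exact: lt_le_trans e0 ee.
have [e3 e30 he3] : exists2 e : R, 0 < e & forall b y, K (p b) y -> Q3 b e y.
  apply: all_fin_unif => [b|b e e' ee h y Ky]; last exact: Q3m ee (h y Ky).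
  have [cK _ dK iK] := hK (p b); apply: (unif cX cK) => [y Ky|e e' y ee]; last exact: Q3m.
  have ac := (hc (p b)).1; have dy := dK y Ky; set p0 := chart_map (c (p b)) y.
  have Wp : Wd (c (p b)) (iota g (p b)) p0 by split; [exact: chart_ball|rewrite chart_mapK'//; exact: iK].
  have [A uA hA] := levi_diag msmooth mpos ac Wp.
  have [K1 K10 hK1] := mulmx_bound A; have [K2 K20 hK2] := mulmx_bound (invmx A).
  have l1 v : vn v ^+ 2 <= K2 ^+ 2 * sqn (v *m A).
    apply: (@le_trans _ _ ((K2 * vn (v *m A)) ^+ 2)); last first.
      by rewrite exprMn ler_wpM2l ?exprn_ge0 ?(ltW K20)//; exact: vn_sqn.
    by apply: lerXn2r; rewrite ?nnegrE ?mulr_ge0 ?vn_ge0 ?(ltW K20)//; have := hK2 (v *m A); rewrite mulmxK.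
  have l2 v : sqn (v *m A) <= n%:R * K1 ^+ 2 * vn v ^+ 2.
    apply: (le_trans (sqn_vn _)); rewrite -mulrA ler_wpM2l// -exprMn.
    by apply: lerXn2r; rewrite ?nnegrE ?mulr_ge0 ?vn_ge0 ?(ltW K10).
  pose e := Num.min (K2 ^-2 / 2) (n%:R * K1 ^+ 2 + 1)^-1.
  have B0 : 0 < n%:R * K1 ^+ 2 + 1 by rewrite ltr_wpDl// mulr_ge0// exprn_ge0// ltW.
  have K22 : 0 < K2 ^-2 / 2 by rewrite divr_gt0// invr_gt0 exprn_gt0.
  have e0 : 0 < e by rewrite lt_min K22 invr_gt0.
  exists e => //.
  have d0 : 0 < Num.min (K2 ^-2 / 2) 1 by rewrite lt_min K22 ltr01.
  have near := levi_near (@open_Wd R X n L g (c (p b)) (iota g (p b))) (lw_C2 msmooth (iota g (p b)) ac) Wp d0.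
  have near2 : \forall y' \near y, forall v : V, `|complex.Re (levi (lw m (c (p b)) (iota g (p b))) (chart_map (c (p b)) y') v) -
      complex.Re (levi (lw m (c (p b)) (iota g (p b))) p0 v)| <= Num.min (K2 ^-2 / 2) 1 * vn v ^+ 2.
    exact: (chart_map_cont dy near).
  apply: filterS near2 => y' h v.
  have := h v; rewrite -/p0 => hv.
  have E : complex.Re (levi (lw m (c (p b)) (iota g (p b))) p0 v) = - sqn (v *m A).
    by have := congr1 (@complex.Re R) (hA v); rewrite cReN /= => <-; rewrite opprK.
  have v2 : 0 <= vn v ^+ 2 by rewrite exprn_ge0// vn_ge0.
  exact: (lev_alg (exprn_gt0 2 K20) B0 v2 E hv (l1 v) (l2 v)).
pose e := Num.min e1 (Num.min e2 e3).
have e0 : 0 < e by rewrite !lt_min e10 e20.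
have [m1 m2 m3] : [/\ e <= e1, e <= e2 & e <= e3] by rewrite /e !ge_min !lexx !orbT.
constructor; apply: (@Background N (fun b => c (p b)) (fun b => iota g (p b)) (fun b => K (p b)) e e0).
- by move=> b; exact: (hc (p b)).1.
- by move=> b; have [] := hK (p b).
- exact: hp.
- by move=> b x Kx; have [_ _ h _] := hK (p b); exact: h.
- by move=> b x Kx; have [_ _ _ h] := hK (p b); exact: h.
- by move=> b y z Ky hz; apply: (he1 b y Ky); exact: lt_le_trans hz m1.
- move=> b b' y z z1 z2 Ky; apply: (Q2m (b, b') e e2 y) => //; first by rewrite e0.
  exact: he2 (b, b') y Ky.
- by move=> b y v Ky; apply: (Q3m b e e3 y) => //; [rewrite e0|exact: he3].
Qed.

End Background.

Arguments bc {R X n L g m} _ _.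
Arguments bi {R X n L g m} _ _.
Arguments bK {R X n L g m} _ _ _.
Arguments b_atlas {R X n L g m} _ _.
Arguments b_cover {R X n L g m} _ _.

(** * Flow boxes and gauges *)

Section FrozenBoxes.
Context {R : realType} {X : topologicalType} {n : nat} {L : lamination R X n} {g : cocycle L}.
Context {m : hermitian_metric g}.
Hypothesis msmooth : smooth_metric m.
Hypothesis mpos : positive_curvature m.
Variable Bg : background m.
Local Notation C := R[i].
Local Notation V := 'rV[C]_n.

(** A common bound for the matrices diagonalizing the Levi forms and for their inverses; the factor
    [n.+1] pays for the passage between the sup norm and the Euclidean norm. *)
Definition Lam : R := (br Bg)^-1 * n.+1%:R + 1.

Lemma Lam_ge1 : 1 <= Lam.
Proof. by rewrite lerDr mulr_ge0// invr_ge0 ltW// br_gt0. Qed.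

Lemma Lam_gt0 : 0 < Lam. Proof. exact: lt_le_trans Lam_ge1. Qed.

Lemma Lam_mx (A : 'M[C]_n) (v : V) :
  br Bg * vn v ^+ 2 <= sqn (v *m A) <= (br Bg)^-1 * vn v ^+ 2 ->
  vn (v *m A) <= Lam * vn v /\ vn v <= Lam * vn (v *m A).
Proof.
have r0 := br_gt0 Bg; have l0 := Lam_gt0; move=> /andP[h1 h2].
have i0 : 0 <= (br Bg)^-1 by rewrite invr_ge0 ltW.
have sq (a b t : R) : 0 <= a -> 0 <= b -> t * 1 <= Lam -> t + 1 <= Lam -> 0 <= t -> a ^+ 2 <= t * b ^+ 2 -> a <= Lam * b.
  move=> a0 b0 _ tL t0 h; rewrite -(@ler_pXn2r _ 2)// ?nnegrE ?mulr_ge0 ?(ltW l0)//.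
  apply: (le_trans h); rewrite exprMn ler_wpM2r ?exprn_ge0//.
  by rewrite expr2; have := l0; nra.
have n1 : 1 <= n.+1%:R :> R by rewrite ler1n.
split.
  apply: (sq _ _ (br Bg)^-1); rewrite ?vn_ge0//.
  - by rewrite mulr1 (le_trans (ler_peMr i0 n1))// /Lam lerDl.
  - by rewrite /Lam lerD2r ler_peMr.
  - exact: le_trans (vn_sqn _) h2.
apply: (sq _ _ ((br Bg)^-1 * n%:R)); rewrite ?vn_ge0 ?mulr_ge0//.
- by rewrite mulr1 /Lam -natr1 mulrDr; lra.
- by rewrite /Lam lerD2r ler_wpM2l// ler_nat.
rewrite -mulrA -ler_pdivrMl ?invr_gt0// invrK; exact: le_trans h1 (sqn_vn _).
Qed.

(* A flow box in which the complex Hessian of the weight is frozen, up to a relative error [eps],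
   at the central point [xp]; the matrix [xA] diagonalizes the Levi form there. *)
Record fbox (eps : R) := FBox {
  xb : 'I_(bN Bg);
  xp : V * chart_trans (bc Bg xb);
  xA : 'M[C]_n;
  xT : set (chart_trans (bc Bg xb));
  xd : R;
  xd_gt0 : 0 < xd;
  xA_unit : xA \in unitmx;
  xT_open : open xT;
  xA_bnd : forall v : V, vn (v *m xA) <= Lam * vn v /\ vn v <= Lam * vn (v *m xA);
  x_sub : forall z t, vn (z - xp.1) < xd -> xT t ->
    unit_ball z /\ bK Bg xb (chart_inv (bc Bg xb) (z, t));
  x_hess : forall z t v, vn (z - xp.1) < xd -> xT t ->
    let f := lw m (bc Bg xb) (bi Bg xb) in
    `|Dv v (Dv v f) (z, t) / 2 - (complex.Re (quad_part f xp v) - sqn (v *m xA))| <= eps * sqn (v *m xA)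
}.

Arguments xT {eps} _ _.
Arguments xA_bnd {eps} _ _.

Definition fdom eps (a : fbox eps) (r : R) : set X := [set x | chart_dom (bc Bg (xb a)) x /\
  vn ((chart_map (bc Bg (xb a)) x).1 - (xp a).1) < r /\ xT a (chart_map (bc Bg (xb a)) x).2].

Lemma fdom_open eps (a : fbox eps) r : open (fdom a r).
Proof.
rewrite openE => x [hx [h1 h2]]; have cm := chart_map_cont hx.
have k1 : \forall y \near x, chart_dom (bc Bg (xb a)) y by apply: open_nbhs_nbhs; split => //; exact: chart_dom_open.
have k2 : \forall y \near x, xT a (chart_map (bc Bg (xb a)) y).2.
  apply: (cont_comp cm (cont_snd _)); apply: open_nbhs_nbhs; split=> //; exact: xT_open.
set z := (chart_map (bc Bg (xb a)) x).1 in h1.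
have k3 : \forall y \near x, vn ((chart_map (bc Bg (xb a)) y).1 - (xp a).1) < r.
  have kk : nbhs z (fun z : V => vn (z - (xp a).1) < r).
    apply/(nearV z (fun z : V => vn (z - (xp a).1) < r)); exists ((r - vn (z - (xp a).1)) / 2).
      by rewrite divr_gt0// subr_gt0.
    move=> h hh; have := vnD (z - (xp a).1) h; rewrite addrAC => h'; apply: (le_lt_trans h'); lra.
  exact: (cont_comp cm (cont_fst _) kk).
by apply: filterS3 k1 k2 k3.
Qed.

Lemma fbox_exists eps x : 0 < eps -> exists a : fbox eps, fdom a (xd a / 2) x.
Proof.
move=> e0; have [b hb] := b_cover Bg x; have Kx := nbhs_singleton hb.
have dx := b_dom Kx; have cx := b_cov Kx; set c := bc Bg b in dx *; set i := bi Bg b in cx *.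
have ac : atlas L c := b_atlas Bg b.
set p := chart_map c x; set f := lw m c i.
have Wp : Wd c i p by split; [exact: chart_ball|rewrite chart_mapK'].
have [A uA hA] := levi_diag msmooth mpos ac Wp.
have E v : sqn (v *m A) = - complex.Re (levi f p v).
  by have := congr1 (@complex.Re R) (hA v); rewrite cReN.
have bnd (v : V) : vn (v *m A) <= Lam * vn v /\ vn v <= Lam * vn (v *m A).
  have hl : br Bg * vn v ^+ 2 <= sqn (v *m A) <= (br Bg)^-1 * vn v ^+ 2 by rewrite E; exact: b_levi.
  exact: (Lam_mx hl).
(* [D2_near] is relative to [vn v ^+ 2], which is at most [Lam ^+ 2 * sqn (v *m A)]. *)
have e1 : 0 < eps / Lam ^+ 2 by rewrite divr_gt0// exprn_gt0// Lam_gt0.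
have k1 := D2_near (@open_Wd R X n L g c i) (lw_C2 msmooth i ac) Wp e1.
have k2 : \forall q \near p, box q /\ bK Bg b (chart_inv c q).
  have k3 : \forall q \near p, box q by apply: open_nbhs_nbhs; split; [exact: open_box|exact: chart_ball].
  have k4 : \forall q \near p, bK Bg b (chart_inv c q).
    have := @chart_inv_cont R X n c p.1 p.2 (chart_ball dx) (bK Bg b); rewrite -surjective_pairing; apply.
    by rewrite chart_mapK'.
  exact: filterI.
have := filterI k1 k2; rewrite {1}(surjective_pairing p) => -[[P Q] /= [nP nQ] PQ].
have [d d0 hd] := (nearV p.1 _).1 nP.
have nQ' : Q°%classic p.2 by [].
have hPQ z t : vn (z - p.1) < d -> Q°%classic t -> P z /\ Q t.
  by move=> hz ht; split; [have := hd (z - p.1) (ltW hz); rewrite addrC subrK|exact: interior_subset].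
pose hess z t v := forall (hz : vn (z - p.1) < d) (ht : Q°%classic t),
  `|Dv v (Dv v f) (z, t) / 2 - (complex.Re (quad_part f p v) - sqn (v *m A))| <= eps * sqn (v *m A).
have hessP z t v : hess z t v.
  move=> hz ht; have [Pz Qt] := hPQ z t hz ht; have [h1 _] := PQ (z, t) (conj Pz Qt).
  have D := D2_levi v (@open_Wd R X n L g c i) (lw_C2 msmooth i ac) Wp.
  have -> : complex.Re (quad_part f p v) - sqn (v *m A) = Dv v (Dv v f) p / 2.
    by rewrite E D opprK.
  have h := h1 v; have [_ b2] := bnd v.
  have l2 : vn v ^+ 2 <= Lam ^+ 2 * sqn (v *m A).
    apply: (@le_trans _ _ ((Lam * vn (v *m A)) ^+ 2)).
      by apply: lerXn2r; rewrite ?nnegrE ?mulr_ge0 ?vn_ge0 ?(ltW Lam_gt0).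
    by rewrite exprMn ler_wpM2l ?exprn_ge0 ?(ltW Lam_gt0)//; exact: vn_sqn.
  rewrite -mulrBl normrM (ger0_norm (_ : 0 <= 2^-1)) ?invr_ge0//.
  have q1 : eps / Lam ^+ 2 * vn v ^+ 2 <= eps * sqn (v *m A).
    by rewrite -mulrA ler_wpM2l ?(ltW e0)// ler_pdivrMl ?exprn_gt0 ?Lam_gt0.
  have q2 := le_trans h q1.
  by rewrite ler_pdivrMr//; apply: (le_trans q2); rewrite ler_peMr ?mulr_ge0 ?(ltW e0) ?sqn_ge0// ler1n.
have subP z t : vn (z - p.1) < d -> Q°%classic t -> unit_ball z /\ bK Bg b (chart_inv c (z, t)).
  by move=> hz ht; have [Pz Qt] := hPQ z t hz ht; have [_] := PQ (z, t) (conj Pz Qt).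
exists (@FBox eps b p A (Q°%classic) d d0 uA (open_interior Q) bnd subP hessP).
split; first exact: dx.
by split; [rewrite /= subrr vn0 divr_gt0|exact: nQ'].
Qed.

End FrozenBoxes.

Arguments xT {R X n L g m Bg eps} _ _.
Arguments xA_bnd {R X n L g m Bg eps} _ _.

(** * Gauges and the passage between sections and the Gaussian model *)

Section Lifts.
Context {R : realType} {X : topologicalType} {n : nat} {L : lamination R X n} {g : cocycle L}.
Context {m : hermitian_metric g}.
Hypothesis msmooth : smooth_metric m.
Context {Bg : background m} {eps : R}.
Variables (a : fbox Bg eps) (k : nat).
Hypothesis k0 : (0 < k)%N.
Hypothesis eps0 : 0 < eps.
Local Notation C := R[i].
Local Notation V := 'rV[C]_n.
Local Notation c := (bc Bg (xb a)).
Local Notation i := (bi Bg (xb a)).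
Local Notation f := (lw m (bc Bg (xb a)) (bi Bg (xb a))).
Local Notation T := (chart_trans (bc Bg (xb a))).

Definition kap_ : R := Num.sqrt k%:R.

Lemma kap_gt0 : 0 < kap_. Proof. by rewrite sqrtr_gt0 ltr0n. Qed.

Lemma kap_sq : kap_ ^+ 2 = k%:R. Proof. by rewrite sqr_sqrtr. Qed.

(* Affine coordinates in which the Levi form of [k * lw] is close to the standard one. *)
Definition pz (z0 w : V) : V := z0 + w *m (kap_^-1%:C *: invmx (xA a)).
Definition pw (z0 z : V) : V := (z - z0) *m (kap_%:C *: xA a).

Lemma pzK z0 w : pw z0 (pz z0 w) = w.
Proof.
rewrite /pw /pz addrC addKr -scalemxAr -!scalemxAr -scalemxAl mulmxKV ?xA_unit// scalerA -rmorphM.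
by rewrite mulfV ?gt_eqF ?kap_gt0// rmorph1 scale1r.
Qed.

Lemma pwK z0 z : pz z0 (pw z0 z) = z.
Proof.
rewrite /pw /pz -!scalemxAr -scalemxAl mulmxK ?xA_unit// scalerA -rmorphM mulVf ?gt_eqF ?kap_gt0//.
by rewrite rmorph1 scale1r addrC subrK.
Qed.

Lemma pw_bnd z0 z z' : vn (pw z0 z - pw z0 z') <= kap_ * Lam Bg * vn (z - z').
Proof.
have -> : pw z0 z - pw z0 z' = kap_%:C *: ((z - z') *m xA a).
  by rewrite /pw -mulmxBl -scalemxAr opprB addrA subrK.
rewrite vnZ ncR gtr0_norm ?kap_gt0// -mulrA ler_wpM2l ?(ltW kap_gt0)//.
by have [] := xA_bnd a (z - z').
Qed.

Lemma pz_bnd z0 w w' : vn (pz z0 w - pz z0 w') <= Lam Bg / kap_ * vn (w - w').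
Proof.
rewrite -{2}(pzK z0 w) -{2}(pzK z0 w'); set z := pz z0 w; set z' := pz z0 w'.
have -> : pw z0 z - pw z0 z' = kap_%:C *: ((z - z') *m xA a).
  by rewrite /pw -mulmxBl -scalemxAr opprB addrA subrK.
rewrite vnZ ncR gtr0_norm ?kap_gt0// mulrA divfK ?gt_eqF ?kap_gt0//.
by have [] := xA_bnd a (z - z').
Qed.

Lemma pz0 z0 : pz z0 0 = z0. Proof. by rewrite /pz mul0mx addr0. Qed.
Lemma pw0 z0 : pw z0 z0 = 0. Proof. by rewrite /pw subrr mul0mx. Qed.

Lemma pw_cont z0 z : {for z, continuous (pw z0)}.
Proof. by apply: differentiable_continuous; exact: diff_affineV. Qed.

Lemma pz_cont z0 w : {for w, continuous (pz z0)}.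
Proof. by apply: differentiable_continuous; exact: diff_affine. Qed.

(* The Taylor polynomial of [lw] at [z0] without its Levi term, the second order part being taken at
   [xp a]; it is holomorphic in [v]. *)
Definition Eexp z0 (t : T) (v : V) : C :=
  (f (z0, t))%:C + 2 * lin_part f (z0, t) v + quad_part f (xp a) v.

Definition Ega z0 (wt : V * T) : C :=
  cexp (- (k%:R / 2)%:C * Eexp z0 wt.2 (wt.1 *m (kap_^-1%:C *: invmx (xA a)))).

Lemma Ega_neq0 z0 wt : Ega z0 wt != 0. Proof. exact: cexp_neq0. Qed.

Definition wcoord z0 x : V * T := (pw z0 (chart_map c x).1, (chart_map c x).2).

Definition wpoint z0 (wt : V * T) : X := chart_inv c (pz z0 wt.1, wt.2).

Lemma wcoordK z0 x : chart_dom c x -> wpoint z0 (wcoord z0 x) = x.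
Proof. by move=> hx; rewrite /wpoint /wcoord /= pwK -surjective_pairing chart_mapK'. Qed.

Lemma wpointK z0 wt : unit_ball (pz z0 wt.1) -> wcoord z0 (wpoint z0 wt) = wt.
Proof. by move=> h; rewrite /wpoint /wcoord chart_invK'//= pzK -surjective_pairing. Qed.

Definition inb (z : V) := vn (z - (xp a).1) < xd a.

Lemma inb_Wd z t : inb z -> xT a t -> Wd c i (z, t).
Proof. by move=> hz ht; have [h1 h2] := x_sub (f:=a) hz ht; split=> //; exact: b_cov. Qed.

Lemma lw_cont c' i' p : atlas L c' -> Wd c' i' p -> {for p, continuous (lw m c' i')}.
Proof.
move=> ac Wp; have [h1 _] := wt_C2 msmooth i' ac.
have w0 := wt_gt0 m Wp.
apply: (@continuous_comp _ _ _ (fun p => wt m i' (chart_inv c' p) ^+ 2) (@ln R)).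
  have h := h1 p Wp; exact: (cvgM h h).
by apply: continuous_ln; rewrite exprn_gt0.
Qed.

Lemma Ega_cont z0 w t : inb z0 -> xT a t -> {for (w, t), continuous (Ega z0)}.
Proof.
move=> hz ht; have Wp := inb_Wd hz ht; have ac := b_atlas Bg (xb a).
have [hC1 _] := lw_C2 msmooth i ac.
have ct : {for (w, t), continuous (fun wt : V * T => (z0, wt.2))}.
  by apply: cont_pair; [exact: cont_cstW|exact: cont_snd].
pose B : 'M[C]_n := kap_^-1%:C *: invmx (xA a).
have cv j : {for (w, t), continuous (fun wt : V * T => (wt.1 *m B) 0 j)}.
  have c1 := @cont_comp _ _ _ (fun wt : V * T => wt.1) (fun w : V => w *m B) (w, t) (cont_fst (w, t)) (@cont_mulmx R n B w).
  exact: (@cont_comp _ _ _ (fun wt : V * T => wt.1 *m B) (fun w : V => w 0 j) (w, t) c1 (coord_cont j _)).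
have cE : {for (w, t), continuous (fun wt : V * T => Eexp z0 wt.2 (wt.1 *m B))}.
  apply: contD; first apply: contD.
  - apply: cont_RC; exact: (@cont_comp _ _ _ (fun wt : V * T => (z0, wt.2)) f (w, t) ct (lw_cont ac Wp)).
  - apply: contM; first exact: cont_cst.
    apply: cont_sum => j; apply: contM; last exact: cv.
    exact: (@cont_comp _ _ _ (fun wt : V * T => (z0, wt.2)) (dz j f) (w, t) ct (@dz_cont R n T _ _ (z0, t) j hC1 Wp)).
  - apply: cont_sum => j; apply: cont_sum => l; apply: contM; first exact: cont_cst.
    by apply: contM; exact: cv.
apply: (@cont_comp _ _ _ (fun wt : V * T => - (k%:R / 2)%:C * Eexp z0 wt.2 (wt.1 *m B)) cexp (w, t)); last exact: cexp_cont.
by apply: contM; [exact: cont_cst|exact: cE].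
Qed.

Lemma Ega_diff z0 w t : differentiable (fun w => Ega z0 (w, t)) w.
Proof.
pose B : 'M[C]_n := kap_^-1%:C *: invmx (xA a).
have dv j : differentiable (fun w : V => (w *m B) 0 j) w.
  exact: (@diff_coord_of R n (fun w => w *m B) j w (diff_mulmx B w)).
apply: (@diff_comp1 R V (fun w => - (k%:R / 2)%:C * Eexp z0 t (w *m B)) cexp w); last exact: differentiable_cexp.
apply: diffM'; first exact: diff_cst'.
apply: diffD; first apply: diffD.
- exact: diff_cst'.
- apply: diffM'; first exact: diff_cst'.
  by apply: diff_sum => j; apply: diffM'; [exact: diff_cst'|exact: dv].
- apply: diff_sum => j; apply: diff_sum => l; apply: diffM'; first exact: diff_cst'.
  by apply: diffM'; exact: dv.
Qed.

(* Taylor's formula with frozen Hessian: up to the relative error [eps], the weight of the gauge is Gaussian. *)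
Lemma gauge_bound z0 w t : inb z0 -> inb (pz z0 w) -> xT a t -> exists2 s : R,
  nc (Ega z0 (w, t)) * metric_weight m i (wpoint z0 (w, t)) ^+ k = expR s &
  `|s + sqn w / 2| <= eps * sqn w.
Proof.
move=> hz0 hz ht; have Wz := inb_Wd hz ht; have ac := b_atlas Bg (xb a).
have hC2 := lw_C2 msmooth i ac; have oW := @open_Wd R X n L g c i.
set v := w *m (kap_^-1%:C *: invmx (xA a)).
have zv : pz z0 w = z0 + v by [].
have sw : sqn w = k%:R * sqn (v *m xA a).
  have -> : w = kap_%:C *: (v *m xA a) by rewrite -{1}(pzK z0 w) /pw zv addrC addKr -scalemxAr.
  by rewrite -kap_sq /sqn mulr_sumr; apply: eq_bigr => j _; rewrite mxE ncM exprMn ncR gtr0_norm ?kap_gt0.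
(* Taylor's formula is used along this segment, which stays in the box because balls are convex. *)
have seg (s : R) : 0 <= s <= 1 -> inb (z0 + s%:C *: v).
  move=> /andP[s0 s1]; rewrite /inb.
  have -> : z0 + s%:C *: v - (xp a).1 = (1 - s)%:C *: (z0 - (xp a).1) + s%:C *: (pz z0 w - (xp a).1).
    by rewrite zv; apply/rowP => j; rewrite !mxE rmorphB rmorph1; ring.
  apply: (le_lt_trans (vnD _ _)); rewrite !vnZ !ncR !ger0_norm ?subr_ge0//.
  have h1 : vn (z0 - (xp a).1) < xd a := hz0; have h2 : vn (pz z0 w - (xp a).1) < xd a := hz.
  have [s1'|s1'] := eqVneq s 1; first by rewrite s1' subrr mul0r mul1r add0r.
  have p1 : (1 - s) * vn (z0 - (xp a).1) < (1 - s) * xd a by rewrite ltr_pM2l// subr_gt0 lt_neqAle s1'.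
  have p2 : s * vn (pz z0 w - (xp a).1) <= s * xd a by rewrite ler_wpM2l// ltW.
  by lra.
set Q : R := 2 * (complex.Re (quad_part f (xp a) v) - sqn (v *m xA a)).
have tay : `|f (z0 + v, t) - f (z0, t) - Dv v f (z0, t) - Q / 2| <= 2 * eps * sqn (v *m xA a).
  apply: (@rd_taylor2 R n v (fun z => f (z, t)) z0 Q) => s hs.
  have Ws := inb_Wd (seg s hs) ht; have [h1 h2] := hC2.
  have [r1 _] := h1 _ Ws v; have [r2 _] := h2 v _ Ws v.
  split; first exact: r1.
  split; first exact: r2.
  have hx : `|real_derive v (real_derive v (fun z => f (z, t))) (z0 + s%:C *: v) / 2 -
    (complex.Re (quad_part f (xp a) v) - sqn (v *m xA a))| <= eps * sqn (v *m xA a) := x_hess (f := a) v (seg s hs) ht.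
  move: hx; rewrite /Q.
  move: (real_derive _ _ _) (complex.Re _) (sqn _) => A B S.
  by rewrite !ler_norml => /andP[? ?]; apply/andP; split; lra.
exists (- (k%:R / 2) * (f (z0, t) + Dv v f (z0, t) + complex.Re (quad_part f (xp a) v)) + k%:R / 2 * f (pz z0 w, t)).
  have -> : nc (Ega z0 (w, t)) = expR (complex.Re (- (k%:R / 2)%:C * Eexp z0 t v)) by exact: nc_cexp.
  have -> : metric_weight m i (wpoint z0 (w, t)) = expR (f (pz z0 w, t) / 2) by exact: (weight_exp m Wz).
  rewrite -expRM_natl -expRD; congr expR.
  have -> : complex.Re (- (k%:R / 2)%:C * Eexp z0 t v) = - (k%:R / 2) * complex.Re (Eexp z0 t v).
    by rewrite cReM -rmorphN /=; ring.
  have E2 : (2 : C) = (2 : R)%:C by rewrite rmorphD rmorph1.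
  rewrite (Dv_lin_part v oW hC2.1 (inb_Wd hz0 ht)) /Eexp E2 !cReD cReM.
  rewrite [complex.Re (2 : R)%:C]/= [complex.Im (2 : R)%:C]/= [complex.Re (f (z0, t))%:C]/=.
  move: (complex.Re _) (complex.Re _) (complex.Im _) (f _) (f _) => A1 A2 A3 A4 A5.
  by field.
move: tay; rewrite -zv /Q sw.
have k1 : 0 <= k%:R :> R by [].
move: k1; move: (k%:R : R) (f (pz z0 w, t)) (f (z0, t)) (Dv v f (z0, t)) (complex.Re (quad_part f (xp a) v)) (sqn (v *m xA a)) => K A B D E S K0 tay.
have -> : - (K / 2) * (B + D + E) + K / 2 * A + K * S / 2 = K / 2 * (A - B - D - 2 * (E - S) / 2) by field.
rewrite normrM ger0_norm ?divr_ge0//.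
apply: (le_trans (ler_wpM2l (divr_ge0 K0 (ler0n R 2)) tay)).
by rewrite le_eqVlt; apply/orP; left; apply/eqP; field.
Qed.

(** The gauge serves as a local holomorphic frame of the k-th power: a function of the rescaled
    coordinates is a section written in this frame, and [gunlift] reads the section back. By
    [lift_dist] and [unlift_dist], the metric becomes the weight controlled by [gauge_bound]. *)
Definition glift z0 (F : V * T -> C) : X -> C :=
  unrep k i (fun x => Ega z0 (wcoord z0 x) * F (wcoord z0 x)).

Definition gunlift z0 (u : X -> C) (wt : V * T) : C := rep k i u (wpoint z0 wt) / Ega z0 wt.

Lemma fdom_inb x : fdom a (xd a) x -> [/\ chart_dom c x, inb (chart_map c x).1, xT a (chart_map c x).2 & cov i x].
Proof.
move=> [h1 [h2 h3]]; split=> //; have [_ h] := inb_Wd h2 h3.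
by move: h; rewrite -surjective_pairing chart_mapK'.
Qed.

Lemma wcoord_cont z0 x : chart_dom c x -> {for x, continuous (wcoord z0)}.
Proof.
move=> hx; have cm := chart_map_cont hx; apply: cont_pair; last exact: (cont_comp cm (cont_snd _)).
exact: (@cont_comp _ _ _ (fun x => (chart_map c x).1) (pw z0) x (cont_comp cm (cont_fst _)) (@pw_cont z0 _)).
Qed.

Lemma lift_cont z0 F x : inb z0 -> fdom a (xd a) x -> {for wcoord z0 x, continuous F} -> contS g k (glift z0 F) x.
Proof.
move=> hz0 /fdom_inb[dx _ tx ix] hF; apply: (@contS_unrep R X n L g k i _ x ix).
have cw := @wcoord_cont z0 x dx.
apply: contM.
  have c1 : {for wcoord z0 x, continuous (Ega z0)} := @Ega_cont z0 _ _ hz0 tx.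
  exact: (@cont_comp _ _ _ (wcoord z0) (Ega z0) x cw c1).
exact: (@cont_comp _ _ _ (wcoord z0) F x cw hF).
Qed.

Lemma lift_hol z0 F x : fdom a (xd a) x ->
  differentiable (fun w => F (w, (wcoord z0 x).2)) (wcoord z0 x).1 -> holS g k (glift z0 F) x.
Proof.
move=> /fdom_inb[dx _ tx ix] hF; apply: (@holS_unrep R X n L g k i _ x ix).
apply: (@hol_chart R X n L c _ x (b_atlas Bg _) dx).
set t := (chart_map c x).2; set z := (chart_map c x).1.
have ub : \forall w \near z, unit_ball w by apply: unit_ball_near; exact: chart_ball.
have h : differentiable (fun w => Ega z0 (pw z0 w, t) * F (pw z0 w, t)) z.
  have dw := @diff_affineV R n z0 (kap_%:C *: xA a) z.
  apply: diffM'.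
    exact: (@diff_compV R n (pw z0) (fun w => Ega z0 (w, t)) z dw (Ega_diff z0 _ t)).
  exact: (@diff_compV R n (pw z0) (fun w => F (w, t)) z dw hF).
have [] := @diff_near R V _ (fun w => Ega z0 (wcoord z0 (chart_inv c (w, t))) * F (wcoord z0 (chart_inv c (w, t)))) z _ h; last by [].
by apply: filterS ub => w hw; rewrite /wcoord (chart_invK' t hw).
Qed.

Lemma unlift_hol z0 u w t : inb (pz z0 w) -> xT a t -> holS g k u (wpoint z0 (w, t)) ->
  differentiable (fun w => gunlift z0 u (w, t)) w.
Proof.
move=> hz ht hu; have [ub ci] := inb_Wd hz ht; have ac := b_atlas Bg (xb a).
have h := hu i ci c (pz z0 w) t ac ub erefl.
apply: diffM'; last by apply: diffV'; [exact: Ega_diff|exact: Ega_neq0].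
exact: (@diff_compV R n (pz z0) (fun z => rep k i u (chart_inv c (z, t))) w (diff_affine z0 _ w) h).
Qed.

Lemma unlift_cont z0 u w t : inb z0 -> inb (pz z0 w) -> xT a t -> contS g k u (wpoint z0 (w, t)) ->
  {for (w, t), continuous (gunlift z0 u)}.
Proof.
move=> hz0 hz ht hu; have [ub ci] := inb_Wd hz ht.
have c1 : {for (w, t), continuous (fun wt : V * T => (pz z0 wt.1, wt.2))}.
  apply: cont_pair; last exact: cont_snd.
  exact: (@cont_comp _ _ _ (fun wt : V * T => wt.1) (pz z0) (w, t) (cont_fst (w, t)) (@pz_cont z0 w)).
have c2 := @cont_comp _ _ _ (fun wt : V * T => (pz z0 wt.1, wt.2)) (chart_inv c) (w, t) c1 (@chart_inv_cont R X n c _ _ ub).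
have c3 := @cont_comp _ _ _ (wpoint z0) (rep k i u) (w, t) c2 (hu i ci).
by apply: (contM c3); apply: contV; [exact: Ega_cont|exact: Ega_neq0].
Qed.

Lemma lift_dist z0 F u w t : inb (pz z0 w) -> xT a t ->
  nc (glift z0 F (wpoint z0 (w, t)) - u (wpoint z0 (w, t))) * mu k m (wpoint z0 (w, t)) =
  nc (F (w, t) - gunlift z0 u (w, t)) * (nc (Ega z0 (w, t)) * metric_weight m i (wpoint z0 (w, t)) ^+ k).
Proof.
move=> hz ht; have [ub ci'] := inb_Wd hz ht; have ci : cov i (wpoint z0 (w, t)) := ci'.
rewrite (mu_dist k m _ _ ci) (rep_unrep k _ ci) wpointK// mulrA -ncM; congr (nc _ * _).
by rewrite /gunlift mulrBl divfK ?Ega_neq0// mulrC.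
Qed.

Lemma unlift_dist z0 u h w t : inb (pz z0 w) -> xT a t ->
  nc (gunlift z0 u (w, t) - gunlift z0 h (w, t)) * (nc (Ega z0 (w, t)) * metric_weight m i (wpoint z0 (w, t)) ^+ k) =
  nc (u (wpoint z0 (w, t)) - h (wpoint z0 (w, t))) * mu k m (wpoint z0 (w, t)).
Proof.
move=> hz ht; have [ub ci'] := inb_Wd hz ht; have ci : cov i (wpoint z0 (w, t)) := ci'.
rewrite (mu_dist k m _ _ ci) mulrA -ncM; congr (nc _ * _).
by rewrite /gunlift mulrBl !divfK ?Ega_neq0.
Qed.

End Lifts.

Arguments glift {R X n L g m Bg eps} a k z0 F.
Arguments gunlift {R X n L g m Bg eps} a k z0 u.
Arguments Ega {R X n L g m Bg eps} a k z0 wt.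
Arguments wpoint {R X n L g m Bg eps} a k z0 wt.

(** * From approximate to holomorphic sections *)

Section SectionAlgebra.
Context {R : realType} {X : topologicalType} {n : nat} {L : lamination R X n} {g : cocycle L} {k : nat}.
Local Notation C := R[i].

Lemma contS_scale (psi : X -> R) s x : {for x, continuous psi} -> contS g k s x ->
  contS g k (fun y => (psi y)%:C * s y) x.
Proof.
move=> cp hs j hj.
have E y : (psi y)%:C * rep k j s y = rep k j (fun y => (psi y)%:C * s y) y by rewrite /rep mulrCA.
by apply: (cont_ext E); apply: (contM (cont_RC cp)); exact: hs.
Qed.

Lemma contS_zero (psi : X -> R) s x : (\forall y \near x, psi y = 0) ->
  contS g k (fun y => (psi y)%:C * s y) x.
Proof.
move=> h j hj; apply: (cont_near _ (cont_cst 0 x)).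
by apply: filterS h => y hy; rewrite /rep hy mul0r mulr0.
Qed.

End SectionAlgebra.

(** * Elementary inequalities *)

Section Estimates.
Context {R : realType}.

Lemma lt_three_quarters (A B D y u v : R) : B < y / 2 -> A <= u -> 0 <= v -> 0 <= u ->
  2 * u + 20 * v <= y / 4 -> D <= A + B -> D < 3 / 4 * y.
Proof. by move=> *; lra. Qed.

Lemma lt_of_three_quarters (A B D y u : R) : 0 < y -> B < 3 / 4 * y -> A <= u -> 2 * u <= y / 4 ->
  D <= A + B -> D < y.
Proof. by move=> *; lra. Qed.

Lemma lt_of_half (A B y u : R) : 0 < y -> A <= u -> u <= y / 4 -> B < y / 2 -> A + B < y.
Proof. by move=> *; lra. Qed.

Lemma le_ten (A B D q : R) : A < 5 * q -> B < 5 * q -> D <= B + A -> D <= 10 * q.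
Proof. by move=> *; lra. Qed.

Lemma far_contradiction (A B D r d s : R) : s <= A -> B < r -> D <= 1 -> A <= B + D -> 0 <= d -> r + d + 2 <= s -> False.
Proof. by move=> *; lra. Qed.

Lemma csq_shift (z w : R[i]) (s : R) : csq s z -> nc (w - z) < 5 -> csq (s + 5) w.
Proof.
move=> [c1 c2] h; have r1 := Re_le_nc (w - z); have r2 := Im_le_nc (w - z).
rewrite cReD cReN in r1; rewrite cImD cImN in r2.
move: c1 c2 r1 r2 h; rewrite /csq !ler_norml => /andP[? ?] /andP[? ?] /andP[? ?] /andP[? ?] ?.
by split; apply/andP; split; lra.
Qed.

Lemma lt_ball (A B D l v y : R) : 0 < l -> A <= l * v -> l * v <= l * 2 -> 20 * l <= y / 4 -> 0 < y ->
  D < y / 2 -> B <= A + D -> B < y.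
Proof. by move=> *; lra. Qed.

Lemma le_err (A B p q e : R) : 0 <= e -> A <= q -> q <= p - 2 * e -> B <= e * 2 -> A + B <= p.
Proof. by move=> *; lra. Qed.

Lemma le_double (A e : R) : 0 <= e -> A <= e -> A <= e * 2.
Proof. by move=> *; lra. Qed.

Lemma le_sum (d r s : R) : r + d + 2 <= s -> 0 < r -> 0 <= s -> d <= 4 * s + 20.
Proof. by move=> *; lra. Qed.

Lemma small_ratio (l s e : R) : 0 < l -> 0 <= s -> 16 * s + 80 * l <= e ->
  [/\ 5 * l <= e, 4 * s + 20 * l <= e / 4 & 20 * l <= e / 4].
Proof. by move=> *; split; lra. Qed.

End Estimates.

(** * Correcting approximate sections *)

Section Solving.
Context {R : realType} {X : topologicalType} {n : nat} {L : lamination R X n} {g : cocycle L}.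
Context {m : hermitian_metric g}.
Hypothesis msmooth : smooth_metric m.
Variable Bg : background m.
Local Notation C := R[i].
Local Notation V := 'rV[C]_n.
Variables (N NA Mh k : nat) (Rr : R).
(** On the polydisc of half-side [N] one has [sqn w <= 2 * n * N ^ 2], hence
    [box_eps * sqn w <= 1 / 2] and the gauge differs from the Gaussian by a factor at most [2]. The
    last [4] ensures [box_eps <= 1 / 4]. *)
Definition box_eps : R := (4 * n%:R * N%:R ^+ 2 + 4)^-1.
Variables (bx : 'I_NA -> fbox Bg box_eps) (rho : 'I_NA -> X -> R) (F : 'I_NA -> set X).
(* Two factors [2], as the weight of the gauge is Gaussian up to [box_eps] only. *)
Definition glue_cst : R := 4 * @KM R n.
(* Bounds the variation of the rescaled coordinates on a leafwise disc of radius [5 * Lam / kap]. *)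
Definition d0 : R := 10 * Lam Bg ^+ 2 * (br Bg)^-1.
Local Notation kap := (@kap_ R k).
Local Notation Lam := (Lam Bg).
Hypothesis rho_cont : forall a x, {for x, continuous (rho a)}.
Hypothesis rho_ge0 : forall a x, 0 <= rho a x.
Hypothesis rho_sum : forall x, \sum_a rho a x = 1.
Hypothesis F_closed : forall a, closed (F a).
Hypothesis rho_F : forall a x, rho a x != 0 -> F a x.
Hypothesis F_dom : forall a, F a `<=` fdom (bx a) (xd (bx a) / 2).
Hypothesis k0 : (0 < k)%N.
(** A disc that meets the support of a tent, of half-side [Rr], moves by at most [d0]; it then stays
    where the coordinates are at most [N - 2], the range of [QM_close]. *)
Hypothesis hN : Rr + d0 + 2 <= N%:R.
Hypothesis hR : 16 * n%:R * d0 * glue_cst + 1 <= Rr.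
Hypothesis hk1 : 5 * Lam / kap <= br Bg.
Hypothesis hk2 : forall a, Lam * (4 * N%:R + 20) / kap <= xd (bx a) / 4.
Hypothesis hM : forall a, kap * Lam * xd (bx a) <= Rr * Mh%:R.

(* Sections are approximated on the leafwise discs of radius [5 * Lam / kap]. *)
Definition disc_idx := {by_ : 'I_(bN Bg) * X | bK Bg by_.1 by_.2}.
Definition disc_ctr (j : disc_idx) : X := (sval j).2.
Definition disc_pt (j : disc_idx) (z : V) : X := chart_inv (bc Bg (sval j).1) (z, (chart_map (bc Bg (sval j).1) (disc_ctr j)).2).
Definition disc_z (j : disc_idx) : V := (chart_map (bc Bg (sval j).1) (disc_ctr j)).1.
Definition leaf_disc (j : disc_idx) : set X := [set x | exists2 z, vn (z - disc_z j) < 5 * Lam / kap & x = disc_pt j z].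

Hypothesis hosc : forall j x, leaf_disc j x -> \sum_a `|rho a x - rho a (disc_ctr j)| <= (4 * glue_cst + 1)^-1.

Let Lam0 : 0 < Lam := Lam_gt0 Bg.
Let kap0 : 0 < kap := kap_gt0 k0.
Let br0 := br_gt0 Bg.

Let KG0 : 0 <= glue_cst. Proof. by rewrite mulr_ge0// KM_ge0. Qed.
Let d00 : 0 <= d0. Proof. by rewrite mulr_ge0 ?mulr_ge0 ?exprn_ge0 ?invr_ge0 ?(ltW Lam0) ?(ltW br0). Qed.
Let Rr0 : 0 < Rr.
Proof.
apply: lt_le_trans hR; apply: ltr_wpDl => //.
exact: (mulr_ge0 (mulr_ge0 (mulr_ge0 (ler0n R 16) (ler0n R n)) d00) KG0).
Qed.
Let eps0 : 0 < box_eps. Proof. by rewrite invr_gt0 ltr_wpDl// !mulr_ge0 ?exprn_ge0. Qed.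

Let eps4 : box_eps <= 1 / 4.
Proof.
rewrite /box_eps -[leRHS]invrK lef_pV2 ?posrE ?invr_gt0 ?divr_gt0//.
  by rewrite invf_div divr1 lerDr !mulr_ge0 ?exprn_ge0.
Qed.

Lemma ctr_leaf_disc j : leaf_disc j (disc_ctr j).
Proof.
exists (disc_z j); first by rewrite subrr vn0; exact: (divr_gt0 (mulr_gt0 (ltr0n R 5) Lam0) kap0).
by rewrite /disc_pt /disc_z -surjective_pairing chart_mapK'//; exact: (b_dom (svalP j)).
Qed.

Let fdom_K a x : fdom (bx a) (xd (bx a)) x -> bK Bg (xb (bx a)) x.
Proof.
move=> [h1 [h2 h3]]; have [_] := x_sub (f := bx a) h2 h3.
by rewrite -surjective_pairing chart_mapK'.
Qed.

Let fdom_half a x : fdom (bx a) (xd (bx a) / 2) x -> fdom (bx a) (xd (bx a)) x.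
Proof.
move=> [h1 [h2 h3]]; split=> //; split=> //; apply: (lt_trans h2).
by have := xd_gt0 (bx a); lra.
Qed.

Definition zeta a x : V := pw (bx a) k (xp (bx a)).1 (chart_map (bc Bg (xb (bx a))) x).1.

(** The scale cancels: discs have a diameter of order [1 / kap], and [pw] dilates by [kap]. This is
    why [d0] does not involve [k]. *)
Lemma leaf_disc_fdom j a x y : leaf_disc j x -> leaf_disc j y -> fdom (bx a) (xd (bx a) / 2) x ->
  fdom (bx a) (xd (bx a)) y /\ vn (zeta a y - zeta a x) <= d0.
Proof.
move=> [zx hx ->] [zy hy ->] fx; have Kx := fdom_K (fdom_half fx).
have lt_br z : vn (z - disc_z j) < 5 * Lam / kap -> vn (z - disc_z j) < br Bg by move=> h; exact: lt_le_trans h hk1.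
have [d1 t1 b1] := b_trans (svalP j) (lt_br _ hx) (lt_br _ hy) (lt_br _ hx) Kx.
have dz : vn (zy - zx) <= 10 * Lam / kap.
  have := vnD (zy - disc_z j) (- (zx - disc_z j)); rewrite vnN opprB addrA subrK => h.
  by move: hx hy h; rewrite -!mulrA => hx hy; exact: le_ten hx hy.
have b2 : vn ((chart_map (bc Bg (xb (bx a))) (disc_pt j zy)).1 - (chart_map (bc Bg (xb (bx a))) (disc_pt j zx)).1) <= (br Bg)^-1 * (10 * Lam / kap).
  by apply: (le_trans b1); rewrite ler_wpM2l// invr_ge0 ltW.
split; last first.
  apply: (le_trans (pw_bnd (bx a) k0 _ _ _)).
  apply: (le_trans (ler_wpM2l (mulr_ge0 (ltW kap0) (ltW Lam0)) b2)).
  by rewrite /d0 le_eqVlt; apply/orP; left; apply/eqP; field; rewrite !gt_eqF.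
have [h1 [h2 h3]] := fx; split; first exact: d1.
split; last by rewrite t1.
have := vnD ((chart_map (bc Bg (xb (bx a))) (disc_pt j zy)).1 - (chart_map (bc Bg (xb (bx a))) (disc_pt j zx)).1)
  ((chart_map (bc Bg (xb (bx a))) (disc_pt j zx)).1 - (xp (bx a)).1).
rewrite addrA subrK => h; apply: (le_lt_trans h).
have b3 : (br Bg)^-1 * (10 * Lam / kap) <= xd (bx a) / 4.
  apply: le_trans (hk2 a).
  have -> : (br Bg)^-1 * (10 * Lam / kap) = (10 * Lam * (br Bg)^-1) / kap by field; rewrite !gt_eqF.
  rewrite ler_wpM2r ?invr_ge0 ?(ltW kap0)//.
  have L1 := Lam_ge1 Bg; have q : 10 * Lam * (br Bg)^-1 <= d0.
    rewrite /d0 ler_wpM2r ?invr_ge0 ?(ltW br0)// ler_wpM2l// expr2 ler_peMr// ltW//.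
  apply: (le_trans q); have NN : d0 <= 4 * N%:R + 20 by exact: le_sum hN Rr0 (ler0n R N).
  by apply: (le_trans NN); rewrite ler_peMl// addr_ge0// mulr_ge0.
exact: (lt_of_half (xd_gt0 (bx a)) b2 b3 h2).
Qed.

(* The patches are the products of a flow box and of a neighbourhood of a point of the lattice of mesh
   [Rr]; in each of them the operator [QM N] acts in coordinates centred at the lattice point. *)
Definition lat_idx := {ffun 'I_n * bool -> 'I_(Mh + Mh).+1}.
Implicit Types (f : lat_idx) (a : 'I_NA) (w z : V).

Definition coo w (js : 'I_n * bool) : R := if js.2 then complex.Im (w 0 js.1) else complex.Re (w 0 js.1).

Definition lat f : V := \row_j ((Rr * ((f (j, false))%:R - Mh%:R)) +i* (Rr * ((f (j, true))%:R - Mh%:R))).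

Definition z0_ a f : V := pz (bx a) k (xp (bx a)).1 (lat f).

Definition lat_tent a f x : R := \prod_js tent (coo (zeta a x) js / Rr + Mh%:R - (f js)%:R).

Definition wof a f x : V := pw (bx a) k (z0_ a f) (chart_map (bc Bg (xb (bx a))) x).1.

(** The matrix of the affine coordinates does not depend on their centre, so that recentring at a
    lattice point is a translation. *)
Lemma wofE a f x : wof a f x = zeta a x - lat f.
Proof.
rewrite /wof /zeta /z0_ /pw /pz opprD addrA mulmxBl; congr (_ - _).
by rewrite -[RHS](pzK (bx a) k0 0) /pw /pz add0r subr0.
Qed.

Lemma cooD w w' js : coo (w - w') js = coo w js - coo w' js.
Proof. by rewrite /coo !mxE; case: js.2; rewrite (cReD, cImD) (cReN, cImN). Qed.

Lemma coo_le w js : `|coo w js| <= vn w.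
Proof. by rewrite /coo; case: js.2; apply: le_trans (nc_le_vn w js.1); [exact: Im_le_nc|exact: Re_le_nc]. Qed.

Lemma coo_lat f js : coo (lat f) js = Rr * ((f js)%:R - Mh%:R).
Proof. by case: js => j b; rewrite /coo mxE /=; case: b. Qed.

Lemma vn_coo w (r : R) : 0 <= r -> (forall js, `|coo w js| <= r) -> vn w <= 2 * r.
Proof.
move=> r0 h; apply: vn_le_row => [|j]; first by rewrite mulr_ge0.
apply: (le_trans (nc_le_ReIm _)); rewrite mulr_natl mulr2n.
by apply: lerD; [exact: (h (j, false))|exact: (h (j, true))].
Qed.

Lemma lat_tent_ge0 a f x : 0 <= lat_tent a f x.
Proof. by apply: prodr_ge0 => js _; exact: tent_ge0. Qed.

Lemma lat_tent_supp a f x : lat_tent a f x != 0 -> forall js, `|coo (wof a f x) js| < Rr.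
Proof.
move=> h js; have : tent (coo (zeta a x) js / Rr + Mh%:R - (f js)%:R) != 0.
  by apply: contra h => /eqP e; apply/eqP; rewrite /lat_tent (bigD1 js)//= e mul0r.
move=> /tent_supp; rewrite wofE cooD coo_lat => h1.
have -> : coo (zeta a x) js - Rr * ((f js)%:R - Mh%:R) = Rr * (coo (zeta a x) js / Rr + Mh%:R - (f js)%:R).
  by field; rewrite gt_eqF.
by rewrite normrM gtr0_norm// -[ltRHS]mulr1 ltr_pM2l.
Qed.

Let range a x : fdom (bx a) (xd (bx a)) x -> forall js,
  0 <= coo (zeta a x) js / Rr + Mh%:R <= (Mh + Mh)%N%:R.
Proof.
move=> [_ [h _]] js; have h1 := coo_le (zeta a x) js.
have h2 : vn (zeta a x) <= Rr * Mh%:R.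
  apply: le_trans (hM a); have := pw_bnd (bx a) k0 (xp (bx a)).1 (chart_map (bc Bg (xb (bx a))) x).1 (xp (bx a)).1.
  rewrite pw0 subr0 -/(zeta a x) => h2; apply: (le_trans h2); rewrite ler_wpM2l ?mulr_ge0 ?(ltW kap0) ?(ltW Lam0)//.
  exact: (ltW h).
have : `|coo (zeta a x) js / Rr| <= Mh%:R.
  by rewrite normrM (gtr0_norm (_ : 0 < Rr^-1)) ?invr_gt0// ler_pdivrMr// mulrC; exact: le_trans h1 h2.
by rewrite ler_norml natrD => /andP[? ?]; apply/andP; split; lra.
Qed.

Lemma lat_tent_sum a x : fdom (bx a) (xd (bx a)) x -> \sum_f lat_tent a f x = 1.
Proof.
move=> hx; rewrite /lat_tent.
rewrite -(bigA_distr_bigA (fun js (p : 'I_(Mh + Mh).+1) => tent (coo (zeta a x) js / Rr + Mh%:R - p%:R))).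
rewrite big1// => js _; have /andP[h1 h2] := range hx js.
exact: tent_sum.
Qed.

Lemma lat_tent_lip a x y : fdom (bx a) (xd (bx a)) x -> fdom (bx a) (xd (bx a)) y -> vn (zeta a x - zeta a y) <= d0 ->
  \sum_f `|lat_tent a f x - lat_tent a f y| <= 4 * n%:R * d0 / Rr.
Proof.
move=> hx hy hd; rewrite /lat_tent.
pose A (z : X) := fun (js : 'I_n * bool) (p : 'I_(Mh + Mh).+1) => tent (coo (zeta a z) js / Rr + Mh%:R - p%:R).
have A1 (z : X) : fdom (bx a) (xd (bx a)) z -> forall js, \sum_p A z js p = 1.
  by move=> hz js; have /andP[h1 h2] := range hz js; exact: tent_sum.
apply: (le_trans (@prod_dist R _ _ (A x) (A y) (fun js p => tent_ge0 _) (fun js p => tent_ge0 _) (A1 x hx) (A1 y hy))).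
apply: (@le_trans _ _ (\sum_(js : 'I_n * bool) 2 * (d0 / Rr))).
  apply: ler_sum => js _; apply: (le_trans (tent_sum_lip _ _ _)); rewrite ler_wpM2l//.
  have -> : coo (zeta a x) js / Rr + Mh%:R - (coo (zeta a y) js / Rr + Mh%:R) = coo (zeta a x - zeta a y) js / Rr.
    by rewrite cooD; ring.
  rewrite normrM (gtr0_norm (_ : 0 < Rr^-1)) ?invr_gt0// ler_wpM2r ?invr_ge0 ?(ltW Rr0)//.
  exact: le_trans (coo_le _ _) hd.
rewrite sumr_const card_prod card_ord card_bool -[_ *+ (_ * _)%N]mulr_natl natrM.
by rewrite le_eqVlt; apply/orP; left; apply/eqP; field; rewrite gt_eqF.
Qed.

(** The patches that count: those with a nonzero weight somewhere are active by [act_supp], and the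
    polydisc of half-side [N + 5] around an active lattice point stays in the flow box by
    [act_inb]. *)
Definition act a f := vn (z0_ a f - (xp (bx a)).1) < 3 / 4 * xd (bx a).

Lemma act_supp a f x : fdom (bx a) (xd (bx a) / 2) x -> (forall js, `|coo (wof a f x) js| <= N%:R) -> act a f.
Proof.
move=> [_ [h _]] hw; rewrite /act.
have := pz_bnd (bx a) k0 (z0_ a f) 0 (wof a f x); rewrite pz0 /wof pwK// sub0r vnN => h1.
have h2 : vn (wof a f x) <= 2 * N%:R by exact: vn_coo.
have h3 : vn (z0_ a f - (chart_map (bc Bg (xb (bx a))) x).1) <= Lam / kap * (2 * N%:R).
  by apply: (le_trans h1); rewrite ler_wpM2l ?divr_ge0 ?(ltW Lam0) ?(ltW kap0).
have := hk2 a; have -> : Lam * (4 * N%:R + 20) / kap = 2 * (Lam / kap * (2 * N%:R)) + 20 * (Lam / kap) by ring.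
have q : 0 <= Lam / kap by rewrite divr_ge0 ?(ltW Lam0) ?(ltW kap0).
have q2 : 0 <= Lam / kap * (2 * N%:R) by rewrite mulr_ge0// mulr_ge0.
have hv := vnD (z0_ a f - (chart_map (bc Bg (xb (bx a))) x).1) ((chart_map (bc Bg (xb (bx a))) x).1 - (xp (bx a)).1).
rewrite addrA subrK in hv.
by move=> hk; exact: (lt_three_quarters h h3 q q2 hk hv).
Qed.

Lemma act_inb a f w : act a f -> (forall j, csq (N%:R + 5) (w 0 j)) -> inb (bx a) (pz (bx a) k (z0_ a f) w).
Proof.
move=> ha hw; rewrite /inb.
have := pz_bnd (bx a) k0 (z0_ a f) w 0; rewrite pz0 subr0 => h1.
have h2 : vn w <= 2 * (N%:R + 5).
  by apply: vn_coo => [|[j b]]; [exact: addr_ge0|have [? ?] := hw j; case: b].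
have h3 : vn (pz (bx a) k (z0_ a f) w - z0_ a f) <= Lam / kap * (2 * (N%:R + 5)).
  by apply: (le_trans h1); rewrite ler_wpM2l ?divr_ge0 ?(ltW Lam0) ?(ltW kap0).
have := hk2 a; have -> : Lam * (4 * N%:R + 20) / kap = 2 * (Lam / kap * (2 * (N%:R + 5))) by ring.
have h4 := vnD (pz (bx a) k (z0_ a f) w - z0_ a f) (z0_ a f - (xp (bx a)).1).
rewrite addrA subrK in h4.
by move=> hk; exact: (lt_of_three_quarters (xd_gt0 (bx a)) ha h3 hk h4).
Qed.

Lemma act_inb0 a f : act a f -> inb (bx a) (z0_ a f).
Proof. by move=> h; apply: (lt_trans h); have := xd_gt0 (bx a); lra. Qed.

Definition cont_section (u : X -> C) := forall x, contS g k u x.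
Definition hol_section j (u : X -> C) := forall x, leaf_disc j x -> holS g k u x.
(** Conjugation of [QM] by the gauge. It is meaningful for active patches and near their lattice
    point; elsewhere its value is multiplied by a vanishing [psi]. *)
Definition patchQ (af : 'I_NA * lat_idx) (u : X -> C) : X -> C :=
  glift (bx af.1) k (z0_ af.1 af.2) (QM N (gunlift (bx af.1) k (z0_ af.1 af.2) u)).
Definition psi (af : 'I_NA * lat_idx) x : R := rho af.1 x * lat_tent af.1 af.2 x.
Local Notation approx_section := (approx leaf_disc (mu k m) cont_section hol_section).

Let un_regular a f u : act a f -> cont_section u -> regular N [::] (gunlift (bx a) k (z0_ a f) u) (xT (bx a)).
Proof.
move=> ha cu w t hw ht; split; last by move=> i; rewrite in_nil.
apply: (unlift_cont msmooth (act_inb0 ha) _ ht (cu _)).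
apply: (act_inb ha) => j; have [h1 h2] := hw j.
by split; [apply: (le_trans (ltW h1))|apply: (le_trans (ltW h2))]; rewrite lerD2l ler1n.
Qed.

Lemma patchQ_reg a f u x : act a f -> cont_section u -> fdom (bx a) (xd (bx a)) x ->
  (forall j, osq N%:R (wof a f x 0 j)) -> holS g k (patchQ (a, f) u) x /\ contS g k (patchQ (a, f) u) x.
Proof.
move=> ha cu hx hw; have [_ [_ tx]] := hx.
have [c1 d1] := QM_regular (xT_open (bx a)) (un_regular ha cu) hw tx.
split; first exact: (lift_hol hx d1).
by apply: lift_cont => //; exact: act_inb0.
Qed.

Let gauge2 a f w t : act a f -> xT (bx a) t -> (forall j, csq N%:R (w 0 j)) ->
  exists2 G : R, nc (Ega (bx a) k (z0_ a f) (w, t)) *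
    metric_weight m (bi Bg (xb (bx a))) (wpoint (bx a) k (z0_ a f) (w, t)) ^+ k = G &
  0 < G /\ G * gw w <= 2 /\ 1 <= 2 * G * gw w.
Proof.
move=> ha ht hw.
have hz : inb (bx a) (pz (bx a) k (z0_ a f) w).
  by apply: act_inb => // j; have [h1 h2] := hw j; split; [apply: (le_trans h1)|apply: (le_trans h2)]; rewrite lerDl.
have [s E hs] := gauge_bound msmooth k0 (act_inb0 ha) hz ht.
exists (expR s); first exact: E.
have gE : gw w = expR (sqn w / 2) by rewrite /gw /sqn mulr_suml.
have sN : sqn w <= 2 * n%:R * N%:R ^+ 2.
  apply: (@le_trans _ _ (\sum_(j < n) 2 * N%:R ^+ 2)); last by rewrite sumr_const card_ord -[_ *+ n]mulr_natl mulrCA mulrA.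
  apply: ler_sum => j _; have [h1 h2] := hw j; rewrite nc_sqr mulr_natl mulr2n.
  by apply: lerD; rewrite -[leLHS]ger0_norm ?sqr_ge0// normrX; apply: lerXn2r; rewrite ?nnegrE.
have es : box_eps * sqn w <= 1 / 2.
  rewrite /box_eps mulrC ler_pdivrMr; last by rewrite ltr_wpDl// !mulr_ge0 ?exprn_ge0.
  by apply: (le_trans sN); lra.
have {}hs := le_trans hs es.
split; first exact: expR_gt0.
rewrite gE -mulrA -expRD.
move: hs; rewrite ler_norml => /andP[h1 h2]; have e1 := expR_ge1Dx (- (s + sqn w / 2)); have e2 := expR_ge1Dx (s + sqn w / 2).
split; last by lra.
rewrite -[s + _]opprK expRN -[leRHS]invrK lef_pV2 ?posrE ?invr_gt0 ?expR_gt0//; lra.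
Qed.

Lemma patchQ_close a f u eta x : 0 <= eta -> approx_section u eta -> act a f -> fdom (bx a) (xd (bx a)) x ->
  (forall j, csq (N%:R - 2) (wof a f x 0 j)) -> nc (patchQ (a, f) u x - u x) * mu k m x <= glue_cst * eta.
Proof.
move=> eta0 [cu au] ha hx hw; have [dx [_ tx]] := hx.
set z0 := z0_ a f; set t := (chart_map (bc Bg (xb (bx a))) x).2 in tx; set w := wof a f x in hw.
have hwN j : csq N%:R (w 0 j) by have [h1 h2] := hw j; split; [apply: (le_trans h1)|apply: (le_trans h2)]; rewrite lerBlDr lerDl.
have inbN w' : (forall j, csq N%:R (w' 0 j)) -> inb (bx a) (pz (bx a) k z0 w').
  by move=> h; apply: act_inb => // j; have [h1 h2] := h j; split; [apply: (le_trans h1)|apply: (le_trans h2)]; rewrite lerDl.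
(* Around each point of the polydisc, the approximant of [u] on the leafwise disc centred there is
   used. As [pz] contracts by [Lam / kap], this disc contains the polydisc of radius [5]; the factor
   [2] is that of the gauge. *)
have ap : approx_near N (gunlift (bx a) k z0 u) t (2 * eta).
  move=> w0 hw0; have hz := inbN w0 hw0; have [ub0 Ky] := x_sub (f := bx a) hz tx.
  pose j : disc_idx := exist _ (xb (bx a), wpoint (bx a) k z0 (w0, t)) Ky.
  have [h [hh hu]] := au j; exists (fun w' => gunlift (bx a) k z0 h (w', t)).
  have cm : chart_map (bc Bg (xb (bx a))) (wpoint (bx a) k z0 (w0, t)) = (pz (bx a) k z0 w0, t) by rewrite /wpoint chart_invK'.
  have inU w' : (forall i, nc (w' 0 i - w0 0 i) < 5) -> leaf_disc j (wpoint (bx a) k z0 (w', t)).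
    move=> h5; exists (pz (bx a) k z0 w'); last by rewrite /disc_pt /= /disc_ctr /= cm.
    rewrite /disc_z /disc_ctr /= cm /=; apply: (le_lt_trans (pz_bnd (bx a) k0 _ _ _)).
    rewrite mulrAC [5 * _]mulrC ltr_pM2r ?invr_gt0// ltr_pM2l//.
    by apply/vn_lt_row => // i; rewrite !mxE.
  have inbU w' : (forall i, nc (w' 0 i - w0 0 i) < 5) -> inb (bx a) (pz (bx a) k z0 w').
    by move=> h5; apply: (act_inb ha) => i; exact: csq_shift (hw0 i) (h5 i).
  split=> w' h5.
    move=> i; apply: (@diff_upd R n (fun w => gunlift (bx a) k z0 h (w, t)) w' i (w' 0 i)); rewrite upd_id.
    exact: (unlift_hol (inbU w' h5) tx (hh _ (inU w' h5))).
  move=> hw'; have [G GE [G0 [_ G2]]] := gauge2 ha tx hw'.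
  have := unlift_dist u h (inbN w' hw') tx; rewrite GE => e1.
  have e2 := hu _ (inU w' h5); rewrite -e1 in e2.
  have g0 : 0 <= gw w' by exact: expR_ge0.
  apply: (@le_trans _ _ (nc (gunlift (bx a) k z0 u (w', t) - gunlift (bx a) k z0 h (w', t)) * (2 * G * gw w'))).
    by rewrite ler_peMr ?nc_ge0.
  have E (p q r s : R) : 0 <= s -> p * q <= r -> p * (2 * q * s) <= 2 * r * s.
    by move=> s0 h0; have := ler_wpM2r s0 h0; lra.
  exact: (E _ _ _ _ g0 e2).
have [G GE [G0 [G1 _]]] := gauge2 ha tx hwN.
have xE : wpoint (bx a) k z0 (w, t) = x by exact: (wcoordK k0 z0 dx).
have := lift_dist k0 (QM N (gunlift (bx a) k z0 u)) u (inbN w hwN) tx; rewrite xE in GE *; rewrite GE => ->.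
have e20 : 0 <= 2 * eta by rewrite mulr_ge0.
have := QM_close (xT_open (bx a)) tx e20 (un_regular ha cu) ap hw.
move=> h; apply: (le_trans (ler_wpM2r (ltW G0) h)).
have K0 := @KM_ge0 R n.
have -> : @KM R n * (2 * eta * gw w) * G = 2 * (@KM R n * eta) * (G * gw w) by ring.
have -> : glue_cst * eta = 2 * (@KM R n * eta) * 2 by rewrite /glue_cst; ring.
by rewrite ler_wpM2l// mulr_ge0// mulr_ge0.
Qed.

Lemma psi_ge0 af x : 0 <= psi af x.
Proof. by rewrite mulr_ge0// lat_tent_ge0. Qed.

Let rho_half a x : rho a x != 0 -> fdom (bx a) (xd (bx a) / 2) x.
Proof. by move=> h; apply: F_dom; exact: rho_F. Qed.

Lemma psi_sum x : \sum_af psi af x = 1.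
Proof.
rewrite -(pair_bigA _ (fun a f => rho a x * lat_tent a f x)) /= -[RHS](rho_sum x); apply: eq_bigr => a _.
rewrite -mulr_sumr; have [->|h] := eqVneq (rho a x) 0; first by rewrite mul0r.
by rewrite lat_tent_sum ?mulr1//; apply: fdom_half; exact: rho_half.
Qed.

Let psi_act a f x : psi (a, f) x != 0 -> fdom (bx a) (xd (bx a) / 2) x /\ act a f /\
  forall js, `|coo (wof a f x) js| < Rr.
Proof.
rewrite /psi mulf_eq0 negb_or /= => /andP[h1 h2]; have hx := rho_half h1; have hw := lat_tent_supp h2.
split=> //; split=> //; apply: (act_supp hx) => js; apply: (le_trans (ltW (hw js))).
by have := hN; have := d00; lra.
Qed.

Lemma psi_osc j x : leaf_disc j x -> \sum_af `|psi af x - psi af (disc_ctr j)| <= (4 * glue_cst + 1)^-1 + 4 * n%:R * d0 / Rr.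
Proof.
move=> Ux; set y := disc_ctr j; have Uy : leaf_disc j y := ctr_leaf_disc j.
have Q0 : 0 <= 4 * n%:R * d0 / Rr.
  exact: (divr_ge0 (mulr_ge0 (mulr_ge0 (ler0n R 4) (ler0n R n)) d00) (ltW Rr0)).
rewrite -(pair_bigA _ (fun a f => `|rho a x * lat_tent a f x - rho a y * lat_tent a f y|)) /=.
apply: (@le_trans _ _ (\sum_a (`|rho a x - rho a y| + rho a y * (4 * n%:R * d0 / Rr)))); last first.
  by rewrite big_split /= -mulr_suml rho_sum mul1r lerD2r; exact: hosc.
apply: ler_sum => a _.
(* Either the box contributes nothing, or the disc meets the support of [rho a] and both points lie
   in the box, where the estimate for the tents applies. *)
have [[hx hy]|hd] : (rho a x = 0 /\ rho a y = 0) \/ (fdom (bx a) (xd (bx a)) x /\ fdom (bx a) (xd (bx a)) y /\ vn (zeta a x - zeta a y) <= d0).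
    have [ex|nx] := eqVneq (rho a x) 0; last first.
      have hx := rho_half nx; have [hy hd] := leaf_disc_fdom Ux Uy hx.
      right; split; first exact: (fdom_half hx).
      split; first exact: hy.
      by rewrite -vnN opprB; exact: hd.
    have [ey|ny] := eqVneq (rho a y) 0; first by left.
    have hy := rho_half ny; have [hx hd] := leaf_disc_fdom Uy Ux hy.
    right; split; first exact: hx.
    split; first exact: (fdom_half hy).
    exact: hd.
  rewrite hx hy subrr normr0 mul0r addr0 big1 => [|f _]; first exact: lexx.
  have E (p q : R) : `|0 * p - 0 * q| = 0 by rewrite !mul0r subrr normr0.
  exact: E.
have [hx [hy hxy]] := hd.
apply: (@le_trans _ _ (\sum_f (`|rho a x - rho a y| * lat_tent a f x + rho a y * `|lat_tent a f x - lat_tent a f y|))).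
  apply: ler_sum => f _.
  have E (p q s t : R) : p * s - q * t = (p - q) * s + q * (s - t) by ring.
  rewrite E.
  rewrite (le_trans (ler_normD _ _))// !normrM (ger0_norm (lat_tent_ge0 a f x)) (ger0_norm (rho_ge0 a y)).
  exact: lexx.
rewrite big_split /= -!mulr_sumr lat_tent_sum// mulr1 lerD2l ler_wpM2l//.
exact: lat_tent_lip.
Qed.

Let wof_cont a f x : fdom (bx a) (xd (bx a)) x -> {for x, continuous (wof a f)}.
Proof.
move=> [dx _]; exact: (@cont_comp _ _ _ (wcoord (bx a) k (z0_ a f)) fst x (@wcoord_cont R X n L g m Bg _ (bx a) k (z0_ a f) x dx) (cont_fst _)).
Qed.

Let coo_cont js w : {for w, continuous (coo^~ js)}.
Proof.
by rewrite /coo; case: js.2; [apply: (@cont_Im R V)|apply: (@cont_Re R V)]; exact: coord_cont.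
Qed.

Lemma lat_tent_cont a f x : fdom (bx a) (xd (bx a)) x -> {for x, continuous (lat_tent a f)}.
Proof.
move=> hx; have cz : {for x, continuous (zeta a)}.
  have [dx _] := hx; exact: (@cont_comp _ _ _ (wcoord (bx a) k (xp (bx a)).1) fst x (@wcoord_cont R X n L g m Bg _ (bx a) k (xp (bx a)).1 x dx) (cont_fst _)).
rewrite /lat_tent; elim: (index_enum _) => [|js s ih].
  by apply: (cont_ext _ (cont_cstW (1 : R) x)) => y; rewrite big_nil.
have c1 : {for x, continuous (fun y => tent (coo (zeta a y) js / Rr + Mh%:R - (f js)%:R))}.
  have c2 := @cont_comp _ _ _ (zeta a) (coo^~ js) x cz (@coo_cont js (zeta a x)).
  apply: (@cont_comp _ _ _ (fun y => coo (zeta a y) js / Rr + Mh%:R - (f js)%:R) tent x); last exact: tent_cont.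
  apply: cvgB; last exact: cvg_cst.
  apply: cvgD; last exact: cvg_cst.
  by apply: cvgM; [exact: c2|exact: cvg_cst].
apply: (cont_ext _ (cvgM c1 ih)) => y; rewrite big_cons; exact: erefl.
Qed.

(** [patchQ] is regular only where all coordinates are below [N]. If one of them reaches [N] at [x],
    it exceeds [Rr] near [x], and the tent vanishes there. *)
Lemma psiQ_cont u : cont_section u -> cont_section (fun x => \sum_af (psi af x)%:C * patchQ af u x).
Proof.
move=> cu x; apply: contS_sum => -[a f].
have [Fx|nFx] := pselect (F a x); last first.
  apply: contS_zero; have : \forall y \near x, (~` F a) y by apply: open_nbhs_nbhs; split=> //; exact: closed_openC.
  apply: filterS => y nF; rewrite /psi /=; have -> : rho a y = 0 by apply/eqP/negPn/negP => /rho_F.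
  by rewrite mul0r.
have hx2 := F_dom Fx; have hx := fdom_half hx2.
have [small|big] := pselect (forall js, `|coo (wof a f x) js| < N%:R).
  have ha : act a f by apply: (act_supp hx2) => js; exact: ltW.
  apply: contS_scale.
    by apply: cvgM; [exact: rho_cont|exact: lat_tent_cont].
  have [] := patchQ_reg ha cu hx; last by [].
  by move=> j; split; [exact: (small (j, false))|exact: (small (j, true))].
have [js hjs] : exists js, N%:R <= `|coo (wof a f x) js|.
  by move/existsNP: big => [js hjs]; exists js; rewrite leNgt; apply/negP.
apply: contS_zero.
have c2 := @cont_comp _ _ _ (wof a f) (coo^~ js) x (@wof_cont a f x hx) (@coo_cont js (wof a f x)).
have c3 := (contRP _ _).1 c2 1 ltr01.
apply: filterS c3 => y hy; rewrite /psi /=.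
have [->|nt] := eqVneq (lat_tent a f y) 0; first by rewrite mulr0.
have := lat_tent_supp nt js; have := ler_normB (coo (wof a f x) js) (coo (wof a f x) js - coo (wof a f y) js).
rewrite opprB addrC subrK distrC => q1 q2; have q3 : `|coo (wof a f y) js - coo (wof a f x) js| <= 1 := hy.
exfalso.
have q4 := ler_normD (coo (wof a f y) js) (coo (wof a f x) js - coo (wof a f y) js).
rewrite addrC subrK distrC in q4.
exact: (far_contradiction hjs q2 q3 q4 d00 hN).
Qed.

Lemma glue_one u eta : 0 <= eta -> approx_section u eta ->
  exists u', (forall x, nc (u' x - u x) * mu k m x <= glue_cst * eta) /\ approx_section u' (eta / 2).
Proof.
move=> eta0 au; have [cu _] := au.
have wN a f x : (forall js, `|coo (wof a f x) js| < Rr) -> forall j, csq (N%:R - 2) (wof a f x 0 j).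
  move=> h j; have := hN; have := d00; have h1 := h (j, false); have h2 := h (j, true).
  by rewrite /coo /= in h1 h2; split; lra.
apply: (@glue_step R X disc_idx leaf_disc disc_ctr (mu k m) cont_section hol_section ctr_leaf_disc (mu_gt0 k m) _ _ psi patchQ glue_cst
  ((4 * glue_cst + 1)^-1 + 4 * n%:R * d0 / Rr) eta u KG0 eta0 _ psi_ge0 psi_sum _ _ psi_osc (psiQ_cont cu)).
- by move=> j I c h hh x Ux; apply: holS_sum => i ci; exact: hh.
- have K1 : 0 < 4 * glue_cst + 1 by have := KG0; lra.
  have h1 : glue_cst * (4 * glue_cst + 1)^-1 <= 1 / 4 by rewrite ler_pdivrMr//; have := KG0; lra.
  have h2 : glue_cst * (4 * n%:R * d0 / Rr) <= 1 / 4.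
    rewrite mulrA ler_pdivrMr//.
    have E (p q s r : R) : 16 * p * q * s + 1 <= r -> s * (4 * p * q) <= 1 / 4 * r by nra.
    exact: (E _ _ _ _ hR).
  by rewrite mulrDr; lra.
- move=> [a f] x /psi_act[hx [ha hw]]; apply: patchQ_close => //; [exact: fdom_half|exact: wN].
- move=> [a f] j x Ux /psi_act[hx [ha hw]].
  have near y : leaf_disc j y -> fdom (bx a) (xd (bx a)) y /\ forall i, csq (N%:R - 2) (wof a f y 0 i).
    move=> Uy; have [hy hd] := leaf_disc_fdom Ux Uy hx; split=> // i.
    have b js : `|coo (wof a f y) js| <= N%:R - 2.
      have e : zeta a y - zeta a x = wof a f y - wof a f x by rewrite !wofE opprB addrA subrK.
      have h1 := le_trans (coo_le (zeta a y - zeta a x) js) hd; rewrite e cooD in h1.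
      have E (p q r s t : R) : `|p - q| <= s -> `|q| < r -> r + s + 2 <= t -> `|p| <= t - 2.
        by move=> A1 A2 A3; have := ler_normD (p - q) q; rewrite subrK; lra.
      exact: (E _ _ _ _ _ h1 (hw js) hN).
    by split; [exact: (b (i, false))|exact: (b (i, true))].
  split=> y Uy; have [hy hwy] := near y Uy; last exact: patchQ_close.
  have [] := patchQ_reg ha cu hy; last by [].
  by move=> i; have [h1 h2] := hwy i; split; [apply: (le_lt_trans h1)|apply: (le_lt_trans h2)]; rewrite ltrBlDr ltrDl.
Qed.

(** [glue_limit] leaves the regularity of the limit open. Continuity passes to uniform limits on
    [X]; for holomorphy at [x], the approximants on the one leafwise disc centred at [x] are
    used. *)
Lemma solve u0 eta : 0 <= eta -> approx_section u0 eta -> exists u, [/\ forall x, contS g k u x,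
  forall x, holS g k u x & forall x, nc (u x - u0 x) * mu k m x <= 2 * glue_cst * eta].
Proof.
move=> eta0 au; have [u [h1 h2]] := glue_limit (mu_gt0 k m) KG0 eta0 au glue_one.
exists u; split=> [x|x|]; last exact: h1.
  by apply: (contS_lim (weight_cont msmooth)) => e e0; have [v [[cv _] hv]] := h2 e e0; exists v.
have [b hb] := b_cover Bg x; have Kx := nbhs_singleton hb.
pose j : disc_idx := exist _ (b, x) Kx.
have r0 : 0 < 5 * Lam / kap := divr_gt0 (mulr_gt0 (ltr0n R 5) Lam0) kap0.
have ub z : vn (z - (chart_map (bc Bg b) x).1) < 5 * Lam / kap -> unit_ball z.
  by move=> hz; apply: (b_ball Kx); exact: lt_le_trans hz hk1.
have := @holS_lim R X n L g k m (weight_cont msmooth) (bc Bg b) u (chart_map (bc Bg b) x).1 (chart_map (bc Bg b) x).2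
  (5 * Lam / kap) (b_atlas Bg b) (chart_ball (b_dom Kx)) r0 ub.
rewrite -surjective_pairing chart_mapK'; last exact: (b_dom Kx).
apply=> e e0; have e20 : 0 < e / 2 by rewrite divr_gt0.
have [v [[_ av] hv]] := h2 (e / 2) e20; have [h [hh hvh]] := av j.
have inU w : vn (w - (chart_map (bc Bg b) x).1) < 5 * Lam / kap -> leaf_disc j (chart_inv (bc Bg b) (w, (chart_map (bc Bg b) x).2)).
  by move=> hw; exists w.
exists h; split=> w hw; first by apply: hh; exact: inU.
set y := chart_inv _ _; have := hv y; have := hvh y (inU w hw).
have m0 := mu_gt0 k m y; have := ler_wpM2r (ltW m0) (ncD (u y - v y) (v y - h y)).
by rewrite addrA subrK mulrDl; lra.
Qed.

End Solving.

(** * Peak sections *)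

Section DirectionalCauchy.
Context {R : realType} {n : nat}.
Local Notation C := R[i].
Local Notation V := 'rV[C]_n.

(** Cauchy's estimate for the derivative at [0] of the difference between [f] on a complex line and
    the affine function [p0 + s * lv]. The number [l] given by [taylor1] is identified with this
    derivative by a small real step [t]. *)
Lemma cauchy_dir (f : V -> C) (w1 v : V) (p0 lv : C) (M : R) : v != 0 ->
  (forall w, vn (w - w1) <= 1 -> differentiable f w) ->
  (forall s : C, nc s * vn v <= 1 -> nc (f (w1 + s *: v) - p0 - s * lv) <= M) ->
  nc ('d f w1 v - lv) <= 2 * @KT R * M * vn v.
Proof.
move=> v0 df hM; have vv : 0 < vn v by rewrite lt_neqAle vn_ge0 eq_sym vn_eq0 v0.
pose g (s : C) := f (w1 + s *: v) - p0 - s * lv.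
have r0 : 0 < (2 * vn v)^-1 by rewrite invr_gt0 mulr_gt0.
have insq s : sq 0 (2 * vn v)^-1 s -> nc s * vn v <= 1.
  move=> /nc_sq; rewrite subr0 => h; apply: (le_trans (ler_wpM2r (vn_ge0 v) h)).
  by rewrite le_eqVlt; apply/orP; left; apply/eqP; field; rewrite gt_eqF.
have dg s : sq 0 (2 * vn v)^-1 s -> differentiable g s.
  move=> /insq hs; apply: diffB; last first.
    by apply: diffM'; [exact: diff_id'|exact: diff_cst'].
  apply: diffB; last exact: diff_cst'.
  by apply: diff_line; apply: df; rewrite addrC addKr vnZ.
have [l [hl hq]] := taylor1 r0 dg (fun s hs => hM s (insq s hs)).
rewrite invrK in hl; have -> : 2 * @KT R * M * vn v = KT * M * (2 * vn v) by ring.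
apply: (@le_trans _ _ (nc l)) => //.
apply/ler_addgt0Pr => e e0.
pose K := KT * M / (2 * vn v)^-1 ^+ 2.
have M0 : 0 <= M by apply: le_trans (nc_ge0 _) (hM 0 _); rewrite nc0 mul0r.
have K0 : 0 <= K by apply: divr_ge0; [exact: (mulr_ge0 (ltW (@KT_gt0 R)) M0)|exact: exprn_ge0 (ltW r0)].
have e2 : 0 < e / 2 / vn v by rewrite divr_gt0// divr_gt0.
have in1 : vn (w1 - w1) <= 1 by rewrite subrr vn0.
have [d dp hd] := diff_eps (df w1 in1) e2.
pose t := Num.min (Num.min (d / vn v) ((2 * vn v)^-1 / 2)) (e / 2 / (K + 1)).
have K1 : 0 < K + 1 by rewrite ltr_wpDl.
have t0 : 0 < t by rewrite /t !lt_min !divr_gt0.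
have t1 : t <= d / vn v by rewrite /t !ge_min lexx.
have t2 : t <= (2 * vn v)^-1 / 2 by rewrite /t !ge_min lexx orbT.
have t3 : t <= e / 2 / (K + 1) by rewrite /t !ge_min lexx orbT.
have nt : nc (t%:C : C) = t by rewrite ncR gtr0_norm.
have h1 : nc (f (w1 + t%:C *: v) - f w1 - t%:C * 'd f w1 v) <= e / 2 * t.
  have := hd (t%:C *: v); rewrite vnZ nt linearZ /= -ler_pdivlMr// => /(_ t1) h; apply: (le_trans h).
  by rewrite le_eqVlt; apply/orP; left; apply/eqP; field; rewrite gt_eqF.
have h2 : nc (g (0 + t%:C) - g 0 - l * t%:C) <= K * t ^+ 2.
  have := hq t%:C; rewrite nt => /(_ t2) h; apply: (le_trans h).
  by rewrite /K mulrAC.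
have h3 : nc (t%:C * ('d f w1 v - lv)) <= nc l * t + K * t ^+ 2 + e / 2 * t.
  have -> : t%:C * ('d f w1 v - lv) = l * t%:C + (g (0 + t%:C) - g 0 - l * t%:C) - (f (w1 + t%:C *: v) - f w1 - t%:C * 'd f w1 v).
    by rewrite /g !add0r scale0r addr0; ring.
  apply: (le_trans (ncB _ _)); apply: lerD => //; apply: (le_trans (ncD _ _)); apply: lerD => //.
  by rewrite ncM nt.
have h4 : K * t <= e / 2.
  apply: (@le_trans _ _ ((K + 1) * t)); first by rewrite ler_wpM2r ?(ltW t0)// lerDl.
  by rewrite mulrC -ler_pdivlMr.
have h5 := ler_wpM2r (ltW t0) h4.
rewrite ncM nt in h3; rewrite -(ler_pM2l t0).
have -> : t * (nc l + e) = nc l * t + e / 2 * t + e / 2 * t by field.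
by apply: (le_trans h3); rewrite lerD2r lerD2l expr2 mulrA.
Qed.

(* The assumptions on ['d] say that the quotients of the functions are stationary along [v]. *)
Lemma jacobian_injective (w1 v : V) (lam : C) (s e : R) (f0 : V -> C) (f : 'I_n -> V -> C) : 0 < s ->
  8 * e <= s -> 16 * @KT R * e <= s ->
  (forall w, vn (w - w1) <= 1 -> differentiable f0 w /\ nc (f0 w - s%:C) <= e) ->
  (forall j w, vn (w - w1) <= 1 -> differentiable (f j) w /\ nc (f j w - s%:C * w 0 j) <= e) ->
  vn w1 < 1 -> 'd f0 w1 v = lam * f0 w1 -> (forall j, 'd (f j) w1 v = lam * f j w1) -> v = 0.
Proof.
move=> s0 e1 e2 h0 h w1n d0 dj; apply/eqP/negPn/negP => v0.
have vv : 0 < vn v by rewrite lt_neqAle vn_ge0 eq_sym vn_eq0 v0.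
have inb (r : C) : nc r * vn v <= 1 -> vn (w1 + r *: v - w1) <= 1 by rewrite addrC addKr vnZ.
have in1 : vn (w1 - w1) <= 1 by rewrite subrr vn0.
have [j hj] : exists j, vn v <= nc (v 0 j).
  apply/not_existsP => hn; have : vn v < vn v; last by rewrite ltxx.
  by apply/(vn_lt_row _ vv) => j; rewrite ltNge; apply/negP; exact: hn.
have {}hj : nc (v 0 j) = vn v by apply/le_anti; rewrite hj nc_le_vn.
(* [f0] is almost constant, which makes [lam] small; [f j] is almost [s] times the coordinate, which
   makes [lam * f j w1] close to [s * v 0 j]. For the largest coordinate of [v] the two are
   incompatible. *)
have c0 : nc ('d f0 w1 v - 0) <= 2 * KT * e * vn v.
  apply: (@cauchy_dir f0 w1 v s%:C 0 e v0) => [w hw|r hr]; first exact: (h0 w hw).1.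
  by rewrite mulr0 subr0; exact: (h0 _ (inb r hr)).2.
have cj : nc ('d (f j) w1 v - s%:C * v 0 j) <= 2 * KT * e * vn v.
  apply: (@cauchy_dir (f j) w1 v (s%:C * w1 0 j) (s%:C * v 0 j) e v0) => [w hw|r hr]; first exact: (h j w hw).1.
  have := (h j _ (inb r hr)).2; rewrite !mxE.
  by have -> : f j (w1 + r *: v) - s%:C * w1 0 j - r * (s%:C * v 0 j) = f j (w1 + r *: v) - s%:C * (w1 0 j + r * v 0 j) by ring.
rewrite subr0 d0 in c0; rewrite dj in cj.
have b0 : s - e <= nc (f0 w1).
  have := (h0 w1 in1).2; have := ncD (f0 w1) (s%:C - f0 w1); rewrite addrC subrK ncR gtr0_norm// nc_dist.
  by lra.
have bj : nc (f j w1) <= s + e.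
  have := (h j w1 in1).2; have := ncD (f j w1 - s%:C * w1 0 j) (s%:C * w1 0 j); rewrite subrK ncM ncR gtr0_norm// => q1 q2.
  have q3 : s * nc (w1 0 j) <= s * 1 by rewrite ler_pM2l//; apply: le_trans (nc_le_vn _ _) (ltW w1n).
  by lra.
have aj : s * vn v <= nc (lam * f j w1) + 2 * KT * e * vn v.
  have := ncB (lam * f j w1) (lam * f j w1 - s%:C * v 0 j); rewrite opprB addrC subrK ncM ncR gtr0_norm// hj.
  by lra.
rewrite !ncM in c0 aj.
have l0 := nc_ge0 lam; have k2 := ler_wpM2r (ltW vv) e2.
have k1 : nc lam * (s - s / 8) <= nc lam * nc (f0 w1) by rewrite ler_wpM2l//; lra.
have k3 : nc lam * nc (f j w1) <= nc lam * (s + s / 8) by rewrite ler_wpM2l//; lra.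
have k4 : 0 < s * vn v by rewrite mulr_gt0.
by move: c0 aj k1 k2 k3 k4; lra.
Qed.

Lemma quotient_deriv (f h q : V -> C) (w v : V) : differentiable h w -> differentiable q w ->
  (\forall z \near w, f z = q z * h z) -> 'd q w v = 0 -> 'd f w v = q w * 'd h w v.
Proof.
move=> dh dq fE q0.
have [_ E] := @diff_near R V (fun z => q z * h z) f w (filterS (fun z e => esym e) fE) (diffM' dq dh).
apply: (eq_trans (congr1 (fun u : V -> C => u v) E)).
apply: (eq_trans (congr1 (fun u : V -> C => u v) (diffM dq dh))).
change (q w * 'd h w v + h w * 'd q w v = q w * 'd h w v).
have E0 (b c : C) : b + c * 0 = b by rewrite mulr0 addr0.
exact: (eq_trans (congr1 (fun z : C => q w * 'd h w v + h w * z) q0) (E0 _ _)).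
Qed.

End DirectionalCauchy.

(** * Sections close to a cut-off gauge *)

Section Peaks.
Context {R : realType} {X : topologicalType} {n : nat} {L : lamination R X n} {g : cocycle L}.
Context {m : hermitian_metric g}.
Hypothesis msmooth : smooth_metric m.
Context {Bg : background m} {eps : R} (a : fbox Bg eps) (k : nat).
Local Notation C := R[i].
Local Notation V := 'rV[C]_n.
Local Notation T := (chart_trans (bc Bg (xb a))).
Local Notation kap := (@kap_ R k).
Local Notation Lam := (Lam Bg).
Hypothesis k0 : (0 < k)%N.
Hypothesis eps4 : eps <= 1 / 4.
Hypothesis hk : Lam * 20 / kap <= xd a / 4.
Hypothesis leaf_disc_a : forall (j : disc_idx Bg) x y, leaf_disc k j x -> leaf_disc k j y -> fdom a (xd a / 2) x -> fdom a (xd a) y.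
Hypothesis solve_a : forall u0 eta, 0 <= eta -> approx (@leaf_disc R X n L g m Bg k) (mu k m) (@cont_section R X n L g k) (@hol_section R X n L g m Bg k) u0 eta ->
  exists u, [/\ forall x, contS g k u x, forall x, holS g k u x & forall x, nc (u x - u0 x) * mu k m x <= 2 * @glue_cst R n * eta].
Let kap0 : 0 < kap := kap_gt0 k0.
Variables (z0 : V).
Hypothesis z0_in : vn (z0 - (xp a).1) < xd a / 2.
Variables (F : set X) (tau : X -> R) (eta : R).
Hypothesis F_closed : closed F.
Hypothesis F_dom : F `<=` fdom a (xd a / 2).
Hypothesis tau_F : forall x, tau x != 0 -> F x.
Hypothesis tau_cont : forall x, {for x, continuous tau}.
Hypothesis eta0 : 0 <= eta.
Hypothesis tau_osc : forall (j : disc_idx Bg) x, leaf_disc k j x -> `|tau x - tau (disc_ctr j)| <= eta.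
Implicit Types (w v : V) (x y : X) (t : T).

Let inb0 : inb a z0. Proof. by apply: (lt_trans z0_in); have := xd_gt0 a; lra. Qed.

(** Since [eps <= 1 / 4], the gauge keeps half of the Gaussian decay on the whole box. The factor
    [2] of [gauge2] holds on bounded polydiscs only, and a cut-off gauge lives on a larger set. *)
Let gauge_le w t : inb a (pz a k z0 w) -> xT a t -> exists2 G : R,
  nc (Ega a k z0 (w, t)) * metric_weight m (bi Bg (xb a)) (wpoint a k z0 (w, t)) ^+ k = G &
  0 < G /\ G <= expR (- sqn w / 4) /\ 1 <= G * expR (sqn w).
Proof.
move=> hz ht; have [s E hs] := gauge_bound msmooth k0 inb0 hz ht.
have s0 := sqn_ge0 w; have q := ler_wpM2r s0 eps4; move: (le_trans hs q); rewrite ler_norml => /andP[h1 h2].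
exists (expR s) => //; split; first exact: expR_gt0.
split; first by rewrite ler_expR; lra.
rewrite -expRD; apply: le_trans (expR_ge1Dx _); lra.
Qed.

Let gauge_0 t : xT a t -> nc (Ega a k z0 (0, t)) * metric_weight m (bi Bg (xb a)) (wpoint a k z0 (0, t)) ^+ k = 1.
Proof.
move=> ht; have hz : inb a (pz a k z0 0) by rewrite pz0.
have [s -> hs] := gauge_bound msmooth k0 inb0 hz ht.
have sq0 : sqn (0 : V) = 0 by rewrite /sqn big1// => j _; rewrite mxE nc0 expr0n.
move: hs; rewrite sq0 mul0r mulr0 addr0 normr_le0 => /eqP ->; exact: expR0.
Qed.

Let unlift0 w t : gunlift a k z0 (fun=> 0) (w, t) = 0.
Proof. by rewrite /gunlift /rep mulr0 mul0r. Qed.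

Definition bump (P : V -> C) x : C := (tau x)%:C * glift a k z0 (fun wt => P wt.1) x.

Let bump_lift P w t : inb a (pz a k z0 w) -> xT a t ->
  bump P (wpoint a k z0 (w, t)) = glift a k z0 (fun wt => (tau (wpoint a k z0 wt))%:C * P wt.1) (wpoint a k z0 (w, t)).
Proof.
move=> hz ht; have [ub _] := inb_Wd hz ht.
by rewrite /bump /glift /unrep wpointK//; ring.
Qed.

(** On a disc where [tau] vanishes the approximant is [0]. Any other disc lies in the box, and
    freezing [tau] at its centre gives a holomorphic section; the error is at most the oscillation
    of [tau], because the gauge times [P] has norm at most [1]. *)
Lemma bump_approx P : (forall w, differentiable P w) -> (forall w, nc (P w) * expR (- sqn w / 4) <= 1) ->
  approx (@leaf_disc R X n L g m Bg k) (mu k m) (@cont_section R X n L g k) (@hol_section R X n L g m Bg k) (bump P) eta.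
Proof.
move=> dP bP; split.
  move=> x; have [Fx|nFx] := pselect (F x); last first.
    apply: contS_zero; have : \forall y \near x, (~` F) y by apply: open_nbhs_nbhs; split=> //; exact: closed_openC.
    by apply: filterS => y nF; apply/eqP/negPn/negP => /tau_F.
  apply: contS_scale; first exact: tau_cont.
  have hx : fdom a (xd a) x.
    have [h1 [h2 h3]] := F_dom Fx; split; first exact: h1.
    by split=> //; apply: (lt_trans h2); have := xd_gt0 a; lra.
  apply: (lift_cont msmooth inb0 hx).
  exact: (@cont_comp _ _ _ fst P (wcoord a k z0 x) (cont_fst _) (diff_cont (dP _))).
move=> j; have [[x Ux tx]|hn] := pselect (exists2 x, leaf_disc k j x & tau x != 0); last first.
  have tz x : leaf_disc k j x -> tau x = 0.
    by move=> Ux; apply/eqP/negPn/negP => tx; apply: hn; exists x.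
  exists (fun=> 0); split.
    move=> x _ i ci c z t ac ub e; have -> : (fun w => rep k i (fun=> 0) (chart_inv c (w, t))) = fun=> 0 by apply/funext => w; rewrite /rep mulr0.
    exact: diff_cst'.
  by move=> x Ux; rewrite /bump (tz x Ux) mul0r subrr nc0 mul0r.
have near y : leaf_disc k j y -> fdom a (xd a) y by move=> Uy; exact: (leaf_disc_a Ux Uy (F_dom (tau_F tx))).
exists (fun y => (tau (disc_ctr j))%:C * glift a k z0 (fun wt => P wt.1) y); split=> y Uy.
  have hl : holS g k (glift a k z0 (fun wt => P wt.1)) y by exact: (lift_hol (near y Uy) (dP _)).
  move=> i ci c z t ac ub e.
  have E : (fun w => rep k i (fun y => (tau (disc_ctr j))%:C * glift a k z0 (fun wt => P wt.1) y) (chart_inv c (w, t))) =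
    (fun w => (tau (disc_ctr j))%:C * rep k i (glift a k z0 (fun wt => P wt.1)) (chart_inv c (w, t))).
    by apply/funext => w; rewrite /rep mulrCA.
  by rewrite E; apply: diffM'; [exact: diff_cst'|exact: hl].
have [dy iy ty _] := fdom_inb (near y Uy).
pose w := (wcoord a k z0 y).1; pose t := (wcoord a k z0 y).2.
have yE : wpoint a k z0 (w, t) = y by rewrite /w /t -surjective_pairing wcoordK.
have hz : inb a (pz a k z0 w) by rewrite /w /wcoord /= pwK.
have ht : xT a t := ty.
have [G GE [G0 [G1 _]]] := gauge_le hz ht.
have e1 := lift_dist k0 (fun wt => P wt.1) (fun=> 0) hz ht; rewrite unlift0 GE subr0 yE subr0 in e1.
rewrite /bump -mulrBl ncM -mulrA e1 -rmorphB ncR.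
have b1 : nc (P w) * G <= 1 by apply: le_trans (bP w); rewrite ler_wpM2l ?nc_ge0.
have b2 : 0 <= nc (P w) * G by apply: mulr_ge0; [exact: nc_ge0|exact: ltW].
have b3 := tau_osc Uy; rewrite -[leRHS]mulr1; exact: ler_pM.
Qed.

Lemma peak P : (forall w, differentiable P w) -> (forall w, nc (P w) * expR (- sqn w / 4) <= 1) ->
  exists u, [/\ forall x, contS g k u x, forall x, holS g k u x,
    forall x, nc (u x - bump P x) * mu k m x <= 2 * @glue_cst R n * eta
  & forall w t, inb a (pz a k z0 w) -> xT a t ->
      nc (gunlift a k z0 u (w, t) - (tau (wpoint a k z0 (w, t)))%:C * P w) <= 2 * @glue_cst R n * eta * expR (sqn w)].
Proof.
move=> dP bP; have [u [cu hu du]] := solve_a eta0 (bump_approx dP bP).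
exists u; split=> // w t hz ht; have [G GE [G0 [_ G1]]] := gauge_le hz ht.
have := du (wpoint a k z0 (w, t)); rewrite (bump_lift P hz ht) nc_dist.
have := lift_dist k0 (fun wt => (tau (wpoint a k z0 wt))%:C * P wt.1) u hz ht; rewrite GE /= => -> h.
rewrite nc_dist; have := ler_wpM2r (expR_ge0 (sqn w)) h; apply: le_trans.
by rewrite -mulrA ler_peMr ?nc_ge0.
Qed.

(** At its centre the gauge has norm exactly [1], so that the norm of a section can be read off its
    model function there. *)
Lemma peak_at_center u x : (wcoord a k z0 x).1 = 0 -> chart_dom (bc Bg (xb a)) x -> xT a (wcoord a k z0 x).2 -> 
  nc (u x) * mu k m x = nc (gunlift a k z0 u (0, (wcoord a k z0 x).2)).
Proof.
move=> w0 dx; set t := (wcoord a k z0 x).2 => ht.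
have hz : inb a (pz a k z0 0) by rewrite pz0.
have xE : wpoint a k z0 (0, t) = x by rewrite -w0 /t -surjective_pairing wcoordK.
have := unlift_dist u (fun=> 0) hz ht; rewrite unlift0 (gauge_0 ht) xE mulr1 !subr0 => ->; exact: erefl.
Qed.

(* As above, the conclusion says that quotients of the [U l] separate the tangent vectors at [x]. *)
Definition immersive (M : finType) (U : M -> X -> C) x := exists w t, [/\ inb a (pz a k z0 w), xT a t,
  wpoint a k z0 (w, t) = x & forall v (lam : C), (forall l,
    'd (fun w => gunlift a k z0 (U l) (w, t)) w v = lam * gunlift a k z0 (U l) (w, t)) -> v = 0].

Lemma sqn_le w (r : R) : vn w <= r -> sqn w <= n%:R * r ^+ 2.
Proof.
move=> h; apply: (le_trans (sqn_vn w)); rewrite ler_wpM2l//.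
by apply: lerXn2r; rewrite ?nnegrE ?vn_ge0 ?(le_trans (vn_ge0 w)).
Qed.

Lemma coord_gauss (j : 'I_n) w : nc (w 0 j) * expR (- sqn w / 4) <= 1.
Proof.
have h1 : nc (w 0 j) ^+ 2 <= sqn w.
  by rewrite /sqn (bigD1 j)//= lerDl; apply: sumr_ge0 => i _; exact: exprn_ge0 (nc_ge0 _).
have h2 : nc (w 0 j) <= expR (sqn w / 4).
  apply: le_trans (expR_ge1Dx _); have := sqr_ge0 (nc (w 0 j) / 2 - 1); lra.
have -> : - sqn w / 4 = - (sqn w / 4) by ring.
by rewrite expRN ler_pdivrMr ?expR_gt0// mul1r.
Qed.

(** The exponential bounds [expR (sqn w)] for [vn w <= 2] in the last estimate of [peak]; the final
    [2] is the cost of freezing [tau] when [P] is a coordinate, at most [2] in modulus. *)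
Definition peak_err : R := (2 * @glue_cst R n * expR (n%:R * 2 ^+ 2) + 2) * eta.

Lemma peak_family (s : R) : 0 < s -> 8 * peak_err <= s -> 16 * @KT R * peak_err <= s ->
  exists U : option 'I_n -> X -> C, [/\ forall l x, contS g k (U l) x, forall l x, holS g k (U l) x &
    forall w t, vn w < 1 -> xT a t -> s <= tau (wpoint a k z0 (w, t)) ->
      (exists l, U l (wpoint a k z0 (w, t)) != 0) /\ immersive U (wpoint a k z0 (w, t))].
Proof.
move=> s0 e1 e2.
have pk (P : V -> C) dP bP := cid (@peak P dP bP).
pose P0 (w : V) : C := 1; pose Pj (j : 'I_n) (w : V) := w 0 j.
have bP0 w : nc (P0 w) * expR (- sqn w / 4) <= 1.
  have h : - sqn w / 4 <= 0 by have := sqn_ge0 w; lra.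
  by rewrite /P0 nc1 mul1r; rewrite -ler_expR expR0 in h.
pose U l := match l with None => sval (pk P0 (fun w => diff_cst' 1 w) bP0) |
  Some j => sval (pk (Pj j) (diff_coord j) (coord_gauss j)) end.
have [c0 h0 _ q0] := svalP (pk P0 (fun w => diff_cst' 1 w) bP0).
have hj j := svalP (pk (Pj j) (diff_coord j) (coord_gauss j)).
exists U; split.
- by case=> [j|] x; [have [c _ _ _] := hj j; exact: c|exact: c0].
- by case=> [j|] x; [have [_ h _ _] := hj j; exact: h|exact: h0].
move=> w1 t hw1 ht hs; set x := wpoint a k z0 (w1, t) in hs *.
have K0 : 0 <= @glue_cst R n by rewrite /glue_cst mulr_ge0// KM_ge0.
have LK : 0 < Lam / kap by rewrite divr_gt0// Lam_gt0.
have hk' : 20 * (Lam / kap) <= xd a / 4 by move: hk; rewrite mulrAC mulrC mulrA.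
have xd0 := xd_gt0 a.
have inw w : vn w <= 2 -> inb a (pz a k z0 w).
  move=> hw; rewrite /inb; have := pz_bnd a k0 z0 w 0; rewrite pz0 subr0 => b1.
  have b2 : Lam / kap * vn w <= Lam / kap * 2 by rewrite ler_wpM2l// ltW.
  have := vnD (pz a k z0 w - z0) (z0 - (xp a).1); rewrite addrA subrK.
  exact: (lt_ball LK b1 b2 hk' xd0 z0_in).
have w12 : vn w1 <= 2 by lra.
have ball2 w : vn (w - w1) <= 1 -> vn w <= 2.
  by move=> h; have := vnD (w - w1) w1; rewrite subrK; lra.
have [ub1 Kx] := x_sub (f := a) (inw w1 w12) ht.
pose j : disc_idx Bg := exist _ (xb a, x) Kx.
have cm : chart_map (bc Bg (xb a)) x = (pz a k z0 w1, t) by rewrite /x /wpoint chart_invK'.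
have inU w : vn (w - w1) <= 1 -> leaf_disc k j (wpoint a k z0 (w, t)).
  move=> h5; exists (pz a k z0 w); last by rewrite /disc_pt /= /disc_ctr /= cm.
  rewrite /disc_z /disc_ctr /= cm /=; apply: (le_lt_trans (pz_bnd a k0 _ _ _)).
  by have := ler_wpM2l (ltW LK) h5; rewrite -mulrA; lra.
have osc w : vn (w - w1) <= 1 -> `|tau (wpoint a k z0 (w, t)) - tau x| <= eta by move=> hw; exact: (tau_osc (inU w hw)).
have E1 w : vn w <= 2 -> 2 * @glue_cst R n * eta * expR (sqn w) <= peak_err - 2 * eta.
  move=> hw; have -> : peak_err - 2 * eta = 2 * @glue_cst R n * eta * expR (n%:R * 2 ^+ 2) by rewrite /peak_err; ring.
  rewrite ler_wpM2l//; first exact: (mulr_ge0 (mulr_ge0 (ler0n R 2) K0) eta0).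
  by rewrite ler_expR; exact: sqn_le.
have hol_un l w : vn (w - w1) <= 1 -> differentiable (fun w => gunlift a k z0 (U l) (w, t)) w.
  move=> hw; apply: (unlift_hol (inw w (ball2 w hw)) ht).
  by case: l => [i|]; [have [_ h _ _] := hj i; exact: h|exact: h0].
have b0 w : vn (w - w1) <= 1 -> nc (gunlift a k z0 (U None) (w, t) - (tau x)%:C) <= peak_err.
  move=> hw; have h2 := ball2 w hw; have := q0 w t (inw w h2) ht; have := osc w hw; have := E1 w h2.
  set f := gunlift a k z0 _ _; set tw := tau (wpoint _ _ _ _); rewrite /P0 mulr1 => A1 A2 A3.
  have -> : f - (tau x)%:C = (f - tw%:C) + (tw - tau x)%:C by rewrite rmorphB addrA subrK.
  by apply: (le_trans (ncD _ _)); rewrite ncR; exact: (le_err eta0 A3 A1 (le_double eta0 A2)).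
have bj i w : vn (w - w1) <= 1 -> nc (gunlift a k z0 (U (Some i)) (w, t) - (tau x)%:C * w 0 i) <= peak_err.
  move=> hw; have h2 := ball2 w hw; have [_ _ _ qi] := hj i; have := qi w t (inw w h2) ht; have := osc w hw; have := E1 w h2.
  set f := gunlift a k z0 _ _; set tw := tau (wpoint _ _ _ _); rewrite /Pj => A1 A2 A3.
  have -> : f - (tau x)%:C * w 0 i = (f - tw%:C * w 0 i) + (tw - tau x)%:C * w 0 i by rewrite rmorphB; ring.
  apply: (le_trans (ncD _ _)); rewrite ncM ncR.
  have A4 : `|tw - tau x| * nc (w 0 i) <= eta * 2 by apply: ler_pM => //; [exact: nc_ge0|exact: le_trans (nc_le_vn _ _) h2].
  exact: (le_err eta0 A3 A1 A4).
have in1 : vn (w1 - w1) <= 1 by rewrite subrr vn0.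
split.
  exists None; apply/eqP => u0; have := b0 w1 in1.
  have -> : gunlift a k z0 (U None) (w1, t) = 0 by rewrite /gunlift /rep -/x u0 mulr0 mul0r.
  by rewrite sub0r ncN ncR gtr0_norm ?(lt_le_trans s0)//; lra.
exists w1, t; split=> //; first exact: inw.
move=> v lam hd.
apply: (@jacobian_injective R n w1 v lam (tau x) peak_err (fun w => gunlift a k z0 (U None) (w, t))
  (fun i w => gunlift a k z0 (U (Some i)) (w, t))).
- exact: lt_le_trans s0 hs.
- exact: le_trans e1 hs.
- exact: le_trans e2 hs.
- by move=> w hw; split; [exact: hol_un|exact: b0].
- by move=> i w hw; split; [exact: hol_un|exact: bj].
- exact: hw1.
- exact: hd.
- by move=> i; exact: hd.
Qed.

End Peaks.

(** * Maps to the projective space *)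

Section Rows.
Context {R : realType}.
Local Notation C := R[i].

Lemma near_neq0 (T : topologicalType) (f : T -> C) x : {for x, continuous f} -> f x != 0 ->
  \forall y \near x, f y != 0.
Proof.
move=> cf fx; have n0 : 0 < nc (f x) by rewrite nc_gt0.
have := (contP _ _).1 cf (nc (f x) / 2) (divr_gt0 n0 (ltr0n R 2)).
apply: filterS => y hy; apply/eqP => f0; move: hy; rewrite f0 sub0r ncN; lra.
Qed.

Lemma diff_row (n N : nat) (F : 'rV[C]_n -> 'rV[C]_N) z :
  (forall j, differentiable (fun w => F w 0 j) z) -> differentiable F z.
Proof.
move=> h; have -> : F = \sum_j (fun w => F w 0 j *: (delta_mx 0 j : 'rV[C]_N)).
  by apply/funext => w; rewrite fct_sumE; exact: row_sum_delta.
by apply: differentiable_sum => j; exact: differentiableZl.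
Qed.

Lemma diff_chain (n : nat) (V W : normedModType C) (f : 'rV[C]_n -> V) (h : V -> W) z w v : f z = w ->
  differentiable f z -> differentiable h w -> 'd (fun z => h (f z)) z v = 'd h w ('d f z v).
Proof. by move=> <- df dh; exact: (congr1 (fun u : 'rV[C]_n -> W => u v) (diff_comp df dh)). Qed.

Lemma diff_chain0 (n : nat) (V W : normedModType C) (f : 'rV[C]_n -> V) (h : V -> W) z w v : f z = w ->
  differentiable f z -> differentiable h w -> 'd f z v = 0 -> 'd (fun z => h (f z)) z v = 0.
Proof.
move=> e df dh f0; apply: (eq_trans (diff_chain v e df dh)).
exact: (eq_trans (congr1 (fun u => 'd h w u) f0) (raddf0 _)).
Qed.

Lemma diff_coord_lin (N : nat) (w v : 'rV[C]_N) j : 'd (fun u : 'rV[C]_N => u 0 j : C) w v = v 0 j.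
Proof.
have [_ e] : differentiable (fun u : 'rV[C]_N => u 0 j : C) w /\
    'd (fun u : 'rV[C]_N => u 0 j : C) w = (fun u => u 0 j) :> ('rV[C]_N -> C).
  apply: (@eps_diff R _ _ _ _ 1) => [a u u'|u|e e0]; first by rewrite !mxE.
    by rewrite mul1r nc_le_vn.
  by exists 1 => // u _; rewrite mxE [_ + u 0 j]addrC addrK subrr nc0 mulr_ge0 ?vn_ge0 ?(ltW e0).
exact: (congr1 (fun h : 'rV[C]_N -> C => h v) e).
Qed.

Lemma diff_coordE (n N : nat) (F : 'rV[C]_n -> 'rV[C]_N) z v j : differentiable F z ->
  'd (fun w => F w 0 j) z v = ('d F z v) 0 j.
Proof.
move=> dF; have dc := @differentiable_coord C 1 N (F z) 0 j.
rewrite (@diff_chain n _ _ F (fun w : 'rV[C]_N => w 0 j) z _ v erefl dF dc); exact: diff_coord_lin.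
Qed.

End Rows.

(** * The map defined by sections without common zero *)

Section ProjectiveMap.
Local Open Scope quotient_scope.
Context {R : realType} {X : topologicalType} {n : nat} {L : lamination R X n} {g : cocycle L}.
Context {m : hermitian_metric g} {Bg : background m} {eps : R} (k N : nat).
Local Notation C := R[i].
Local Notation V := 'rV[C]_n.
Hypothesis k0 : (0 < k)%N.
Variable U : 'I_N.+1 -> X -> C.
Hypothesis U_cont : forall l x, contS g k (U l) x.
Hypothesis U_hol : forall l x, holS g k (U l) x.
Hypothesis U_nz : forall x, exists l, U l x != 0.
Implicit Types (x y : X) (l j : 'I_N.+1).

Let row_nz (f : 'I_N.+1 -> C) : (exists l, f l != 0) -> \row_l f l \in @nonzero_vector R N.
Proof.
by move=> [l hl]; rewrite inE; apply/eqP => /rowP/(_ l); rewrite !mxE; exact/eqP.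
Qed.

Definition proj_class (f : 'I_N.+1 -> C) (h : exists l, f l != 0) : CP R N :=
  \pi_({eq_quot (@collinear_rel R N)}) (exist _ (\row_l f l) (row_nz h)).

Definition proj_map x : CP R N := proj_class (U_nz x).

Lemma proj_class_eq f f' (h : exists l, f l != 0) (h' : exists l, f' l != 0) (a : C) :
  (forall l, f' l = a * f l) -> proj_class h = proj_class h'.
Proof.
move=> e; apply/eqmodP/asboolP; exists a; apply/rowP => l; rewrite !mxE; exact: e.
Qed.

Lemma homogeneous_proj x : exists2 a : C, a != 0 & forall l, homogeneous (proj_map x) 0 l = a * U l x.
Proof.
have /eqmodP/asboolP[b hb] : \pi_({eq_quot (@collinear_rel R N)}) (repr (proj_map x : {eq_quot (@collinear_rel R N)})) = proj_map x by exact: reprK.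
have e l : U l x = b * homogeneous (proj_map x) 0 l.
  by have /rowP/(_ l) := hb; rewrite !mxE.
have b0 : b != 0.
  by apply/eqP => b0; have [l] := U_nz x; rewrite e b0 mul0r eqxx.
by exists b^-1 => [|l]; [rewrite invr_eq0|rewrite e mulKf].
Qed.

Lemma proj_map_sep x y l l' : U l x * U l' y != U l' x * U l y -> proj_map x != proj_map y.
Proof.
move=> h; apply/eqP => /eqmodP/asboolP[a ha]; move/eqP: h; apply.
have e j : U j y = a * U j x by have /rowP/(_ j) := ha; rewrite !mxE.
by rewrite !e; ring.
Qed.

Let G_neq0 x (i : cov_idx g) : cov i x -> cocycle_fun i (iota g x) x ^+ k != 0.
Proof. by move=> ci; rewrite expf_neq0//; exact: (cocycle_neq0 ci (iotaP g x)). Qed.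

(** The values [U l x] refer to a frame that changes with [x]. Passing to a fixed frame multiplies
    all of them by one nonzero scalar, which the projective class ignores, and makes them
    continuous. *)
Lemma proj_map_cont : continuous proj_map.
Proof.
move=> x W; rewrite nbhsE => -[B [oB Bx] BW].
have [A oA hA] : open (\pi_({eq_quot (@collinear_rel R N)}) @^-1` B : set (@nonzero_vector R N)) by exact: oB.
set i := iota g x; have ci : cov i x := iotaP g x.
have nzi y : cov i y -> exists l, rep k i (U l) y != 0.
  by move=> hy; have [l hl] := U_nz y; exists l; rewrite mulf_neq0// G_neq0.
have E y (hy : cov i y) : proj_map y = proj_class (nzi y hy).
  by apply: (@proj_class_eq _ _ _ _ (cocycle_fun i (iota g y) y ^+ k)) => l.
have inA y (hy : cov i y) : A (\row_l rep k i (U l) y) <-> B (proj_map y).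
  rewrite (E y hy) /proj_class.
  have := congr1 (fun S : set (@nonzero_vector R N) => S (exist _ (\row_l rep k i (U l) y) (row_nz (nzi y hy)))) hA.
  by rewrite /preimage /= => <-.
have cr : {for x, continuous (fun y => \row_l rep k i (U l) y)}.
  apply: (@cont_row R N.+1 X (fun l y => rep k i (U l) y) x) => l; exact: (@U_cont l x i ci).
have k1 : \forall y \near x, A (\row_l rep k i (U l) y).
  by apply: cr; apply: open_nbhs_nbhs; split=> //; apply/(inA x ci).
have k2 : \forall y \near x, cov i y by exact: cov_near.
by apply: filterS2 k1 k2 => y h1 h2; apply: BW; apply/(inA y h2).
Qed.

Lemma affine_proj x j kk : affine_chart j (proj_map x) 0 kk = U (lift j kk) x / U j x.
Proof.
rewrite mxE; have [a a0 e] := homogeneous_proj x; rewrite !e.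
by rewrite invfM mulrACA mulfV// mul1r.
Qed.

Lemma affine_dom_proj x j : affine_dom j (proj_map x) -> U j x != 0.
Proof. by have [a a0 e] := homogeneous_proj x; rewrite /affine_dom /= e mulf_eq0 negb_or => /andP[]. Qed.

Lemma ratio_rep i x l j : cov i x -> U l x / U j x = @rep R X n L g k i (U l) x / @rep R X n L g k i (U j) x.
Proof. by move=> ci; rewrite /rep invfM mulrACA mulfV ?mul1r// G_neq0. Qed.

Hypothesis U_imm : forall x, exists (a : fbox Bg eps) z0, immersive a k z0 U x.

(** If [v] is killed by the differential, the quotients of the sections by [U j] are stationary
    along [v]. Frames and gauge cancel in quotients, so in the coordinates of a flow box the image
    of [v] satisfies the premise of [immersive] and vanishes; the change of coordinates being
    invertible, so does [v]. *)
Lemma proj_map_immersion : leafwise_holomorphic_immersion L proj_map.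
Proof.
move=> c ac t z hz j; set x := chart_inv c (z, t) => /affine_dom_proj Uj F.
have ci : cov (iota g x) x := iotaP g x.
have FE (i : cov_idx g) w kk : cov i (chart_inv c (w, t)) -> F w 0 kk =
    rep k i (U (lift j kk)) (chart_inv c (w, t)) / rep k i (U j) (chart_inv c (w, t)).
  by move=> h; rewrite /F affine_proj (ratio_rep _ _ h).
have nearc (i : cov_idx g) : cov i x -> \forall w \near z, cov i (chart_inv c (w, t)).
  by move=> h; apply: (@plaque_near R X n c z t (cov i) hz); exact: cov_near.
have rep_nz (i : cov_idx g) y : cov i y -> U j y != 0 -> rep k i (U j) y != 0.
  by move=> h h'; rewrite mulf_neq0// G_neq0.
have dFk kk : differentiable (fun w => F w 0 kk) z.
  have dq : differentiable (fun w => rep k (iota g x) (U (lift j kk)) (chart_inv c (w, t)) / rep k (iota g x) (U j) (chart_inv c (w, t))) z.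
    apply: diffM'; first exact: (U_hol (lift j kk) ci ac hz erefl).
    by apply: diffV'; [exact: (U_hol j ci ac hz erefl)|exact: rep_nz].
  have [] := @diff_near R V _ (fun w => F w 0 kk) z _ dq; last by [].
  by apply: filterS (nearc _ ci) => w hw; rewrite -FE.
have dF : differentiable F z := diff_row dFk.
split; first exact: dF.
apply: raddf_inj => v dv0.
have [a [z0 [w1 [t1 [hw ht xE him]]]]] := U_imm x.
have [ub ci'] := inb_Wd hw ht; rewrite /= in ci'.
have acb : atlas L (bc Bg (xb a)) := b_atlas Bg (xb a).
have ci1 : cov (bi Bg (xb a)) x by rewrite -xE.
have cmx : chart_map (bc Bg (xb a)) x = (pz a k z0 w1, t1) by rewrite -xE /wpoint chart_invK'.
have dbx : chart_dom (bc Bg (xb a)) x by rewrite -xE; exact: chart_inv_dom'.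
pose S z' := pw a k z0 (chart_map (bc Bg (xb a)) (chart_inv c (z', t))).1.
pose T w := (chart_map c (wpoint a k z0 (w, t1))).1.
have Sz : S z = w1 by rewrite /S -/x cmx /= pzK.
have pl := plaque ac acb hz (t := t) dbx.
have Sd : differentiable S z.
  have [_ _ _ d1] := nbhs_singleton pl.
  exact: (@differentiable_comp C _ _ _ (fun z' => (chart_map (bc Bg (xb a)) (chart_inv c (z', t))).1) (pw a k z0) z d1 (diff_affineV _ _ _)).
have SE : \forall z' \near z, unit_ball z' /\ wpoint a k z0 (S z', t1) = chart_inv c (z', t).
  apply: filterS pl => z' [u1 d1 e1 _]; split=> //.
  by rewrite /wpoint /S /= pwK// -[in RHS](chart_mapK' d1) [in RHS](surjective_pairing (chart_map (bc Bg (xb a)) _)) e1 -/x cmx.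
have Td : differentiable T w1.
  have dcx : chart_dom c (chart_inv (bc Bg (xb a)) (pz a k z0 w1, t1)) by rewrite -/(wpoint a k z0 (w1, t1)) xE; exact: chart_inv_dom'.
  have [_ _ _ d1] := nbhs_singleton (plaque acb ac ub dcx).
  exact: (@differentiable_comp C _ _ _ (pz a k z0) (fun w => (chart_map c (chart_inv (bc Bg (xb a)) (w, t1))).1) w1 (diff_affine _ _ _) d1).
pose f l w := gunlift a k z0 (U l) (w, t1).
have fd l : differentiable (f l) w1.
  by apply: (unlift_hol hw ht); rewrite xE; exact: U_hol.
have fj0 : f j w1 != 0.
  rewrite /f /gunlift xE mulf_neq0 ?invr_eq0 ?Ega_neq0//; exact: rep_nz.
have Fk0 kk : 'd (fun w => F w 0 kk) z v = 0 by rewrite (diff_coordE v kk dF) dv0 mxE.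
have v'0 : 'd S z v = 0.
  (* The common logarithmic derivative: stationary quotients mean that all the [f l] have the same
     one. *)
  pose lam := 'd (f j) w1 ('d S z v) / f j w1.
  apply: (him ('d S z v) lam) => l.
  have [kk -> | ->] := unliftP j l; last by rewrite /lam divfK.
  set l' := lift j kk.
  pose q w := f l' w / f j w.
  have dq : differentiable q w1 by apply: diffM'; [exact: fd|apply: diffV'; [exact: fd|exact: fj0]].
  have q0 : 'd q w1 ('d S z v) = 0.
    apply: (eq_trans (esym (diff_chain v Sz Sd dq))).
    have qE : \forall z' \near z, F z' 0 kk = q (S z').
      apply: filterS2 SE (nearc _ ci1) => z' [_ e] hc.
      rewrite (FE _ _ _ hc) /q /f /gunlift e; set y := chart_inv c (z', t).
      have E0 (x1 x2 x3 : C) : x3 != 0 -> x1 / x2 = x1 / x3 / (x2 / x3).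
        by move=> h; rewrite [(x2 / x3)^-1]invfM invrK mulrACA mulVf// mulr1.
      by apply: E0; exact: Ega_neq0.
    have [_ e] := @diff_near R V (fun w => F w 0 kk) (fun z => q (S z)) z qE (dFk kk).
    exact: (eq_trans (congr1 (fun u : V -> C => u v) e) (Fk0 kk)).
  have fE : \forall w \near w1, f l' w = q w * f j w.
    have nz := near_neq0 (diff_cont (fd j)) fj0.
    by apply: filterS nz => w hw'; rewrite /q divfK.
  apply: (eq_trans (quotient_deriv (fd j) dq fE q0)).
  rewrite /lam /q -/(f l' w1).
  have E0 (x1 x2 x3 : C) : x1 / x2 * x3 = x3 / x2 * x1 by rewrite mulrAC [RHS]mulrAC [x1 * x3]mulrC.
  exact: E0.
(* [T] is a left inverse of [S] near [z], so the coordinates of [v] are recovered from the zero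
   vector ['d S z v]. *)
apply/rowP => i; rewrite mxE.
have Ti : differentiable (fun w => T w 0 i) w1 := diff_coord_of i Td.
have TSd : differentiable (fun w => T w 0 i) (S z) := eq_ind_r (fun u => differentiable (fun w => T w 0 i) u) Ti Sz.
have nid : \forall z' \near z, T (S z') 0 i = z' 0 i.
  by apply: filterS SE => z' [u1 e]; rewrite /T e chart_invK'.
have [_ e] := @diff_near R V (fun z' => T (S z') 0 i) (fun z' : V => z' 0 i) z nid (@diff_compV R n S (fun w => T w 0 i) z Sd TSd).
have e2 := congr1 (fun u : V -> C => u v) e.
have e3 := diff_chain0 Sz Sd Ti v'0.
exact: (eq_trans (esym (diff_coord_lin z v i)) (eq_trans e2 e3)).
Qed.

End ProjectiveMap.

(** * Choice of the constants *)

Section CompactFunctions.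
Context {R : realType} {X : topologicalType}.
Hypothesis cX : compact [set: X].
Hypothesis hX : hausdorff_space X.

Lemma closed_point (x : X) : closed [set x].
Proof. exact: (accessible_closed_set1 (hausdorff_accessible hX)). Qed.

Lemma urysohn_open (x : X) (O : set X) : open O -> O x -> exists f : X -> R,
  [/\ forall y, {for y, continuous f}, f x = 1, forall y, 0 <= f y <= 1 & forall y, f y != 0 -> O y].
Proof.
move=> oO Ox; have e0 : ~` O `&` [set x] = set0 by apply/seteqP; split=> // y [nO e]; apply: nO; rewrite e.
have [f [cf f0 f1 f01]] := @urysohn_ext_itv X R (compact_normal hX cX) _ _ 0 1 (open_closedC oO) (@closed_point x) e0 ltr01.
exists f; split.
- exact: cf.
- by apply: f1; exists x.
- by move=> y; have := f01 (f y); rewrite /= in_itv; apply; exists y.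
- by move=> y; apply: contra_neqP => nO; apply: f0; exists y.
Qed.

(** The bumps are cut at height [1 / 2], so that the weights vanish outside closed sets that are
    still inside the given open ones. The neighbourhoods where the bumps exceed [3 / 4] cover [X],
    which makes the sum positive. *)
Lemma partition_of_unity (O : X -> set X) : (forall x, open (O x)) -> (forall x, O x x) ->
  exists (N : nat) (p : 'I_N -> X) (rho : 'I_N -> X -> R) (F : 'I_N -> set X),
  [/\ forall a x, {for x, continuous (rho a)}, forall a x, 0 <= rho a x, forall x, \sum_a rho a x = 1,
      forall a, closed (F a) & forall a x, (rho a x != 0 -> F a x) /\ (F a x -> O (p a) x)].
Proof.
move=> oO Ox.
have H : forall x : X, exists f : X -> R, [/\ forall y, {for y, continuous f}, f x = 1, forall y, 0 <= f y <= 1 & forall y, f y != 0 -> O x y].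
  by move=> x; exact: urysohn_open.
have [f hf] := choice H.
have nf x : nbhs x [set y | 3 / 4 < f x y].
  have [c1 e1 _ _] := hf x; have := (contRP _ _).1 (c1 x) (1 / 8).
  rewrite divr_gt0// => /(_ isT); apply: filterS => y; rewrite e1 ler_norml => /andP[h1 h2] /=; lra.
have [N [p hp]] := finite_cover cX nf.
pose h (a : 'I_N) x := Num.max 0 (2 * f (p a) x - 1).
have h0 a x : 0 <= h a x by rewrite le_max lexx.
have S0 x : 0 < \sum_a h a x.
  have [b /nbhs_singleton/= hb] := hp x; rewrite (bigD1 b)//= ltr_pwDl//; last by apply: sumr_ge0.
  by rewrite /h lt_max; apply/orP; right; lra.
have hc a x : {for x, continuous (h a)}.
  have [c1 _ _ _] := hf (p a).
  have c2 : {for x, continuous (fun y => 2 * f (p a) y - 1)}.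
    by apply: cvgB; [apply: cvgM; [exact: cvg_cst|exact: c1]|exact: cvg_cst].
  have c3 : {for x, continuous (fun y : X => (0 : R))} by exact: cvg_cst.
  exact: (continuous_max c3 c2).
have Sc x : {for x, continuous (fun y => \sum_a h a y)}.
  elim: (index_enum _) => [|a s ih].
    by apply: (cont_ext _ (cont_cstW (0 : R) x)) => y; rewrite big_nil.
  apply: (cont_ext _ (cvgD (hc a x) ih)) => y; rewrite big_cons; exact: erefl.
exists N, p, (fun a x => h a x / \sum_a h a x), (fun a => [set x | 1 / 2 <= f (p a) x]); split.
- move=> a x; apply: cvgM; first exact: hc.
  by apply: cvgV; [rewrite gt_eqF|exact: Sc].
- by move=> a x; rewrite divr_ge0 ?(ltW (S0 x)).
- by move=> x; rewrite -mulr_suml mulfV// gt_eqF.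
- move=> a; have [c1 _ _ _] := hf (p a).
  exact: (@closed_comp _ _ (f (p a)) [set s : R | 1 / 2 <= s] (fun x _ => c1 x) (@closed_ge R (1 / 2))).
- move=> a x; have [_ _ _ s1] := hf (p a); split=> [|fx].
    rewrite mulf_eq0 negb_or => /andP[+ _]; rewrite /h; case: ltP => //; last by rewrite eqxx.
    by move=> q _ /=; lra.
  by apply: s1; rewrite gt_eqF//; move: fx => /=; lra.
Qed.

End CompactFunctions.

(** * All the constants together *)

Section Setup.
Context {R : realType} {X : topologicalType} {n : nat} {L : lamination R X n} {g : cocycle L}.
Context {m : hermitian_metric g}.
Hypothesis msmooth : smooth_metric m.
Hypothesis mpos : positive_curvature m.
Hypothesis cX : compact [set: X].
Hypothesis hX : hausdorff_space X.
Local Notation C := R[i].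
Local Notation V := 'rV[C]_n.

Lemma disc_osc (Bg : background m) (f : X -> R) (e : R) : (forall x, {for x, continuous f}) -> 0 < e ->
  exists2 r : R, 0 < r & forall b y, bK Bg b y -> forall z, vn (z - (chart_map (bc Bg b) y).1) < r ->
    `|f (chart_inv (bc Bg b) (z, (chart_map (bc Bg b) y).2)) - f y| <= e.
Proof.
move=> cf e0; apply: (@all_fin_unif R 'I_(bN Bg) (fun b r => forall y, bK Bg b y -> forall z, vn (z - (chart_map (bc Bg b) y).1) < r ->
    `|f (chart_inv (bc Bg b) (z, (chart_map (bc Bg b) y).2)) - f y| <= e)).
  move=> b; apply: (unif cX (b_closed (b := b))) => [y Ky|r r' y /andP[_ rr] h z hz]; last first.
    by apply: h; exact: lt_le_trans hz rr.
  have e2 : 0 < e / 2 by rewrite divr_gt0.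
  have ny := (contRP _ _).1 (cf y) (e / 2) e2.
  have [r r0 hr] := disc_near (b_dom Ky) ny; exists r => //.
  apply: filterS2 hr ny => y' [_ h] hy z /h[_]; move: hy.
  move: (f _) (f _) (f _) => A B D; rewrite !ler_norml => /andP[? ?] /andP[? ?]; apply/andP; split; lra.
by move=> b r r' /andP[_ rr] h y Ky z hz; apply: (h y Ky); exact: lt_le_trans hz rr.
Qed.

(* [None] serves for immersions, [Some b] for separating a zero of [th] from a zero of [1 - th]. *)
Definition cutoff (th rho : X -> R) (o : option bool) x : R :=
  rho x * match o with None => 1 | Some true => th x | Some false => 1 - th x end.

(* What the construction of sections retains of the choice of the constants. *)
Record setup (th : X -> R) := Setup {
  sBg : background m;
  seps : R;
  sNA : nat;
  sk : nat;
  seta : R;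
  sbx : 'I_sNA -> fbox sBg seps;
  srho : 'I_sNA -> X -> R;
  sF : 'I_sNA -> set X;
  sk_gt0 : (0 < sk)%N;
  seps4 : seps <= 1 / 4;
  sbx_size : forall a, Lam sBg * 20 / @kap_ R sk <= xd (sbx a) / 4;
  sleaf_disc : forall a (j : disc_idx sBg) x y, leaf_disc sk j x -> leaf_disc sk j y -> fdom (sbx a) (xd (sbx a) / 2) x ->
    fdom (sbx a) (xd (sbx a)) y;
  ssolve : forall u0 eta, 0 <= eta ->
    approx (@leaf_disc R X n L g m sBg sk) (mu sk m) (@cont_section R X n L g sk) (@hol_section R X n L g m sBg sk) u0 eta ->
    exists u, [/\ forall x, contS g sk u x, forall x, holS g sk u x &
      forall x, nc (u x - u0 x) * mu sk m x <= 2 * @glue_cst R n * eta];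
  srho_cont : forall a x, {for x, continuous (srho a)};
  srho_sum : forall x, \sum_a srho a x = 1;
  sF_closed : forall a, closed (sF a);
  srho_F : forall a x, srho a x != 0 -> sF a x;
  sF_dom : forall a, sF a `<=` fdom (sbx a) (xd (sbx a) / 2);
  seta_ge0 : 0 <= seta;
  sosc : forall a o (j : disc_idx sBg) x, leaf_disc sk j x ->
    `|cutoff th (srho a) o x - cutoff th (srho a) o (disc_ctr j)| <= seta;
  serr1 : 8 * @peak_err R n seta <= (2 * sNA%:R)^-1;
  serr2 : 16 * @KT R * @peak_err R n seta <= (2 * sNA%:R)^-1;
  serr3 : 2 * (2 * @glue_cst R n * seta) < sNA%:R^-1
}.

Lemma cutoff_cont th rho o : (forall x, {for x, continuous th}) -> (forall x, {for x, continuous rho}) ->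
  forall x, {for x, continuous (cutoff th rho o)}.
Proof.
move=> ct cr x; apply: cvgM; first exact: cr.
case: o => [[]|]; [exact: ct| |exact: cvg_cst].
by apply: cvgB; [exact: cvg_cst|exact: ct].
Qed.

(** The denominator is a sum in which each requirement on [e] finds its own terms. *)
Let eta_alg (NA K C1 T : R) : 1 <= NA -> 0 <= K -> 0 <= C1 -> 0 < T ->
  let e := (NA * (4 * K + 1 + 2 * (8 + 16 * T) * C1 + 8 * K))^-1 in
  [/\ 0 < e, NA * e <= (4 * K + 1)^-1, 8 * (C1 * e) <= (2 * NA)^-1, 16 * T * (C1 * e) <= (2 * NA)^-1
    & 2 * (2 * K * e) < NA^-1].
Proof.
move=> A1 K0 C0 T0; set Q := _ + 8 * K; set e := _^-1 => /=.
have TC : 0 <= T * C1 by rewrite mulr_ge0// ltW.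
have A0 : 0 < NA by lra.
have QE : Q = 12 * K + 1 + 16 * C1 + 32 * (T * C1) by rewrite /Q; ring.
have Q0 : 0 < Q by rewrite QE; lra.
have K1 : 0 < 4 * K + 1 by lra.
have e0 : 0 < e by rewrite invr_gt0 mulr_gt0.
have eE : NA * e = Q^-1 by rewrite /e; field; rewrite !gt_eqF.
have eQ : e * Q = NA^-1 by rewrite /e; field; rewrite !gt_eqF.
have E2 : (2 * NA)^-1 = e * Q / 2 by rewrite eQ; field; rewrite gt_eqF.
split.
- exact: e0.
- by rewrite eE lef_pV2 ?posrE// QE; lra.
- have -> : 8 * (C1 * e) = e * (16 * C1) / 2 by field.
  by rewrite E2 ler_pM2r// ler_pM2l// QE; lra.
- have -> : 16 * T * (C1 * e) = e * (32 * (T * C1)) / 2 by field.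
  by rewrite E2 ler_pM2r// ler_pM2l// QE; lra.
- have -> : 2 * (2 * K * e) = e * (4 * K) by ring.
  by rewrite -eQ ltr_pM2l// QE; lra.
Qed.

Lemma nat_above (r : R) : exists N : nat, r <= N%:R.
Proof. by exists (Num.bound `|r|); apply: (le_trans (ler_norm r)); apply: ltW; exact: archi_boundP. Qed.

Lemma kap_above (r : R) : exists2 k, (0 < k)%N & r <= @kap_ R k.
Proof.
have [N hN] := nat_above (`|r| ^+ 2); exists N.+1 => //.
apply: (le_trans (ler_norm r)); rewrite /kap_ -[leLHS]ger0_norm// -sqrtr_sqr ler_wsqrtr//.
by apply: (le_trans hN); rewrite ler_nat.
Qed.

Lemma exists_setup (th : X -> R) (x0 : X) : (forall x, {for x, continuous th}) -> inhabited (setup th).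
Proof.
move=> cth; have [Bg] := exists_background msmooth mpos cX hX.
have Lam0 := Lam_gt0 Bg; have br0 := br_gt0 Bg.
have KG0 : 0 <= @glue_cst R n by exact: (mulr_ge0 (ler0n R 4) (@KM_ge0 R n)).
have d00 : 0 <= d0 Bg.
  exact: (mulr_ge0 (mulr_ge0 (ler0n R 10) (exprn_ge0 2 (ltW Lam0))) (ltW (eq_ind_r is_true br0 (invr_gt0 _)))).
(* Neither [d0] nor [glue_cst] depends on [N], which can therefore be chosen after [Rr]. *)
pose Rr : R := 16 * n%:R * d0 Bg * @glue_cst R n + 1.
have Rr1 : 1 <= Rr.
  have := mulr_ge0 (mulr_ge0 (mulr_ge0 (ler0n R 16) (ler0n R n)) d00) KG0; rewrite /Rr; lra.
have [N hN] := nat_above (Rr + d0 Bg + 2).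
have Q0 : 0 <= 4 * n%:R * N%:R ^+ 2 :> R by exact: (mulr_ge0 (mulr_ge0 (ler0n R 4) (ler0n R n)) (exprn_ge0 2 (ler0n R N))).
have eps0 : 0 < @box_eps R n N by rewrite invr_gt0; lra.
have eps4 : @box_eps R n N <= 1 / 4 by rewrite /box_eps -[leRHS]invrK lef_pV2 ?posrE ?invr_gt0 ?divr_gt0// ?invf_div; lra.
have Hb : forall x : X, exists a : fbox Bg (@box_eps R n N), fdom a (xd a / 2) x by move=> x; exact: (fbox_exists msmooth mpos Bg x eps0).
have [box hbox] := choice Hb.
have [NA [p [rho [F [rc r0 rs Fc rF]]]]] := @partition_of_unity R X cX hX (fun x => fdom (box x) (xd (box x) / 2))
  (fun x => fdom_open (box x) _) hbox.
pose bx a := box (p a).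
(* The weights sum to [1] at [x0], so the cover is not empty. *)
have NA1 : 1 <= NA%:R :> R.
  rewrite ler1n lt0n; apply/eqP => NA0; have := rs x0.
  rewrite big1 => [|i _]; first by move/eqP; rewrite eq_sym oner_eq0.
  by have := ltn_ord i; rewrite {2}NA0.
pose C1 := 2 * @glue_cst R n * expR (n%:R * 2 ^+ 2) + 2.
have C10 : 0 <= C1.
  have := mulr_ge0 (mulr_ge0 (ler0n R 2) KG0) (expR_ge0 (n%:R * 2 ^+ 2)); rewrite /C1; lra.
have [] := eta_alg NA1 KG0 C10 (@KT_gt0 R); set eta := _^-1 => eta0 he1 he2 he3 he4.
have [r rp hr] : exists2 r : R, 0 < r & forall ao : 'I_NA * option bool, forall b y, bK Bg b y ->
    forall z, vn (z - (chart_map (bc Bg b) y).1) < r ->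
    `|cutoff th (rho ao.1) ao.2 (chart_inv (bc Bg b) (z, (chart_map (bc Bg b) y).2)) - cutoff th (rho ao.1) ao.2 y| <= eta.
  apply: all_fin_unif => [[a o]|ao e e' /andP[_ ee] h b y Ky z hz].
    have [e e0 he] := @disc_osc Bg (cutoff th (rho a) o) eta (@cutoff_cont th (rho a) o cth (rc a)) eta0.
    exists e; [exact: e0|exact: he].
  by apply: (h b y Ky); exact: lt_le_trans hz ee.
have [xm xm0 hxm] : exists2 e : R, 0 < e & forall a, e <= xd (bx a).
  apply: all_fin_unif => [a|a e e' /andP[_ ee] h]; last exact: le_trans ee h.
  by exists (xd (bx a)); [exact: xd_gt0|].
(* The constants [N] and [Rr], the boxes and the cut-offs being fixed, [k] is chosen last. *)
pose e0 := Num.min (br Bg) (Num.min r xm).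
have e00 : 0 < e0 by rewrite !lt_min br0 rp.
have [m1 m2 m3] : [/\ e0 <= br Bg, e0 <= r & e0 <= xm] by rewrite /e0 !ge_min !lexx !orbT.
have [k k0 hk] := kap_above (Lam Bg * (16 * N%:R + 80) / e0).
have kap0 : 0 < @kap_ R k := kap_gt0 k0.
have kk : Lam Bg * (16 * N%:R + 80) / @kap_ R k <= e0 by rewrite ler_pdivrMr// [e0 * _]mulrC -ler_pdivrMr.
have LK : 0 < Lam Bg / @kap_ R k by exact: divr_gt0.
have LN : 0 <= Lam Bg / @kap_ R k * N%:R by exact: (mulr_ge0 (ltW LK) (ler0n R N)).
have kE : Lam Bg * (16 * N%:R + 80) / @kap_ R k = 16 * (Lam Bg / @kap_ R k * N%:R) + 80 * (Lam Bg / @kap_ R k) by ring.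
rewrite kE in kk.
have [k5' k6 k7] := small_ratio LK LN kk.
have k5 : 5 * Lam Bg / @kap_ R k <= e0 by rewrite -mulrA.
have e4 a : e0 / 4 <= xd (bx a) / 4 by rewrite ler_pM2r ?invr_gt0//; exact: le_trans m3 (hxm a).
have hk1 := le_trans k5 m1.
have hk2 a : Lam Bg * (4 * N%:R + 20) / @kap_ R k <= xd (bx a) / 4.
  have -> : Lam Bg * (4 * N%:R + 20) / @kap_ R k = 4 * (Lam Bg / @kap_ R k * N%:R) + 20 * (Lam Bg / @kap_ R k) by ring.
  exact: le_trans k6 (e4 a).
have hk3 a : Lam Bg * 20 / @kap_ R k <= xd (bx a) / 4.
  have -> : Lam Bg * 20 / @kap_ R k = 20 * (Lam Bg / @kap_ R k) by ring.
  exact: le_trans k7 (e4 a).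
(* The sum dominates each term, so one lattice size covers all the rescaled boxes; nothing else
   depends on it. *)
have [Mh hMh] := nat_above (\sum_a @kap_ R k * Lam Bg * xd (bx a)).
have hM a : @kap_ R k * Lam Bg * xd (bx a) <= Rr * Mh%:R.
  apply: (@le_trans _ _ Mh%:R); last by rewrite ler_peMl.
  apply: le_trans hMh; rewrite (bigD1 a)//= lerDl; apply: sumr_ge0 => i _.
  exact: (mulr_ge0 (mulr_ge0 (ltW kap0) (ltW Lam0)) (ltW (xd_gt0 (bx i)))).
have osc a o (j : disc_idx Bg) x : leaf_disc k j x -> `|cutoff th (rho a) o x - cutoff th (rho a) o (disc_ctr j)| <= eta.
  move=> [z hz ->]; have := hr (a, o) (sval j).1 (disc_ctr j) (svalP j) z; apply.
  exact: (lt_le_trans hz (le_trans k5 m2)).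
have hosc (j : disc_idx Bg) x : leaf_disc k j x -> \sum_a `|rho a x - rho a (disc_ctr j)| <= (4 * @glue_cst R n + 1)^-1.
  move=> Ux; apply: le_trans he1; rewrite mulr_natl -[X in _ *+ X]card_ord -sumr_const; apply: ler_sum => a _.
  by have := osc a None j x Ux; rewrite /cutoff !mulr1.
have rF1 a x : rho a x != 0 -> F a x := (rF a x).1.
have Fd a : F a `<=` fdom (bx a) (xd (bx a) / 2) := fun x => (rF a x).2.
have hR : 16 * n%:R * d0 Bg * @glue_cst R n + 1 <= Rr := lexx _.
have sleaf_disc' a (j : disc_idx Bg) x y : leaf_disc k j x -> leaf_disc k j y -> fdom (bx a) (xd (bx a) / 2) x -> fdom (bx a) (xd (bx a)) y.
  by move=> Ux Uy fx; have [] := leaf_disc_fdom k0 hN hR hk1 hk2 Ux Uy fx.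
have sol := @solve R X n L g m msmooth Bg N NA Mh k Rr bx rho F rc r0 rs Fc rF1 Fd k0 hN hR hk1 hk2 hM hosc.
constructor; exact: (@Setup th Bg (@box_eps R n N) NA k eta bx rho F k0 eps4 hk3 sleaf_disc' sol rc rs Fc rF1 Fd (ltW eta0) osc he2 he3 he4).
Qed.

End Setup.

(** * Separation of points and tangent vectors *)

Section Sections.
Context {R : realType} {X : topologicalType} {n : nat} {L : lamination R X n} {g : cocycle L}.
Context {m : hermitian_metric g}.
Hypothesis msmooth : smooth_metric m.
Hypothesis cX : compact [set: X].
Variables (th : X -> R) (S : @setup R X n L g m th).
Hypothesis th_cont : forall x, {for x, continuous th}.
Local Notation C := R[i].
Local Notation V := 'rV[C]_n.
Local Notation Bg := (sBg S).
Local Notation k := (sk S).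
Local Notation NA := (sNA S).
Implicit Types (x y : X).

Let NA_gt0 x : 0 < NA%:R :> R.
Proof.
rewrite ltr0n lt0n; apply/eqP => NA0; have := srho_sum S x.
rewrite big1 => [|i _]; first by move/eqP; rewrite eq_sym oner_eq0.
by have := ltn_ord i; rewrite {2}NA0.
Qed.

Lemma large_weight x : exists a : 'I_NA, NA%:R^-1 <= srho (s := S) a x.
Proof.
apply/not_existsP => h; have : \sum_a srho (s := S) a x < 1; last by rewrite srho_sum ltxx.
have -> : 1 = \sum_(a < NA) NA%:R^-1 :> R.
  by rewrite sumr_const card_ord -[_ *+ _]mulr_natr mulVf// gt_eqF// NA_gt0.
have lt a : srho (s := S) a x < NA%:R^-1 by rewrite ltNge; apply/negP; exact: h.
have [a0 _] : exists a0 : 'I_NA, True.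
  by have := NA_gt0 x; rewrite ltr0n => h0; exists (Ordinal h0).
by apply: ltr_sum => [|a _]; [apply/hasP; exists a0 => //; exact: mem_index_enum|exact: lt].
Qed.

Let rho_dom a x : NA%:R^-1 <= srho (s := S) a x -> fdom (sbx a) (xd (sbx a) / 2) x.
Proof.
move=> h; apply: (sF_dom (s := S)); apply: srho_F; rewrite gt_eqF//; apply: lt_le_trans h.
by rewrite invr_gt0 (NA_gt0 x).
Qed.

Let cut_F a o x : cutoff th (srho (s := S) a) o x != 0 -> sF (s := S) a x.
Proof. by rewrite /cutoff mulf_eq0 negb_or => /andP[h _]; exact: srho_F. Qed.

Let cut_cont a o x : {for x, continuous (cutoff th (srho (s := S) a) o)}.
Proof. exact: (@cutoff_cont R X th (srho (s := S) a) o th_cont (@srho_cont _ _ _ _ _ _ _ S a) x). Qed.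

(** A gauge centred at [x] is cut off by a weight that is at least [1 / NA] at [x], times [th] or
    [1 - th]. The product keeps this value at [x] and vanishes at [y]; the correction to a
    holomorphic section moves both norms by at most [2 * glue_cst * seta]. *)
Lemma separating_section (b : bool) x y : (if b then th x = 1 else th x = 0) -> (if b then th y = 0 else th y = 1) ->
  exists u : X -> C, [/\ forall z, contS g k u z, forall z, holS g k u z,
    NA%:R^-1 - 2 * @glue_cst R n * seta S <= nc (u x) * mu k m x &
    nc (u y) * mu k m y <= 2 * @glue_cst R n * seta S].
Proof.
move=> hx hy; have [a ha] := large_weight x; have [dx [xin tx]] := rho_dom ha.
set z0 := (chart_map (bc Bg (xb (sbx a))) x).1 in xin.
have bP0 w : nc (1 : C) * expR (- @sqn R n w / 4) <= 1.
  have h : - @sqn R n w / 4 <= 0 by have := sqn_ge0 w; lra.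
  by rewrite nc1 mul1r; rewrite -ler_expR expR0 in h.
have [u [cu hu du pu]] := @peak R X n L g m msmooth Bg (seps S) (sbx a) k (sk_gt0 S) (seps4 S) (sleaf_disc (s := S) (a := a)) (ssolve (s := S)) z0 xin
  (sF (s := S) a) (cutoff th (srho (s := S) a) (Some b)) (seta S) (@sF_closed _ _ _ _ _ _ _ S a) (sF_dom (s := S) (a := a)) (@cut_F a (Some b)) (@cut_cont a (Some b))
  (seta_ge0 S) (sosc (s := S) a (Some b)) (fun=> 1) (fun w => diff_cst' 1 w) bP0.
exists u; split=> //.
  have w0 : (wcoord (sbx a) k z0 x).1 = 0 by rewrite /wcoord /= pw0.
  rewrite (peak_at_center msmooth (sk_gt0 S) xin u w0 dx tx).
  have z0in : inb (sbx a) (pz (sbx a) k z0 0) by rewrite pz0 /inb; apply: (lt_trans xin); have := xd_gt0 (sbx a); lra.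
  have := pu 0 _ z0in tx.
  have -> : wpoint (sbx a) k z0 (0, (chart_map (bc Bg (xb (sbx a))) x).2) = x by rewrite -w0; exact: (wcoordK (sk_gt0 S) z0 dx).
  have -> : cutoff th (srho (s := S) a) (Some b) x = srho (s := S) a x.
    by rewrite /cutoff; move: hx; case: b {hy pu du bP0 hu cu} => ->; rewrite ?subr0 mulr1.
  have -> : @sqn R n 0 = 0 by rewrite /sqn big1// => j _; rewrite mxE nc0 expr0n.
  rewrite expR0 !mulr1 nc_dist => q.
  have := ncD (gunlift (sbx a) k z0 u (0, (chart_map (bc Bg (xb (sbx a))) x).2)) ((srho (s := S) a x)%:C - gunlift (sbx a) k z0 u (0, (chart_map (bc Bg (xb (sbx a))) x).2)).
  rewrite addrC subrK ncR; move: q; rewrite /wcoord /=.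
  by have := ler_norm (srho (s := S) a x); move: ha; lra.
have := du y; rewrite /bump.
have -> : cutoff th (srho (s := S) a) (Some b) y = 0.
  by rewrite /cutoff; move: hy; case: b {hx pu du bP0 hu cu} => ->; rewrite ?subrr mulr0.
by rewrite mul0r subr0.
Qed.

Lemma immersive_family x : exists U : option 'I_n -> X -> C, [/\ forall l z, contS g k (U l) z, forall l z, holS g k (U l) z &
  \forall y \near x, (exists l, U l y != 0) /\ exists (a : 'I_NA) z0, immersive (sbx a) k z0 U y].
Proof.
have [a ha] := large_weight x; have [dx [xin tx]] := rho_dom ha.
set z0 := (chart_map (bc Bg (xb (sbx a))) x).1 in xin.
have s0 : 0 < (2 * NA%:R)^-1 :> R by rewrite invr_gt0 mulr_gt0// (NA_gt0 x).
have [U [cU hU iU]] := @peak_family R X n L g m msmooth Bg (seps S) (sbx a) k (sk_gt0 S) (seps4 S) (sbx_size (s := S) a) (sleaf_disc (s := S) (a := a)) (ssolve (s := S)) z0 xin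
  (sF (s := S) a) (cutoff th (srho (s := S) a) None) (seta S) (@sF_closed _ _ _ _ _ _ _ S a) (sF_dom (s := S) (a := a)) (@cut_F a None) (@cut_cont a None)
  (seta_ge0 S) (sosc (s := S) a None) _ s0 (serr1 S) (serr2 S).
exists U; split=> //.
have cE y : cutoff th (srho (s := S) a) None y = srho (s := S) a y by rewrite /cutoff mulr1.
have k1 : \forall y \near x, fdom (sbx a) (xd (sbx a) / 2) y.
  by apply: open_nbhs_nbhs; split; [exact: fdom_open|split].
have k2 : \forall y \near x, (2 * NA%:R)^-1 <= srho (s := S) a y.
  have := (contRP _ _).1 (@srho_cont _ _ _ _ _ _ _ S a x) _ s0; apply: filterS => y; rewrite ler_norml => /andP[h1 _].
  move: ha h1; have -> : NA%:R^-1 = 2 * (2 * NA%:R)^-1 :> R by field; rewrite gt_eqF// (NA_gt0 x).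
  by lra.
have k3 : \forall y \near x, vn (wcoord (sbx a) k z0 y).1 < 1.
  have c1 := @cont_comp _ _ _ (wcoord (sbx a) k z0) fst x (@wcoord_cont R X n L g m Bg _ (sbx a) k z0 x dx) (cont_fst _).
  have c2 := @cont_comp _ _ _ (fun y => (wcoord (sbx a) k z0 y).1) (@vn R V) x c1 (@vn_cont R n _).
  have := (contRP _ _).1 c2 (1 / 2); rewrite divr_gt0// => /(_ isT); apply: filterS => y.
  have -> : (wcoord (sbx a) k z0 x).1 = 0 by rewrite /wcoord /= pw0.
  rewrite vn0 subr0 ler_norml => /andP[_]; lra.
apply: filterS3 k1 k2 k3 => y [dy [_ ty]] h2 h3.
have yE : wpoint (sbx a) k z0 ((wcoord (sbx a) k z0 y).1, (wcoord (sbx a) k z0 y).2) = y.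
  by rewrite -surjective_pairing wcoordK// sk_gt0.
have := iU (wcoord (sbx a) k z0 y).1 (wcoord (sbx a) k z0 y).2 h3 ty; rewrite yE cE => /(_ h2)[i1 i2].
by split=> //; exists a, z0.
Qed.

Lemma immersive_reindex (a : 'I_NA) z0 (M M' : finType) (U : M -> X -> C) (U' : M' -> X -> C) (f : M -> M') x :
  (forall l, U' (f l) = U l) -> immersive (sbx a) k z0 U x -> immersive (sbx a) k z0 U' x.
Proof.
move=> e [w [t [h1 h2 h3 h4]]]; exists w, t; split=> // v lam hl; apply: (h4 v lam) => l.
by rewrite -e; exact: hl.
Qed.

(** Projective space sees only ratios, so a section that is large at [x] and small at [y] is paired
    with one that behaves in the opposite way. The determinant of their values at [x] and [y] is
    then nonzero. *)
Lemma separating_map x y : th x = 1 -> th y = 0 ->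
  exists (N : nat) (f : X -> CP R N), [/\ continuous f, leafwise_holomorphic_immersion L f & f x != f y].
Proof.
move=> tx ty.
have [u1 [c1 h1 l1 s1]] := @separating_section true x y tx ty.
have [u2 [c2 h2 l2 s2]] := @separating_section false y x ty tx.
have H : forall p : X, exists U : option 'I_n -> X -> C, [/\ forall l z, contS g k (U l) z, forall l z, holS g k (U l) z &
  \forall y \near p, (exists l, U l y != 0) /\ exists (a : 'I_NA) z0, immersive (sbx a) k z0 U y] := immersive_family.
have [U hU] := choice H.
have [N1 [p hp]] := @finite_cover X cX (fun p => [set y | (exists l, U p l y != 0) /\ exists (a : 'I_NA) z0, immersive (sbx a) k z0 (U p) y]) (fun p => let: And3 _ _ h := hU p in h).
pose M : finType := (bool + 'I_N1 * option 'I_n)%type.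
pose W (l : M) : X -> C := match l with inl true => u1 | inl false => u2 | inr bl => U (p bl.1) bl.2 end.
have cW l z : contS g k (W l) z.
  by case: l => [[]|[b l]]; [exact: c1|exact: c2|]; have [c _ _] := hU (p b); exact: c.
have hW l z : holS g k (W l) z.
  by case: l => [[]|[b l]]; [exact: h1|exact: h2|]; have [_ h _] := hU (p b); exact: h.
have cM : #|M| = (#|M|.-1).+1.
  (* The separating sections make the index set nonempty, so that its cardinal is a successor, as
     the homogeneous coordinates require. *)
  by rewrite prednK//; apply/card_gt0P; exists (inl true).
pose N := #|M|.-1.
pose Z (i : 'I_N.+1) : X -> C := W (enum_val (cast_ord (esym cM) i)).
pose f (l : M) : 'I_N.+1 := cast_ord cM (enum_rank l).
have fE l : Z (f l) = W l by rewrite /Z /f cast_ordK enum_rankK.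
have Znz z : exists l, Z l z != 0.
  have [b /nbhs_singleton[[l hl] _]] := hp z; exists (f (inr (b, l))); rewrite fE; exact: hl.
have Zimm z : exists (a : fbox Bg (seps S)) z0, immersive a k z0 Z z.
  have [b /nbhs_singleton[_ [a [z0 hi]]]] := hp z; exists (sbx a), z0.
  by apply: (@immersive_reindex a z0 _ _ _ _ (fun l => f (inr (b, l))) z _ hi) => l; rewrite fE.
exists N, (proj_map Znz); split.
- exact: (@proj_map_cont R X n L g k N Z (fun l z => cW _ z) Znz).
- exact: (@proj_map_immersion R X n L g m Bg (seps S) k N (sk_gt0 S) Z (fun l z => hW _ z) Znz Zimm).
- apply: (@proj_map_sep R X N Z Znz x y (f (inl true)) (f (inl false))); rewrite !fE /W; apply/eqP => e.
  have m1 := mu_gt0 k m x; have m2 := mu_gt0 k m y.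
  have e1 : (nc (u1 x) * mu k m x) * (nc (u2 y) * mu k m y) = (nc (u2 x) * mu k m x) * (nc (u1 y) * mu k m y).
    have := congr1 (@nc R) e; rewrite !ncM => q.
    by rewrite mulrACA q mulrACA.
  have := serr3 S; move: e1 l1 l2 s1 s2.
  have p1 : 0 <= nc (u1 y) * mu k m y by exact: (mulr_ge0 (nc_ge0 _) (ltW m2)).
  have p2 : 0 <= nc (u2 x) * mu k m x by exact: (mulr_ge0 (nc_ge0 _) (ltW m1)).
  move: p1 p2; move: (nc (u1 x) * _) (nc (u2 y) * _) (nc (u1 y) * _) (nc (u2 x) * _) (2 * glue_cst * seta S) (NA%:R^-1 : R).
  (* With [r = 1 / NA] and [q] the error, one product is at least [(r - q) ^ 2] and the other at
     most [q ^ 2], whereas [2 * q < r]. *)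
  move=> A B D E q r D0 E0 eq lA lB lD lE hq.
  have AB : (r - q) * (r - q) <= A * B by apply: ler_pM => //; lra.
  have DE : E * D <= q * q by apply: ler_pM.
  have : q * q < (r - q) * (r - q) by apply: ltr_pM; lra.
  lra.
Qed.

End Sections.

Theorem mainTheorem3 (R : realType) (X : topologicalType) (n : nat)
  (L : lamination R X n)
  (X_compact : compact [set: X])
  (X_hausdorff : hausdorff_space X)
  (no_vanishing_cycle : ~ exists gamma, vanishing_cycle L gamma)
  (positive_bundle : exists (E : line_bundle L) (g : cocycle L)
     (m : hermitian_metric g),
     [/\ bundle_class E g, smooth_metric m & positive_curvature m]) :
  projective_lamination L.
Proof.
case: positive_bundle => _ [g [m [_ msmooth mpos]]] x y xy.
(* Projectivity is a condition on one pair of points at a time, so all the constants, the power [k]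
   included, may depend on this function. *)
have [th [cth th1 _ thO]] := @urysohn_open R X X_compact X_hausdorff x (~` [set y])
  (closed_openC (@closed_point X X_hausdorff y)) (fun e => elimN eqP xy e).
have [S] := @exists_setup R X n L g m msmooth mpos X_compact X_hausdorff th x cth.
have th0 : th y = 0 by apply/eqP/negPn/negP => /thO; apply.
exact: (@separating_map R X n L g m msmooth X_compact th S cth x y th1 th0).
Qed.
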